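(* Let $p\ge 2$ and $k\ge 3$ be integers. Then for all sufficiently large $n$ the following hold. (i) If $(k,p)\neq(3,2)$, i.e. $C_k^{p+1}\neq C_3^3$, then for $s=\lfloor\frac{k-1}{2}\rfloor+1$: when $k$ is odd, $H(n,p,s)$ is the unique extremal graph for $C_k^{p+1}$; when $k$ is even, $H'(n,p,s)$ is the unique extremal graph for $C_k^{p+1}$. (ii) For $C_3^3$ (the case $k=3$, $p=2$): if $4\mid n$, then $H^*(n)$ is the unique extremal graph for $C_3^3$; otherwise both $H^*(n)$ and $H(n,2,2)$ are extremal graphs for $C_3^3$.
   Context: All graphs are finite, simple, undirected. $C_k$ is the cycle with $k$ edges. For a graph $H$, the blow-up $H^{p+1}$ is the graph obtained by replacing each edge of $H$ by a clique $K_{p+1}$ containing that edge, where the new vertices added for different edges are all distinct. The extremal number $\mathrm{ex}(n,H)$ is the maximum number of edges of an $n$-vertex graph not containing $H$ as a subgraph; an $H$-free $n$-vertex graph with $\mathrm{ex}(n,H)$ edges is an extremal graph for $H$. $T_{n,p}$ is the Turán graph: the complete $p$-partite graph on $n$ vertices with class sizes as equal as possible. For vertex-disjoint graphs $H,G$, $H\bigotimes G$ denotes the graph obtained from their disjoint union by joining every vertex of $H$ to every vertex of $G$. $H(n,p,s)=K_{s-1}\bigotimes T_{n-s+1,p}$, and $H'(n,p,s)$ denotes any graph obtained from $H(n,p,s)$ by adding one extra edge inside one class of the $T_{n-s+1,p}$ part. $H^*(n)$ denotes any graph obtained from $K_{\lceil n/2\rceil,\lfloor n/2\rfloor}$ by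 adding a perfect (or, for a class of odd size, almost perfect, i.e. missing one vertex) matching inside each of its two classes. The graphs denoted $H'(n,p,s)$ (resp. $H^*(n)$) may be non-isomorphic but all have the same number of edges; ''unique extremal graph'' means every extremal graph is one of the graphs so denoted. *)

(* Defs.v *)
From mathcomp Require Import all_boot.

Set Implicit Arguments.
Unset Strict Implicit.
Unset Printing Implicit Defensive.

Record sgraph := SGraph {
  vertex :> finType;
  adj : rel vertex;
  adj_sym : symmetric adj;
  adj_irrefl : irreflexive adj }.

(* Simple graph generated by an arbitrary relation: symmetrize, drop loops. *)
Section GraphOf.
Variables (T : finType) (r : rel T).

Definition simple_rel : rel T := fun x y => (x != y) && (r x y || r y x).

Lemma simple_rel_sym : symmetric simple_rel.
Proof. by move=> x y; rewrite /simple_rel eq_sym orbC. Qed.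

Lemma simple_rel_irrefl : irreflexive simple_rel.
Proof. by move=> x; rewrite /simple_rel eqxx. Qed.

Definition graph_of : sgraph := SGraph simple_rel_sym simple_rel_irrefl.
End GraphOf.

Definition edges (G : sgraph) : {set {set G}} :=
  [set e | [exists x : G, exists y : G, adj x y && (e == [set x; y])]].

Definition contains (G H : sgraph) : bool :=
  [exists f : {ffun H -> G},
     injectiveb f && [forall x : H, forall y : H, adj x y ==> adj (f x) (f y)]].

Definition iso (G H : sgraph) : Prop :=
  exists f : G -> H, bijective f /\ forall x y : G, adj (f x) (f y) = adj x y.

(* The graph on {0, ..., n-1} whose edges are the pairs of distinct vertices
   belonging to E (members of E of other sizes are ignored), so that E ranges
   over all labelled n-vertex graphs. *)
Definition labelled_graph (n : nat) (E : {set {set 'I_n}}) : sgraph :=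
  graph_of (fun x y : 'I_n => [set x; y] \in E).

Definition ex (n : nat) (H : sgraph) : nat :=
  \max_(E : {set {set 'I_n}} | ~~ contains (labelled_graph E) H)
     #|edges (labelled_graph E)|.

Definition extremal (n : nat) (H G : sgraph) : Prop :=
  [/\ #|G| = n, ~~ contains G H & #|edges G| = ex n H].

(* "The unique extremal graph", for a family of graphs sharing one name: the
   extremal graphs are exactly the members of F. *)
Definition unique_extremal (n : nat) (H : sgraph) (F : sgraph -> Prop) : Prop :=
  forall G : sgraph, extremal n H G <-> F G.

(* The cycle with k edges for k >= 3; ordS is the successor modulo k. *)
Definition cycle_graph (k : nat) : sgraph :=
  graph_of (fun i j : 'I_k => ordS i == j).

(* H^q: the edge e receives the q - 2 new vertices inr (e, _). *)
Definition blowup_rel (H : sgraph) (q : nat) :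
    rel (H + {e : {set H} | e \in edges H} * 'I_(q - 2))%type :=
  fun u v => match u, v with
  | inl x, inl y => adj x y
  | inl x, inr (e, _) => x \in val e
  | inr (e, _), inl x => x \in val e
  | inr (e, _), inr (e', _) => e == e'
  end.

Definition blowup (H : sgraph) (q : nat) : sgraph := graph_of (@blowup_rel H q).

Definition complete_graph (m : nat) : sgraph := graph_of (fun _ _ : 'I_m => true).

(* The p classes are the residue classes modulo p. *)
Definition turan_graph (n p : nat) : sgraph :=
  graph_of (fun i j : 'I_n => i != j %[mod p]).

Definition join_rel (G H : sgraph) : rel (G + H)%type :=
  fun u v => match u, v with
  | inl x, inl y => adj x y
  | inr x, inr y => adj x y
  | _, _ => true
  end.

Definition join_graph (G H : sgraph) : sgraph := graph_of (@join_rel G H).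

Definition add_edges (G : sgraph) (E : {set {set G}}) : sgraph :=
  graph_of (fun x y : G => adj x y || ([set x; y] \in E)).

Definition Hgraph (n p s : nat) : sgraph :=
  join_graph (complete_graph (s - 1)) (turan_graph (n - (s - 1)) p).

Definition is_H (n p s : nat) (G : sgraph) : Prop := iso G (Hgraph n p s).

Definition is_Hprime (n p s : nat) (G : sgraph) : Prop :=
  exists x y : turan_graph (n - (s - 1)) p,
    [/\ x != y, val x = val y %[mod p] &
        iso G (@add_edges (Hgraph n p s) [set [set inr x; inr y]])].

Definition complete_bipartite (a b : nat) : sgraph :=
  graph_of (fun u v : 'I_a + 'I_b =>
    match u, v with inl _, inr _ => true | _, _ => false end).

(* M is a set of pairwise disjoint pairs inside A that covers all of A except
   exactly one vertex when #|A| is odd. *)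
Definition near_perfect_matching (T : finType) (A : {set T})
    (M : {set {set T}}) : bool :=
  [&& [forall e in M, #|e| == 2], trivIset M, cover M \subset A &
      #|A :\: cover M| == odd #|A|].

Definition is_Hstar (n : nat) (G : sgraph) : Prop :=
  exists M1 M2 : {set {set complete_bipartite (uphalf n) n./2}},
    [/\ near_perfect_matching [set inl i | i : 'I_(uphalf n)] M1,
        near_perfect_matching [set inr j | j : 'I_n./2] M2 &
        iso G (add_edges (M1 :|: M2))].

(* Main.v *)
Require Import Defs.
From mathcomp Require Import all_boot zify ring.

(** Write [s1 = (k-1)/2], so that [s = s1 + 1] in the theorem.

    Part (i).  The increments [f(n) - f(n-1)] of the conjectured extremal value
    are about [(1 - 1/p) n].  Deleting a vertex of smaller degree from a graph
    with more than [f(n)] edges raises the surplus, which is bounded at a fixed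
    size, so one may assume a minimum degree of about [(1 - 1/p) n].  Such a
    graph contains large complete [p]-partite graphs, is close to the Turán
    graph, and has a [p]-colouring (a maximum cut) with few monochromatic edges.
    The boundedly many "heavy" vertices, with linear degree inside their own
    class, form a set [A]; all other vertices miss few vertices of each foreign
    class, so that short cliques can be completed greedily and copies of
    [C_k^(p+1)] are obtained by closing up chains of cliques through a few
    prescribed vertices.  To compare with the lower bound on the edges, weigh a
    vertex outside [A] by twice its degree to [A] plus a share of its inside
    edges; choosing for every class a type of vertices that is popular and of
    maximal weight forces [|A| = s1] and [A] complete to most of the graph.
    With this at hand every inside edge costs at least as many missing edges,
    up to the single extra edge when [k] is even, and the exact count follows.

    Part (ii).  A graph contains [C_3^3] iff the common neighbourhoods of the
    sides of some triangle have distinct representatives.  If [n = 2N] and all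
    degrees exceed [N], every triangle [xyz] has a vertex [x] with
    [N(x) & N(y) = {z, d}] and [N(x) & N(z) = {y, d}]; this makes the graph
    [(N+1)]-regular and determines it as [H^*(n)], with [N] even.  For odd [n]
    the minimum degree forced by deletion already bounds the edges.  The surplus
    grows only at the multiples of 4, which is enough. *)

Set Implicit Arguments.
Unset Strict Implicit.
Unset Printing Implicit Defensive.

(** The value of [s1] comes from a count. Each of the [k] cliques of the blow-up has [p + 1]
    vertices, so in an almost [p]-partite graph it uses a vertex of [A] or an edge inside a class. A
    vertex lies in at most two cliques: [s1] vertices leave one clique unserved for odd [k] and two
    for even [k], and a single inside edge serves only one. The obstacle is that linearly many
    vertices might give up adjacency to [A] in exchange for inside edges. Up to boundedly many
    vertices, a class has no path on four vertices (on three, unless [p = 2] and [k] is odd), so a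
    vertex gains at most 2 this way, and full vertices together with inside edges of total weight
    [2 * s1] already yield the blow-up. For [(k, p) = (3, 2)] this fails: matchings in both classes
    weigh as much as one vertex of [A], which is the tie between [H^*(n)] and [H(n, 2, 2)]. A second
    obstacle is that heavy refers to a threshold, and vertices just below it spoil greedy choices
    made relative to [A]. Boundedly many, rapidly growing thresholds are used, and a consecutive
    pair is selected between which few inside edges are lost. *)

Ltac nat_only := repeat match goal with H : is_true ?b |- _ =>
  match b with leq _ _ => fail 1 | _ => clear H end end.
Ltac plia := nat_only; lia.
Ltac pnia := nat_only; nia.

(** * Neighbourhoods, degrees into a set, and the handshake identity *)

Section Basics.
Variable G : sgraph.
Implicit Types (x y u v : G) (S T : {set G}).

Definition nbr v : {set G} := [set u | adj v u].
Definition dg v S := #|nbr v :&: S|.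

Lemma in_nbr v u : (u \in nbr v) = adj v u.
Proof. by rewrite inE. Qed.

Lemma adjC x y : adj x y = adj y x.
Proof. exact: adj_sym. Qed.

Lemma adj_neq x y : adj x y -> x != y.
Proof. by apply: contraTneq => ->; rewrite adj_irrefl. Qed.

Lemma dgE v S : dg v S = \sum_(u in S) adj v u.
Proof.
rewrite /dg -sum1_card big_mkcond [RHS]big_mkcond /=; apply: eq_bigr => u _.
by rewrite !inE; case: (adj v u); case: (u \in S).
Qed.

Lemma dg_exchange S T : \sum_(v in S) dg v T = \sum_(u in T) dg u S.
Proof.
under eq_bigr do rewrite dgE.
rewrite exchange_big /=; apply: eq_bigr => u _.
by rewrite dgE; apply: eq_bigr => v _; rewrite adjC.
Qed.

Lemma handshake : \sum_v #|nbr v| = (#|edges G|).*2.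
Proof.
pose P : pred (G * G) := fun q => adj q.1 q.2.
have -> : \sum_v #|nbr v| = #|P|.
  rewrite -sum1_card (eq_bigr (fun v => \sum_(u | adj v u) 1)); last first.
    by move=> v _; rewrite -sum1_card; apply: eq_bigl => u; rewrite inE.
  by rewrite pair_big_dep /=; apply: eq_bigl => -[a b].
rewrite -[LHS]sum1_card.
rewrite (@partition_big _ _ _ _ _ _ P (fun q : G * G => [set q.1; q.2]) (fun e => e \in edges G)) /=; last first.
  move=> [a b] /= ab; rewrite inE; apply/existsP; exists a; apply/existsP; exists b.
  by rewrite eqxx andbT.
rewrite (eq_bigr (fun=> 2)) ?sum_nat_const ?muln2 //.
move=> e; rewrite inE => /existsP[a /existsP[b /andP[ab /eqP ->]]].
have nab := adj_neq ab.
rewrite (eq_bigl (mem [set (a, b); (b, a)])) /=; last first.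
  move=> [c d]; rewrite !inE /= !xpair_eqE.
  apply/andP/orP => [[cd /eqP/setP E]|[]/andP[/eqP-> /eqP->]].
  - have ncd := adj_neq cd.
    have := E c; have := E d; rewrite !inE !eqxx orbT /= => /esym/orP Ed /esym/orP Ec.
    case: Ec Ed => /eqP ? [] /eqP ?; subst; rewrite ?eqxx ?orbT //; first by rewrite eqxx in ncd.
    + by left.
    + by right.
    + by rewrite eqxx in ncd.
  - by rewrite /P /= ab.
  - by rewrite /P /= adjC ab setUC.
by rewrite sum1_card cards2 xpair_eqE negb_and nab.
Qed.

End Basics.

(** * Closed chains of cliques are blown-up cycles *)

Section Chains.
Variables (G : sgraph) (p k : nat).
Hypotheses (hp : 2 <= p) (hk : 3 <= k).
Implicit Types (x y z u v : G) (S Z Q : seq G).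

Definition cliq Q := pairwise (@adj G) Q.

Definition step : Type := (seq G * G)%type.

(* A step [(Q, y)] taken from [x] stands for the clique [x, y, Q] on [p + 1] vertices. *)
Fixpoint chain x (s : seq step) : bool :=
  if s is (Q, y) :: s' then [&& size Q == p.-1, cliq (x :: y :: Q) & chain y s'] else true.

(** Each step contributes its inner vertices and then its endpoint, [p] vertices in all. The start
    is omitted, so that a closed chain lists every vertex exactly once. *)
Definition verts (s : seq step) : seq G := flatten [seq rcons st.1 st.2 | st <- s].
Definition endp x (s : seq step) : G := last x [seq st.2 | st <- s].

Lemma cliq_adj Q a b : cliq Q -> a \in Q -> b \in Q -> a != b -> adj a b.
Proof.
elim: Q => //= c Q IH /andP[/allP cQ cl]; rewrite !inE.
case/predU1P=> [->|aQ] /predU1P[->|bQ] nab; first by rewrite eqxx in nab.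
- exact: cQ.
- by rewrite adjC; exact: cQ.
- exact: IH.
Qed.

Lemma verts_cat s t : verts (s ++ t) = verts s ++ verts t.
Proof. by rewrite /verts map_cat flatten_cat. Qed.

Lemma endp_cat x s t : endp x (s ++ t) = endp (endp x s) t.
Proof. by rewrite /endp map_cat last_cat. Qed.

Lemma chain_cat x s t : chain x (s ++ t) = chain x s && chain (endp x s) t.
Proof. by elim: s x => [|[Q y] s IH] x //=; rewrite IH !andbA. Qed.

Lemma size_verts x s : chain x s -> size (verts s) = p * size s.
Proof.
elim: s x => [|[Q y] s IH] x //=; first by rewrite muln0.
case/and3P=> /eqP sQ _ /IH E; rewrite /verts /= size_cat size_rcons sQ.
by rewrite -/(verts s) E mulnS prednK // (leq_trans _ hp).
Qed.

Lemma endp_verts x s : s != [::] -> endp x s \in verts s.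
Proof.
elim: s x => [|[Q y] s IH] x //= _; rewrite /endp /verts /= mem_cat mem_rcons.
case: s IH => [|st s] IH /=; first by rewrite mem_head.
by have := IH y isT; rewrite /endp /verts /= => ->; rewrite orbT.
Qed.

Lemma nth_verts x0 x s i j : chain x s -> i < size s -> j < p ->
  nth x0 (verts s) (i * p + j) =
  nth x0 (rcons (nth ([::], x0) s i).1 (nth ([::], x0) s i).2) j.
Proof.
elim: s x i => [|[Q y] s IH] x i //= /and3P[/eqP sQ _ ch].
have sz : size (rcons Q y) = p by rewrite size_rcons sQ prednK // (leq_trans _ hp).
case: i => [|i] hi hj; rewrite /verts /= nth_cat sz.
  by rewrite mul0n add0n hj.
by rewrite mulSn -addnA ltnNge leq_addr /= addKn (IH y).
Qed.

Lemma chain_step x0 x s i : chain x s -> i < size s ->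
  let Q := (nth ([::], x0) s i).1 in
  size Q = p.-1 /\
  cliq (nth x0 (x :: [seq st.2 | st <- s]) i :: (nth ([::], x0) s i).2 :: Q).
Proof.
elim: s x i => [|[Q y] s IH] x i //= /and3P[/eqP sQ cl ch].
by case: i => [|i] hi //=; apply: (IH y).
Qed.

(** The embedding is [nth] in [verts s] at an explicit position, so injectivity reduces to Euclidean
    division by [p], and adjacency to membership in a common clique [B i]. *)
Lemma ring_contains x s : chain x s -> size s = k -> endp x s = x -> uniq (verts s) ->
  contains G (blowup (cycle_graph k) (p + 1)).
Proof.
move=> ch sz ex un; have p0 : 0 < p by apply: leq_trans hp.
have szv : size (verts s) = p * k by rewrite (size_verts ch) sz.
pose H := cycle_graph k.
have k0 : 0 < k by apply: leq_trans hk.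
have hidx (e : {e : {set H} | e \in edges H}) : exists i : 'I_k, val e == [set i; ordS i].
  case: e => e /=; rewrite inE => /existsP[a /existsP[b /andP[/andP[nab /orP[]]]]].
  - by move=> /eqP <- /eqP ->; exists a.
  - by move=> /eqP <- /eqP ->; exists b; rewrite setUC.
pose idx e := xchoose (hidx e).
have idxP e : val e = [set idx e; ordS (idx e)] by apply/eqP; apply: (xchooseP (hidx e)).
(* Cycle vertex [i] closes block [i - 1] modulo [k]; writing [(i + k).-1] avoids truncated
   subtraction at [i = 0]. *)
pose pos (u : blowup H (p + 1)) : nat := match u with
  | inl i => ((i + k).-1 %% k) * p + p.-1
  | inr (e, j) => idx e * p + j end.
have pos_lt (u : blowup H (p + 1)) : pos u < p * k.
  case: u => [i|[e j]] /=.
    have := ltn_pmod (i + k).-1 k0; move: (_ %% _) => m hm; nia.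
  have := ltn_ord (idx e); have := ltn_ord j; move: (val j) (val (idx e)) => a b; nia.
have div1 a b : b < p -> (a * p + b) %/ p = a by move=> hb; rewrite divnMDl // divn_small // addn0.
have mod1 a b : b < p -> (a * p + b) %% p = b by move=> hb; rewrite modnMDl modn_small.
have hj (j : 'I_(p + 1 - 2)) : j < p.-1 by have := ltn_ord j; lia.
have pos_inj : injective pos.
  move=> [i|[e j]] [i'|[e' j']] /= E.
  - have E1 : (i + k).-1 %% k = (i' + k).-1 %% k.
      by have := congr1 (fun m => m %/ p) E; rewrite !div1 // prednK.
    congr inl; apply: val_inj => /=.
    have f (m : 'I_k) : (((m + k).-1 %% k) + 1) %% k = m.
      by rewrite modnDml addn1 prednK ?modnDr ?modn_small // addn_gt0 k0 orbT.
    by rewrite -(f i) -(f i') E1.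
  - have lj := leq_trans (hj j') (leq_pred p).
    by have := congr1 (fun m => m %% p) E; rewrite !mod1 ?prednK // => E'; have := hj j'; rewrite -E' ltnn.
  - have lj := leq_trans (hj j) (leq_pred p).
    by have := congr1 (fun m => m %% p) E; rewrite !mod1 ?prednK // => E'; have := hj j; rewrite E' ltnn.
  - have lj := leq_trans (hj j) (leq_pred p); have lj' := leq_trans (hj j') (leq_pred p).
    have Ei : idx e = idx e'.
      by apply: val_inj; have := congr1 (fun m => m %/ p) E; rewrite !div1.
    have Ej : j = j' by apply: val_inj; have := congr1 (fun m => m %% p) E; rewrite !mod1.
    by congr inr; congr pair => //; apply: val_inj; rewrite !idxP Ei.
pose f (u : blowup H (p + 1)) := nth x (verts s) (pos u).
have f_inj : injective f.
  move=> u v /eqP; rewrite /f nth_uniq ?szv ?pos_lt // => /eqP; exact: pos_inj.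
pose c (i : nat) := nth x (x :: [seq st.2 | st <- s]) i.
have ck : c k = x by rewrite -[RHS]ex /endp (last_nth x) size_map sz.
have fl (i : 'I_k) : f (inl i) = c i.
  rewrite /f /=; case: (posnP i) => [i0|i0].
    rewrite i0 add0n modn_small ?prednK // (nth_verts _ ch) ?sz ?prednK //.
    have [sQ _] := chain_step x ch (i := k.-1) ltac:(by rewrite sz prednK).
    rewrite nth_rcons sQ ltnn eqxx -[RHS]ck /c.
    by rewrite -{2}(prednK k0) /= (nth_map ([::], x)) // sz prednK.
  have -> : (i + k).-1 %% k = i.-1.
    have -> : (i + k).-1 = i.-1 + k by lia.
    by rewrite modnDr modn_small //; have := ltn_ord i; lia.
  have li : i.-1 < size s by rewrite sz; have := ltn_ord i; lia.
  rewrite (nth_verts _ ch) //; last by rewrite prednK.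
  have [sQ _] := chain_step x ch li.
  by rewrite nth_rcons sQ ltnn eqxx /c -{2}(prednK i0) /= (nth_map ([::], x)).
have fr e (j : 'I_(p + 1 - 2)) :
    f (inr (e, j)) = nth x (nth ([::], x) s (idx e)).1 j.
  have lj := leq_trans (hj j) (leq_pred p).
  have le_i : idx e < size s by rewrite sz.
  rewrite /f /= (nth_verts _ ch) //.
  by have [sQ _] := chain_step x ch le_i; rewrite nth_rcons sQ hj.
have cS (i : 'I_k) : c (ordS i) = (nth ([::], x) s i).2.
  rewrite /=; have [E|E] : i.+1 = k \/ i.+1 < k by have := ltn_ord i; lia.
    have -> : i.+1 %% k = 0 by rewrite E modnn.
    have -> : c 0 = c i.+1 by rewrite E ck.
    by rewrite /c /= (nth_map ([::], x)) // sz.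
  by rewrite modn_small // /c /= (nth_map ([::], x)) // sz.
pose B (i : 'I_k) := c i :: c (ordS i) :: (nth ([::], x) s i).1.
have clB i : cliq (B i).
  by rewrite /B cS; apply: (proj2 (chain_step x ch _)); rewrite sz.
have frB e j : f (inr (e, j)) \in B (idx e).
  rewrite fr /B !inE mem_nth ?orbT //.
  by rewrite (proj1 (chain_step x ch _)) ?sz.
have flB (e : {e : {set H} | e \in edges H}) (i : H) : i \in val e -> f (inl i) \in B (idx e).
  by rewrite idxP fl !inE => /orP[] /eqP ->; rewrite eqxx ?orbT.
have key (u v : blowup H (p + 1)) : u != v -> @blowup_rel H (p + 1) u v -> adj (f u) (f v).
  move=> nuv; have nf : f u != f v by rewrite (inj_eq f_inj).
  case: u v nf {nuv} => [i|[e j]] [i'|[e' j']] nf /=.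
  - case/andP=> ni /orP[] /eqP E.
    + apply: (cliq_adj (clB i)) => //; rewrite !fl ?mem_head // -E /B !inE eqxx ?orbT //.
    + apply: (cliq_adj (clB i')) => //; rewrite !fl -?E /B !inE eqxx ?orbT //.
  - by move=> h; apply: (cliq_adj (clB (idx e'))) => //; apply: flB.
  - by move=> h; apply: (cliq_adj (clB (idx e))) => //; apply: flB.
  - by move=> /eqP E; apply: (cliq_adj (clB (idx e))) => //; rewrite E; apply: frB.
apply/existsP; exists [ffun u => f u]; apply/andP; split.
  by apply/injectiveP => u v; rewrite !ffunE => /f_inj.
apply/forallP => u; apply/forallP => v; apply/implyP => /andP[nuv /orP[] h].
  by rewrite !ffunE; apply: key.
by rewrite !ffunE adjC; apply: key; rewrite // eq_sym.
Qed.

End Chains.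

(** * Chains of cliques *)

Lemma fill_arith mu m a b : 0 < m -> a <= 5 * m -> b <= 4 * m -> mu * a + b < 10 * m * mu.+1.
Proof.
move=> m0 ha hb; have : mu * a <= mu * (5 * m) by rewrite leq_mul2l ha orbT.
have -> : mu * (5 * m) = 5 * (m * mu) by ring.
have -> : 10 * m * mu.+1 = 10 * (m * mu) + 10 * m by ring.
move: (mu * a) (m * mu) => c d; lia.
Qed.

(** Reduces the disjointness conditions of all later constructions to linear inequalities between
    counts. *)
Lemma uniq_le (T : eqType) (L L' : seq T) : uniq L ->
  (forall a : pred T, count a L' <= count a L) -> uniq L'.
Proof.
move=> uL h; apply: count_mem_uniq => x.
have := h (pred1 x); rewrite (count_uniq_mem _ uL) -(has_pred1 x L') has_count.
by case: (x \in L); case: (count_mem x L') => [|[|n]].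
Qed.

Ltac cnt := rewrite /= ?count_cat /= ?count_cat /= ?count_cat;
  repeat (let n := fresh in set n := (nat_of_bool _); clearbody n);
  repeat (let n := fresh in set n := (count _ _); clearbody n);
  clear; lia.
Ltac uq H := apply: (uniq_le H); intro; cnt.
Ltac pq := apply/permP; intro; cnt.

Section Links.
Variables (G : sgraph) (p k : nat).
Hypotheses (hp : 2 <= p) (hk : 3 <= k).
Implicit Types (w x y z u v c : G) (S Z Q L R : seq G).

Notation F := (blowup (cycle_graph k) (p + 1)).
Notation off Z := (all (fun v => v \notin Z)).

Lemma uniq_swap3 x y z L : uniq (x :: z :: y :: L) = uniq (x :: y :: z :: L).
Proof. by apply: perm_uniq; rewrite perm_cons; exact/permPl/(perm_catCA [:: z] [:: y] L). Qed.

Lemma uniq_swap2 x y L : uniq (x :: y :: L) = uniq (y :: x :: L).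
Proof. by apply: perm_uniq; exact/permPl/(perm_catCA [:: x] [:: y] L). Qed.

(* [x] and [y] are joined by a chain of [l] cliques that can be made to avoid any
   prescribed small [Z]; it may run through the vertices of [S], which the rest of a
   construction must therefore leave free. *)
Definition Link S l x y :=
  [/\ uniq (x :: y :: S), size S < p * l &
   forall Z, size Z + (p * l).+1 <= p * k -> off Z (x :: y :: S) ->
   exists s, [/\ chain p x s, size s = l, endp x s = y, uniq (x :: verts s)
               & off Z (verts s)]].

Lemma off_sub Z L L' : {subset L <= L'} -> off Z L' -> off Z L.
Proof. by move=> h /allP a; apply/allP => v /h /a. Qed.

Lemma off_catZ Z1 Z2 L : off (Z1 ++ Z2) L = off Z1 L && off Z2 L.
Proof. by rewrite -all_predI; apply: eq_all => v /=; rewrite mem_cat negb_or. Qed.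

Lemma uniq_off (L1 L2 : seq G) : uniq (L1 ++ L2) = [&& uniq L1, off L1 L2 & uniq L2].
Proof. by rewrite cat_uniq -all_predC. Qed.

Lemma Link_weak S S' l x y : Link S l x y -> {subset S <= S'} -> uniq (x :: y :: S') ->
  size S' < p * l -> Link S' l x y.
Proof.
move=> [_ _ h] sub un sz; split=> // Z hZ oZ; apply: h => //.
by apply: off_sub oZ => v; rewrite !inE => /or3P[->|->|/sub ->]; rewrite ?orbT.
Qed.

(** The first chain is asked to avoid the vertices reserved for the second link, and the second to
    avoid the first chain as actually built. The condition [size S < p * l] pays for the former, and
    the budget on [Z] is what the [p * k] vertices of a ring leave over. *)
Lemma Link_cat S1 S2 l1 l2 x y z : Link S1 l1 x y -> Link S2 l2 y z ->
  uniq (x :: y :: z :: S1 ++ S2) -> Link (y :: S1 ++ S2) (l1 + l2) x z.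
Proof.
move=> [u1 sz1 h1] [u2 sz2 h2] un; split.
- by rewrite uniq_swap3.
- by rewrite /= size_cat mulnDr; plia.
move=> Z hZ oZ.
move: (un); rewrite /= !inE !mem_cat !negb_or cat_uniq -!andbA.
case/and5P=> nxy nxz xS1 xS2 /and5P[nyz yS1 yS2 zS1] /and4P[zS2 _ /hasPn S12 _].
move: oZ => /= /and4P[xZ zZ yZ]; rewrite all_cat => /andP[S1Z S2Z].
have [||s1 [c1 n1 e1 un1 o1]] := h1 (Z ++ z :: S2).
- by rewrite size_cat /=; move: hZ; rewrite mulnDr; plia.
- apply/allP => v; rewrite mem_cat !inE !negb_or => /or3P[/eqP->|/eqP->|vS].
  + by rewrite xZ nxz xS2.
  + by rewrite yZ nyz yS2.
  + rewrite (allP S1Z _ vS) /=; apply/andP; split; first by apply: contraNneq zS1 => <-.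
    by apply/negP => /S12; rewrite vS.
move: o1; rewrite off_catZ => /andP[o1Z o1S].
have szv1 : size (verts s1) = p * l1 by rewrite (size_verts hp c1) n1.
have ne1 : s1 != [::] by rewrite -size_eq0 n1; case: (l1) sz1 => //; rewrite muln0.
have yv1 : y \in verts s1 by rewrite -e1 endp_verts.
(* The junction [y] belongs to the first chain but is the start of the second, so it must not be
   among the vertices to avoid. *)
have [||s2 [c2 n2 e2 un2 o2]] := h2 (Z ++ x :: rem y (verts s1)).
- rewrite size_cat /= size_rem // szv1; move: hZ; rewrite mulnDr.
  have h0 : 0 < p * l1 by apply: leq_ltn_trans sz1.
  plia.
- have uv1 : uniq (verts s1) by case/andP: un1.
  have aux v : v \notin x :: verts s1 -> v \notin x :: rem y (verts s1).
    by apply: contra; rewrite !inE => /orP[->//|/mem_rem ->]; rewrite orbT.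
  apply/allP => v; rewrite mem_cat negb_or !(in_cons _ _ v) => /or3P[/eqP->|/eqP->|vS].
  + by rewrite yZ negb_or eq_sym nxy mem_rem_uniqF.
  + rewrite zZ; apply: aux; rewrite inE negb_or eq_sym nxz /=.
    by apply: contraL o1S => zv; apply/allPn; exists z; rewrite // negbK inE eqxx.
  + rewrite (allP S2Z _ vS); apply: aux; rewrite inE negb_or; apply/andP; split.
      by apply: contraNneq xS2 => <-.
    by apply: contraL o1S => zv; apply/allPn; exists v; rewrite // negbK inE vS orbT.
move: o2; rewrite off_catZ => /andP[o2Z o2S].
exists (s1 ++ s2); split.
- by rewrite chain_cat c1 e1.
- by rewrite size_cat n1 n2.
- by rewrite endp_cat e1.
- rewrite -[_ && _]/(uniq (x :: verts (s1 ++ s2))) verts_cat -cat_cons uniq_off.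
  rewrite [uniq (x :: _)]un1 /=.
  case/andP: un2 => yv2 uv2; rewrite [uniq (verts s2)]uv2 andbT.
  apply/allP => v vv2; have := allP o2S _ vv2; apply: contra.
  rewrite !inE => /orP[->//|vv1]; apply/orP; right.
  have uv1 : uniq (verts s1) by case/andP: un1.
  rewrite mem_rem_uniq // inE vv1 andbT.
  by apply: contraNneq yv2 => <-.
- by rewrite verts_cat all_cat o1Z.
Qed.

(** The budget in [Link] is exhausted exactly here: the second chain has to avoid all but one of the
    [p * l1] vertices of the first. *)
Lemma Link_close S1 S2 l1 l2 x y : Link S1 l1 x y -> Link S2 l2 y x ->
  uniq (x :: y :: S1 ++ S2) -> l1 + l2 = k -> contains G F.
Proof.
move=> [u1 sz1 h1] [u2 sz2 h2] un E.
move: (un); rewrite /= !inE !mem_cat !negb_or cat_uniq -!andbA.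
case/and5P=> nxy xS1 xS2 yS1 /and4P[yS2 _ /hasPn S12 _].
have [||s1 [c1 n1 e1 un1 o1]] := h1 S2.
- by rewrite -E mulnDr; plia.
- by rewrite /= xS2 yS2 /=; apply/allP => v vS; apply/negP => /S12; rewrite vS.
have szv1 : size (verts s1) = p * l1 by rewrite (size_verts hp c1) n1.
have ne1 : s1 != [::] by rewrite -size_eq0 n1; case: (l1) sz1 => //; rewrite muln0.
have yv1 : y \in verts s1 by rewrite -e1 endp_verts.
have uv1 : uniq (verts s1) by case/andP: un1.
have xv1 : x \notin verts s1 by case/andP: un1.
have [||s2 [c2 n2 e2 un2 o2]] := h2 (rem y (verts s1)).
- rewrite size_rem // szv1 -E mulnDr.
  have h0 : 0 < p * l1 by apply: leq_ltn_trans sz1.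
  plia.
- rewrite /= mem_rem_uniqF //= (contra (@mem_rem _ _ _ _) xv1) /=.
  apply/allP => v vS; apply: (contra (@mem_rem _ _ _ _)).
  by apply: contraL o1 => zv; apply/allPn; exists v; rewrite // negbK.
apply: (@ring_contains _ _ _ hp hk x (s1 ++ s2)).
- by rewrite chain_cat c1 e1.
- by rewrite size_cat n1 n2.
- by rewrite endp_cat e1.
- rewrite verts_cat uniq_off uv1 /=.
  case/andP: un2 => yv2 uv2; rewrite [uniq (verts s2)]uv2 andbT.
  apply/allP => v vv2; have := allP o2 _ vv2; apply: contra => vv1.
  rewrite mem_rem_uniq // inE vv1 andbT.
  by apply: contraNneq yv2 => <-.
Qed.

(** The middle vertex [c], with its companions [E], is chosen afresh for every set to be avoided;
    hence it does not enter the reserved vertices of the resulting link. *)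
Lemma Link_via_ext S1 S2 l1 l2 x z : uniq (x :: z :: S1 ++ S2) ->
  (forall Z, size Z <= p * k -> exists c E,
     [/\ uniq (c :: E), off Z (c :: E), Link (E ++ S1) l1 x c & Link S2 l2 c z]) ->
  Link (S1 ++ S2) (l1 + l2) x z.
Proof.
move=> un h.
have [|c0 [E0 [_ _ [_ sz1 _] [_ sz2 _]]]] := h [::] => //.
rewrite size_cat in sz1.
have sz : size (S1 ++ S2) + 2 <= p * (l1 + l2) by rewrite size_cat mulnDr; plia.
split=> //; first by plia.
move=> Z hZ oZ.
have [|c [E [uE oE L1 L2]]] := h (Z ++ x :: z :: S1 ++ S2).
  by rewrite size_cat; move: sz hZ; rewrite -[size (x :: _)]/((size (S1 ++ S2)).+2); plia.
move: oE; rewrite off_catZ => /andP[oEZ oES].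
have unA : uniq ((x :: z :: S1 ++ S2) ++ c :: E) by rewrite uniq_off un oES.
have un' : uniq (x :: c :: z :: (E ++ S1) ++ S2) by uq unA.
have [_ _ hL] := Link_cat L1 L2 un'.
apply: hL => //; apply/allP => v vI.
have : v \in (c :: E) ++ (x :: z :: S1 ++ S2).
  move: vI; rewrite !(mem_cat, inE).
  by do !case: (_ == _) => //=; do !case: (_ \in _).
by rewrite mem_cat => /orP[] hv; [exact: (allP oEZ) | exact: (allP oZ)].
Qed.

Lemma Link_via S1 S2 l1 l2 x z : uniq (x :: z :: S1 ++ S2) ->
  (forall Z, size Z <= p * k -> exists c, [/\ c \notin Z, Link S1 l1 x c & Link S2 l2 c z]) ->
  Link (S1 ++ S2) (l1 + l2) x z.
Proof.
move=> un h; apply: Link_via_ext => // Z /h[c [cZ L1 L2]].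
by exists c, [::]; split; rewrite //= cZ.
Qed.

(** * Greedy completion of cliques inside large, almost complete classes *)

Section Fill.
Variables (P : 'I_p -> {set G}) (mu : nat).

Definition ok j v := #|P j :\: nbr v| <= mu.
(** A vertex that behaves like a member of class [i]: it misses few vertices of every other [P j],
    while its adjacency to [P i] is left open, so that it may carry inside edges. *)
Definition nrm i v := forall j, j != i -> ok j v.
Definition full w := forall j v, v \in P j -> adj w v.
(** The factor 10 covers a greedy step that must be adjacent to at most [5 * k * p] vertices, each
    missing up to [mu], and must avoid [4 * k * p] others. *)
Definition bound := 10 * k * p * mu.+1.

Record Fill : Prop := { FillN : forall i v, v \in P i -> nrm i v;
                        FillB : forall i, bound <= #|P i| }.

Hypothesis HF : Fill.

Lemma full_ok w j : full w -> ok j w.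
Proof.
move=> fw; rewrite /ok (_ : _ :\: _ = set0) ?cards0 //.
by apply/setP => v; rewrite !inE; case vP: (v \in P j); rewrite ?andbF // (fw j).
Qed.

Lemma pick_fill_gen (X : {set G}) L Z : (forall v, v \in L -> #|X :\: nbr v| <= mu) ->
  mu * size L + size Z < #|X| ->
  exists c, [/\ c \in X, c \notin Z & forall v, v \in L -> adj v c].
Proof.
move=> hL hZ; pose B := [set v in Z] :|: \bigcup_(v <- L) (X :\: nbr v).
have cB : #|B| <= size Z + mu * size L.
  apply: leq_trans (leq_card_setU _ _) _; rewrite leq_add //.
    by rewrite cardsE card_size.
  elim: L hL {hZ B} => [|v L IH] hL; first by rewrite big_nil cards0.
  rewrite big_cons; apply: leq_trans (leq_card_setU _ _) _.
  rewrite /= mulnS leq_add //; first by apply: hL; rewrite mem_head.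
  by apply: IH => u uL; apply: hL; rewrite inE uL orbT.
have /subsetPn[c cX cB'] : ~~ (X \subset B).
  by apply: contraTN hZ => /subset_leq_card; plia.
exists c; split=> //; first by apply: contra cB' => h; rewrite !inE h.
move=> v vL; apply: contraR cB' => nv; rewrite !inE; apply/orP; right.
by rewrite (big_rem v vL) /= !inE nv cX.
Qed.

Lemma pick_fill j L Z : (forall v, v \in L -> ok j v) -> size L <= 5 * k * p ->
  size Z <= 4 * k * p -> exists c, [/\ c \in P j, c \notin Z & forall v, v \in L -> adj v c].
Proof.
move=> hL sL sZ; apply: pick_fill_gen => //; apply: leq_trans (FillB HF j); rewrite /bound.
have kp : 0 < k * p by rewrite muln_gt0; apply/andP; split; plia.
by rewrite -(mulnA 10); apply: fill_arith kp _ _; rewrite mulnA.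
Qed.

Lemma extend_cliq (J : seq 'I_p) L Z : uniq J -> cliq L -> size L + size J <= p.+1 ->
  size Z <= p * k -> (forall j v, j \in J -> v \in L -> ok j v) ->
  exists Q, [/\ size Q = size J, cliq (L ++ Q) & off Z Q].
Proof.
elim: J L => [|j J IH] L; first by exists [::]; rewrite cats0.
move=> /= /andP[jJ uJ] cL sz sZ hok.
have [|||c [cP cZ cadj]] := @pick_fill j L Z.
- by move=> v vL; apply: hok; rewrite ?mem_head.
- by pnia.
- by pnia.
have [||||Q [sQ cQ oQ]] := IH (rcons L c) uJ.
- rewrite /cliq pairwise_rcons [pairwise _ _]cL andbT; apply/allP => v /cadj; done.
- by rewrite size_rcons; plia.
- by [].
- move=> i v iJ; rewrite mem_rcons inE => /predU1P[->|vL].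
    by apply: (FillN HF cP); apply: contraNneq jJ => <-.
  by apply: hok; rewrite // inE iJ orbT.
by exists (c :: Q); rewrite /= sQ -cat_rcons cQ cZ oQ.
Qed.

(** [D] lists the classes occupied by the given vertices, and one vertex from each remaining class
    completes the clique. A clique has one vertex more than there are classes, so the given
    [(size S).+2] vertices may occupy only [(size S).+1] classes: either two of them form an inside
    edge or one is full. *)
Lemma base_link (D : seq 'I_p) S x y : cliq (x :: y :: S) -> uniq D -> size D = (size S).+1 ->
  (forall j v, j \notin D -> v \in x :: y :: S -> ok j v) -> Link S 1 x y.
Proof.
move=> cl uD sD hok.
have un L : cliq L -> uniq L.
  elim: L => //= v L IH /andP[/allP hv /IH ->]; rewrite andbT.
  by apply/negP => /hv; rewrite adj_irrefl.
have sDp : size D <= p by rewrite -(card_uniqP uD) -[X in _ <= X]card_ord max_card.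
split; [exact: un | by rewrite muln1; plia |].
move=> Z hZ /= /and3P[xZ yZ SZ].
pose J := [seq j <- enum 'I_p | j \notin D].
have uJ : uniq J by rewrite filter_uniq ?enum_uniq.
have sJ : size J + size D = p.
  rewrite -(card_uniqP uD) -(card_uniqP uJ) addnC -[RHS]card_ord -(cardC (mem D)).
  by congr addn; apply: eq_card => j; rewrite mem_filter mem_enum !inE andbT.
have sJS : size S + size J = p.-1.
  by move: (size J) (size D) (size S) sJ sD => a b c1 sJ sD; plia.
have [|||Q [sQ cQ oQ]] := @extend_cliq J (x :: y :: S) Z uJ cl.
- rewrite /= !addSn sJS; plia.
- by move: hZ; rewrite muln1; plia.
- by move=> j v; rewrite mem_filter => /andP[jD _]; apply: hok.
have unQ := un _ cQ.
have vE : verts [:: (S ++ Q, y)] = rcons (S ++ Q) y by rewrite /verts /= cats0.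
have uV : uniq (x :: verts [:: (S ++ Q, y)]).
  have pe : perm_eq (x :: rcons (S ++ Q) y) (x :: y :: S ++ Q) by rewrite perm_cons perm_rcons.
  by rewrite vE (perm_uniq pe); exact: unQ.
exists [:: (S ++ Q, y)]; split=> //.
- by rewrite /chain size_cat sQ sJS eqxx andbT.
- by rewrite vE all_rcons yZ all_cat SZ oQ.
Qed.

(** This and the next lemmas list the ways in which a clique gets its vertex in excess of the
    classes: a full end, an inside edge joining the two ends, an inside edge at one end, an inside
    edge away from both ends, or a full vertex away from both ends. *)
Lemma Link_full_nrm i w x : full w -> nrm i x -> adj w x -> Link [::] 1 w x.
Proof.
move=> fw nx wx; apply: (@base_link [:: i]) => //=; first by rewrite /cliq /= wx.
move=> j v; rewrite !inE => ji /orP[] /eqP ->; [exact: full_ok | exact: nx].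
Qed.

Lemma Link_nrm_full i w x : full w -> nrm i x -> adj w x -> Link [::] 1 x w.
Proof.
move=> fw nx wx; apply: (@base_link [:: i]) => //=; first by rewrite /cliq /= adjC wx.
move=> j v; rewrite !inE => ji /orP[] /eqP ->; [exact: nx|exact: full_ok].
Qed.

Lemma Link_edge i u v : nrm i u -> nrm i v -> adj u v -> Link [::] 1 u v.
Proof.
move=> nu nv uv; apply: (@base_link [:: i]) => //=; first by rewrite /cliq /= uv.
by move=> j t; rewrite !inE => ji /orP[] /eqP ->; [exact: nu|exact: nv].
Qed.

Lemma Link_from i j u v y : i != j -> nrm i u -> nrm i v -> nrm j y ->
  adj u v -> adj u y -> adj v y -> Link [:: v] 1 u y.
Proof.
move=> ij nu nv ny uv uy vy; apply: (@base_link [:: i; j]) => //=.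
- by rewrite /cliq /= uv uy adjC vy.
- by rewrite inE ij.
- move=> l t; rewrite !inE negb_or => /andP[li lj] /or3P[] /eqP ->;
  by [exact: nu | exact: ny | exact: nv].
Qed.

Lemma Link_to i j u v y : i != j -> nrm i u -> nrm i v -> nrm j y ->
  adj u v -> adj u y -> adj v y -> Link [:: v] 1 y u.
Proof.
move=> ij nu nv ny uv uy vy; apply: (@base_link [:: i; j]) => //=.
- by rewrite /cliq /= uv ![adj y _]adjC uy vy.
- by rewrite inE ij.
- move=> l t; rewrite !inE negb_or => /andP[li lj] /or3P[] /eqP ->;
  by [exact: nu | exact: ny | exact: nv].
Qed.

Lemma Link_apex i j l u v y z : uniq [:: i; j; l] -> nrm i u -> nrm i v -> nrm j y -> nrm l z ->
  adj u v -> adj u y -> adj v y -> adj u z -> adj v z -> adj y z -> Link [:: u; v] 1 y z.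
Proof.
move=> un nu nv ny nz uv uy vy uz vz yz; apply: (@base_link [:: i; j; l]) => //=.
- by rewrite /cliq /= uv yz ![adj y _]adjC ![adj z _]adjC uy vy uz vz.
- move=> m t; rewrite !inE !negb_or => /and3P[mi mj ml] /or4P[] /eqP ->;
  by [exact: nu | exact: ny | exact: nv | exact: nz].
Qed.

Lemma Link_full_apex j l w y z : j != l -> (forall m, m != j -> m != l -> ok m w) ->
  nrm j y -> nrm l z -> adj w y -> adj w z -> adj y z -> Link [:: w] 1 y z.
Proof.
move=> jl fw ny nz wy wz yz; apply: (@base_link [:: j; l]) => //=.
- by rewrite /cliq /= yz [adj y w]adjC [adj z w]adjC wy wz.
- by rewrite inE jl.
- move=> m t; rewrite !inE !negb_or => /andP[mj ml] /or3P[] /eqP ->;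
  by [exact: fw | exact: ny | exact: nz].
Qed.

(** Two cliques meeting in a class vertex that is chosen afresh; both are completed because each
    contains one full vertex. *)
Lemma Link_full_full w w' : full w -> full w' -> w != w' -> Link [::] 2 w w'.
Proof.
move=> fw fw' nw; pose j : 'I_p := Ordinal (ltn_trans (ltnSn 0) hp).
apply: (@Link_via [::] [::] 1 1); first by rewrite /= inE nw.
move=> Z sZ; have [||| c [cP cZ _]] := @pick_fill j [::] Z => //.
  by apply: leq_trans sZ _; pnia.
exists c; split=> //; [apply: (Link_full_nrm (i := j)) | apply: (Link_nrm_full (i := j))] => //;
  solve [exact: (FillN HF cP) | exact: fw cP | exact: fw' cP].
Qed.

(** Consecutive full vertices are two cliques apart. This rate of two cliques per full vertex is
    what makes [s1] the critical number. *)
Lemma Rpath w R : uniq (w :: R) -> (forall v, v \in w :: R -> full v) -> R != [::] ->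
  exists S, perm_eq (w :: last w R :: S) (w :: R) /\ Link S (2 * size R) w (last w R).
Proof.
elim: R w => // w' R IH w un hf _.
have nw : w != w' by move: un; rewrite /= inE negb_or; case: (w == w').
have L1 : Link [::] 2 w w' by apply: Link_full_full => //; apply: hf; rewrite !inE eqxx ?orbT.
case: (eqVneq R [::]) => [->|nR] /=; first by exists [::]; rewrite muln1.
have [||S [pS LS]] := IH w' _ _ nR.
- by case/andP: un.
- by move=> v vR; apply: hf; rewrite inE vR orbT.
exists (w' :: S); split.
  rewrite perm_cons -(perm_catCA [:: w'] [:: last w' R] S) /=; exact: pS.
have -> : 2 * (size R).+1 = 2 + 2 * size R by plia.
have pe : perm_eq (w :: w' :: last w' R :: S) (w :: w' :: R) by rewrite perm_cons.
apply: (@Link_cat [::] S); [exact: L1 | exact: LS |].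
by rewrite [uniq _](perm_uniq pe).
Qed.

(** The full vertices [w :: R] take care of [2 * size R] cliques, so a template only has to bridge
    the remaining ones from [last w R] back to [w]. *)
Lemma close_R w R c S1 S2 l1 m : (forall v, v \in w :: R -> full v) ->
  Link S1 l1 (last w R) c -> Link S2 m c w -> l1 + m + 2 * size R = k ->
  uniq (c :: (w :: R) ++ S1 ++ S2) -> contains G F.
Proof.
move=> hf L1 L2 E un.
case: (eqVneq R [::]) => [R0|nR].
  rewrite R0 /= addn0 in L1 E un; apply: (Link_close L1 L2) => //.
  by rewrite uniq_swap2.
have unR : uniq (w :: R) by move: un; rewrite cons_uniq => /andP[_]; rewrite cat_uniq => /andP[].
have [S [pS LS]] := Rpath unR hf nR.
have pe : perm_eq (w :: last w R :: c :: S ++ S1 ++ S2) (c :: (w :: R) ++ S1 ++ S2).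
  have h2 : perm_eq (c :: (w :: last w R :: S) ++ S1 ++ S2) (c :: (w :: R) ++ S1 ++ S2).
    by rewrite perm_cons perm_cat2r.
  apply: perm_trans h2; exact/permPl/(perm_catCA [:: w; last w R] [:: c]).
rewrite -(perm_uniq pe) in un.
have L3 : Link (last w R :: S ++ S1) (2 * size R + l1) w c.
  have : uniq ([:: w, last w R, c & S ++ S1] ++ S2) by rewrite !cat_cons -catA.
  by rewrite cat_uniq => /andP[un2 _]; apply: Link_cat; [exact: LS | exact: L1 | exact: un2].
apply: (Link_close L3 L2); last by plia.
by rewrite cat_cons -catA uniq_swap3.
Qed.


Lemma nrmP i j v : j != i -> v \in P i -> ok j v.
Proof. by move=> ji vP; apply: (FillN HF vP). Qed.

Lemma pick1 j L Z : (forall v, v \in L -> ok j v) -> size L <= 5 * k * p -> size Z <= 4 * k * p ->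
  exists c, [/\ c \in P j, nrm j c, c \notin Z & forall v, v \in L -> adj v c].
Proof.
move=> h1 h2 h3; have [c [cP cZ ca]] := pick_fill h1 h2 h3; exists c; split=> //.
exact: (FillN HF cP).
Qed.

Lemma other_color (i : 'I_p) : exists j, j != i.
Proof.
pose a : 'I_p := Ordinal (ltn_trans (ltnSn 0) hp); pose b : 'I_p := Ordinal hp.
case: (eqVneq i a) => [->|n]; first by exists b.
by exists a; rewrite eq_sym.
Qed.

Lemma kp_small a : a <= k + 20 -> a <= 4 * k * p.
Proof. by move=> h; pnia. Qed.

Lemma third_color (i j : 'I_p) : 3 <= p -> exists l, (l != i) && (l != j).
Proof.
move=> p3; have /subsetPn[l _ h] : ~~ (setT \subset [set i; j]).
  apply/negP => /subset_leq_card; rewrite cardsT card_ord cards2; case: (_ != _) => /=; plia.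
by exists l; move: h; rewrite !inE negb_or.
Qed.

(** * Rings through full vertices and a few inside edges *)

Section WithFull.
Variables (w : G) (R : seq G).
Hypothesis hR : forall v, v \in w :: R -> full v.
Hypothesis sR : size R <= k.

Lemma hw : full w. Proof. by apply: hR; rewrite mem_head. Qed.
Lemma hl : full (last w R). Proof. by apply: hR; apply: mem_last. Qed.

Lemma fw_nrm i c : c \in P i -> Link [::] 1 c w.
Proof. by move=> cP; apply: (Link_nrm_full (i := i)); [exact: hw|exact: FillN cP|exact: hw cP]. Qed.

Lemma fl_nrm i c : c \in P i -> Link [::] 1 (last w R) c.
Proof. by move=> cP; apply: (Link_full_nrm (i := i)); [exact: hl|exact: FillN cP|exact: hl cP]. Qed.

Lemma tmpl_full_even : uniq (w :: R) -> 2 * (size R).+1 = k -> contains G F.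
Proof.
move=> uR sz; pose j : 'I_p := Ordinal hp.
have [||| c [cP nc cZ _]] := @pick1 j [::] (w :: R) => //; first by apply: kp_small => /=; plia.
apply: (close_R hR (fl_nrm cP) (fw_nrm cP)); first by plia.
have un : uniq (c :: w :: R) by rewrite cons_uniq cZ.
by uq un.
Qed.

(** The last full vertex [a] serves a single clique only: it sits off the cycle, above the cycle
    edge [c d]. *)
Lemma tmpl_full_odd a : uniq (a :: w :: R) -> full a -> 2 * size R + 3 = k -> contains G F.
Proof.
move=> uR fa sz; pose j : 'I_p := Ordinal hp; have [i ij] := other_color j.
have [||| c [cP nc cZ _]] := @pick1 j [::] (a :: w :: R) => //; first by apply: kp_small => /=; plia.
have [||| d [dP nd dZ da]] := @pick1 i [:: c] (c :: a :: w :: R).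
- by move=> v; rewrite inE => /eqP ->; apply: nrmP cP.
- by apply: (leq_trans (n := 4 * k * p)); [apply: kp_small => /=; plia | pnia].
- by apply: kp_small => /=; plia.
have cd : adj c d by apply: da; rewrite inE.
have un : uniq (d :: c :: a :: w :: R) by rewrite !cons_uniq dZ cZ.
have L1 : Link [:: a] 1 c d.
  apply: (Link_full_apex (j := j) (l := i)) => //; [by rewrite eq_sym| |exact: fa cP|exact: fa dP].
  by move=> m _ _; exact: full_ok.
have L2 : Link (d :: [:: a] ++ [::]) (1 + 1) c w by apply: (Link_cat L1 (fw_nrm dP)); uq un.
by apply: (close_R hR (fl_nrm cP) L2); [plia | uq un].
Qed.

(** With three classes the inside edge can be placed off the cycle, above cycle vertices of two
    other classes, and needs no adjacency to a full vertex. With two classes there is no room for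
    this; [tmpl_edge_full] then makes [u] a cycle vertex and asks for [adj (last w R) u]. *)
Lemma tmpl_edge_apex i u v : 3 <= p -> uniq (u :: v :: w :: R) -> nrm i u -> nrm i v -> adj u v ->
  2 * size R + 3 = k -> contains G F.
Proof.
move=> p3 uR nu nv uv sz.
have [j ji] := other_color i.
have [l lij] : exists l : 'I_p, l \notin [:: i; j].
  have /subsetPn[l _ h] : ~~ (setT \subset [set i; j]).
    apply/negP => /subset_leq_card; rewrite cardsT card_ord cards2; case: (_ != _) => /=; plia.
  by exists l; move: h; rewrite !inE.
move: lij; rewrite !inE negb_or => /andP[li lj].
have [||| c [cP nc cZ ca]] := @pick1 j [:: u; v] (u :: v :: w :: R).
- by move=> t; rewrite !inE => /orP[] /eqP ->; [exact: nu|exact: nv].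
- by apply: (leq_trans (n := 4 * k * p)); [apply: kp_small => /=; plia | pnia].
- by apply: kp_small => /=; plia.
have [||| d [dP nd dZ da]] := @pick1 l [:: u; v; c] (c :: u :: v :: w :: R).
- by move=> t; rewrite !inE => /or3P[] /eqP ->; [exact: nu|exact: nv|exact: nrmP cP].
- by apply: (leq_trans (n := 4 * k * p)); [apply: kp_small => /=; plia | pnia].
- by apply: kp_small => /=; plia.
have un : uniq (d :: c :: u :: v :: w :: R) by rewrite !(cons_uniq c, cons_uniq d) dZ cZ.
have L1 : Link [:: u; v] 1 c d.
  apply: (Link_apex (i := i) (j := j) (l := l)) => //; try by [apply: ca; rewrite !inE eqxx ?orbT | apply: da; rewrite !inE eqxx ?orbT].
  by rewrite /= !inE negb_or eq_sym ji eq_sym li eq_sym lj.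
have L2 : Link (d :: [:: u; v] ++ [::]) (1 + 1) c w by apply: (Link_cat L1 (fw_nrm dP)); uq un.
by apply: (close_R hR (fl_nrm cP) L2); [plia | uq un].
Qed.

(** The centre [z] becomes a cycle vertex and its two edges serve the two cliques that meet in
    it. *)
Lemma tmpl_P3 i l z r : uniq (l :: z :: r :: w :: R) -> nrm i l -> nrm i z -> nrm i r ->
  adj z l -> adj z r -> 2 * size R + 4 = k -> contains G F.
Proof.
move=> uR nl nz nr zl zr sz; have [j ji] := other_color i.
have ij : i != j by rewrite eq_sym.
have [||| c [cP nc cZ ca]] := @pick1 j [:: l; z] (l :: z :: r :: w :: R).
- by move=> t; rewrite !inE => /orP[] /eqP ->; [exact: nl|exact: nz].
- by apply: (leq_trans (n := 4 * k * p)); [apply: kp_small => /=; plia | pnia].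
- by apply: kp_small => /=; plia.
have [||| d [dP nd dZ da]] := @pick1 j [:: r; z] (c :: l :: z :: r :: w :: R).
- by move=> t; rewrite !inE => /orP[] /eqP ->; [exact: nr|exact: nz].
- by apply: (leq_trans (n := 4 * k * p)); [apply: kp_small => /=; plia | pnia].
- by apply: kp_small => /=; plia.
have un : uniq (d :: c :: l :: z :: r :: w :: R) by rewrite !(cons_uniq c, cons_uniq d) dZ cZ.
have L1 : Link [:: l] 1 c z.
  by apply: (Link_to (i := i) (j := j)) => //; apply: ca; rewrite !inE eqxx ?orbT.
have L2 : Link [:: r] 1 z d.
  by apply: (Link_from (i := i) (j := j)) => //; apply: da; rewrite !inE eqxx ?orbT.
have L3 := Link_cat L2 (fw_nrm dP) ltac:(uq un).
have L4 := Link_cat L1 L3 ltac:(uq un).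
by apply: (close_R hR (fl_nrm cP) L4); [plia | uq un].
Qed.

Lemma tmpl_two_edges i i' u v u' v' : 3 <= p -> uniq (u :: v :: u' :: v' :: w :: R) ->
  nrm i u -> nrm i v -> nrm i' u' -> nrm i' v' -> adj u v -> adj u' v' ->
  2 * size R + 4 = k -> contains G F.
Proof.
move=> p3 uR nu nv nu' nv' uv uv' sz.
have [l /andP[li li']] := third_color i i' p3.
have [j /andP[ji jl]] := third_color i l p3.
have [j' /andP[ji' jl']] := third_color i' l p3.
have [||| c [cP nc cZ ca]] := @pick1 j [:: u; v] (u :: v :: u' :: v' :: w :: R).
- by move=> t; rewrite !inE => /orP[] /eqP ->; [exact: nu|exact: nv].
- by apply: (leq_trans (n := 4 * k * p)); [apply: kp_small => /=; plia | pnia].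
- by apply: kp_small => /=; plia.
have [||| e [eP ne eZ ea]] := @pick1 j' [:: u'; v'] (c :: u :: v :: u' :: v' :: w :: R).
- by move=> t; rewrite !inE => /orP[] /eqP ->; [exact: nu'|exact: nv'].
- by apply: (leq_trans (n := 4 * k * p)); [apply: kp_small => /=; plia | pnia].
- by apply: kp_small => /=; plia.
have [||| d [dP nd dZ da]] := @pick1 l [:: u; v; u'; v'; c; e] (e :: c :: u :: v :: u' :: v' :: w :: R).
- move=> t; rewrite !inE => /orP[/eqP->|/orP[/eqP->|/orP[/eqP->|/orP[/eqP->|/orP[]/eqP->]]]];
  by [exact: nu|exact: nv|exact: nu'|exact: nv'|apply: nc; rewrite eq_sym|apply: ne; rewrite eq_sym].
- by apply: (leq_trans (n := 4 * k * p)); [apply: kp_small => /=; plia | pnia].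
- by apply: kp_small => /=; plia.
have un : uniq (d :: e :: c :: u :: v :: u' :: v' :: w :: R) by rewrite !(cons_uniq c, cons_uniq d, cons_uniq e) dZ cZ eZ.
have L1 : Link [:: u; v] 1 c d.
  apply: (Link_apex (i := i) (j := j) (l := l)) => //; try by [apply: ca; rewrite !inE eqxx ?orbT | apply: da; rewrite !inE eqxx ?orbT].
  by rewrite /= !inE negb_or [i == j]eq_sym ji [i == l]eq_sym li jl.
have L2 : Link [:: u'; v'] 1 d e.
  apply: (Link_apex (i := i') (j := l) (l := j')) => //; try by [apply: ea; rewrite !inE eqxx ?orbT | apply: da; rewrite !inE eqxx ?orbT | rewrite adjC; apply: da; rewrite !inE eqxx ?orbT].
  by rewrite /= !inE negb_or [i' == j']eq_sym ji' [i' == l]eq_sym li' [l == j']eq_sym jl'.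
have L3 := Link_cat L2 (fw_nrm eP) ltac:(uq un).
have L4 := Link_cat L1 L3 ltac:(uq un).
by apply: (close_R hR (fl_nrm cP) L4); [plia | uq un].
Qed.

(** The cycle runs from the last full vertex to [u], on to a common neighbour [c], then to [u'] and
    back to the first full vertex; one adjacency of each edge to a full vertex is enough. *)
Lemma tmpl_two_edges_same i u v u' v' : uniq (u :: v :: u' :: v' :: w :: R) ->
  nrm i u -> nrm i v -> nrm i u' -> nrm i v' -> adj u v -> adj u' v' ->
  adj (last w R) u -> adj w u' -> 2 * size R + 4 = k -> contains G F.
Proof.
move=> uR nu nv nu' nv' uv uv' lu wu' sz; have [j ji] := other_color i.
have ij : i != j by rewrite eq_sym.
have [||| c [cP nc cZ ca]] := @pick1 j [:: u; v; u'; v'] (u :: v :: u' :: v' :: w :: R).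
- by move=> t; rewrite !inE => /or4P[] /eqP ->; by [exact: nu|exact: nv|exact: nu'|exact: nv'].
- by apply: (leq_trans (n := 4 * k * p)); [apply: kp_small => /=; plia | pnia].
- by apply: kp_small => /=; plia.
have un : uniq (c :: u :: v :: u' :: v' :: w :: R) by rewrite !(cons_uniq c) cZ.
have L1 : Link [:: v] 1 u c.
  by apply: (Link_from (i := i) (j := j)) => //; apply: ca; rewrite !inE eqxx ?orbT.
have L2 : Link [:: v'] 1 c u'.
  by apply: (Link_to (i := i) (j := j)) => //; apply: ca; rewrite !inE eqxx ?orbT.
have L0 : Link [::] 1 (last w R) u by apply: (Link_full_nrm (i := i)) => //; exact: hl.
have L9 : Link [::] 1 u' w by apply: (Link_nrm_full (i := i)) => //; exact: hw.
have L3 := Link_cat L2 L9 ltac:(uq un).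
have L4 := Link_cat L1 L3 ltac:(uq un).
by apply: (close_R hR L0 L4); [plia | uq un].
Qed.

(** The two inside edges serve consecutive cliques sharing [a], which therefore has to see both ends
    of the other edge. This is the configuration excluded by [unb_cross]. *)
Lemma tmpl_two_edges_cross i j a b c d : i != j -> uniq (a :: b :: c :: d :: w :: R) ->
  nrm i a -> nrm i b -> nrm j c -> nrm j d -> adj a b -> adj c d ->
  adj a c -> adj a d -> adj w c -> 2 * size R + 4 = k -> contains G F.
Proof.
move=> ij uR na nb nc nd ab cd ac ad wc sz; have ji : j != i by rewrite eq_sym.
have [||| y [yP ny yZ ya]] := @pick1 j [:: a; b] (a :: b :: c :: d :: w :: R).
- by move=> t; rewrite !inE => /orP[] /eqP ->; [exact: na|exact: nb].
- by apply: (leq_trans (n := 4 * k * p)); [apply: kp_small => /=; plia | pnia].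
- by apply: kp_small => /=; plia.
have un : uniq (y :: a :: b :: c :: d :: w :: R) by rewrite !(cons_uniq y) yZ.
have L1 : Link [:: b] 1 y a.
  by apply: (Link_to (i := i) (j := j)) => //; apply: ya; rewrite !inE eqxx ?orbT.
have L2 : Link [:: d] 1 a c by apply: (Link_to (i := j) (j := i)); rewrite // adjC.
have L9 : Link [::] 1 c w by apply: (Link_nrm_full (i := j)) => //; exact: hw.
have L3 := Link_cat L2 L9 ltac:(uq un).
have L4 := Link_cat L1 L3 ltac:(uq un).
by apply: (close_R hR (fl_nrm yP) L4); [plia | uq un].
Qed.

Lemma tmpl_edge_full i u v : uniq (u :: v :: w :: R) -> nrm i u -> nrm i v -> adj u v ->
  adj (last w R) u -> 2 * size R + 3 = k -> contains G F.
Proof.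
move=> uR nu nv uv lu sz; have [j ji] := other_color i; have ij : i != j by rewrite eq_sym.
have [||| y [yP ny yZ ya]] := @pick1 j [:: u; v] (u :: v :: w :: R).
- by move=> t; rewrite !inE => /orP[] /eqP ->; [exact: nu|exact: nv].
- by apply: (leq_trans (n := 4 * k * p)); [apply: kp_small => /=; plia | pnia].
- by apply: kp_small => /=; plia.
have un : uniq (y :: u :: v :: w :: R) by rewrite !(cons_uniq y) yZ.
have L1 : Link [:: v] 1 u y.
  by apply: (Link_from (i := i) (j := j)) => //; apply: ya; rewrite !inE eqxx ?orbT.
have L0 : Link [::] 1 (last w R) u by apply: (Link_full_nrm (i := i)) => //; exact: hl.
have L3 := Link_cat L1 (fw_nrm yP) ltac:(uq un).
by apply: (close_R hR L0 L3); [plia | uq un].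
Qed.

(** The three edges of the path serve three consecutive cliques, [a] and [b] being cycle
    vertices. *)
Lemma tmpl_P4 i l a b r : uniq (l :: a :: b :: r :: w :: R) ->
  nrm i l -> nrm i a -> nrm i b -> nrm i r -> adj a l -> adj a b -> adj b r ->
  2 * size R + 5 = k -> contains G F.
Proof.
move=> uR nl na nb nr al ab br sz; have [j ji] := other_color i; have ij : i != j by rewrite eq_sym.
have [||| c [cP nc cZ ca]] := @pick1 j [:: l; a] (l :: a :: b :: r :: w :: R).
- by move=> t; rewrite !inE => /orP[] /eqP ->; [exact: nl|exact: na].
- by apply: (leq_trans (n := 4 * k * p)); [apply: kp_small => /=; plia | pnia].
- by apply: kp_small => /=; plia.
have [||| d [dP nd dZ da]] := @pick1 j [:: r; b] (c :: l :: a :: b :: r :: w :: R).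
- by move=> t; rewrite !inE => /orP[] /eqP ->; [exact: nr|exact: nb].
- by apply: (leq_trans (n := 4 * k * p)); [apply: kp_small => /=; plia | pnia].
- by apply: kp_small => /=; plia.
have un : uniq (d :: c :: l :: a :: b :: r :: w :: R) by rewrite !(cons_uniq c, cons_uniq d) dZ cZ.
have L1 : Link [:: l] 1 c a.
  by apply: (Link_to (i := i) (j := j)) => //; apply: ca; rewrite !inE eqxx ?orbT.
have L2 : Link [:: r] 1 b d.
  by apply: (Link_from (i := i) (j := j)) => //; apply: da; rewrite !inE eqxx ?orbT.
have L5 : Link [::] 1 a b by apply: (Link_edge (i := i)).
have L3 := Link_cat L2 (fw_nrm dP) ltac:(uq un).
have L4 := Link_cat L5 L3 ltac:(uq un).
have L6 := Link_cat L1 L4 ltac:(uq un).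
by apply: (close_R hR (fl_nrm cP) L6); [plia | uq un].
Qed.

Lemma tmpl_edge_P3 i x z l c r : uniq (x :: z :: l :: c :: r :: w :: R) ->
  nrm i x -> nrm i z -> nrm i l -> nrm i c -> nrm i r -> adj x z -> adj c l -> adj c r ->
  adj (last w R) x -> 2 * size R + 5 = k -> contains G F.
Proof.
move=> uR nx nz nl nc nr xz cl cr lx sz.
have [j ji] := other_color i; have ij : i != j by rewrite eq_sym.
have [||| y [yP ny yZ ya]] := @pick1 j [:: x; z; l; c] (x :: z :: l :: c :: r :: w :: R).
- by move=> t; rewrite !inE => /or4P[] /eqP ->; by [exact: nx|exact: nz|exact: nl|exact: nc].
- by apply: (leq_trans (n := 4 * k * p)); [apply: kp_small => /=; plia | pnia].
- by apply: kp_small => /=; plia.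
have [||| d [dP nd dZ da]] := @pick1 j [:: r; c] (y :: x :: z :: l :: c :: r :: w :: R).
- by move=> t; rewrite !inE => /orP[] /eqP ->; [exact: nr|exact: nc].
- by apply: (leq_trans (n := 4 * k * p)); [apply: kp_small => /=; plia | pnia].
- by apply: kp_small => /=; plia.
have un : uniq (d :: y :: x :: z :: l :: c :: r :: w :: R) by rewrite !(cons_uniq y, cons_uniq d) dZ yZ.
have L0 : Link [::] 1 (last w R) x by apply: (Link_full_nrm (i := i)) => //; exact: hl.
have L1 : Link [:: z] 1 x y.
  by apply: (Link_from (i := i) (j := j)) => //; apply: ya; rewrite !inE eqxx ?orbT.
have L2 : Link [:: l] 1 y c.
  by apply: (Link_to (i := i) (j := j)) => //; apply: ya; rewrite !inE eqxx ?orbT.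
have L3 : Link [:: r] 1 c d.
  by apply: (Link_from (i := i) (j := j)) => //; apply: da; rewrite !inE eqxx ?orbT.
have L4 := Link_cat L3 (fw_nrm dP) ltac:(uq un).
have L5 := Link_cat L2 L4 ltac:(uq un).
have L6 := Link_cat L1 L5 ltac:(uq un).
by apply: (close_R hR L0 L6); [plia | uq un].
Qed.

Lemma tmpl_three_edges i j x x' y y' z z' : i != j ->
  uniq (x :: x' :: y :: y' :: z :: z' :: w :: R) ->
  nrm i x -> nrm i x' -> nrm j y -> nrm j y' -> nrm i z -> nrm i z' ->
  adj x x' -> adj y y' -> adj z z' -> adj x y -> adj x' y -> adj y z -> adj y' z ->
  adj (last w R) x -> 2 * size R + 5 = k -> contains G F.
Proof.
move=> ij uR nx nx' ny ny' nz nz' xx yy zz xy x'y yz y'z lx sz.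
have ji : j != i by rewrite eq_sym.
have [||| d [dP nd dZ da]] := @pick1 j [:: z; z'] (x :: x' :: y :: y' :: z :: z' :: w :: R).
- by move=> t; rewrite !inE => /orP[] /eqP ->; [exact: nz|exact: nz'].
- by apply: (leq_trans (n := 4 * k * p)); [apply: kp_small => /=; plia | pnia].
- by apply: kp_small => /=; plia.
have un : uniq (d :: x :: x' :: y :: y' :: z :: z' :: w :: R) by rewrite !(cons_uniq d) dZ.
have L0 : Link [::] 1 (last w R) x by apply: (Link_full_nrm (i := i)) => //; exact: hl.
have L1 : Link [:: x'] 1 x y by apply: (Link_from (i := i) (j := j)).
have L2 : Link [:: y'] 1 y z by apply: (Link_from (i := j) (j := i)).
have L3 : Link [:: z'] 1 z d.
  by apply: (Link_from (i := i) (j := j)) => //; apply: da; rewrite !inE eqxx ?orbT.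
have L4 := Link_cat L3 (fw_nrm dP) ltac:(uq un).
have L5 := Link_cat L2 L4 ltac:(uq un).
have L6 := Link_cat L1 L5 ltac:(uq un).
by apply: (close_R hR L0 L6); [plia | uq un].
Qed.

End WithFull.

(** * Rings built from inside edges alone *)

Lemma Link_perm S S' l x y : perm_eq S S' -> Link S l x y -> Link S' l x y.
Proof.
move=> pS LS; have [un sz _] := LS; apply: (Link_weak LS).
- by move=> v; rewrite (perm_mem pS).
- have pe : perm_eq (x :: y :: S) (x :: y :: S') by rewrite !perm_cons.
  by rewrite -(perm_uniq pe).
- by rewrite -(perm_size pS).
Qed.

Definition flat2 (es : seq (G * G)) := flatten [seq [:: e.1; e.2] | e <- es].
Definition flat3 (ts : seq (G * G * G)) := flatten [seq [:: t.1.1; t.1.2; t.2] | t <- ts].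

Lemma size_flat2 es : size (flat2 es) = 2 * size es.
Proof. by elim: es => //= e es IH; rewrite -/(flat2 es) IH; lia. Qed.

Lemma P3_bridge i b r z l : uniq [:: b; z; r; l] -> nrm i b -> nrm i r -> nrm i z -> nrm i l ->
  adj b r -> adj z l -> Link [:: r; l] 2 b z.
Proof.
move=> un nb nr nz nl br zl; have [j ji] := other_color i; have ij : i != j by rewrite eq_sym.
apply: (@Link_via [:: r] [:: l] 1 1); first by uq un.
move=> Z sZ; have [||| c [cP nc cZ ca]] := @pick1 j [:: b; r; z; l] Z.
- by move=> t; rewrite !inE => /or4P[] /eqP ->; by [exact: nb|exact: nr|exact: nz|exact: nl].
- by apply: (leq_trans (n := 4 * k * p)); [apply: kp_small => /=; plia | pnia].
- by apply: (leq_trans sZ); pnia.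
exists c; split=> //.
- by apply: (Link_from (i := i) (j := j)) => //; apply: ca; rewrite !inE eqxx ?orbT.
- by apply: (Link_to (i := i) (j := j)) => //; apply: ca; rewrite !inE eqxx ?orbT.
Qed.

(** Two consecutive centres are bridged by two cliques, each using one edge at its centre; every
    path on three vertices thus serves two cliques, like a full vertex. *)
Lemma P3_path i ts b r a l : (forall v, v \in b :: a :: r :: l :: flat3 ts -> nrm i v) ->
  adj b r -> adj a l -> (forall t, t \in ts -> adj t.1.2 t.1.1 && adj t.1.2 t.2) ->
  uniq (b :: a :: r :: l :: flat3 ts) -> Link (r :: l :: flat3 ts) (2 * (size ts).+1) b a.
Proof.
elim: ts b r => [|[[l1 z1] r1] ts IH] b r hn br al ht un.
  apply: (P3_bridge (i := i)) => //; by apply: hn; rewrite !inE eqxx ?orbT.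
have /andP[zl1 zr1] : adj z1 l1 && adj z1 r1 by apply: (ht (l1, z1, r1)); rewrite mem_head.
have L1 : Link [:: r; l1] 2 b z1.
  apply: (P3_bridge (i := i)) => //; try (by apply: hn; rewrite !inE eqxx ?orbT).
  by uq un.
have L2 : Link (r1 :: l :: flat3 ts) (2 * (size ts).+1) z1 a.
  apply: IH => //; [|by move=> t tt; apply: ht; rewrite inE tt orbT|by uq un].
  by move=> v; rewrite !inE => vI; apply: hn; rewrite !inE; move: vI; do !case: (_ == _) => //=.
have un3 : uniq (b :: z1 :: a :: [:: r; l1] ++ r1 :: l :: flat3 ts) by uq un.
have := Link_cat L1 L2 un3.
have -> : 2 + 2 * (size ts).+1 = 2 * (size ((l1, z1, r1) :: ts)).+1 by rewrite /=; lia.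
by apply: Link_perm; pq.
Qed.

(** The centres are every other cycle vertex, so [k / 2] disjoint paths suffice when [k] is even. *)
Lemma tmpl_P3s i l z r l' z' r' ts :
  (forall v, v \in flat3 [:: (l, z, r), (l', z', r') & ts] -> nrm i v) ->
  (forall t, t \in [:: (l, z, r), (l', z', r') & ts] -> adj t.1.2 t.1.1 && adj t.1.2 t.2) ->
  uniq (flat3 [:: (l, z, r), (l', z', r') & ts]) -> 2 * size ts + 4 = k -> contains G F.
Proof.
move=> hn ht un sz.
have /andP[/= zl zr] : adj z l && adj z r by apply: (ht (l, z, r)); rewrite !inE eqxx.
have /andP[/= zl' zr'] : adj z' l' && adj z' r' by apply: (ht (l', z', r')); rewrite !inE eqxx orbT.
have L1 : Link [:: r; l'] 2 z z'.
  apply: (P3_bridge (i := i)) => //; try (by apply: hn; rewrite !inE eqxx ?orbT).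
  by uq un.
have L2 : Link (r' :: l :: flat3 ts) (2 * (size ts).+1) z' z.
  apply: (P3_path (i := i)) => //; [|by move=> t tt; apply: ht; rewrite !inE tt !orbT|by uq un].
  by move=> v; rewrite !inE => vI; apply: hn; rewrite !inE; move: vI; do !case: (_ == _) => //=.
by apply: (Link_close L1 L2); [uq un | plia].
Qed.

(** The middle edge of a path on four vertices contributes one further clique, which repairs the
    parity when [k] is odd. *)
Lemma tmpl_P4_P3s i l a b r ts :
  (forall v, v \in l :: a :: b :: r :: flat3 ts -> nrm i v) ->
  (forall t, t \in ts -> adj t.1.2 t.1.1 && adj t.1.2 t.2) ->
  uniq (l :: a :: b :: r :: flat3 ts) -> adj a l -> adj a b -> adj b r ->
  2 * size ts + 3 = k -> contains G F.
Proof.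
move=> hn ht un al ab br sz.
have L1 : Link [::] 1 a b.
  by apply: (Link_edge (i := i)) => //; apply: hn; rewrite !inE eqxx ?orbT.
have L2 : Link (r :: l :: flat3 ts) (2 * (size ts).+1) b a.
  apply: (P3_path (i := i)) => //; [|by uq un].
  by move=> v; rewrite !inE => vI; apply: hn; rewrite !inE; move: vI; do !case: (_ == _) => //=.
by apply: (Link_close L1 L2); [uq un | plia].
Qed.

(** The parity is repaired with a second class: the edge [z x] of class [i] is a clique of its own,
    inserted into a chain of paths of class [j]. *)
Lemma tmpl_P3s_cross i j z x x2 q y q' u u' ts : i != j ->
  nrm i z -> nrm i x -> nrm i x2 -> (forall v, v \in q :: y :: q' :: u :: u' :: flat3 ts -> nrm j v) ->
  (forall t, t \in ts -> adj t.1.2 t.1.1 && adj t.1.2 t.2) ->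
  uniq (z :: x :: x2 :: q :: y :: q' :: u :: u' :: flat3 ts) ->
  adj z x -> adj z x2 -> adj y q -> adj y q' -> adj u u' ->
  adj x y -> adj x q -> adj u z -> adj u x2 ->
  2 * size ts + 5 = k -> contains G F.
Proof.
move=> ij nz nx nx2 hn ht un zx zx2 yq yq' uu' xy xq uz ux2 sz.
have ji : j != i by rewrite eq_sym.
have L1 : Link [::] 1 z x by apply: (Link_edge (i := i)).
have ny : nrm j y by apply: hn; rewrite !inE eqxx ?orbT.
have nq : nrm j q by apply: hn; rewrite !inE eqxx ?orbT.
have nu : nrm j u by apply: hn; rewrite !inE eqxx ?orbT.
have L2 : Link [:: q] 1 x y by apply: (Link_to (i := j) (j := i)); rewrite // adjC.
have L3 : Link (q' :: u' :: flat3 ts) (2 * (size ts).+1) y u.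
  apply: (P3_path (i := j)) => //; [|by uq un].
  by move=> v; rewrite !inE => vI; apply: hn; rewrite !inE; move: vI; do !case: (_ == _) => //=.
have L4 : Link [:: x2] 1 u z by apply: (Link_to (i := i) (j := j)); rewrite // adjC.
have L5 := Link_cat L2 L3 ltac:(uq un).
have L6 := Link_cat L5 L4 ltac:(uq un).
by apply: (Link_close L1 L6); [uq un | plia].
Qed.

Lemma edge_path i L x : path (@adj G) x L -> uniq (x :: L) -> (forall v, v \in x :: L -> nrm i v) ->
  L != [::] -> exists S, perm_eq (x :: last x L :: S) (x :: L) /\ Link S (size L) x (last x L).
Proof.
elim: L x => // y L IH x /= /andP[xy pL] un hn _.
have L1 : Link [::] 1 x y by apply: (Link_edge (i := i)) => //; apply: hn; rewrite !inE eqxx ?orbT.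
case: (eqVneq L [::]) => [->|nL] /=; first by exists [::].
have [||S [pS LS]] := IH y pL _ _ nL.
- by case/andP: un.
- by move=> v vR; apply: hn; rewrite inE vR orbT.
have un' : uniq (x :: y :: L) by [].
exists (y :: S); split.
  rewrite perm_cons; apply: perm_trans pS.
  by pq.
have pe : perm_eq (x :: y :: last y L :: S) (x :: y :: L) by rewrite perm_cons.
apply: (@Link_cat [::] S 1 (size L)); [exact: L1 | exact: LS |].
by rewrite [uniq _](perm_uniq pe).
Qed.

(** The inner vertices of a path with [k] edges form a chain of [k - 2] cliques, and the two end
    edges serve the two cliques that close it. *)
Lemma tmpl_path i v0 v1 L vk : uniq (v0 :: vk :: v1 :: L) ->
  (forall v, v \in v0 :: vk :: v1 :: L -> nrm i v) ->
  path (@adj G) v0 (v1 :: rcons L vk) -> size L + 2 = k -> contains G F.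
Proof.
move=> un hn /= /andP[v01]; rewrite rcons_path => /andP[pL lk] sz.
have nL : L != [::] by rewrite -size_eq0; apply/eqP => E; move: hk; rewrite -sz E.
have un1 : uniq (v1 :: L) by uq un.
have hn1 v : v \in v1 :: L -> nrm i v by move=> vL; apply: hn; rewrite (in_cons v0) (in_cons vk) vL !orbT.
have [S [pS LS]] := edge_path pL un1 hn1 nL.
have pe : perm_eq (v1 :: last v1 L :: S ++ [:: vk; v0]) (v0 :: vk :: v1 :: L).
  move/permP: pS => pS; apply/permP => f; have := pS f; cnt.
have unF : uniq (v1 :: last v1 L :: S ++ [:: vk; v0]) by rewrite (perm_uniq pe).
have hn' v : v \in v1 :: last v1 L :: S ++ [:: vk; v0] -> nrm i v by rewrite (perm_mem pe); apply: hn.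
apply: (Link_close LS (S2 := [:: vk; v0]) (l2 := 2)) => //.
apply: (P3_bridge (i := i)) => //; try (by apply: hn'; rewrite !(mem_cat, inE) eqxx ?orbT).
- by uq unF.
- by rewrite adjC.
Qed.

(** The cycle vertices alternate between the classes [a] and [b], each clique having an edge of
    class [i] off the cycle; [fc] is the class where the parity of [es] makes the chain end. The
    list [L j] holds further vertices that chain vertices of class [j] must see, so that [hz] can
    add the last clique. *)
Lemma edge_chain i z S0 (L : 'I_p -> seq G) (fc : 'I_p) es a b x : size S0 <= 2 ->
  uniq [:: i; a; b] -> (forall v, v \in flat2 es -> nrm i v) ->
  (forall e, e \in es -> adj e.1 e.2) -> x \in P a ->
  (forall v, v \in L a ++ flat2 es -> adj v x) ->
  (forall j v, v \in L j -> j \in [:: a; b] -> ok j v /\ size (L j) <= 5) ->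
  size es <= k -> fc = (if odd (size es) then b else a) ->
  (forall c, c \in P fc -> (forall v, v \in L fc -> adj v c) -> Link S0 1 c z) ->
  uniq (x :: z :: flat2 es ++ S0) -> Link (flat2 es ++ S0) (size es).+1 x z.
Proof.
move=> sS0; elim: es a b x => [|[u v] es IH] a b x unc hn he xP xa hL sz fE hz un.
  by apply: hz; rewrite fE //= => v vL; apply: xa; rewrite mem_cat vL.
have nu : nrm i u by apply: hn; rewrite !inE eqxx.
have nv : nrm i v by apply: hn; rewrite !inE eqxx orbT.
have bi : b != i by apply: contraTneq unc => ->; rewrite /= !inE eqxx ?orbT.
have ba : b != a by apply: contraTneq unc => ->; rewrite /= !inE eqxx ?andbF.
have hn' t : t \in flat2 es -> nrm i t by move=> tt; apply: hn; rewrite 2!in_cons tt !orbT.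
change (flat2 ((u, v) :: es) ++ S0) with ([:: u; v] ++ (flat2 es ++ S0)).
apply: (@Link_via [:: u; v] (flat2 es ++ S0) 1 (size es).+1); first by uq un.
move=> Z sZ.
have sL : size (L b) <= 5.
  by case E : (L b) => [//|t L']; have [||_] := hL b t; [rewrite E mem_head|rewrite !inE eqxx orbT|rewrite E].
have [||| c [cP nc cZ ca]] := @pick1 b (x :: u :: v :: L b ++ flat2 es) (Z ++ z :: flat2 es ++ S0).
- move=> t; rewrite !inE mem_cat => /or4P[/eqP->|/eqP->|/eqP->|/orP[tL|tf]].
  + by apply: nrmP xP.
  + exact: nu.
  + exact: nv.
  + by have [] := hL b t tL; rewrite // !inE eqxx orbT.
  + exact: hn'.
- rewrite /= size_cat size_flat2; move: sz sL => /=.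
  move: (size es) (size (L b)) => n1 n2 h1 h2; nat_only; nia.
- rewrite size_cat /= size_cat size_flat2; move: sz sS0 => /= h1 h2.
  have h3 : 3 * k <= k * p + k by nat_only; nia.
  have h4 : 4 * k * p = k * p + 3 * (k * p) by ring.
  by rewrite h4; move: sZ; rewrite mulnC; plia.
move: cZ; rewrite mem_cat negb_or => /andP[cZ cz].
exists c; split=> //.
- apply: (Link_apex (i := i) (j := a) (l := b)) => //; try (by apply: ca; rewrite !inE eqxx ?orbT).
  + exact: FillN xP.
  + exact: (he (u, v) (mem_head _ _)).
  + by apply: xa; rewrite mem_cat !inE eqxx !orbT.
  + by apply: xa; rewrite mem_cat !inE eqxx !orbT.
- apply: (IH b a c) => //.
  + by move: unc; rewrite /= !inE !negb_or !andbT [b == a]eq_sym => /andP[/andP[-> ->] ->].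
  + by move=> e ee; apply: he; rewrite inE ee orbT.
  + by move=> t; rewrite mem_cat => tt; apply: ca; rewrite 3!in_cons mem_cat tt !orbT.
  + by move=> j t tL jj; apply: (hL j t) => //; move: jj; rewrite !inE orbC.
  + by move: sz => /=; plia.
  + by rewrite fE /=; case: (odd _).
  + by rewrite cons_uniq cz; uq un.
Qed.

Lemma tmpl_P3_edges i l z r es : 3 <= p ->
  (forall v, v \in l :: z :: r :: flat2 es -> nrm i v) -> (forall e, e \in es -> adj e.1 e.2) ->
  uniq (l :: z :: r :: flat2 es) -> adj z l -> adj z r -> size es + 2 = k -> contains G F.
Proof.
move=> p3 hn he un zl zr sz.
have [j ji] := other_color i; have [m /andP[mi mj]] := third_color i j p3.
have nl : nrm i l by apply: hn; rewrite !inE eqxx ?orbT.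
have nz : nrm i z by apply: hn; rewrite !inE eqxx ?orbT.
have nr : nrm i r by apply: hn; rewrite !inE eqxx ?orbT.
have szf := size_flat2 es.
have [||| c [cP nc cZ ca]] := @pick1 j (l :: z :: r :: flat2 es) (l :: z :: r :: flat2 es).
- by move=> v /hn; apply.
- by rewrite /= szf; pnia.
- by rewrite /= szf; pnia.
have un' : uniq (c :: l :: z :: r :: flat2 es) by rewrite (cons_uniq c) cZ.
have L1 : Link [:: r] 1 z c.
  by apply: (Link_from (i := i) (j := j)); rewrite // 1?eq_sym //; apply: ca; rewrite !inE eqxx ?orbT.
have L2 : Link (flat2 es ++ [:: l]) (size es).+1 c z.
  apply: (edge_chain (i := i) (L := fun=> [:: z; l]) (a := j) (b := m) (fc := if odd (size es) then m else j)) => //.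
  - by rewrite /= !inE !negb_or eq_sym ji [i == m]eq_sym mi [j == m]eq_sym mj.
  - by move=> v vf; apply: hn; rewrite 3!in_cons vf !orbT.
  - move=> v; rewrite mem_cat => /orP[|vf]; last by apply: ca; rewrite 3!in_cons vf !orbT.
    by rewrite !inE => /orP[] /eqP ->; apply: ca; rewrite !inE eqxx ?orbT.
  - move=> j' v; rewrite !inE => vI jI; split=> //.
    have ij' : j' != i by case/orP: jI => /eqP ->.
    by case/orP: vI => /eqP ->; [exact: nz|exact: nl].
  - by plia.
  - move=> c' c'P c'a; have nij : i != if odd (size es) then m else j by case: ifP; rewrite eq_sym.
    apply: (Link_to nij); rewrite //; try (by apply: c'a; rewrite !inE eqxx ?orbT).
    exact: FillN c'P.
  - by uq un'.
by apply: (Link_close L1 L2); [uq un' | plia].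
Qed.

Lemma tmpl_two_classes i j c x y y' es : 3 <= p -> i != j ->
  (forall v, v \in c :: x :: flat2 es -> nrm i v) -> nrm j y -> nrm j y' ->
  (forall e, e \in es -> adj e.1 e.2) -> uniq (c :: x :: y :: y' :: flat2 es) ->
  adj c x -> adj y y' -> adj c y -> adj c y' -> size es + 2 = k -> contains G F.
Proof.
move=> p3 ij hn ny ny' he un cx yy' cy cy' sz.
have ji : j != i by rewrite eq_sym.
have [l /andP[li lj]] := third_color i j p3.
have nc : nrm i c by apply: hn; rewrite !inE eqxx ?orbT.
have nx : nrm i x by apply: hn; rewrite !inE eqxx ?orbT.
have szf := size_flat2 es.
(* The chain has to end in the class [l], where the edge [y y'] and the vertex [c] are both foreign;
   the parity of [es] decides in which class it must start. *)
pose a := if odd (size es) then j else l; pose b := if odd (size es) then l else j.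
pose L m := if m == l then [:: c; y; y'] else [:: c].
have ai : a != i by rewrite /a; case: ifP.
have okL m v : v \in L m -> m \in [:: a; b] -> ok m v /\ size (L m) <= 5.
  rewrite /L => vL mab; split; last by case: ifP.
  have mi : m != i by move: mab; rewrite !inE /a /b; case: ifP => _ /orP[] /eqP ->.
  move: vL; case: eqP => [->|_]; rewrite !inE; last by move=> /eqP ->; exact: nc.
  by move=> /or3P[] /eqP ->; [exact: nc|exact: ny|exact: ny'].
have sL m : size (L m) <= 3 by rewrite /L; case: ifP.
have [||| d [dP nd dZ da]] := @pick1 a (c :: x :: L a ++ flat2 es) (c :: x :: y :: y' :: flat2 es).
- move=> v; rewrite !inE mem_cat => /or4P[/eqP->|/eqP->|vL|vf]; [exact: nc|exact: nx| |].
  + by have [] := okL a v vL; rewrite // inE eqxx.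
  + by apply: (hn v); rewrite // 2!in_cons vf !orbT.
- by rewrite /= size_cat szf; move: (sL a); pnia.
- by rewrite /= szf; pnia.
have un' : uniq (d :: c :: x :: y :: y' :: flat2 es) by rewrite (cons_uniq d) dZ.
have L1 : Link [:: x] 1 c d.
  by apply: (Link_from (i := i) (j := a)); rewrite // 1?eq_sym //; apply: da; rewrite !inE eqxx ?orbT.
have L2 : Link (flat2 es ++ [:: y; y']) (size es).+1 d c.
  apply: (edge_chain (i := i) (L := L) (a := a) (b := b) (fc := l)) => //.
  - rewrite /a /b; case: ifP => _ /=; rewrite !inE !negb_or;
    by rewrite [i == l]eq_sym li ij ?[j == l]eq_sym lj.
  - by move=> v vf; apply: hn; rewrite 2!in_cons vf !orbT.
  - by move=> v vf; apply: da; rewrite 2!in_cons vf !orbT.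
  - by plia.
  - by rewrite /a /b; case: ifP => [->|->].
  - rewrite /L eqxx => c' c'P c'a.
    have a1 : adj c c' by apply: c'a; rewrite !inE eqxx ?orbT.
    have a2 : adj y c' by apply: c'a; rewrite !inE eqxx ?orbT.
    have a3 : adj y' c' by apply: c'a; rewrite !inE eqxx ?orbT.
    apply: (Link_apex (i := j) (j := l) (l := i)) => //; try by rewrite adjC.
    + by rewrite /= !inE !negb_or [j == l]eq_sym lj ji li.
    + exact: FillN c'P.
  - by uq un'.
by apply: (Link_close L1 L2); [uq un' | plia].
Qed.

Section Ladder.
Variables (i j : 'I_p) (Sp : seq G).
Hypothesis ij : i != j.
Hypothesis hSp : forall v, v \in Sp -> nrm i v.
Hypothesis supply : forall Z, size Z <= p * k -> exists u m,
  [/\ off Z [:: u; m], nrm j u, nrm j m, adj u m & forall v, v \in Sp -> adj v u && adj v m].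

(** With two classes an inside edge must have an end on the cycle. Here the cliques use alternately
    an edge [u m] of class [j] at [u] and the edge [z l] of class [i] at [z]; the former is supplied
    afresh and sees all of [Sp]. *)
Lemma ladder_step x z l : {subset [:: x; z; l] <= Sp} -> uniq [:: x; z; l] -> adj z l ->
  Link [:: l] 2 x z.
Proof.
move=> sub un zl; have ji : j != i by rewrite eq_sym.
have xS : x \in Sp by apply: sub; rewrite !inE eqxx.
have zS : z \in Sp by apply: sub; rewrite !inE eqxx orbT.
have lS : l \in Sp by apply: sub; rewrite !inE eqxx !orbT.
apply: (@Link_via_ext [::] [:: l] 1 1) => // Z sZ.
have [u [m [oZ nu nm um ha]]] := supply sZ.
have /andP[xu xm] := ha _ xS; have /andP[zu zm] := ha _ zS; have /andP[lu lm] := ha _ lS.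
exists u, [:: m]; split=> //; first by rewrite /= inE andbT; exact: adj_neq.
- by apply: (Link_to (i := j) (j := i)); rewrite // ?(adjC _ x) //; exact: hSp.
- by apply: (Link_to (i := i) (j := j)); rewrite //; exact: hSp.
Qed.

Lemma ladder es x z l : {subset x :: z :: l :: flat2 es <= Sp} -> uniq (x :: z :: l :: flat2 es) ->
  adj z l -> (forall e, e \in es -> adj e.1 e.2) ->
  Link (l :: flat2 es) (2 * (size es).+1) x z.
Proof.
elim: es x => [|[a b] es IH] x sub un zl he; first exact: ladder_step.
have L1 : Link [:: b] 2 x a.
  apply: ladder_step; [|by uq un|exact: (he (a, b) (mem_head _ _))].
  by move=> v; rewrite !inE => h; apply: sub; rewrite !inE; move: h; do !case: (_ == _) => //=.
have L2 : Link (l :: flat2 es) (2 * (size es).+1) a z.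
  apply: IH => //; [|by uq un|by move=> e ee; apply: he; rewrite inE ee orbT].
  by move=> v; rewrite !inE => h; apply: sub; rewrite !inE; move: h; do !case: (_ == _) => //=.
have := Link_cat L1 L2 ltac:(uq un).
have -> : 2 + 2 * (size es).+1 = 2 * (size ((a, b) :: es)).+1 by rewrite /=; clear; lia.
by apply: Link_perm; pq.
Qed.

Lemma tmpl_ladder a b a' b' es : {subset flat2 [:: (a, b), (a', b') & es] <= Sp} ->
  uniq (flat2 [:: (a, b), (a', b') & es]) -> (forall e, e \in [:: (a, b), (a', b') & es] -> adj e.1 e.2) ->
  2 * size es + 4 = k -> contains G F.
Proof.
move=> sub un he sz.
have ab : adj a b := he (a, b) ltac:(by rewrite !inE eqxx).
have ab' : adj a' b' := he (a', b') ltac:(by rewrite !inE eqxx orbT).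
have L1 : Link [:: b'] 2 a a'.
  apply: ladder_step => //; last by uq un.
  by move=> v; rewrite !inE => h; apply: sub; rewrite !inE; move: h; do !case: (_ == _) => //=.
have L2 : Link (b :: flat2 es) (2 * (size es).+1) a' a.
  apply: ladder => //; [|by uq un|by move=> e ee; apply: he; rewrite !inE ee !orbT].
  by move=> v; rewrite !inE => h; apply: sub; rewrite !inE; move: h; do !case: (_ == _) => //=.
by apply: (Link_close L1 L2); [uq un | plia].
Qed.

End Ladder.
End Fill.

(** * Rings through a vertex that is full in all classes but one *)

Section AlmostFull.
Variables (P P' : 'I_p -> {set G}) (mu : nat) (i0 : 'I_p) (a w : G) (R : seq G).
Hypotheses (HF : Fill P mu) (HF' : Fill P' mu).
Hypothesis PP' : forall j, j != i0 -> P' j = P j.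
Hypotheses (fR : forall v, v \in w :: R -> full P v) (fa : full P' a) (sR : size R <= k).

Let fw : full P w. Proof. by apply: fR; rewrite mem_head. Qed.
Let fl : full P (last w R). Proof. by apply: fR; apply: mem_last. Qed.

(** The cycle neighbours of [a] are taken in a class [j] where [P] and [P'] agree. The cliques at
    [a] are completed within [P'], for which [a] is full, and all others within [P]. *)
Lemma tmpl_almost_even : uniq (a :: w :: R) -> 2 * size R + 4 = k -> contains G F.
Proof.
move=> un sz; have [j ji] := other_color i0.
have [||| c [cP nc cZ _]] := @pick1 P mu HF j [::] (a :: w :: R) => //; first by apply: kp_small => /=; plia.
have [||| d [dP nd dZ _]] := @pick1 P mu HF j [::] (c :: a :: w :: R) => //; first by apply: kp_small => /=; plia.
have cP' : c \in P' j by rewrite PP'.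
have dP' : d \in P' j by rewrite PP'.
have un' : uniq (d :: c :: a :: w :: R) by rewrite 2!(cons_uniq _ (_ :: _)) dZ cZ.
have L0 : Link [::] 1 (last w R) c by apply: (Link_full_nrm HF (i := j)) => //; exact: fl cP.
have L1 : Link [::] 1 c a by apply: (Link_nrm_full HF' (i := j)); rewrite //; [exact: FillN HF' _ _ cP' | exact: fa cP'].
have L2 : Link [::] 1 a d by apply: (Link_full_nrm HF' (i := j)); rewrite //; [exact: FillN HF' _ _ dP' | exact: fa dP'].
have L3 : Link [::] 1 d w by apply: (Link_nrm_full HF (i := j)) => //; exact: fw dP.
have L4 := Link_cat L2 L3 ltac:(uq un').
have L5 := Link_cat L1 L4 ltac:(uq un').
by apply: (close_R HF fR L0 L5); [plia | uq un'].
Qed.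

Lemma tmpl_almost_odd3 : 3 <= p -> uniq (a :: w :: R) -> 2 * size R + 3 = k -> contains G F.
Proof.
move=> p3 un sz; have [j ji] := other_color i0; have [l /andP[li lj]] := third_color i0 j p3.
have [||| c [cP nc cZ _]] := @pick1 P mu HF j [::] (a :: w :: R) => //; first by apply: kp_small => /=; plia.
have [||| d [dP nd dZ da]] := @pick1 P mu HF l [:: c] (c :: a :: w :: R).
- by move=> v; rewrite inE => /eqP ->; apply: nc.
- by apply: (leq_trans (n := 4 * k * p)); [apply: kp_small => /=; plia | pnia].
- by apply: kp_small => /=; plia.
have cd : adj c d by apply: da; rewrite inE.
have cP' : c \in P' j by rewrite PP'.
have dP' : d \in P' l by rewrite PP'.
have un' : uniq (d :: c :: a :: w :: R) by rewrite 2!(cons_uniq _ (_ :: _)) dZ cZ.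
have L0 : Link [::] 1 (last w R) c by apply: (Link_full_nrm HF (i := j)) => //; exact: fl cP.
have L1 : Link [:: a] 1 c d.
  apply: (Link_full_apex HF' (j := j) (l := l)) => //; first by rewrite eq_sym.
  + by move=> m _ _; exact: full_ok.
  + exact: FillN HF' _ _ cP'.
  + exact: FillN HF' _ _ dP'.
  + exact: fa cP'.
  + exact: fa dP'.
have L3 : Link [::] 1 d w by apply: (Link_nrm_full HF (i := l)) => //; exact: fw dP.
have L4 := Link_cat L1 L3 ltac:(uq un').
by apply: (close_R HF fR L0 L4); [plia | uq un'].
Qed.

(** For odd [k] one clique is still missing; it is obtained from another full vertex [b] placed off
    the cycle, which also works with two classes. *)
Lemma tmpl_almost_odd b : full P b -> uniq (b :: a :: w :: R) -> 2 * size R + 5 = k -> contains G F.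
Proof.
move=> fb un sz; have [j ji] := other_color i0.
have [||| c [cP nc cZ _]] := @pick1 P mu HF j [::] (b :: a :: w :: R) => //; first by apply: kp_small => /=; plia.
have [||| d [dP nd dZ _]] := @pick1 P mu HF j [::] (c :: b :: a :: w :: R) => //; first by apply: kp_small => /=; plia.
have [||| e [eP ne eZ ea]] := @pick1 P mu HF i0 [:: d] (d :: c :: b :: a :: w :: R).
- by move=> v; rewrite inE => /eqP ->; apply: nd; rewrite eq_sym.
- by apply: (leq_trans (n := 4 * k * p)); [apply: kp_small => /=; plia | pnia].
- by apply: kp_small => /=; plia.
have de : adj d e by apply: ea; rewrite inE.
have cP' : c \in P' j by rewrite PP'.
have dP' : d \in P' j by rewrite PP'.
have un' : uniq (e :: d :: c :: b :: a :: w :: R) by rewrite 3!(cons_uniq _ (_ :: _)) eZ dZ cZ.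
have L0 : Link [::] 1 (last w R) c by apply: (Link_full_nrm HF (i := j)) => //; exact: fl cP.
have L1 : Link [::] 1 c a by apply: (Link_nrm_full HF' (i := j)); rewrite //; [exact: FillN HF' _ _ cP' | exact: fa cP'].
have L2 : Link [::] 1 a d by apply: (Link_full_nrm HF' (i := j)); rewrite //; [exact: FillN HF' _ _ dP' | exact: fa dP'].
have L3 : Link [:: b] 1 d e.
  apply: (Link_full_apex HF (j := j) (l := i0)) => //; [by move=> m _ _; exact: full_ok|exact: fb dP|exact: fb eP].
have L4 : Link [::] 1 e w by apply: (Link_nrm_full HF (i := i0)) => //; exact: fw eP.
have L5 := Link_cat L3 L4 ltac:(uq un').
have L6 := Link_cat L2 L5 ltac:(uq un').
have L7 := Link_cat L1 L6 ltac:(uq un').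
by apply: (close_R HF fR L0 L7); [plia | uq un'].
Qed.

End AlmostFull.
End Links.

(** * Stability *)

Lemma pigeon (aT rT : finType) (f : aT -> rT) (A : {set aT}) (B : {set rT}) t :
  (forall x, x \in A -> f x \in B) -> #|B| * t < #|A| ->
  exists2 b, b \in B & t < #|[set x in A | f x == b]|.
Proof.
move=> fAB hA; apply/exists_inP; apply: contraTT hA; rewrite negb_exists_in => /forall_inP h.
rewrite -leqNgt.
have -> : #|A| = \sum_(b in B) #|[set x in A | f x == b]|.
  rewrite -sum1_card (partition_big f (mem B)) //=.
  by apply: eq_bigr => b _; rewrite -sum1_card; apply: eq_bigl => x; rewrite inE.
rewrite -sum_nat_const; apply: leq_sum => b bB.
by rewrite leqNgt; apply: h.
Qed.

Lemma subset_of_card (T : finType) (A : {set T}) m : m <= #|A| ->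
  exists2 B : {set T}, B \subset A & #|B| = m.
Proof.
move=> hm; have : 0 < #|[set B : {set T} | (B \subset A) && (#|B| == m)]|.
  by rewrite cards_draws bin_gt0.
by case/card_gt0P => B; rewrite inE => /andP[BA /eqP]; exists B.
Qed.

Lemma enum_of_card (T : finType) (A : {set T}) m : m <= #|A| ->
  exists s : seq T, [/\ uniq s, size s = m & {subset s <= A}].
Proof.
case/subset_of_card => B /subsetP BA cB; exists (enum B); split.
- exact: enum_uniq.
- by rewrite -cardE.
- by move=> x; rewrite mem_enum => /BA.
Qed.

Definition trim (T : finType) m (A : {set T}) : {set T} := [set v in take m (enum A)].

Lemma trim_card (T : finType) m (A : {set T}) : m <= #|A| -> #|trim m A| = m.
Proof.
by move=> h; rewrite cardsE (card_uniqP _) ?take_uniq ?enum_uniq // size_takel // -cardE.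
Qed.

Section Degenerate.
Variable G : sgraph.
Implicit Types (v x : G) (S : {set G}).

(** Twice the number of edges inside [S]. *)
Definition E2 S := \sum_(v in S) dg v S.

Lemma dg_setD1 v x S : x \in S -> dg v S = adj v x + dg v (S :\ x).
Proof. by move=> xS; rewrite !dgE (big_setD1 x xS). Qed.

Lemma dgS v S S' : S \subset S' -> dg v S <= dg v S'.
Proof. by move=> h; apply: subset_leq_card; apply: setIS. Qed.

Lemma dg_le v S : dg v S <= #|S|.
Proof. by apply: subset_leq_card; apply: subsetIr. Qed.

Lemma dgT v : dg v setT = #|nbr v|.
Proof. by rewrite /dg setIT. Qed.

Lemma E2_setD1 x S : x \in S -> E2 S = E2 (S :\ x) + 2 * dg x S.
Proof.
move=> xS; rewrite /E2 (big_setD1 x xS) /=.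
rewrite (eq_bigr (fun v => adj v x + dg v (S :\ x))) => [|v _]; last exact: dg_setD1.
rewrite big_split /= (eq_bigr (fun v => adj x v : nat)) => [|v _]; last by rewrite adjC.
rewrite -dgE (dg_setD1 x xS) adj_irrefl; lia.
Qed.

Lemma path_extend S D l : (forall v, v \in S -> D <= dg v S) -> S != set0 -> l <= D ->
  exists x L, [/\ path (@adj G) x L, uniq (x :: L), {subset x :: L <= S} & size L = l].
Proof.
move=> hD /set0Pn[x0 x0S]; elim: l => [|l IH] hl.
  by exists x0, [::]; split=> // v; rewrite inE => /eqP ->.
have [|x [L [pL uL sL szL]]] := IH; first by lia.
have /subsetPn[y] : ~~ (nbr (last x L) :&: S \subset [set v in belast x L]).
  apply/negP => /subset_leq_card h; have := leq_trans (hD _ (sL _ (mem_last x L))) h.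
  by rewrite cardsE => h'; have := leq_trans h' (card_size _); rewrite size_belast szL leqNgt hl.
rewrite !inE => /andP[ay yS] ny.
exists x, (rcons L y); split; last by rewrite size_rcons szL.
- by rewrite rcons_path pL.
- rewrite -rcons_cons rcons_uniq uL andbT lastI mem_rcons inE negb_or ny andbT.
  by apply: contraTneq ay => ->; rewrite adj_irrefl.
- by move=> v; rewrite -rcons_cons mem_rcons inE => /predU1P[->//|/sL].
Qed.

(** If all degrees inside [S] were at least [D], a greedy walk would give a path with [D] edges. So
    some vertex has smaller degree, and it is removed. *)
Lemma degenerate S D :
  (forall x L, path (@adj G) x L -> uniq (x :: L) -> {subset x :: L <= S} -> size L <> D) ->
  E2 S <= 2 * D * #|S|.
Proof.
have [m] := ubnP #|S|; elim: m S => // m IH S hS hP.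
have [->|nS] := eqVneq S set0; first by rewrite /E2 big_set0.
have [v vS dv] : exists2 v, v \in S & dg v S < D.
  apply/exists_inP; apply: contraT; rewrite negb_exists_in => /forall_inP h.
  have hD v : v \in S -> D <= dg v S by move=> vS; rewrite leqNgt; apply: h.
  have [x [L [pL uL sL szL]]] := path_extend hD nS (leqnn D).
  by case: (hP x L pL uL sL).
rewrite (E2_setD1 vS) (cardsD1 v) vS mulnDr muln1.
have : E2 (S :\ v) <= 2 * D * #|S :\ v|.
  apply: IH => [|x L pL uL sL]; first by move: hS; rewrite (cardsD1 v) vS; plia.
  by apply: (hP x L pL uL) => u /sL; rewrite inE => /andP[].
plia.
Qed.

End Degenerate.

Section Stability.
Variables (p k : nat).
Hypotheses (hp : 2 <= p) (hk : 3 <= k).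

Notation F := (blowup (cycle_graph k) (p + 1)).

(** Minimum degree at least [(1 - 1/p) n - C/p], cleared of fractions. *)
Definition mindeg (G : sgraph) C := forall v : G, p.-1 * #|G| <= p * #|nbr v| + C.

(** The complete [q]-partite graph with parts of size [T], as a subgraph that need not be
    induced. *)
Definition KT (G : sgraph) q T (K : nat -> {set G}) :=
  (forall i, i < q -> #|K i| = T) /\
  (forall i j x y, i < q -> j < q -> i <> j -> x \in K i -> y \in K j -> adj x y).

Section OneGraph.
Variables (G : sgraph) (C : nat).
Hypothesis hC : mindeg G C.

Lemma mindeg_sum (K : {set G}) : p.-1 * #|G| * #|K| <= p * (\sum_(v : G) dg v K) + C * #|K|.
Proof.
have -> : \sum_(v : G) dg v K = \sum_(u in K) #|nbr u|.
  rewrite (eq_bigl (fun v => v \in setT)) => [|v]; last by rewrite in_setT.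
  by rewrite dg_exchange; apply: eq_bigr => u _; rewrite dgT.
rewrite mulnC -sum_nat_const big_distrr /= [C * _]mulnC -sum_nat_const -big_split /=.
by apply: leq_sum => v _; exact: hC.
Qed.

Definition rich q T (K : nat -> {set G}) := [set v : G | [forall i : 'I_q, T <= dg v (K i)]].

Lemma KT_sum_lower q T K : KT q T K ->
  p.-1 * #|G| * (q * T) <= p * (\sum_(v : G) \sum_(i < q) dg v (K i)) + C * (q * T).
Proof.
case=> hc _; rewrite exchange_big /=.
have e1 a : a * (q * T) = \sum_(i < q) a * T by rewrite sum_nat_const card_ord mulnCA.
rewrite !e1 big_distrr /= -big_split /=.
by apply: leq_sum => i _; have := mindeg_sum (K i); rewrite hc.
Qed.

(** A vertex that is not rich loses most of one part, so it sends at most [q.-1 * T' + T] edges into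
    the parts; a vertex of [B] loses [th] more in a second part. *)
Lemma KT_sum_upper q T' T (K : nat -> {set G}) (B : {set G}) th : KT q T' K -> 0 < q -> T <= T' -> th <= T' ->
  (forall v, v \in B -> v \notin rich q T K /\
     forall i : 'I_q, dg v (K i) < T -> exists2 j : 'I_q, j != i & dg v (K j) + th <= T') ->
  \sum_(v : G) \sum_(i < q) dg v (K i) + #|B| * th <= #|rich q T K| * (q * T') + #|G| * (q.-1 * T' + T).
Proof.
move=> [hc _] q0 TT' thT hB.
have dK v (i : 'I_q) : dg v (K i) <= T' by rewrite -(hc i) // dg_le.
have sumI (X : {set G}) (c : nat) : \sum_v (v \in X) * c = #|X| * c.
  by rewrite -big_distrl /= -sum1_card [in RHS]big_mkcond.
rewrite -!sumI -sum_nat_const -!big_split /=.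
apply: leq_sum => v _.
have cI (i : 'I_q) : \sum_(j < q | j != i) T' = q.-1 * T'.
  by rewrite sum_nat_const (cardC1 i) card_ord.
have qT : q * T' = T' + q.-1 * T' by rewrite -mulSn prednK.
have [vr|vr] := boolP (v \in rich q T K).
  have -> : (v \in B) = false by apply/negP => /hB[]; rewrite vr.
  have : \sum_(i < q) dg v (K i) <= q * T'.
    have -> : q * T' = \sum_(i < q) T' by rewrite sum_nat_const card_ord.
    by apply: leq_sum.
  by rewrite /= mul0n mul1n addn0 => h; apply: leq_trans h (leq_addr _ _).
have [i hi] : exists i : 'I_q, dg v (K i) < T.
  by move: vr; rewrite inE negb_forall => /existsP[i]; rewrite -ltnNge; exists i.
rewrite (bigD1 i) //= mul0n add0n.
have [vB|vB] := boolP (v \in B); last first.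
  have : \sum_(j < q | j != i) dg v (K j) <= q.-1 * T' by rewrite -(cI i); apply: leq_sum.
  by rewrite /= mul0n addn0 addnC => h; apply: leq_add h (ltnW hi).
have [_ /(_ _ hi)[j ji hj]] := hB v vB.
have : \sum_(j' < q | j' != i) (dg v (K j') + (j' == j) * th) <= q.-1 * T'.
  rewrite -(cI i); apply: leq_sum => j' _.
  by have [->|_] := eqVneq j' j; rewrite ?mul1n ?mul0n ?addn0.
have e1 : \sum_(j' < q | j' != i) (j' == j) * th = th.
  rewrite (bigD1 j) //= eqxx mul1n big1 ?addn0 // => j' /andP[_ /negPf ->].
  by rewrite mul0n.
rewrite big_split /= e1 mul1n => h; rewrite -addnA [X in _ <= X]addnC.
exact: leq_add (ltnW hi) h.
Qed.

Lemma KT_pigeon q T' T K m : KT q T' K -> m * 2 ^ (q * T') < #|rich q T K| ->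
  exists B : {set G}, (forall i : 'I_q, T <= #|B :&: K i|) /\
    m < #|[set v | B \subset nbr v]|.
Proof.
move=> [hc _] hm; pose U := \bigcup_(i < q) K i.
have cU : #|U| <= q * T'.
  apply: leq_trans (_ : \sum_(i < q) #|K i| <= _).
    rewrite /U; elim/big_rec2: _ => [|i y X _ h]; first by rewrite cards0.
    by apply: leq_trans (leq_card_setU _ _) _; rewrite leq_add2l.
  by rewrite (eq_bigr (fun=> T')) ?sum_nat_const ?card_ord // => i _; apply: hc.
have [v _|//|B BU hB] := @pigeon G _ (fun v => nbr v :&: U) (rich q T K) (powerset U) m.
- by rewrite inE subsetIr.
- apply: leq_ltn_trans hm; rewrite card_powerset mulnC leq_mul2l; apply/orP; right.
  by rewrite leq_exp2l.
exists B; split.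
  have [v] : exists v, v \in [set x in rich q T K | nbr x :&: U == B].
    by apply/card_gt0P; apply: leq_ltn_trans hB.
  rewrite !inE => /andP[/forallP vr /eqP <-] i; apply: leq_trans (vr i) _.
  apply: subset_leq_card; apply/subsetP => x; rewrite !inE => /andP[-> xK]; rewrite xK andbT /=.
  by apply/bigcupP; exists i.
apply: leq_trans hB _; apply: subset_leq_card; apply/subsetP => v; rewrite !inE => /andP[_ /eqP <-].
exact: subsetIl.
Qed.

End OneGraph.

(** Erdős-Stone under a minimum degree, by induction on the number of parts: with few rich vertices
    the degree sum of a complete multipartite subgraph would be too small. Enough rich vertices
    share their trace on it, and they form the new part. *)
Lemma ES q : 0 < q <= p -> forall T C, exists n0, forall G : sgraph, n0 <= #|G| -> mindeg G C ->
  exists K : nat -> {set G}, KT q T K.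
Proof.
case: q => // q; elim: q => [|q IH] hq T C.
  exists T => G hG _; rewrite -cardsT in hG; have [B _ cB] := subset_of_card hG.
  by exists (fun=> B); split=> // i j x y; rewrite !ltnS !leqn0 => /eqP-> /eqP->.
have [|n1 h1] := IH _ (p * T).+1 C; first by lia.
pose q1 := q.+1; pose T' := (p * T).+1.
pose bigc := p * (T * 2 ^ (q1 * T') * (q1 * T')) + C * (q1 * T').
exists (n1 + bigc.+1) => G hG hC.
have [||K KK] := h1 G => //; first by lia.
have TT' : T <= T' by rewrite /T'; nia.
have hr : T * 2 ^ (q1 * T') < #|rich q1 T K|.
  rewrite ltnNge; apply/negP => hr.
  have lo : p.-1 * #|G| * (q1 * T') <=
    p * (\sum_(v : G) \sum_(i < q1) dg v (K i)) + C * (q1 * T') := KT_sum_lower hC KK.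
  have hB v : v \in (set0 : {set G}) -> v \notin rich q1 T K /\
     forall i : 'I_q1, dg v (K i) < T -> exists2 j : 'I_q1, j != i & dg v (K j) + 0 <= T'.
    by rewrite in_set0.
  have up : \sum_(v : G) \sum_(i < q1) dg v (K i) <=
      #|rich q1 T K| * (q1 * T') + #|G| * (q * T' + T).
    by have := KT_sum_upper KK (ltn0Sn _) TT' (leq0n _) hB; rewrite muln0 addn0.
  (* This uses that there are fewer than [p] parts so far, and it explains the choice
     [T' = p * T + 1]. *)
  have e1 : p * (q * T' + T) + 1 <= p.-1 * (q1 * T').
    have h : p * q + 1 <= p.-1 * q1.
      have hq' : q.+2 <= p by case/andP: hq.
      rewrite /q1 -(subnKC hq'); move: (p - q.+2) => d; clear; nia.
    have : (p * q + 1) * T' <= p.-1 * q1 * T' by rewrite leq_mul2r h orbT.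
    have T'E : T' = p * T + 1 by rewrite addn1.
    rewrite mulnDl mul1n [X in _ + X <= _]T'E mulnDr !mulnA.
    by move: (_ * T') (_ * T') (p * T); clear; lia.
  have e2 : #|rich q1 T K| * (q1 * T') <= T * 2 ^ (q1 * T') * (q1 * T') by rewrite leq_mul2r hr orbT.
  move: lo up e1 e2 hG; rewrite /bigc.
  move: (T * 2 ^ (q1 * T') * (q1 * T')) (#|rich q1 T K| * (q1 * T')) => b1 b2.
  move: (\sum_(v : G) _) (C * (q1 * T')) (q1 * T') (q * T' + T) #|G| => S c a1 a2 N.
  move=> lo up e1 e2 hG.
  have e3 : p * S <= p * (b2 + N * a2) by rewrite leq_mul2l up orbT.
  have e4 : N * (p * a2 + 1) <= N * (p.-1 * a1) by rewrite leq_mul2l e1 orbT.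
  have e5 : p * b2 <= p * b1 by rewrite leq_mul2l e2 orbT.
  have e6 : N * (p * a2 + 1) = p * (N * a2) + N by ring.
  have e7 : N * (p.-1 * a1) = p.-1 * N * a1 by ring.
  by rewrite mulnDr in e3; plia.
have [B [hB1 hB2]] := KT_pigeon KK hr.
pose K' i := if i < q1 then B :&: K i else [set v | B \subset nbr v].
have [_ Kadj] := KK; have trimS A : trim T A \subset A.
  by apply/subsetP => v; rewrite inE => /mem_take; rewrite mem_enum.
exists (fun i => trim T (K' i)); split=> [i hi|i j x y hi hj ij].
  apply: trim_card; rewrite /K'; case: ifP => iq; first exact: (hB1 (Ordinal iq)).
  by apply: ltnW.
have out l : l < q.+2 -> ~~ (l < q1) -> l = q1 by rewrite /q1; lia.
move=> /(subsetP (trimS _ _)) xK /(subsetP (trimS _ _)) yK; move: xK yK; rewrite /K'.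
case: (boolP (i < q1)) => iq; case: (boolP (j < q1)) => jq.
- by rewrite !inE => /andP[_ xK] /andP[_ yK]; apply: Kadj xK yK.
- by rewrite !inE => /andP[xB _] /subsetP /(_ x xB); rewrite inE adjC.
- by rewrite !inE => /subsetP Bx /andP[yB _]; have := Bx y yB; rewrite inE.
- by case: ij; rewrite (out i) // (out j).
Qed.

Section Coloring.
Variable G : sgraph.
Implicit Types (col : {ffun G -> 'I_p}) (v u : G) (S : {set G}).

Definition cls col i := [set v | col v == i].
(** Twice the number of monochromatic edges within [B]. *)
Definition In2 col (B : {set G}) := \sum_(v in B) dg v (cls col (col v) :&: B).

Lemma In2E col B : In2 col B = \sum_i E2 (cls col i :&: B).
Proof.
rewrite /In2 (partition_big col predT) //=; apply: eq_bigr => i _; rewrite /E2.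
apply: eq_big => [v|v /andP[_ /eqP -> //]]; by rewrite !inE andbC.
Qed.

Lemma dg_setU1 v S : v \notin S -> dg v (v |: S) = dg v S.
Proof. by move=> vS; rewrite (dg_setD1 v (setU11 v S)) adj_irrefl setU1K. Qed.

Lemma maxcut col0 : exists col, In2 col setT <= In2 col0 setT /\
  forall v j, dg v (cls col (col v)) <= dg v (cls col j).
Proof.
have [col _ hmin] := arg_minnP (fun col => In2 col setT) (P := predT) (i0 := col0) isT.
exists col; split; first exact: hmin.
move=> v j; have [->//|nj] := eqVneq j (col v).
pose col' : {ffun G -> 'I_p} := [ffun u => if u == v then j else col u].
have := hmin col' isT; rewrite !In2E (bigD1 (col v)) //= (bigD1 j) //=.
rewrite [X in _ <= X -> _](bigD1 (col v)) //= [X in _ <= _ + X -> _](bigD1 j) //= !setIT.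
have -> : cls col' (col v) = cls col (col v) :\ v.
  apply/setP => u; rewrite !inE ffunE; case: (u =P v) => [->|_] //=; exact: negbTE.
have -> : cls col' j = v |: cls col j.
  by apply/setP => u; rewrite !inE ffunE; case: (u =P v) => [->|_] //=; rewrite eqxx.
have vc : v \in cls col (col v) by rewrite inE.
have vj : v \notin cls col j by rewrite inE eq_sym.
rewrite (E2_setD1 vc) (E2_setD1 (setU11 v _)) setU1K // dg_setU1 //.
set X := \sum_(i | _) _; set Y := \sum_(i | _) _.
have -> : Y = X.
  apply: eq_bigr => i /andP[ic ij]; congr (E2 (_ :&: _)); apply/setP => u; rewrite !inE ffunE.
  by case: (u =P v) => [->|//]; rewrite ![_ == i]eq_sym (negPf ic) (negPf ij).
by move: (E2 _) (E2 _) (dg v _) (dg v _) X; clear; lia.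
Qed.
End Coloring.

Section FillUse.
Variables (G : sgraph) (P : 'I_p -> {set G}) (mu : nat).
Hypotheses (HF : Fill k P mu) (noF : ~~ contains G F).

(** A path with [k] edges among vertices normal for one class closes a ring by [tmpl_path], so
    [degenerate] applies. *)
Lemma E2_normal i (S : {set G}) : (forall v, v \in S -> nrm P mu i v) -> E2 S <= 2 * k * #|S|.
Proof.
move=> hn; apply: degenerate => x L pL uL sL szL; case/negP: noF.
case: L pL uL sL szL => [|y L]; first by move=> _ _ _ E; move: hk; rewrite -E.
case: (lastP L) => [|{}L z] pL uL sL szL; first by move: hk; rewrite -szL.
have pe : perm_eq (x :: z :: y :: L) (x :: y :: rcons L z).
  by rewrite perm_cons -rcons_cons perm_sym perm_rcons.
apply: (tmpl_path hp hk HF (i := i) (v0 := x) (v1 := y) (vk := z) (L := L)) => //.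
- by rewrite (perm_uniq pe).
- by move=> v; rewrite (perm_mem pe) => /sL; apply: hn.
- by move: szL; rewrite /= size_rcons; clear; lia.
Qed.

(** Full vertices serve two cliques each, so [s1 + 1] of them serve all [k]. *)
Lemma full_set (A : {set G}) : (forall a, a \in A -> full P a) -> #|A| <= (k - 1) %/ 2.
Proof.
move=> hA; rewrite leqNgt; apply/negP => /enum_of_card[s [us sz sA]]; case/negP: noF.
case: s us sz sA => // w R us sz sA.
have fs v : v \in w :: R -> full P v by move/sA; apply: hA.
have hs : size R = (k - 1) %/ 2 by move: sz => /=; lia.
case: (boolP (odd k)) => ok.
  case: R us sz sA fs hs => [|w' R] us sz sA fs hs; first by move: hs => /=; move: hk; clear; lia.
  have fR v : v \in w' :: R -> full P v by move=> vR; apply: fs; rewrite inE vR orbT.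
  have sR : size R <= k by move: hs => /=; move: hk; clear; lia.
  apply: (tmpl_full_odd hp hk HF fR sR us); first by apply: fs; rewrite mem_head.
  by move: hs ok => /=; move: hk; clear; lia.
have sR : size R <= k by move: hs => /=; move: hk; clear; lia.
apply: (tmpl_full_even hp hk HF fs sR us).
by move: hs ok => /=; move: hk; clear; lia.
Qed.
End FillUse.

Lemma KT_fill (G : sgraph) T (K : nat -> {set G}) mu : KT p T K -> 10 * k * p * mu.+1 <= T ->
  Fill k (fun i : 'I_p => K i) mu.
Proof.
move=> [hc ha] hT; split=> [i v vK j ji|i]; last by rewrite hc.
apply: (@leq_trans 0) => //; rewrite leqn0 cards_eq0; apply/eqP/setP => u; rewrite !inE.
apply/negP => /andP[nu uK]; case/negP: nu; apply: (ha i j) => //.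
by move/ord_inj => E; rewrite E eqxx in ji.
Qed.

(** Relative to a large complete [p]-partite subgraph, rich vertices are boundedly many, since those
    with a common trace are full for it. Every other vertex misses most of one part; by the degree
    sum few of them miss much of a second part. The rest are normal for one class, and [E2_normal]
    leaves only linearly many edges inside. *)
Lemma stability E C : exists n0, forall G : sgraph, n0 <= #|G| -> mindeg G C -> ~~ contains G F ->
  exists col : {ffun G -> 'I_p}, E * In2 col setT <= #|G| * #|G|.
Proof.
(* With [th = 8 * T * E] the degree sum leaves about [n / (8 * E)] bad vertices, which can spoil at
   most a small fraction of [n * n / E] pairs. *)
pose T := 10 * k * p; pose th := 8 * T * E; pose T' := 10 * k * p * th.+1 + T + th.
pose B0 := k * 2 ^ (p * T'); pose X := B0 * (p * T') + C * T'.
have [|n1 h1] := @ES p _ T' C; first by rewrite leqnn (leq_trans _ hp).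
exists (n1 + 2 * (2 * E * k * p + 2 * E * B0 + X)) => G hG hC noF.
have [||K KK] := h1 G => //; first by lia.
have [hc ha] := KK; set N := #|G| in hG *.
have TT' : T <= T' by rewrite /T'; lia.
have thT' : th <= T' by rewrite /T'; lia.
have HF : Fill k (fun i : 'I_p => K i) th by apply: KT_fill KK _; rewrite /T'; lia.
have hr : #|rich p T K| <= B0.
  rewrite leqNgt; apply/negP => hr.
  have [B [hB1 hB2]] := KT_pigeon KK hr.
  have HB : Fill k (fun i : 'I_p => B :&: K i) 0.
    split=> [i v|i]; last by rewrite /bound muln1; exact: hB1.
    rewrite inE => /andP[_ vK] j ji; rewrite /ok leqn0 cards_eq0; apply/eqP/setP => u; rewrite !inE.
    apply/negP => /and3P[nu _ uK]; case/negP: nu; apply: (ha i j) => //.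
    by move/ord_inj => E'; rewrite E' eqxx in ji.
  have := full_set HB noF (A := [set v | B \subset nbr v]).
  move=> h; have {}h : #|[set v | B \subset nbr v]| <= (k - 1) %/ 2.
    apply: h => a; rewrite inE => /subsetP Ba j v; rewrite inE => /andP[vB _].
    by have := Ba v vB; rewrite inE.
  by move: h hB2; move: #|_| => x; clear; lia.
pose V (i : 'I_p) := [set v | (dg v (K i) < T) &&
  [forall j : 'I_p, (j != i) ==> (T' - th <= dg v (K j))]].
have nV i v : v \in V i -> nrm (fun i : 'I_p => K i) th i v.
  rewrite inE => /andP[_ /forallP h] j ji; have := h j; rewrite ji /= => hj.
  by rewrite /ok cardsD hc // setIC -/(dg v (K j)) leq_subLR; move: hj; clear; lia.
pose Z := ~: \bigcup_i V i; pose Bad := Z :\: rich p T K.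
have cZ : #|Z| <= B0 + #|Bad|.
  rewrite -(cardsID (rich p T K) Z) leq_add2r; apply: leq_trans hr.
  by apply: subset_leq_card; apply: subsetIr.
have hB v : v \in Bad -> v \notin rich p T K /\
     forall i : 'I_p, dg v (K i) < T -> exists2 j : 'I_p, j != i & dg v (K j) + th <= T'.
  rewrite in_setD in_setC => /andP[vr vZ]; split=> //.
  move=> i hi; have : v \notin V i by apply: contra vZ => vV; apply/bigcupP; exists i.
  rewrite inE hi negb_forall => /existsP[j]; rewrite negb_imply -ltnNge => /andP[ji hj].
  by exists j => //; move: hj; clear; lia.
have hBad : #|Bad| * th <= N * T + X.
  have lo : p.-1 * N * (p * T') <=
    p * (\sum_(v : G) \sum_(i < p) dg v (K i)) + C * (p * T') := KT_sum_lower hC KK.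
  have up := KT_sum_upper KK (ltn_trans (ltnSn 0) hp) TT' thT' hB.
  have e2 : #|rich p T K| * (p * T') <= B0 * (p * T') by rewrite leq_mul2r hr orbT.
  move: lo up e2; rewrite -/N /X.
  move: (\sum_(v : G) _) (#|rich p T K| * (p * T')) (B0 * (p * T')) (#|Bad| * th) => S b1 b2 b3 lo up e2.
  have p0 : 0 < p by apply: leq_trans hp.
  rewrite -(leq_pmul2l p0).
  have e3 : p * (S + b3) <= p * (b1 + N * (p.-1 * T' + T)) by rewrite leq_mul2l up orbT.
  have e4 : p * b1 <= p * b2 by rewrite leq_mul2l e2 orbT.
  have e5 : p * (N * (p.-1 * T' + T)) = p.-1 * N * (p * T') + p * (N * T) by ring.
  have e6 : C * (p * T') = p * (C * T') by ring.
  rewrite !(mulnDr p) e5 in e3; rewrite e6 in lo; rewrite !(mulnDr p).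
  move: lo e3 e4; move: (p.-1 * N * _) (p * S) (p * b3) (p * b1) (p * b2) (p * (C * _)) (p * (N * _)).
  by clear; lia.
have T0 : 0 < T by rewrite /T !muln_gt0 /=; apply/andP; split; [exact: leq_trans hk | exact: leq_trans hp].
have hBad' : 8 * E * #|Bad| <= N + X.
  rewrite -(leq_pmul2l T0); apply: leq_trans (_ : N * T + X <= _).
    by apply: leq_trans hBad; rewrite /th; apply: eq_leq; ring.
  by rewrite mulnDr mulnC leq_add2l -{1}[X]mul1n leq_mul2r T0 orbT.
(* Vertices of [Z] get an arbitrary default colour; there are few of them, and each is charged [n]
   inside edges. *)
pose col : {ffun G -> 'I_p} := [ffun v => odflt (Ordinal hp) [pick i | v \in V i]].
have colV v : v \notin Z -> v \in V (col v).
  rewrite inE negbK => /bigcupP[i _ vi]; rewrite ffunE.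
  by case: pickP => //= /(_ i); rewrite vi.
exists col.
have dgUle (v : G) (S S' S'' : {set G}) : S \subset S' :|: S'' -> dg v S <= dg v S' + dg v S''.
  move=> h; apply: leq_trans (dgS v h) _; rewrite /dg setIUr; exact: leq_card_setU.
have hcls v : v \notin Z -> dg v (cls col (col v)) <= dg v (V (col v)) + dg v Z.
  move=> vZ; apply: dgUle; apply/subsetP => u; rewrite !inE => /eqP <-.
  by case: (boolP (u \in Z)) => [|/colV]; rewrite !inE => ->; rewrite ?orbT.
have dN (v : G) (S : {set G}) : dg v S <= N by apply: leq_trans (dg_le _ _) (max_card _).
have s1 : In2 col setT <= \sum_i E2 (V i) + 2 * (#|Z| * N).
  have -> : In2 col setT = \sum_v dg v (cls col (col v)).
    by rewrite /In2 (eq_bigl predT) => [|v]; [apply: eq_bigr => v _; rewrite setIT | rewrite in_setT].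
  have -> : \sum_i E2 (V i) = \sum_v \sum_i (v \in V i) * dg v (V i).
    rewrite exchange_big /=; apply: eq_bigr => i _; rewrite /E2 big_mkcond /=.
    by apply: eq_bigr => v _; case: (v \in V i); rewrite ?mul1n ?mul0n.
  have e1 : \sum_v (v \in Z) * N = #|Z| * N.
    by rewrite -big_distrl /= -sum1_card [in RHS]big_mkcond.
  have e2 : \sum_v dg v Z <= #|Z| * N.
    rewrite (eq_bigl (fun v => v \in setT)) => [|v]; last by rewrite in_setT.
    by rewrite dg_exchange -sum_nat_const; apply: leq_sum.
  apply: leq_trans (_ : \sum_v (\sum_i (v \in V i) * dg v (V i) + (v \in Z) * N + dg v Z) <= _).
    apply: leq_sum => v _; case: (boolP (v \in Z)) => vZ.
      by rewrite mul1n; apply: leq_trans (dN _ _) _; rewrite addnAC leq_addl.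
    rewrite mul0n addn0; apply: leq_trans (hcls v vZ) _; rewrite leq_add2r.
    by rewrite (bigD1 (col v)) //= colV // mul1n leq_addr.
  by rewrite !big_split /= e1; move: e2; move: (\sum_v dg v Z) => x; clear; lia.
have s2 : \sum_i E2 (V i) <= p * (2 * k * N).
  have -> : p * (2 * k * N) = \sum_(i < p) 2 * k * N by rewrite sum_nat_const card_ord.
  apply: leq_sum => i _; apply: leq_trans (E2_normal HF noF (nV i)) _.
  by rewrite leq_mul2l max_card orbT.
have s3 : In2 col setT <= N * (2 * k * p + 2 * (B0 + #|Bad|)).
  apply: leq_trans s1 _; have : #|Z| * N <= (B0 + #|Bad|) * N by rewrite leq_mul2r cZ orbT.
  move: s2; have -> : p * (2 * k * N) = N * (2 * k * p) by ring.
  have -> : (B0 + #|Bad|) * N = N * (B0 + #|Bad|) by rewrite mulnC.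
  have -> : N * (2 * k * p + 2 * (B0 + #|Bad|)) = N * (2 * k * p) + 2 * (N * (B0 + #|Bad|)) by ring.
  by move: (N * _) (N * _) (\sum_i _) (#|Z| * N); clear; lia.
apply: leq_trans (_ : E * (N * (2 * k * p + 2 * (B0 + #|Bad|))) <= _).
  by rewrite leq_mul2l s3 orbT.
rewrite mulnCA leq_mul2l; apply/orP; right.
have e3 : E * (2 * k * p + 2 * (B0 + #|Bad|)) = 2 * E * k * p + 2 * E * B0 + 2 * (E * #|Bad|) by ring.
have e4 : 8 * E * #|Bad| = 8 * (E * #|Bad|) by ring.
by rewrite e3; rewrite e4 in hBad'; move: (2 * E * k * p) (2 * E * B0) (E * #|Bad|) hBad' hG; clear; lia.
Qed.

End Stability.

(** * Weights of inside edges *)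

(** Greedy choice: disjoint copies of the pattern are collected until there are [N] of them, or the
    at most [h * N] vertices taken meet every copy. *)
Lemma packing (T : finType) h (pat : pred (seq T)) N (S : {set T}) :
  (exists ls : seq (seq T), [/\ size ls = N, all (fun l => pat l && (size l == h)) ls,
      uniq (flatten ls) & {subset flatten ls <= S}]) \/
  (exists C : {set T}, [/\ C \subset S, #|C| <= h * N &
      forall l, size l = h -> uniq l -> {subset l <= S :\: C} -> ~~ pat l]).
Proof.
elim: N S => [|N IH] S; first by left; exists [::].
case: (boolP [exists t : h.-tuple T, [&& pat t, uniq t & all (mem S) t]]) => [/existsP[t /and3P[pt ut /allP tS]]|].
  case: (IH (S :\: [set x in t])) => [[ls [sl al ul sub]]|[C [CS cC hC]]].
    left; exists (tval t :: ls); split=> /=.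
    - by rewrite sl.
    - by rewrite pt size_tuple eqxx.
    - rewrite cat_uniq ut ul andbT; apply/hasPn => x /sub; rewrite !inE => /andP[xt _]; exact: xt.
    - by move=> x; rewrite mem_cat => /orP[/tS|/sub]; rewrite ?inE // => /andP[].
  right; exists (C :|: [set x in t]); split.
  - rewrite subUset (subset_trans CS (subsetDl _ _)) /=.
    by apply/subsetP => x; rewrite inE; apply: tS.
  - rewrite mulnS addnC; apply: leq_trans (leq_card_setU _ _) _; rewrite leq_add // cardsE.
    by apply: leq_trans (card_size _) _; rewrite size_tuple.
  - move=> l sl ul sub; apply: hC => // x /sub; rewrite !inE negb_or -!andbA.
    by case/and3P=> -> -> ->.
rewrite negb_exists => /forallP h'; right; exists set0; split; rewrite ?sub0set ?cards0 //.
move=> l sl ul sub; apply/negP => pl; have := h' (tcast sl (in_tuple l)).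
rewrite !val_tcast pl ul /= => /negP; apply; apply/allP => x /sub; by rewrite !inE.
Qed.

Section Lam.
Variables (G : sgraph) (S : {set G}).
Implicit Types (u v z : G).

(* Every edge inside [S] distributes a total of 2 over its ends, all of it to an end of
   smaller degree; in a [P_4]-free graph nobody then collects more than 2. *)
Definition om (a b : nat) : nat := if a < b then 2 else a == b.
Definition lam v := \sum_(u in nbr v :&: S) om (dg v S) (dg u S).

Definition P4free := forall l a b r, {subset [:: l; a; b; r] <= S} -> uniq [:: l; a; b; r] ->
  adj l a -> adj a b -> adj b r -> False.
Definition P3free := forall l z r, {subset [:: l; z; r] <= S} -> l != r -> adj z l -> adj z r -> False.

Lemma om_sum a b : om a b + om b a = 2.
Proof. by rewrite /om; case: ltngtP. Qed.

Lemma lam_sum : \sum_(v in S) lam v = E2 S.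
Proof.
have e1 : \sum_(v in S) lam v = \sum_(v in S) \sum_(u in S | adj v u) om (dg v S) (dg u S).
  by apply: eq_bigr => v _; apply: eq_bigl => u; rewrite !inE andbC.
have e2 : E2 S = \sum_(v in S) \sum_(u in S | adj v u) 1.
  rewrite /E2; apply: eq_bigr => v _; rewrite /dg -sum1_card.
  by apply: eq_bigl => u; rewrite !inE andbC.
have e3 : \sum_(v in S) \sum_(u in S | adj v u) om (dg v S) (dg u S) =
          \sum_(v in S) \sum_(u in S | adj v u) om (dg u S) (dg v S).
  rewrite (exchange_big_dep (fun u => u \in S)) //=; last by move=> v u _ /andP[].
  by apply: eq_bigr => u uS; apply: eq_bigl => v; rewrite uS /= adjC.
apply/eqP; rewrite -(eqn_pmul2l (ltn0Sn 1)) !mul2n -!addnn e1 {2}e3 e2 -!big_split /=.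
apply/eqP; apply: eq_bigr => v _; rewrite -!big_split /=.
by apply: eq_bigr => u _; rewrite om_sum.
Qed.

Lemma lam_pos v : 0 < lam v -> exists2 u, u \in S & adj v u.
Proof.
rewrite lt0n => nz; have [u] : exists u, u \in nbr v :&: S.
  apply/set0Pn; apply: contra nz => /eqP E; by rewrite /lam E big_set0.
by rewrite !inE => /andP[a b]; exists u.
Qed.

Lemma lam_le1 v : P3free -> v \in S -> lam v <= 1.
Proof.
move=> h vS; have d1 u : u \in S -> dg u S <= 1.
  move=> uS; rewrite leqNgt; apply/negP => /card_gt1P[x [y [xI yI nxy]]].
  move: xI yI; rewrite !inE => /andP[ax xS] /andP[ay yS].
  by apply: (h x u y) => // t; rewrite !inE => /or3P[] /eqP ->.
have : \sum_(u in nbr v :&: S) om (dg v S) (dg u S) <= \sum_(u in nbr v :&: S) 1.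
  apply: leq_sum => u; rewrite !inE => /andP[au uS].
  have du : 0 < dg u S by apply/card_gt0P; exists v; rewrite !inE adjC au.
  have dv : 0 < dg v S by apply/card_gt0P; exists u; rewrite !inE au.
  have := d1 u uS; have := d1 v vS; rewrite /om; case: ltngtP => //; plia.
by rewrite sum1_card => hh; apply: leq_trans hh (d1 v vS).
Qed.

Hypothesis P4 : P4free.

(** A neighbour [x] of [v] and a neighbour [y] of [u], both off the edge [v u], must coincide, since
    otherwise [x v u y] is a path on four vertices. *)
Lemma P4_triangle v u : v \in S -> u \in nbr v :&: S -> 1 < dg v S -> 1 < dg u S ->
  exists2 w, w \in S & [/\ nbr v :&: S = [set u; w], nbr u :&: S = [set v; w] & adj v w && adj u w].
Proof.
rewrite !inE => vS /andP[vu uS] dv du.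
have other x y : 1 < dg x S -> exists2 w, w \in nbr x :&: S & w != y.
  rewrite /dg (cardsD1 y); case: (y \in _) => /= h.
    have /card_gt0P[w] : 0 < #|(nbr x :&: S) :\ y| by move: h; rewrite addSn ltnS add0n.
    by rewrite !inE => /andP[nw wI]; exists w; rewrite // !inE.
  have /card_gt0P[w] : 0 < #|(nbr x :&: S) :\ y| by apply: ltnW; move: h; rewrite add0n.
  by rewrite !inE => /andP[nw wI]; exists w; rewrite // !inE.
have [w] := other v u dv; rewrite !inE => /andP[vw wS] wu.
have key x y : x \in S -> y \in S -> adj v x -> adj u y -> x != u -> y != v -> x = y.
  move=> xS yS vx uy xu yv; apply/eqP; apply: contraT => nxy; exfalso.
  apply: (P4 (l := x) (a := v) (b := u) (r := y)) => //.
  - by move=> t; rewrite !inE => /or4P[] /eqP ->.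
  - rewrite /= !inE !negb_or xu nxy (adj_neq vu) eq_sym (adj_neq vx) eq_sym yv /=.
    by rewrite andbT (adj_neq uy).
  - by rewrite adjC.
have [w' ] := other u v du; rewrite !inE => /andP[uw' w'S] w'v.
have ww' : w = w' := key w w' wS w'S vw uw' wu w'v.
exists w => //; split.
- apply/setP => x; rewrite !inE; apply/andP/orP => [[vx xS]|[] /eqP -> //].
  by case: (eqVneq x u) => [|xu]; [left|right; apply/eqP; rewrite ww'; exact: key].
- apply/setP => x; rewrite !inE; apply/andP/orP => [[ux xS]|[] /eqP ->].
  + by case: (eqVneq x v) => [|xv]; [left|right; apply/eqP; apply/esym; exact: key].
  + by rewrite adjC.
  + by rewrite ww' uw' w'S.
- by rewrite vw ww' uw'.
Qed.

(** The components are stars and triangles. An isolated edge gives 1 to each end, a larger star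
    gives 2 to each leaf and nothing to its centre, a triangle gives 2 to each vertex; so the value
    2 comes with a path [v z w]. *)
Lemma lam_cases v : v \in S ->
  [\/ lam v = 0,
      lam v = 1 /\ (exists u, [/\ u \in S, nbr v :&: S = [set u] & nbr u :&: S = [set v]]) |
      lam v = 2 /\ (exists z w, [/\ z \in S, w \in S, adj v z, adj z w & w != v])].
Proof.
move=> vS; have du u : u \in nbr v :&: S -> 0 < dg u S.
  by rewrite !inE => /andP[vu uS]; apply/card_gt0P; exists v; rewrite !inE adjC vu.
have [d0|d1|dv] := ltngtP (dg v S) 1.
- have : dg v S = 0 by move: d0; case: (dg v S).
  by move=> /eqP; rewrite cards_eq0 => /eqP E; apply: Or31; rewrite /lam E big_set0.
- case: (boolP [exists u in nbr v :&: S, dg v S <= dg u S]) => [/exists_inP[u uI hu]|].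
    have du1 : 1 < dg u S by apply: leq_trans hu.
    have [w wS [Ev Eu /andP[vw uw]]] := P4_triangle vS uI d1 du1.
    move: (uI); rewrite !inE => /andP[vu uS].
    have wI : w \in nbr v :&: S by rewrite Ev !inE eqxx orbT.
    have nuw : u != w by apply: adj_neq uw.
    have dw : 1 < dg w S.
      apply/card_gt1P; exists v, u; rewrite !inE adjC vw vS adjC uw uS; split=> //.
      exact: adj_neq.
    have [w2 _ [Ev2 Ew2 _]] := P4_triangle vS wI d1 dw.
    have dE x y (z : G) : x != y -> nbr z :&: S = [set x; y] -> dg z S = 2.
      by move=> nxy E; rewrite /dg E cards2 nxy.
    have d2v := dE _ _ v nuw Ev.
    have d2u : dg u S = 2 by apply: (dE v w) => //; apply: adj_neq.
    have d2w : dg w S = 2.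
      by rewrite /dg Ew2 cards2; move: dw; rewrite /dg Ew2 cards2; case: (_ == _).
    apply: Or33; split; last by exists u, w; split=> //; rewrite eq_sym; exact: adj_neq vw.
    by rewrite /lam Ev big_setU1 ?inE //= big_set1 d2v d2u d2w.
  rewrite negb_exists_in => /forall_inP h; apply: Or31.
  rewrite /lam big1 // => u uI; have := h u uI; rewrite /om; case: ltngtP => //.
- have /cards1P[u Eu] : #|nbr v :&: S| == 1 by rewrite -/(dg v S) dv.
  have uI : u \in nbr v :&: S by rewrite Eu inE.
  move: (uI); rewrite !inE => /andP[vu uS].
  have lamE : lam v = om 1 (dg u S) by rewrite /lam Eu big_set1 dv.
  have [h|h|h] := ltngtP (dg u S) 1.
  + by have := du u uI; move: h; case: (dg u S).
  + apply: Or33; rewrite lamE /om h; split=> //.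
    have /card_gt1P[x [y [xI yI nxy]]] := h.
    have [xv|xv] := eqVneq x v.
      move: yI; rewrite !inE => /andP[uy yS]; exists u, y; split=> //.
      by rewrite -xv eq_sym.
    by move: xI; rewrite !inE => /andP[ux xS]; exists u, x.
  + apply: Or32; rewrite lamE h; split=> //; exists u; split=> //.
    have /cards1P[x Ex] : #|nbr u :&: S| == 1 by rewrite -/(dg u S) h.
    have : v \in nbr u :&: S by rewrite !inE adjC vu.
    by rewrite Ex inE => /eqP ->.
Qed.

Lemma lam_le2 v : v \in S -> lam v <= 2.
Proof. by case/lam_cases=> [->|[-> _]|[-> _]]. Qed.

Lemma P4free_E2 : E2 S <= 2 * #|S|.
Proof. by rewrite -lam_sum mulnC -sum_nat_const; apply: leq_sum => v; apply: lam_le2. Qed.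

Definition ball2 z := z |: (nbr z :&: S) :|: \bigcup_(c in nbr z :&: S) (nbr c :&: S).

(** If [z] has two neighbours, a vertex at distance two would start a path on four vertices, so the
    ball is [z] with its neighbours; otherwise it has one branch. Hence the bound is linear in
    [d]. *)
Lemma card_ball2 z d : z \in S -> (forall v, v \in S -> dg v S <= d) -> #|ball2 z| <= 1 + 2 * d.
Proof.
move=> zS hd; have dz := hd z zS.
have [d1|d1] := leqP (dg z S) 1.
  apply: leq_trans (leq_card_setU _ _) _; apply: (@leq_trans ((1 + d) + d)); last by clear; lia.
  apply: leq_add.
    by apply: leq_trans (leq_card_setU _ _) _; rewrite cards1 leq_add2l.
  have [E|/set0Pn[c cI]] := eqVneq (nbr z :&: S) set0; first by rewrite E big_set0 cards0.
  have E : nbr z :&: S = [set c].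
    by apply/eqP; rewrite eq_sym eqEcard sub1set cI cards1.
  by rewrite E big_set1; apply: hd; move: cI; rewrite inE => /andP[].
apply: leq_trans (_ : #|z |: (nbr z :&: S)| <= _).
  apply: subset_leq_card; rewrite /ball2 subUset subxx /=; apply/bigcupsP => c cI.
  apply/subsetP => x; rewrite !inE => /andP[cx xS].
  have [->|xz] := eqVneq x z; first by [].
  move: (cI); rewrite !inE => /andP[zc cS].
  have [c' c'I nc] : exists2 c', c' \in nbr z :&: S & c' != c.
    have /card_gt1P[a [b [aI bI nab]]] := d1.
    by have [E|] := eqVneq a c; [exists b; rewrite // -E eq_sym | exists a].
  move: c'I; rewrite !inE => /andP[zc' c'S].
  have [->|xc'] := eqVneq x c'; first by rewrite zc' c'S orbT.
  exfalso; apply: (P4 (l := x) (a := c) (b := z) (r := c')) => //.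
  - by move=> t; rewrite !inE => /or4P[] /eqP ->.
  - rewrite /= !inE !negb_or xz xc' [c == c']eq_sym nc eq_sym (adj_neq cx) eq_sym (adj_neq zc) /=.
    by rewrite (adj_neq zc').
  - by rewrite adjC.
  - by rewrite adjC.
by apply: leq_trans (leq_card_setU _ _) _; rewrite cards1 leq_add2l; move: dz; rewrite /dg; clear; lia.
Qed.

End Lam.

(** * Popular vertices in all classes *)

Section Combo.
Variables (p k : nat).
Hypotheses (hp : 2 <= p) (hk : 3 <= k).
Notation F := (blowup (cycle_graph k) (p + 1)).
Variables (G : sgraph) (Y H P : 'I_p -> {set G}) (mu : nat) (R0 : {set G}) (l : 'I_p -> nat).
Hypothesis noF : ~~ contains G F.
Hypothesis HF : Fill k P mu.
Hypothesis hY : forall i v, v \in Y i -> nrm Y mu i v.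
Hypothesis hPY : forall i, P i \subset Y i.
Hypothesis hHY : forall i, H i \subset Y i.
Hypothesis hdeg : forall i v, v \in Y i -> dg v (Y i) <= mu.
Hypothesis hdisj : forall i j v, v \in Y i -> v \in Y j -> i = j.
Hypothesis P4 : forall i, P4free (H i).
Hypothesis hl : forall i v, v \in P i -> (if v \in H i then lam (H i) v else 0) = l i.
Hypothesis hR : forall w, w \in R0 -> full P w.
Hypothesis hRY : forall w i, w \in R0 -> w \notin Y i.
Implicit Types (u v w z : G) (Z L : seq G).

Notation off Z := (all (fun v => v \notin Z)).

Lemma nrmYP i v : v \in Y i -> nrm P mu i v.
Proof.
by move=> vY j ji; apply: leq_trans (hY vY ji); apply: subset_leq_card; apply: setSD.
Qed.

Lemma hdegH i v : v \in H i -> dg v (H i) <= mu.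
Proof.
move=> vH; apply: leq_trans (dgS v (hHY i)) _.
by apply: hdeg; apply: (subsetP (hHY i)).
Qed.

Lemma lam_posP i u : 0 < l i -> u \in P i -> u \in H i.
Proof. by move=> li uP; have := hl uP; case: ifP => // _ E; rewrite -E in li. Qed.

Lemma sz2 c : c <= 2 * k -> c <= 2 * k * p.
Proof. by move=> h; apply: leq_trans h _; rewrite leq_pmulr // (leq_trans _ hp). Qed.

(** At weight 1 a popular vertex lies in an isolated edge and determines its mate injectively. So
    forbidding a set of mates excludes no more popular vertices than the set has elements. *)
Lemma supply1 i Z L : l i = 1 -> size Z <= 2 * k * p -> size L <= 2 * k ->
  (forall w, w \in L -> #|Y i :\: nbr w| <= mu) ->
  exists u m, [/\ u \in P i, m \in Y i, off Z [:: u; m], adj u m &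
    forall w, w \in L -> adj w u && adj w m].
Proof.
move=> l1 sZ sL hL.
have mate u : u \in P i -> exists m, [/\ m \in H i, nbr u :&: H i = [set m] & nbr m :&: H i = [set u]].
  move=> uP; have uH : u \in H i by apply: lam_posP => //; rewrite l1.
  have := hl uP; rewrite uH l1 => E.
  by case: (lam_cases (@P4 i) uH) => [|[_ []]|[]]; rewrite ?E // => m [? ? ?]; exists m.
pose m u := odflt u [pick x in nbr u :&: H i].
have mE u : u \in P i -> [/\ m u \in H i, nbr u :&: H i = [set m u] & nbr (m u) :&: H i = [set u]].
  move=> uP; have [x [xH E1 E2]] := mate u uP.
  suff -> : m u = x by [].
  rewrite /m; case: pickP => [y|/(_ x)] /=; first by rewrite E1 inE => /eqP.
  by rewrite E1 inE eqxx.
pose B := [set z in Z] :|: \bigcup_(w <- L) (Y i :\: nbr w).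
have cB : #|B| <= size Z + mu * size L.
  apply: leq_trans (leq_card_setU _ _) _; rewrite leq_add //; first by rewrite cardsE card_size.
  elim: L hL {sL B} => [|v L IH] hL; first by rewrite big_nil cards0.
  rewrite big_cons; apply: leq_trans (leq_card_setU _ _) _.
  rewrite /= mulnS leq_add //; first by apply: hL; rewrite mem_head.
  by apply: IH => u uL; apply: hL; rewrite inE uL orbT.
pose Bad := [set u in P i | m u \in B].
have cBad : #|Bad| <= #|B|.
  have inj : {in Bad &, injective m}.
    move=> x y; rewrite !inE => /andP[xP _] /andP[yP _] Exy.
    have [_ _ E1] := mE x xP; have [_ _ E2] := mE y yP.
    by apply/set1P; rewrite -E2 -Exy E1 inE.
  rewrite -(card_in_imset inj); apply: subset_leq_card.
  by apply/subsetP => y /imsetP[x]; rewrite inE => /andP[_ xB] ->.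
have [||u [uX uZ uL]] := pick_fill_gen hp hk (mu := mu) (X := P i :\: Bad) (L := L) (Z := Z).
- move=> v vL; apply: leq_trans (hL v vL); apply: subset_leq_card; apply: setSD.
  by apply: subset_trans (subsetDl _ _) (hPY i).
- have := FillB HF i; rewrite -(cardsID Bad (P i)) /bound.
  have : #|P i :&: Bad| <= #|Bad| by apply: subset_leq_card; apply: subsetIr.
  have e1 : mu * size L <= 2 * (k * mu).
    have -> : 2 * (k * mu) = mu * (2 * k) by ring.
    by rewrite leq_mul2l sL orbT.
  have e2 : 10 * k * p * mu.+1 = 10 * (k * p) + 10 * (k * mu) * p by ring.
  have e3 : k * mu * 2 <= k * mu * p by rewrite leq_mul2l hp orbT.
  have e4 : 2 * k * p = 2 * (k * p) by ring.
  have e5 : 10 * (k * mu) * p = 10 * (k * mu * p) by ring.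
  have kp : 0 < k * p by rewrite muln_gt0; apply/andP; split; [apply: leq_trans hk | apply: leq_trans hp].
  rewrite e2 e5; rewrite e4 in sZ.
  move: e1 e3 sZ cB cBad kp; move: (mu * _) (k * mu) (k * mu * p) (k * p) #|_ :&: _| #|_ :\: _| #|Bad| #|B| (size Z).
  by clear; lia.
move: uX; rewrite !inE => /andP[nB uP]; rewrite uP /= !negb_or in nB.
case/andP: nB => mZ nB; have [mH Eu Em] := mE u uP.
have mY := subsetP (hHY i) _ mH.
exists u, (m u); split=> //; first by rewrite /= uZ mZ.
  have : m u \in nbr u :&: H i by rewrite Eu inE.
  by rewrite !inE => /andP[].
move=> w wL; rewrite uL //=; apply: contraR nB => nw.
by rewrite (big_rem w wL) /= !inE nw mY.
Qed.

(** At weight 2 the path [u z v] can hit a forbidden vertex only if [u] is within distance two of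
    it, and [card_ball2] bounds the number of such [u]. Only [u], not [z] or [v], is required to see
    [L]. *)
Lemma supply2 i Z L : l i = 2 -> size Z <= 4 * k -> size L <= 2 * k ->
  (forall w, w \in L -> #|Y i :\: nbr w| <= mu) ->
  exists u z v, [/\ u \in P i, z \in Y i, v \in Y i, off Z [:: u; z; v] &
    [/\ adj u z, adj z v, uniq [:: u; z; v] & forall w, w \in L -> adj w u]].
Proof.
move=> l2 sZ sL hL.
pose B := [set z in Z] :|: \bigcup_(z <- Z | z \in H i) ball2 (H i) z.
have cB : #|B| <= size Z * (2 + 2 * mu).
  have -> : size Z * (2 + 2 * mu) = size Z + size Z * (1 + 2 * mu) by ring.
  apply: leq_trans (leq_card_setU _ _) _; rewrite leq_add //; first by rewrite cardsE card_size.
  elim: Z {sZ B} => [|z Z IH]; first by rewrite big_nil cards0.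
  rewrite big_cons /=; case: ifP => zH; last by apply: leq_trans IH _; rewrite leq_mul2r ltnW ?orbT.
  apply: leq_trans (leq_card_setU _ _) _; rewrite mulSn leq_add //.
  by apply: (card_ball2 (@P4 i)) => // v; apply: hdegH.
have [||u [uX uZ uL]] := pick_fill_gen hp hk (mu := mu) (X := P i :\: B) (L := L) (Z := Z).
- move=> v vL; apply: leq_trans (hL v vL); apply: subset_leq_card; apply: setSD.
  by apply: subset_trans (subsetDl _ _) (hPY i).
- have := FillB HF i; rewrite -(cardsID B (P i)) /bound.
  have : #|P i :&: B| <= #|B| by apply: subset_leq_card; apply: subsetIr.
  have e1 : mu * size L <= 2 * (k * mu).
    have -> : 2 * (k * mu) = mu * (2 * k) by ring.
    by rewrite leq_mul2l sL orbT.
  have e2 : 10 * k * p * mu.+1 = 10 * (k * p) + 10 * (k * mu * p) by ring.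
  have e3 : k * mu * 2 <= k * mu * p by rewrite leq_mul2l hp orbT.
  have e4 : k * 2 <= k * p by rewrite leq_mul2l hp orbT.
  have e5 : size Z * (2 + 2 * mu) <= 4 * k * (2 + 2 * mu) by rewrite leq_mul2r sZ orbT.
  have e6 : 4 * k * (2 + 2 * mu) = 8 * k + 8 * (k * mu) by ring.
  rewrite e2; rewrite e6 in e5.
  move: hk e1 e3 e4 e5 sZ cB; move: (mu * size _) (k * mu) (k * mu * p) (k * p) #|_ :&: _| #|_ :\: _| #|B| (size Z) (size Z * _).
  by clear; lia.
move: uX; rewrite in_setD => /andP[nB uP].
have uH : u \in H i by apply: lam_posP => //; rewrite l2.
have := hl uP; rewrite uH l2 => E.
case: (lam_cases (@P4 i) uH) => [|[]|[_ [z [v [zH vH uz zv nvu]]]]]; rewrite ?E //.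
have inB t : t \in Z -> t \in H i -> u \in ball2 (H i) t -> False.
  move=> tZ tH ub; case/negP: nB; rewrite inE; apply/orP; right.
  by rewrite (big_rem t tZ) /= tH inE ub.
exists u, z, v; split=> //; try exact: (subsetP (hHY i)).
- have zZ : z \notin Z.
    apply/negP => tZ; apply: (inB z) => //.
    by rewrite /ball2 !inE; apply/orP; left; rewrite adjC uz uH orbT.
  have vZ : v \notin Z.
    apply/negP => tZ; apply: (inB v) => //; rewrite /ball2 in_setU; apply/orP; right.
    by apply/bigcupP; exists z; rewrite !inE ?(adjC v) ?zv // adjC uz.
  by rewrite /= uZ zZ vZ.
- split=> //; rewrite /= !inE negb_or (adj_neq uz) eq_sym nvu /= andbT.
  exact: adj_neq.
Qed.

Lemma supply_edges i N Z : l i = 1 -> size Z + 2 * N <= 2 * k * p ->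
  exists es : seq (G * G), [/\ size es = N, forall e, e \in es -> adj e.1 e.2,
    forall v, v \in flat2 es -> v \in Y i, uniq (flat2 es) & off Z (flat2 es)].
Proof.
move=> l1; elim: N Z => [|N IH] Z hZ; first by exists [::].
have [||//|u [m [uP mY oZ um _]]] := @supply1 i Z [::] l1; [by plia|by []|].
have [|es [se he hv ue oe]] := IH (u :: m :: Z); first by move: hZ => /=; clear; lia.
have uY := subsetP (hPY i) _ uP.
exists ((u, m) :: es); split=> /=.
- by rewrite se.
- by move=> e; rewrite inE => /predU1P[->//|/he].
- by move=> v; rewrite !inE => /or3P[/eqP->|/eqP->|/hv].
- have o1 : all (fun v => v \notin [:: u; m]) (flat2 es).
    by apply: sub_all oe => v; rewrite !inE !negb_or => /and3P[-> ->].
  have h : uniq ([:: u; m] ++ flat2 es) by rewrite uniq_off ue o1 /= inE (adj_neq um).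
  exact: h.
- move: oZ => /= /andP[-> /andP[-> _]] /=; apply: sub_all oe => v.
  by rewrite !inE !negb_or => /and3P[].
Qed.

Lemma supply_P3s i N Z : l i = 2 -> size Z + 3 * N <= 4 * k ->
  exists ts : seq (G * G * G), [/\ size ts = N,
    forall t, t \in ts -> adj t.1.2 t.1.1 && adj t.1.2 t.2,
    forall v, v \in flat3 ts -> v \in Y i, uniq (flat3 ts) & off Z (flat3 ts)].
Proof.
move=> l1; elim: N Z => [|N IH] Z hZ; first by exists [::].
have [||//|u [z [v [uP zY vY oZ [uz zv un _]]]]] := @supply2 i Z [::] l1; [by plia|by []|].
have [|es [se he hv ue oe]] := IH (u :: z :: v :: Z); first by move: hZ => /=; clear; lia.
have uY := subsetP (hPY i) _ uP.
exists ((u, z, v) :: es); split=> //=.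
- by rewrite se.
- by move=> e; rewrite inE => /predU1P[->|/he //] /=; rewrite adjC uz zv.
- by move=> x; rewrite !inE => /or4P[/eqP->|/eqP->|/eqP->|/hv].
- have o1 : all (fun t => t \notin [:: u; z; v]) (flat3 es).
    apply/allP => x xe; have := allP oe x xe; rewrite !inE !negb_or.
    by case/and4P=> h1 h2 h3 _; rewrite ?h1 ?h2 ?h3.
  have h : uniq ([:: u; z; v] ++ flat3 es) by rewrite uniq_off ue o1 un.
  exact: h.
- move: oZ => /= /and4P[-> -> -> _] /=; apply: sub_all oe => x.
  by rewrite !inE !negb_or => /and4P[].
Qed.

Let s1 := (k - 1) %/ 2.

Lemma R0_le : #|R0| <= s1.
Proof. exact: (full_set hp hk HF noF hR). Qed.

Lemma R0_list m : #|R0| = m.+1 -> exists w R, [/\ uniq (w :: R), size R = m,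
  forall v, v \in w :: R -> full P v & forall v, v \in w :: R -> v \in R0].
Proof.
move=> E; have := enum_uniq R0; have := mem_enum R0; have : size (enum R0) = m.+1 by rewrite -cardE.
case: (enum R0) => // w R [sR] hm uR; exists w, R; split=> // v vR; last by rewrite -[_ \in _]hm.
by apply: hR; rewrite -[_ \in _]hm.
Qed.

Lemma uniq_R0 (w : G) R L : uniq (w :: R) -> (forall v, v \in w :: R -> v \in R0) -> uniq L ->
  (forall v, v \in L -> exists i, v \in Y i) -> uniq (L ++ w :: R).
Proof.
move=> uR hwR uL hL; rewrite uniq_off uL uR andbT andTb.
apply/allP => v vR; apply/negP => /hL[i]; exact/negP/(hRY i)/hwR.
Qed.

(** For odd [k] the [s1] full vertices leave a single clique, which an inside edge at a popular
    vertex fills; popular vertices are adjacent to every full one. *)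
Lemma combo_full_odd i : odd k -> #|R0| = s1 -> l i = 0.
Proof.
move=> ok ER; apply/eqP; apply: contraT; rewrite -lt0n => li; case/negP: noF.
have s10 : 0 < s1 by rewrite /s1; move: hk; clear; lia.
have [w [R [uR sR fR hwR]]] : exists w R, [/\ uniq (w :: R), size R = s1.-1,
  forall v, v \in w :: R -> full P v & forall v, v \in w :: R -> v \in R0].
  by apply: R0_list; rewrite prednK.
have [u uP] : exists u, u \in P i.
  by apply/set0Pn; rewrite -card_gt0; apply: leq_trans (FillB HF i); rewrite /bound !muln_gt0; nat_only; lia.
have uH := lam_posP li uP; have := hl uP; rewrite uH => E; rewrite -E in li.
have [v vH uv] := lam_pos li; have uY := subsetP (hHY i) _ uH; have vY := subsetP (hHY i) _ vH.
have sRk : size R <= k by rewrite sR /s1; move: hk; clear; lia.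
apply: (@tmpl_edge_full G p k hp hk P mu HF w R fR sRk i u v) => //; try exact: nrmYP.
- apply: (@uniq_R0 w R [:: u; v]) => //; first by rewrite /= inE andbT adj_neq.
  by move=> x; rewrite !inE => /orP[] /eqP ->; exists i.
- apply: (fR (last w R) (mem_last _ _)) uP.
- by rewrite sR /s1; move: hk ok s10; rewrite /s1; clear; lia.
Qed.

Lemma combo_full_even i : ~~ odd k -> #|R0| = s1 -> l i != 1.
Proof.
move=> ok ER; apply/negP => /eqP li; case/negP: noF.
have s10 : 0 < s1 by rewrite /s1; move: hk; clear; lia.
have [w [R [uR sR fR hwR]]] : exists w R, [/\ uniq (w :: R), size R = s1.-1,
  forall v, v \in w :: R -> full P v & forall v, v \in w :: R -> v \in R0].
  by apply: R0_list; rewrite prednK.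
have [||//|u [m [uP mY _ um _]]] := @supply1 i [::] [::] li => //.
have [||//|u' [m' [uP' mY' oZ um' _]]] := @supply1 i [:: u; m] [::] li => //; first by try apply: sz2; rewrite /=; plia.
have uY := subsetP (hPY i) _ uP; have uY' := subsetP (hPY i) _ uP'.
have sRk : size R <= k by rewrite sR /s1; move: hk; clear; lia.
apply: (@tmpl_two_edges_same G p k hp hk P mu HF w R fR sRk i u m u' m') => //; try exact: nrmYP.
- apply: (@uniq_R0 w R [:: u; m; u'; m']) => //; last first.
    by move=> x; rewrite !inE => /or4P[] /eqP ->; exists i.
  have h : uniq ([:: u; m] ++ [:: u'; m']).
    by rewrite uniq_off oZ /= !inE (adj_neq um) (adj_neq um').
  exact: h.
- apply: (fR (last w R) (mem_last _ _)) uP.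
- apply: (fR w (mem_head _ _)) uP'.
- by rewrite sR /s1; move: hk ok s10; rewrite /s1; clear; lia.
Qed.

Lemma combo_two_classes i j : 3 <= p -> i != j -> l i = 1 -> l j = 1 -> False.
Proof.
move=> p3 ij li lj; case/negP: noF.
have [||//|y [y' [yP yY' _ yy' _]]] := @supply1 j [::] [::] lj => //.
have yY := subsetP (hPY j) _ yP.
have hYi t : t \in Y j -> #|Y i :\: nbr t| <= mu by move=> tY; apply: hY tY _ ij.
have [|||c [x [cP xY oZ cx hc]]] := @supply1 i [:: y; y'] [:: y; y'] li.
- by try apply: sz2; rewrite /=; plia.
- by try apply: sz2; rewrite /=; plia.
- by move=> t; rewrite !inE => /orP[] /eqP ->; apply: hYi.
have cY := subsetP (hPY i) _ cP.
have [|es [se he hv ue oe]] := @supply_edges i (k - 2) [:: c; x; y; y'] li.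
  by try apply: sz2; rewrite /=; plia.
apply: (@tmpl_two_classes G p k hp hk P mu HF i j c x y y' es) => //; try exact: nrmYP.
- by move=> v; rewrite !inE => /or3P[/eqP->|/eqP->|/hv]; apply: nrmYP.
- have h : uniq ([:: y; y'] ++ [:: c; x]).
    by rewrite uniq_off oZ /= !inE (adj_neq yy') (adj_neq cx).
  have h2 : uniq [:: c; x; y; y'] by uq h.
  have h3 : uniq ([:: c; x; y; y'] ++ flat2 es) by rewrite uniq_off ue oe h2.
  exact: h3.
- by rewrite adjC; have /andP[] := hc y (mem_head _ _).
- by rewrite adjC; have /andP[] := hc y' ltac:(by rewrite !inE eqxx orbT).
- by rewrite se; move: hk; clear; lia.
Qed.

Lemma combo_ladder i j : ~~ odd k -> i != j -> l i = 1 -> l j = 1 -> False.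
Proof.
move=> ok ij li lj; case/negP: noF.
have ji : j != i by rewrite eq_sym.
have [|es [se he hv ue oe]] := @supply_edges i (k %/ 2) [::] li.
  by try apply: sz2; rewrite /=; plia.
case: es se he hv ue oe => [|[a b] [|[a' b'] es]] se he hv ue oe;
  try by move: se hk ok => /=; clear; lia.
apply: (@tmpl_ladder G p k hp hk P mu HF i j (flat2 [:: (a, b), (a', b') & es]) ij _ _ a b a' b' es) => //.
- by move=> v /hv; apply: nrmYP.
- move=> Z sZ; have [|||u [m [uP mY oZ um hL]]] := @supply1 j Z (flat2 [:: (a, b), (a', b') & es]) lj.
  + by apply: leq_trans sZ _; nat_only; nia.
  + by rewrite (size_flat2 hp hk) se; move: hk; clear; lia.
  + by move=> w /hv wY; apply: hY wY _ ji.
  have uY := subsetP (hPY j) _ uP.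
  by exists u, m; split=> //; exact: nrmYP.
- by move: se hk ok => /=; clear; lia.
Qed.

Lemma combo_three_edges i j : odd k -> 5 <= k -> i != j -> l i = 1 -> l j = 1 -> #|R0| = s1.-1 -> False.
Proof.
move=> ok k5 ij li lj ER; case/negP: noF; have ji : j != i by rewrite eq_sym.
have [w [R [uR sR fR hwR]]] : exists w R, [/\ uniq (w :: R), size R = s1.-2,
  forall v, v \in w :: R -> full P v & forall v, v \in w :: R -> v \in R0].
  by apply: R0_list; rewrite ER /s1; move: k5; clear; lia.
have sRk : size R <= k by rewrite sR /s1; move: hk; clear; lia.
have [||//|x [x' [xP xY' _ xx' _]]] := @supply1 i [::] [::] li => //.
have [||//|z [z' [zP zY' oz zz' _]]] := @supply1 i [:: x; x'] [::] li => //; first by try apply: sz2; rewrite /=; plia.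
have xY := subsetP (hPY i) _ xP; have zY := subsetP (hPY i) _ zP.
have [|||y [y' [yP yY' oy yy' hy]]] := @supply1 j [:: x; x'; z; z'] [:: x; x'; z; z'] lj.
- by try apply: sz2; rewrite /=; plia.
- by try apply: sz2; rewrite /=; plia.
- have hYj t : t \in Y i -> #|Y j :\: nbr t| <= mu by move=> tY; apply: hY tY _ ji.
  by move=> t; rewrite !inE => /or4P[] /eqP ->; apply: hYj.
have yY := subsetP (hPY j) _ yP.
have ha t : t \in [:: x; x'; z; z'] -> adj t y /\ adj t y' by move=> /hy /andP[].
apply: (@tmpl_three_edges G p k hp hk P mu HF w R fR sRk i j x x' y y' z z') => //; try exact: nrmYP.
- apply: (@uniq_R0 w R [:: x; x'; y; y'; z; z']) => //; last first.
    move=> t; rewrite !inE => /or4P[/eqP->|/eqP->|/eqP->|/or3P[] /eqP ->];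
    by [exists i | exists j].
  have u1 : uniq [:: x; x'; z; z'].
    have h : uniq ([:: x; x'] ++ [:: z; z']) by rewrite uniq_off oz /= !inE (adj_neq xx') (adj_neq zz').
    exact: h.
  have u2 : uniq ([:: x; x'; z; z'] ++ [:: y; y']).
    by rewrite uniq_off u1 oy /= inE (adj_neq yy').
  by uq u2.
- by have [] := ha x ltac:(by rewrite !inE eqxx).
- by have [] := ha x' ltac:(by rewrite !inE eqxx orbT).
- by rewrite adjC; have [] := ha z ltac:(by rewrite !inE eqxx !orbT).
- by rewrite adjC; have [] := ha z ltac:(by rewrite !inE eqxx !orbT).
- exact: (fR (last w R) (mem_last _ _)) xP.
- by rewrite sR /s1; move: hk ok k5; clear; lia.
Qed.

Lemma combo_edge_P3 i : odd k -> 5 <= k -> l i = 2 -> #|R0| = s1.-1 -> False.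
Proof.
move=> ok k5 li ER; case/negP: noF.
have [w [R [uR sR fR hwR]]] : exists w R, [/\ uniq (w :: R), size R = s1.-2,
  forall v, v \in w :: R -> full P v & forall v, v \in w :: R -> v \in R0].
  by apply: R0_list; rewrite ER /s1; move: k5; clear; lia.
have sRk : size R <= k by rewrite sR /s1; move: hk; clear; lia.
have [||//|x [z [v [xP zY vY _ [xz zv un _]]]]] := @supply2 i [::] [::] li => //.
have [||//|a [c [b [aP cY bY oZ [ac cb un2 _]]]]] := @supply2 i [:: x; z] [::] li => //.
  by try apply: sz2; rewrite /=; plia.
have xY := subsetP (hPY i) _ xP; have aY := subsetP (hPY i) _ aP.
apply: (@tmpl_edge_P3 G p k hp hk P mu HF w R fR sRk i x z a c b) => //; try exact: nrmYP.
- apply: (@uniq_R0 w R [:: x; z; a; c; b]) => //; last first.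
    by move=> t; rewrite !inE => /or4P[/eqP->|/eqP->|/eqP->|/orP[] /eqP ->]; exists i.
  have h : uniq ([:: x; z] ++ [:: a; c; b]) by rewrite uniq_off oZ un2 /= inE (adj_neq xz).
  exact: h.
- by rewrite adjC.
- exact: (fR (last w R) (mem_last _ _)) xP.
- by rewrite sR /s1; move: hk ok k5; clear; lia.
Qed.

Lemma combo_P3s i j : odd k -> 5 <= k -> i != j -> l i = 2 -> l j = 2 -> False.
Proof.
move=> ok k5 ij li lj; case/negP: noF; have ji : j != i by rewrite eq_sym.
have [|ts [st ht hv ut ot]] := @supply_P3s j ((k - 3) %/ 2) [::] lj.
  by rewrite /=; nat_only; lia.
case: ts st ht hv ut ot => [|[[q y] q'] ts] st ht hv ut ot.
  by move: st hk ok k5 => /=; clear; lia.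
have yY : y \in Y j by apply: hv; rewrite !inE eqxx orbT.
have qY : q \in Y j by apply: hv; rewrite !inE eqxx.
have /andP[/= yq yq'] : adj y q && adj y q' by apply: (ht (q, y, q')); rewrite mem_head.
have [||//|x [z [x2 [xP zY xY2 _ [xz zx2 un hx]]]]] := @supply2 i [::] [:: y; q] li => //.
- by try apply: sz2; rewrite /=; plia.
- have hYi t : t \in Y j -> #|Y i :\: nbr t| <= mu by move=> tY; apply: hY tY _ ij.
  by move=> t; rewrite !inE => /orP[] /eqP ->; apply: hYi.
have xY := subsetP (hPY i) _ xP.
have szf : size (flat3 ts) = 3 * size ts.
  by elim: (ts) => //= t ts' IH; rewrite -/(flat3 ts') IH; clear; lia.
have [||//|u [u' [u2 [uP uY' uY2 oZ [uu' _ un3 hu]]]]] :=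
   @supply2 j (flat3 ((q, y, q') :: ts)) [:: z; x2] lj => //.
- by rewrite /= -/(flat3 ts) szf; move: st => /=; move: k5; clear; lia.
- by try apply: sz2; rewrite /=; plia.
- have hYj t : t \in Y i -> #|Y j :\: nbr t| <= mu by move=> tY; apply: hY tY _ ji.
  by move=> t; rewrite !inE => /orP[] /eqP ->; apply: hYj.
have uY := subsetP (hPY j) _ uP.
apply: (@tmpl_P3s_cross G p k hp hk P mu HF i j z x x2 q y q' u u' ts) => //; try exact: nrmYP.
- move=> t tI; apply: nrmYP; move: tI; rewrite 5!in_cons.
  case/or4P=> [/eqP->|/eqP->|/eqP->|/or3P[/eqP->|/eqP->|tt]] //.
  + by apply: hv; rewrite !inE eqxx !orbT.
  + by apply: hv; rewrite 3!in_cons tt !orbT.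
- by move=> t tt; apply: ht; rewrite inE tt orbT.
- have u1 : uniq (flat3 ((q, y, q') :: ts) ++ [:: u; u']).
    rewrite uniq_off; apply/and3P; split=> //; last by rewrite /= inE andbT adj_neq.
    by case/and4P: oZ => o1 o2 _ _; apply/and3P; split.
  have u2' : uniq ([:: x; z; x2] ++ (flat3 ((q, y, q') :: ts) ++ [:: u; u'])).
    rewrite uniq_off u1 andbT; apply/andP; split=> //; apply/allP => t tI; apply/negP => tX.
    have ti : t \in Y i by move: tX; rewrite !inE => /or3P[] /eqP ->.
    have tj : t \in Y j.
      by move: tI; rewrite mem_cat => /orP[/hv //|]; rewrite !inE => /orP[] /eqP ->.
    by case/negP: ij; apply/eqP; apply: hdisj ti tj.
  by uq u2'.
- by rewrite adjC.
- by rewrite adjC; apply: hx; rewrite !inE eqxx.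
- by rewrite adjC; apply: hx; rewrite !inE eqxx orbT.
- by rewrite adjC; apply: hu; rewrite !inE eqxx.
- by rewrite adjC; apply: hu; rewrite !inE eqxx orbT.
- by move: st => /=; move: k5 ok; clear; lia.
Qed.

(** The preceding lemmas forbid enough combinations of [#|R0|] and the weights to leave a finite
    check. If [p >= 3] or [k] is even, at most one class has positive weight. If [p = 2] and [k] is
    odd, both may, but then some full vertices must be missing. *)
Lemma combo : (k, p) <> (3, 2) -> (forall i, l i <= if (p == 2) && odd k then 2 else 1) ->
  (forall i, l i = 0) \/ 2 * #|R0| + \sum_i l i < 2 * s1.
Proof.
move=> kp hl2; have [/forallP h|] := boolP [forall i, l i == 0]; first by left=> i; apply/eqP.
rewrite negb_forall => /existsP[i li]; right; have := R0_le.
have R1 : odd k -> #|R0| != s1.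
  by move=> ok; apply: contra li => /eqP /(combo_full_odd i ok) ->.
case: ifP hl2 => [/andP[/eqP p2 ok]|pk] hl2.
  (* The excluded case [k = 3] would allow weights 1 and 1 without any full vertex, a tie with
     [2 * s1 = 2]. *)
  have k5 : 5 <= k.
    move: kp ok hk; rewrite p2; clear; case: k => [|[|[|[|[|k']]]]] //.
  have [j ji] := @other_color p hp i.
  have ij : i != j by rewrite eq_sym.
  have -> : \sum_i l i = l i + l j.
    rewrite (bigD1 i) //= (bigD1 j) ?ji //= big1 ?addn0 // => m /andP[mi mj].
    case/negP: mj; apply/eqP/val_inj; move: (p2) mi ji (ltn_ord i) (ltn_ord j) (ltn_ord m).
    by rewrite -!val_eqE /=; move: (nat_of_ord i) (nat_of_ord j) (nat_of_ord m); clear; lia.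
  have R2 := R1 ok => R0s.
  have n22 : ~ (l i = 2 /\ l j = 2) by case=> a b; apply: (combo_P3s ok k5 ij a b).
  have n11 : #|R0| = s1.-1 -> ~ (l i = 1 /\ l j = 1).
    by move=> E [a b]; apply: (combo_three_edges ok k5 ij a b E).
  have n2 m : #|R0| = s1.-1 -> l m <> 2 by move=> E a; apply: (combo_edge_P3 ok k5 a E).
  have := hl2 i; have := hl2 j; have := n2 i; have := n2 j.
  move: R0s R2 n22 n11 li; move: (l i) (l j) #|R0| s1.
  by clear; case=> [|[|[|x]]]; case=> [|[|[|y]]] //=; lia.
have l1 m : l m != 0 -> l m = 1 by move: (hl2 m); case: (l m) => [|[]].
have -> : \sum_i l i = 1.
  rewrite (bigD1 i) //= l1 // big1 // => j ji; apply/eqP; apply: contraT => lj.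
  have ij : i != j by rewrite eq_sym.
  have [p3|p2] := ltnP 2 p.
    by case: (combo_two_classes p3 ij (l1 _ li) (l1 _ lj)).
  have ek : ~~ odd k by move: pk; rewrite (_ : (p == 2) = true) ?eqn_leq ?p2 ?hp /= => [->|].
  by case: (combo_ladder ek ij (l1 _ li) (l1 _ lj)).
have R2 : #|R0| != s1.
  have [ok|ek] := boolP (odd k); first exact: R1.
  by apply/eqP => /(combo_full_even i ek); rewrite l1.
by move: R2; clear; lia.
Qed.

End Combo.

(** * Heavy vertices *)

Section Structure.
Variables (p k : nat).
Hypotheses (hp : 2 <= p) (hk : 3 <= k).
Notation F := (blowup (cycle_graph k) (p + 1)).
Variables (G : sgraph) (C D E : nat) (col : {ffun G -> 'I_p}).
Notation n := #|G|.
Hypothesis hC : mindeg p G C.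
Hypothesis noF : ~~ contains G F.
Hypothesis hmax : forall v j, dg v (cls col (col v)) <= dg v (cls col j).
Hypothesis hE : E * In2 col setT <= n * n.
Hypothesis hED : 2 * p * p * D <= E.
Hypothesis hnD : 2 * D * C <= n.
Hypothesis n0 : 0 < n.
Implicit Types (v u w : G) (i j : 'I_p).

Definition din v := dg v (cls col (col v)).
(** Inside degree at least [n / Q]; a larger threshold [Q] makes more vertices heavy. *)
Definition heavy Q := [set v | n <= Q * din v].
(** By [miss_le], the number of vertices of a foreign class that a vertex not heavy at [Q] can
    miss. *)
Definition slack Q := (2 * n) %/ Q.

Lemma sum_cls : \sum_i #|cls col i| = n.
Proof.
rewrite -sum1_card (partition_big col predT) //=; apply: eq_bigr => i _.
by rewrite -sum1_card; apply: eq_bigl => v; rewrite inE.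
Qed.

Lemma In2T : In2 col setT = \sum_v din v.
Proof. by apply: eq_big => [v|v _]; rewrite ?inE // setIT. Qed.

Lemma nbr_le v : #|nbr v| + #|cls col (col v)| <= n + din v.
Proof.
have <- : #|nbr v :&: cls col (col v)| = din v by [].
by rewrite -cardsUI leq_add2r max_card.
Qed.

Lemma nbr_le2 v j : j != col v ->
  #|nbr v| + #|cls col (col v)| + #|cls col j :\: nbr v| <= n + din v.
Proof.
move=> jv; have <- : #|nbr v :&: cls col (col v)| = din v by [].
rewrite -cardsUI addnAC leq_add2r.
have <- : #|(nbr v :|: cls col (col v)) :|: (cls col j :\: nbr v)| =
          #|nbr v :|: cls col (col v)| + #|cls col j :\: nbr v|.
  rewrite cardsU (_ : _ :&: _ = set0) ?cards0 ?subn0 //; apply/setP => u; rewrite !inE.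
  by case: (adj v u) => //=; apply/negP => /andP[/eqP -> /eqP E']; rewrite E' eqxx in jv.
exact: max_card.
Qed.

(** A vertex of minimal inside degree in a large class has very few inside neighbours, so its
    degree, about [(1 - 1/p) n], has to fit into the complement of the class. *)
Lemma cls_upper i : D * (p * #|cls col i|) <= (D + 1) * n.
Proof.
have [le|lt] := leqP (p * #|cls col i|) n.
  by apply: leq_trans (_ : D * n <= _); [rewrite leq_mul2l le orbT | rewrite leq_mul2r leq_addr orbT].
have [v0 v0i] : exists v, v \in cls col i.
  apply/set0Pn; rewrite -card_gt0; move: lt n0; case: #|cls col i| => //; rewrite muln0; plia.
have [v vi vmin] := arg_minnP din v0i.
have hv : #|cls col i| * din v <= In2 col setT.
  rewrite -sum_nat_const In2T [X in _ <= X](bigID (mem (cls col i))) /=.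
  by apply: leq_trans (leq_addr _ _); apply: leq_sum.
have cv : col v = i by apply/eqP; have : v \in cls col i by []; rewrite inE.
have e1 : E * din v <= p * n.
  have : n * (E * din v) <= n * (p * n).
    have -> : n * (p * n) = p * (n * n) by ring.
    apply: leq_trans (_ : p * (E * In2 col setT) <= _); last by rewrite leq_mul2l hE orbT.
    apply: leq_trans (_ : p * #|cls col i| * (E * din v) <= _); first by rewrite leq_mul2r ltnW ?orbT.
    have -> : p * #|cls col i| * (E * din v) = p * (E * (#|cls col i| * din v)) by ring.
    by rewrite !leq_mul2l hv !orbT.
  by rewrite leq_mul2l => /orP[/eqP h|//]; move: n0; rewrite h.
have e2 : 2 * (D * p * din v) <= n.
  have p0 : 0 < p by apply: leq_trans hp.
  rewrite -(leq_pmul2l p0); apply: leq_trans e1.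
  have -> : p * (2 * (D * p * din v)) = 2 * p * p * D * din v by ring.
  by rewrite leq_mul2r hED orbT.
have e3 : p * #|cls col i| <= n + C + p * din v.
  have := hC v; have := nbr_le v; rewrite cv => h1 h2.
  have h3 : p * (#|nbr v| + #|cls col i|) <= p * (n + din v) by rewrite leq_mul2l h1 orbT.
  move: h2 h3; rewrite !mulnDr; have -> : p * n = p.-1 * n + n by rewrite addnC -mulSn prednK // (leq_trans _ hp).
  by clear; lia.
have : D * (p * #|cls col i|) <= D * (n + C + p * din v) by rewrite leq_mul2l e3 orbT.
have -> : D * (n + C + p * din v) = D * n + D * C + D * p * din v by ring.
have -> : (D + 1) * n = D * n + n by ring.
move: e2 hnD; rewrite -!mulnA; move: (D * (p * din v)) (D * C) (D * n) (D * _) n.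
by clear; lia.
Qed.

Lemma cls_lower i : D * n <= D * (p * #|cls col i|) + p * n.
Proof.
have e0 : p * (D * n) <= D * (p * #|cls col i|) + p.-1 * ((D + 1) * n).
  have -> : p * (D * n) = \sum_j D * (p * #|cls col j|).
    by rewrite -sum_cls !big_distrr /=; apply: eq_bigr => j _; ring.
  rewrite (bigD1 i) //= leq_add2l -[X in _ <= X * _](_ : #|predC1 i| = _); last by rewrite cardC1 card_ord.
  by rewrite -sum_nat_const; apply: leq_sum => j _; apply: cls_upper.
have e1 : p * (D * n) = D * n + p.-1 * (D * n) by rewrite -mulSn prednK // (leq_trans _ hp).
have e2 : p * n = n + p.-1 * n by rewrite -mulSn prednK // (leq_trans _ hp).
move: e0; rewrite e1 e2 mulnDl mul1n mulnDr.
by move: (D * n) (D * _) (p.-1 * n) (p.-1 * _); clear; lia.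
Qed.

Lemma heavyN v Q : v \notin heavy Q -> Q * din v < n.
Proof. by rewrite inE -ltnNge. Qed.

(** The foreign classes offer hardly more than the minimum degree, so what [v] misses there is paid
    by its inside degree and by the imbalance of the classes. *)
Lemma miss_le v j Q : 0 < D -> 2 * Q <= D -> 2 * Q * C <= n -> v \notin heavy Q -> j != col v ->
  Q * #|cls col j :\: nbr v| <= 2 * n.
Proof.
move=> D0 hQ hQC /heavyN hv jv; have h1 := nbr_le2 jv; have h2 := hC v; have h3 := cls_lower (col v).
move: h1 h2 h3 hv; move: #|cls col j :\: nbr v| #|nbr v| #|cls col (col v)| (din v) => m d b x h1 h2 h3 hv.
have h1' : p * (d + b + m) <= p * (n + x) by rewrite leq_mul2l h1 orbT.
have pn : p * n = n + p.-1 * n by rewrite -mulSn prednK // (leq_trans _ hp).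
have h4 : p * b + p * m <= n + C + p * x by move: h1' h2; rewrite !mulnDr pn; clear; lia.
have h5 : D * (p * b + p * m) <= D * (n + C + p * x) by rewrite leq_mul2l h4 orbT.
have h6 : D * (p * m) <= p * n + D * C + D * (p * x) by move: h3 h5; rewrite !mulnDr; clear; lia.
have h7 : Q * (D * (p * m)) <= Q * (p * n + D * C + D * (p * x)) by rewrite leq_mul2l h6 orbT.
have h8 : 2 * (Q * (p * n)) <= D * (p * n).
  by rewrite mulnA leq_mul2r hQ orbT.
have h9 : 2 * (Q * (D * C)) <= D * (p * n).
  have -> : 2 * (Q * (D * C)) = D * (2 * Q * C) by ring.
  rewrite leq_mul2l; apply/orP; right; apply: leq_trans hQC _.
  by rewrite leq_pmull // (leq_trans _ hp).
have h10 : Q * (D * (p * x)) <= D * (p * n).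
  have -> : Q * (D * (p * x)) = D * (p * (Q * x)) by ring.
  by rewrite !leq_mul2l (ltnW hv) !orbT.
have : D * p * (Q * m) <= D * p * (2 * n).
  have -> : D * p * (Q * m) = Q * (D * (p * m)) by ring.
  have -> : D * p * (2 * n) = 2 * (D * (p * n)) by ring.
  by move: h7 h8 h9 h10; rewrite !mulnDr; clear; lia.
by rewrite leq_pmul2l // muln_gt0 D0 (leq_trans _ hp).
Qed.

Lemma nrm_heavy (P : 'I_p -> {set G}) v Q : (forall i, P i \subset cls col i) -> 0 < Q -> 2 * Q <= D -> 2 * Q * C <= n ->
  v \notin heavy Q -> nrm P (slack Q) (col v) v.
Proof.
move=> hP Q0 hQ hQC vQ j jv.
apply: leq_trans (_ : #|cls col j :\: nbr v| <= _).
  by apply: subset_leq_card; apply: setSD.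
rewrite /slack leq_divRL // mulnC; apply: miss_le => //.
by apply: leq_trans hQ; rewrite muln_gt0.
Qed.

Lemma fill_heavy (P : 'I_p -> {set G}) Q K : (forall i, P i \subset cls col i :\: heavy Q) -> 0 < Q -> 2 * Q <= D ->
  2 * Q * C <= n -> (forall i, n <= K * #|P i|) -> 40 * k * p * K <= Q -> 20 * k * p * K <= n ->
  Fill k P (slack Q).
Proof.
move=> hP Q0 hQ hQC hK hQK hnK.
have hP' i : P i \subset cls col i by apply: subset_trans (hP i) (subsetDl _ _).
split=> [i v vP|i].
  have := subsetP (hP i) _ vP; rewrite in_setD => /andP[vh]; rewrite inE => /eqP <-.
  exact: nrm_heavy.
have K0 : 0 < K by case: (posnP K) => // K0; have := leq_trans n0 (hK i); rewrite K0.
rewrite /bound -(leq_pmul2l K0); apply: leq_trans (hK i).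
have e1 : 40 * k * p * K * slack Q <= 2 * n.
  apply: leq_trans (_ : Q * slack Q <= _); first by rewrite leq_mul2r hQK orbT.
  by rewrite /slack mulnC leq_trunc_div.
have -> : K * (10 * k * p * (slack Q).+1) = 10 * (k * p * K * slack Q) + 10 * (k * p * K) by ring.
by move: e1 hnK; rewrite -!mulnA; move: (k * (p * (K * _))) (k * (p * K)) n; clear; lia.
Qed.

(** Markov's inequality for [din]. *)
Lemma card_heavy Q : E * #|heavy Q| <= Q * n.
Proof.
rewrite -(leq_pmul2l n0); apply: leq_trans (_ : Q * (E * In2 col setT) <= _); last first.
  by rewrite (_ : n * (Q * n) = Q * (n * n)); [rewrite leq_mul2l hE orbT | ring].
have -> : n * (E * #|heavy Q|) = E * (#|heavy Q| * n) by ring.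
have -> : Q * (E * In2 col setT) = E * (Q * In2 col setT) by ring.
rewrite leq_mul2l; apply/orP; right; rewrite -sum_nat_const In2T big_distrr /=.
rewrite [X in _ <= X](bigID (mem (heavy Q))) /=; apply: leq_trans (leq_addr _ _).
by apply: leq_sum => v; rewrite inE.
Qed.

End Structure.

(* Kővári–Sós–Turán: many vertices of linear degree to [Z] have a large subset with
   linearly many common neighbours. *)
Lemma kst_step (G : sgraph) (A Z : {set G}) n q t : 0 < n -> 0 < q -> 0 < t -> #|Z| <= n ->
  2 * q * t <= #|A| -> (forall a, a \in A -> n <= q * dg a Z) ->
  exists A' : {set G}, [/\ A' \subset A, #|A'| = t &
    n <= q * 2 ^ (2 * q * t + 1) * #|[set z in Z | A' \subset nbr z]|].
Proof.
move=> n0 q0 t0 cZ /subset_of_card[A0 A0A cA] hA.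
pose X := [set z in Z | t <= dg z A0].
have hX : n <= 2 * q * #|X|.
  have h1 : #|A0| * n <= q * \sum_(z in Z) dg z A0.
    rewrite dg_exchange -sum_nat_const big_distrr /=; apply: leq_sum => a aA.
    by apply: hA; apply: (subsetP A0A).
  have h2 : \sum_(z in Z) dg z A0 <= #|Z| * t + #|X| * #|A0|.
    rewrite -!sum_nat_const [X in _ <= _ + X](_ : _ = \sum_(z in Z) (t <= dg z A0) * #|A0|).
      rewrite -big_split /=; apply: leq_sum => z _; case: (leqP t (dg z A0)) => h /=; last by rewrite mul0n addn0 ltnW.
      by rewrite mul1n (leq_trans (dg_le _ _)) // leq_addl.
    rewrite [RHS](bigID (fun z => t <= dg z A0)) /= [X in _ + X]big1 ?addn0; last first.
      by move=> z /andP[_ /negPf ->].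
    by apply: eq_big => [z|z]; rewrite !inE // => /andP[_ ->]; rewrite mul1n.
  have h3 : #|Z| * t <= n * t by rewrite leq_mul2r cZ orbT.
  have h4 : q * (\sum_(z in Z) dg z A0) <= q * (n * t + #|X| * #|A0|).
    by rewrite leq_mul2l (leq_trans h2) ?orbT // leq_add2r.
  have := leq_trans h1 h4; rewrite cA.
  have -> : 2 * q * t * n = q * t * n + q * t * n by ring.
  have -> : q * (n * t + #|X| * (2 * q * t)) = q * t * n + q * t * (2 * q * #|X|) by ring.
  by rewrite leq_add2l leq_pmul2l // muln_gt0 q0.
pose d := q * 2 ^ (2 * q * t + 1); have d0 : 0 < d by rewrite muln_gt0 q0 expn_gt0.
have [||A' hA' hf] := @pigeon G {set G} (fun z => trim t (nbr z :&: A0)) X (powerset A0) (n.-1 %/ d).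
- move=> z; rewrite !inE => /andP[_ zt]; apply/subsetP => x; rewrite inE => /mem_take.
  by rewrite mem_enum inE => /andP[].
- rewrite card_powerset cA; rewrite -(ltn_pmul2l (_ : 0 < 2 * q)) ?muln_gt0 //.
  apply: leq_trans hX; have -> : 2 * q * (2 ^ (2 * q * t) * (n.-1 %/ d)) = n.-1 %/ d * d.
    by rewrite /d expnD; ring.
  by apply: leq_ltn_trans (leq_trunc_div _ _) _; rewrite prednK.
move: hf; rewrite ltn_divLR // prednK // => hf.
have [z] : exists z, z \in [set x in X | trim t (nbr x :&: A0) == A'].
  by apply/set0Pn; rewrite -card_gt0; case: #|_| hf n0 => //; plia.
rewrite !inE => /andP[/andP[_ zt] /eqP zA]; exists A'; split.
- by move: hA'; rewrite inE => /subset_trans; apply.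
- by rewrite -zA trim_card.
rewrite -/d mulnC; apply: leq_trans hf _; rewrite leq_mul2r; apply/orP; right.
apply: subset_leq_card; apply/subsetP => x; rewrite !inE => /andP[/andP[-> _] /eqP <-] /=.
by apply/subsetP => y; rewrite inE => /mem_take; rewrite mem_enum inE => /andP[].
Qed.

(** Iterates [kst_step] over [m] sets, shrinking [A] each time. The constants depend on [q], [t],
    [m] only and are returned in a sigma type, because the thresholds are later computed from
    them. *)
Lemma kst q t m : 0 < q -> 0 < t -> {LK : nat * nat | 0 < LK.1 /\
  forall (G : sgraph) (Zs : seq {set G}) (A : {set G}) n, size Zs = m -> 0 < n -> LK.1 <= #|A| ->
  (forall Z, Z \in Zs -> #|Z| <= n) -> (forall a Z, a \in A -> Z \in Zs -> n <= q * dg a Z) ->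
  exists A' : {set G}, [/\ A' \subset A, #|A'| = t &
    forall Z, Z \in Zs -> n <= LK.2 * #|[set z in Z | A' \subset nbr z]|]}.
Proof.
move=> q0 t0; elim: m => [|m [[L K] /= [L0 IH]]].
  exists (t, 0) => /=; split=> // G [|//] A n _ _ /subset_of_card[B BA cB] _ _.
  by exists B.
exists (2 * q * L, q * 2 ^ (2 * q * L + 1) + K) => /=; split; first by rewrite !muln_gt0 q0.
move=> G [|Z Zs] //= A n [sZ] n0 hA cZ hd.
have [||A1 [A1A cA1 hA1]] := @kst_step G A Z n q L n0 q0 L0 _ hA.
- by apply: cZ; rewrite mem_head.
- by move=> a aA; apply: hd => //; rewrite mem_head.
have [|||B [BA1 cB hB]] := IH G Zs A1 n sZ n0.
- by rewrite cA1.
- by move=> Y YZ; apply: cZ; rewrite inE YZ orbT.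
- by move=> a Y aA YZ; apply: hd; rewrite ?inE ?YZ ?orbT // (subsetP A1A).
exists B; split=> //; first exact: subset_trans A1A.
move=> Y; rewrite inE => /predU1P[->|YZ]; last first.
  by apply: leq_trans (hB Y YZ) _; rewrite leq_mul2r leq_addl orbT.
apply: leq_trans hA1 _; apply: leq_mul; first exact: leq_addr.
apply: subset_leq_card; apply/subsetP => z; rewrite !inE => /andP[-> h].
exact: subset_trans BA1 h.
Qed.

Section Heavy.
Variables (p k : nat).
Hypotheses (hp : 2 <= p) (hk : 3 <= k).
Notation F := (blowup (cycle_graph k) (p + 1)).

(** In a maximum cut a heavy vertex has linear degree into every class. Too many heavy vertices
    would include [s1 + 1] with linearly many common neighbours in each class; after removal of the
    vertices heavy at [Q'] these common neighbours make them full. *)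
Lemma heavy_bound Q : 0 < Q -> {LK : nat * nat | forall (G : sgraph) C D E (col : {ffun G -> 'I_p}) Q',
  mindeg p G C -> ~~ contains G F -> (forall v j, dg v (cls col (col v)) <= dg v (cls col j)) ->
  E * In2 col setT <= #|G| * #|G| -> 2 * p * p * D <= E -> 2 * D * C <= #|G| -> 0 < #|G| ->
  80 * k * p * LK.2 <= Q' -> 2 * Q' * LK.2 <= E -> 2 * Q' <= D -> 2 * Q' * C <= #|G| -> 0 < Q' ->
  40 * k * p * LK.2 <= #|G| -> #|heavy col Q| < LK.1}.
Proof.
move=> Q0; have [[L K] /= [L0 H]] := @kst Q ((k - 1) %/ 2).+1 p Q0 isT.
exists (L, K) => G C D E col Q' /= hC noF hmax hE hED hnD n0 hQK hQE hQD hQC Q'0 hK.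
rewrite ltnNge; apply/negP => hL.
have [|||B [BA cB hB]] := H G [seq cls col i | i : 'I_p] (heavy col Q) #|G| _ n0 hL.
- by rewrite size_map -cardE card_ord.
- by move=> Z _; apply: max_card.
- move=> a Z; rewrite inE => ha /mapP[i _ ->]; apply: leq_trans ha _.
  by rewrite leq_mul2l hmax orbT.
pose P (i : 'I_p) := [set z in cls col i | B \subset nbr z] :\: heavy col Q'.
have HF : Fill k P (slack G Q').
  apply: (fill_heavy hp hk hC hE hED hnD n0 (K := 2 * K)) => //.
  - by move=> i; apply: setSD; apply/subsetP => x; rewrite inE => /andP[].
  - move=> i; have := hB _ (map_f (fun i => cls col i) (mem_enum 'I_p i)).
    rewrite -(cardsID (heavy col Q') [set z in cls col i | _]) -/(P i).
    have h1 : #|[set z in cls col i | B \subset nbr z] :&: heavy col Q'| <= #|heavy col Q'|.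
      by apply: subset_leq_card; apply: subsetIr.
    have h2 := card_heavy hE n0 Q'; move: h1 h2.
    move: #|_ :&: _| #|heavy col Q'| #|P i| => a b c h1 h2 h3.
    have h4 : 2 * Q' * (K * b) <= Q' * #|G|.
      apply: leq_trans h2; have -> : 2 * Q' * (K * b) = 2 * Q' * K * b by ring.
      by rewrite leq_mul2r hQE orbT.
    have h5 : 2 * (K * b) <= #|G|.
      by rewrite -(leq_pmul2l Q'0); apply: leq_trans h4; rewrite mulnA [2 * Q']mulnC mulnA.
    have h6 : K * a <= K * b by rewrite leq_mul2l h1 orbT.
    by move: h3 h5 h6; rewrite mulnDr -mulnA; move: (K * a) (K * b) (K * c); clear; lia.
  - by move: hQK; rewrite (_ : 40 * k * p * (2 * K) = 80 * k * p * K) //; ring.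
  - by move: hK; rewrite (_ : 20 * k * p * (2 * K) = 40 * k * p * K) //; ring.
have := full_set hp hk HF noF (A := B).
rewrite cB ltnn; move=> h; have : false by apply: h => a aB i z; rewrite !inE => /and3P[_ _ /subsetP h]; rewrite adjC -in_nbr; apply: h.
by [].
Qed.
End Heavy.

Section Clean.
Variables (p k : nat).
Hypotheses (hp : 2 <= p) (hk : 3 <= k).
Notation F := (blowup (cycle_graph k) (p + 1)).
Variables (G : sgraph) (P : 'I_p -> {set G}) (mu : nat) (i : 'I_p) (Y : {set G}).
Hypotheses (HF : Fill k P mu) (noF : ~~ contains G F) (hY : forall v, v \in Y -> nrm P mu i v).

Definition triple (x0 : G) (l : seq G) := (nth x0 l 0, nth x0 l 1, nth x0 l 2).

Lemma flat3_subseq x0 ls : all (fun l => 2 < size l) ls ->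
  subseq (@flat3 G [seq triple x0 l | l <- ls]) (flatten ls).
Proof.
elim: ls => [|l ls IH] //= /andP[sl al]; rewrite -/(@flat3 G _).
case: l sl => [|a [|b [|c l]]] //= _; rewrite !eqxx.
by apply: subseq_trans (IH al) (suffix_subseq _ _).
Qed.

Lemma flat2_subseq x0 ls : all (fun l => 1 < size l) ls ->
  subseq (@flat2 G [seq (nth x0 l 0, nth x0 l 1) | l <- ls]) (flatten ls).
Proof.
elim: ls => [|l ls IH] //= /andP[sl al]; rewrite -/(@flat2 G _).
case: l sl => [|a [|b l]] //= _; rewrite !eqxx.
by apply: subseq_trans (IH al) (suffix_subseq _ _).
Qed.

Lemma P3freeN (S : {set G}) : P3free S -> P4free S.
Proof.
move=> h l a b r sub un al ab br; apply: (h l a b).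
- by move=> x xI; apply: sub; move: xI; rewrite !inE => /or3P[] ->; rewrite ?orbT.
- by apply: contraTneq un => ->; rewrite /= !inE eqxx !orbT.
- by rewrite adjC.
- by [].
Qed.

(** Many disjoint copies of the forbidden path would close a ring, so a bounded set meets all
    copies. Rings out of paths on three vertices need [p >= 3] or an even [k]; in the remaining case
    only paths on four vertices can be excluded, which is why [lam] may reach 2 there. *)
Lemma clean : exists H : {set G}, [/\ H \subset Y, #|Y :\: H| <= 4 * k, P4free H &
  ~~ ((p == 2) && odd k) -> P3free H].
Proof.
have [x0 _] : exists x, x \in P i.
  apply/set0Pn; rewrite -card_gt0; apply: leq_trans (FillB HF i).
  by rewrite /bound !muln_gt0; nat_only; lia.
have sD (S : {set G}) : S \subset Y -> Y :\: (Y :\: S) = S by move=> h; rewrite setDDr setDv set0U; apply/setIidPr.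
pose pat3 l := let: (a, b, c) := triple x0 l in adj b a && adj b c.
pose pat4 l := pat3 l && adj (nth x0 l 2) (nth x0 l 3).
have [/andP[/eqP p2 ok]|npk] := boolP ((p == 2) && odd k).
  (* One path is used whole, the other [(k - 3) / 2] through their first three vertices. *)
  case: (packing 4 pat4 ((k - 1) %/ 2) Y) => [[ls [sl al ul sub]]|[C [CY cC hC]]].
    case/negP: noF; case: ls sl al ul sub => [|l ls] sl al ul sub; first by move: sl hk => /=; clear; lia.
    case/andP: al => /andP[pl sl4] al.
    have s3 : all (fun l => 2 < size l) ls by apply: sub_all al => l' /andP[_ /eqP ->].
    case: l sl4 pl ul sub sl => [|a [|b [|c [|d [|]]]]] // _ pl ul sub sl.
    move: pl; rewrite /pat4 /pat3 /= => /andP[/andP[ba bc] cd].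
    have un : uniq ([:: a; b; c; d] ++ @flat3 G [seq triple x0 l | l <- ls]).
      by apply: (subseq_uniq _ ul); apply: (@cat_subseq _ [:: a; b; c; d] _ [:: a; b; c; d]); rewrite ?subseq_refl ?flat3_subseq.
    apply: (tmpl_P4_P3s hp hk HF (i := i) (l := a) (a := b) (b := c) (r := d) (ts := [seq triple x0 l | l <- ls])) => //.
    - move=> v vI; apply: hY; apply: sub; move: vI; rewrite !inE => /or4P[->|->|->|]; rewrite ?orbT //.
      by case/orP=> [->|/(mem_subseq (flat3_subseq x0 s3)) ->]; rewrite ?orbT.
    - by move=> t /mapP[l' l'I ->]; have /andP[/andP[]] := allP al l' l'I.
    - by rewrite size_map; move: sl ok hk => /=; clear; lia.
  exists (Y :\: C); split; rewrite ?subsetDl ?setDDr ?setDv ?set0U //.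
  - rewrite (setIidPr CY); apply: leq_trans cC _; by rewrite leq_mul2l; lia.
  - move=> l a b r sub un al ab br; have := hC [:: l; a; b; r] erefl un sub.
    by rewrite /pat4 /pat3 /= (adjC a l) al ab br.
(* Enough for both uses: one path and [k - 2] single edges if [p >= 3], and [k / 2] paths if
   [p = 2]. *)
case: (packing 3 pat3 (k - 1) Y) => [[ls [sl al ul sub]]|[C [CY cC hC]]]; last first.
  have h3 : P3free (Y :\: C).
    move=> l z r sub lr zl zr.
    have un : uniq [:: l; z; r] by rewrite /= !inE negb_or lr (adj_neq zr) eq_sym (adj_neq zl).
    by have := hC [:: l; z; r] erefl un sub; rewrite /pat3 /= zl zr.
  exists (Y :\: C); split; rewrite ?subsetDl ?setDDr ?setDv ?set0U //; last exact: P3freeN.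
  by rewrite (setIidPr CY); apply: leq_trans cC _; lia.
case/negP: noF.
case: ls sl al ul sub => [|l ls] sl al ul sub; first by move: sl hk => /=; clear; lia.
case/andP: al => /andP[pl sl4] al.
have s3 : all (fun l => 2 < size l) ls by apply: sub_all al => l' /andP[_ /eqP ->].
have s2 : all (fun l => 1 < size l) ls by apply: sub_all al => l' /andP[_ /eqP ->].
case: l sl4 pl ul sub sl => [|a [|b [|c [|]]]] // _ pl ul sub sl.
move: pl; rewrite /pat3 /= => /andP[ba bc].
have [p3|p2] := ltnP 2 p.
  have un : uniq ([:: a; b; c] ++ @flat2 G [seq (nth x0 l 0, nth x0 l 1) | l <- ls]).
    by apply: (subseq_uniq _ ul); apply: (@cat_subseq _ [:: a; b; c] _ [:: a; b; c]); rewrite ?subseq_refl ?flat2_subseq.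
  apply: (tmpl_P3_edges hp hk HF (i := i) (l := a) (z := b) (r := c) (es := [seq (nth x0 l 0, nth x0 l 1) | l <- ls])) => //.
  - move=> v vI; apply: hY; apply: sub; move: vI; rewrite !inE => /or4P[->|->|->|]; rewrite ?orbT //.
    by move=> /(mem_subseq (flat2_subseq x0 s2)) ->; rewrite ?orbT.
  - by move=> t /mapP[l' l'I ->]; have /andP[/andP[h _] _] := allP al l' l'I; rewrite adjC.
  - by rewrite size_map; move: sl hk => /=; clear; lia.
have ek : ~~ odd k by move: npk; rewrite (_ : (p == 2) = true) // eqn_leq p2 hp.
pose m := (k - 4) %/ 2.
case: ls sl al ul sub s3 s2 => [|l ls] sl al ul sub s3 s2; first by move: sl hk ek => /=; clear; case: k => [|[|[|[|?]]]].
case/andP: al => /andP[pl sl4] al; case/andP: s3 => _ s3.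
case: l sl4 pl ul sub sl {s2} => [|a' [|b' [|c' [|]]]] // _ pl ul sub sl.
move: pl; rewrite /pat3 /= => /andP[ba' bc'].
have st : all (fun l => 2 < size l) (take m ls) by apply/allP => l' /mem_take; apply: (allP s3).
have ss : subseq (@flat3 G [seq triple x0 l | l <- take m ls]) (flatten ls).
  by apply: subseq_trans (flat3_subseq x0 st) _; rewrite -{2}(cat_take_drop m ls) flatten_cat prefix_subseq.
have un : uniq ([:: a; b; c; a'; b'; c'] ++ @flat3 G [seq triple x0 l | l <- take m ls]).
  by apply: (subseq_uniq _ ul); apply: (@cat_subseq _ [:: a; b; c; a'; b'; c'] _ [:: a; b; c; a'; b'; c']); rewrite ?subseq_refl.
apply: (tmpl_P3s hp hk HF (i := i) (l := a) (z := b) (r := c) (l' := a') (z' := b') (r' := c')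
  (ts := [seq triple x0 l | l <- take m ls])) => //.
- move=> v vI; apply: hY; apply: sub; move: vI; rewrite !inE => /or4P[->|->|->|]; rewrite ?orbT //.
  by case/or4P=> [->|->|->|/(mem_subseq ss) ->]; rewrite ?orbT.
- move=> t; rewrite !inE => /or3P[/eqP->|/eqP->|]; rewrite /= ?ba ?ba' ?bc ?bc' //.
  by move=> /mapP[l' /mem_take l'I ->]; have /andP[] := allP al l' l'I.
- have hm : m <= size ls by move: sl ek hk; rewrite /m /=; clear; lia.
  by rewrite size_map size_takel // /m; move: ek hk; clear; case: k => [|[|[|[|k']]]] //= *; lia.
Qed.
End Clean.

(** * The approximate structure *)

Section Approx.
Variables (p k : nat).
Hypotheses (hp : 2 <= p) (hk : 3 <= k) (kp : (k, p) <> (3, 2)).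
Notation F := (blowup (cycle_graph k) (p + 1)).
Variables (G : sgraph) (A : {set G}) (Y H : 'I_p -> {set G}) (mu K1 : nat).
Notation n := #|G|.
Notation a := #|A|.
Notation s1 := ((k - 1) %/ 2).
Hypothesis noF : ~~ contains G F.
Hypothesis hFill : forall P : 'I_p -> {set G}, (forall i, P i \subset Y i) ->
  (forall i, n <= K1 * #|P i|) -> Fill k P mu.
Hypothesis hY : forall i v, v \in Y i -> nrm Y mu i v.
Hypothesis hdeg : forall i v, v \in Y i -> dg v (Y i) <= mu.
Hypothesis hdisj : forall i j v, v \in Y i -> v \in Y j -> i = j.
Hypothesis hAY : forall w i, w \in A -> w \notin Y i.
Hypothesis hAdeg : forall x j, x \in A -> n <= K1 * dg x (Y j).
Hypothesis hHY : forall i, H i \subset Y i.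
Hypothesis hHC : forall i, #|Y i :\: H i| <= 4 * k.
Hypothesis hP4 : forall i, P4free (H i).
Hypothesis hP3 : ~~ ((p == 2) && odd k) -> forall i, P3free (H i).
Implicit Types (u v w x : G) (i j : 'I_p).

Definition lm i v := if v \in H i then lam (H i) v else 0.
(** Twice the contribution of [v] to the edge count: an edge to [A] counts 2, and an inside edge
    distributes 2 over its ends through [lam]. *)
Definition val2 i v := 2 * dg v A + lm i v.
(* The truncation [inord] is harmless: [lm] never exceeds 2. *)
Definition ty i v := (nbr v :&: A, inord (lm i v) : 'I_3).
Definition alike i v := [set u in Y i | ty i u == ty i v].
Definition popular i v := n <= K1 * #|alike i v|.

Lemma lm_le i v : lm i v <= if (p == 2) && odd k then 2 else 1.
Proof.
rewrite /lm; case: ifP => vH; last by case: ifP.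
case: ifP => [_|/negbT h]; first by apply: lam_le2 (@hP4 i) _ vH.
by apply: lam_le1 vH; apply: hP3.
Qed.

Lemma lm_lt i v : lm i v < 3.
Proof. by rewrite ltnS (leq_trans (lm_le i v)) //; case: ifP. Qed.

Lemma alike_nbr i u v x : u \in alike i v -> x \in A -> adj u x = adj v x.
Proof.
rewrite inE => /andP[_ /eqP[E _]] xA.
by have := congr1 (fun S : {set G} => x \in S) E; rewrite /= !inE xA !andbT.
Qed.

Lemma alike_lm i u v : u \in alike i v -> lm i u = lm i v.
Proof.
rewrite inE => /andP[_ /eqP[_ /(congr1 val)]].
by rewrite /= !inordK ?lm_lt.
Qed.

Section Tuple.
Variable w : 'I_p -> G.
Hypothesis wpop : forall i, popular i (w i).
Hypothesis wval : 2 * p.-1 * a + 2 * s1 <= \sum_i val2 i (w i).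
Let P i := alike i (w i).
Let R0 := [set x in A | [forall i, adj (w i) x]].
Let c x := \sum_i adj (w i) x.

Let PY i : P i \subset Y i.
Proof. by apply/subsetP => v; rewrite inE => /andP[]. Qed.

Let HF : Fill k P mu.
Proof. by apply: hFill. Qed.

Let R0full x : x \in R0 -> full P x.
Proof.
rewrite inE => /andP[xA /forallP h] j v vP.
by rewrite adjC (alike_nbr vP).
Qed.

Let c_le x : x \in A -> c x <= p.-1 + (x \in R0).
Proof.
move=> xA; rewrite inE xA /=; case: (boolP [forall i, _]) => [_|].
  rewrite addn1 (ltn_predK hp); apply: (@leq_trans (\sum_(i < p) 1)).
    by apply: leq_sum => i _; apply: leq_b1.
  by rewrite sum1_card card_ord.
rewrite negb_forall => /existsP[i ni]; rewrite /c (bigD1 i) //= (negPf ni) add0n addn0.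
apply: (@leq_trans (\sum_(j < p | j != i) 1)); first by apply: leq_sum => j _; apply: leq_b1.
by rewrite sum1_card (cardC1 i) card_ord.
Qed.

Let sumP : 2 * (\sum_(x in A) c x) + \sum_i lm i (w i) = \sum_i val2 i (w i).
Proof.
rewrite /val2 big_split /= -big_distrr /=; congr (2 * _ + _).
by rewrite exchange_big /=; apply: eq_bigr => i _; rewrite dgE.
Qed.

Let sumR : \sum_(x in A) (p.-1 + (x \in R0)) = p.-1 * a + #|R0|.
Proof.
rewrite big_split /= sum_nat_const mulnC; congr (_ + _).
by rewrite -sum1_card big_mkcond [RHS]big_mkcond /=; apply: eq_bigr => x _; rewrite inE; case: (x \in A); case: [forall _, _].
Qed.

(** A vertex of [A] adjacent to all [w i] is full for the popular sets, and any other one sees at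
    most [p.-1] of the [w i]. So [wval] forces the full vertices and the inside weights to reach
    [2 * s1], and [combo] kills the inside weights. Then [#|R0| = s1] holds, and a vertex of [A]
    outside [R0] misses exactly one [w i]. *)
Lemma tuple_exact : [/\ a = s1, forall i, A \subset nbr (w i) & forall i, lm i (w i) = 0].
Proof.
have l0 : forall i, lm i (w i) = 0.
  case: (combo hp hk noF HF hY PY hHY hdeg hdisj hP4 (l := fun i => lm i (w i)) _ R0full _ kp) => //.
  - by move=> i v vP; rewrite -(alike_lm vP).
  - by move=> x i; rewrite inE => /andP[xA _]; apply: hAY.
  - by move=> i; apply: lm_le.
  move=> lt; have h : \sum_(x in A) c x <= p.-1 * a + #|R0| by rewrite -sumR; apply: leq_sum => x; apply: c_le.
  by move: wval h lt; rewrite -sumP -!mulnA; move: (\sum_i _) (\sum_(x in A) _) (p.-1 * _) #|R0|; clear; lia.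
have R0s := R0_le hp hk noF HF R0full.
have S0 : \sum_i lm i (w i) = 0 by apply: big1.
have cE x : x \in A -> c x = p.-1 + (x \in R0).
  move=> xA; apply/eqP; rewrite eqn_leq c_le //=.
  have h : \sum_(y in A :\ x) c y <= \sum_(y in A :\ x) (p.-1 + (y \in R0)).
    by apply: leq_sum => y; rewrite inE => /andP[_]; apply: c_le.
  have := wval; rewrite -sumP S0 addn0 (big_setD1 x xA) /=.
  have := sumR; rewrite (big_setD1 x xA) /= -mulnA.
  by move: h R0s; move: (\sum_(y in _) _) (\sum_(y in _) _) (p.-1 * _) (c x) #|R0| (p.-1 + _); clear; lia.
have R0E : #|R0| = s1.
  apply/eqP; rewrite eqn_leq R0s /=; have := wval; rewrite -sumP S0 addn0.
  have -> : \sum_(x in A) c x = p.-1 * a + #|R0| by rewrite -sumR; apply: eq_bigr.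
  by rewrite -mulnA; move: (p.-1 * _) #|R0|; clear; lia.
suff AR : A \subset R0.
  have R0A : R0 \subset A by apply/subsetP => x; rewrite inE => /andP[].
  have E : A = R0 by apply/eqP; rewrite eqEsubset AR.
  split=> //; first by rewrite E.
  by move=> i; apply/subsetP => x /(subsetP AR); rewrite !inE => /andP[_ /forallP].
(* Replacing the one missed class by the neighbours of [x] there, a linear set by [hAdeg], makes [x]
   full; with the [s1] vertices of [R0] it closes a ring. *)
apply/subsetP => x xA; apply: contraT => xR; case/negP: noF.
have [i0 ni0] : exists i, ~~ adj (w i) x by apply/existsP; rewrite -negb_forall; apply: contra xR => h; rewrite inE xA.
have adjx j : j != i0 -> adj (w j) x.
  move=> ji; apply: contraT => nj; have := cE x xA; rewrite (negPf xR) addn0.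
  rewrite /c (bigD1 i0) //= (bigD1 j) //= (negPf ni0) (negPf nj) !add0n => E.
  have : \sum_(i | (i != i0) && (i != j)) adj (w i) x <= \sum_(i | (i != i0) && (i != j)) 1.
    by apply: leq_sum => i _; apply: leq_b1.
  have := cardC1 i0; rewrite card_ord -sum1_card (bigD1 j) //= E.
  by move: (\sum_(i | _) 1) hp; clear; lia.
pose P' j := if j == i0 then nbr x :&: Y i0 else P j.
have HF' : Fill k P' mu.
  apply: hFill => j; rewrite /P'; case: eqP => [E|_] //.
  - by rewrite E subsetIr.
  - exact: hAdeg.
  - exact: wpop.
have PP' j : j != i0 -> P' j = P j by rewrite /P' => /negPf ->.
have fx : full P' x.
  move=> j v; rewrite /P'; case: eqP => [_|/eqP ji vP]; first by rewrite !inE => /andP[].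
  by rewrite adjC (alike_nbr vP) // adjx.
have s10 : 0 < s1 by move: hk; clear; lia.
have := enum_uniq R0; have := mem_enum R0; have : size (enum R0) = s1 by rewrite -cardE.
case: (enum R0) => [E|b R sz mR uR]; first by move: s10; rewrite -E.
have fR v : v \in b :: R -> full P v by move=> vR; apply: R0full; rewrite -[_ \in _]mR.
have xbR : uniq (x :: b :: R) by rewrite cons_uniq uR andbT; apply: contra xR => h; rewrite -[_ \in _]mR.
have sR : size R <= k by move: sz => /=; move: hk; clear; lia.
have [ok|ek] := boolP (odd k); last first.
  apply: (tmpl_almost_even hp hk HF HF' PP' fR fx sR xbR).
  by move: sz ek hk => /=; clear; lia.
have [p3|p2] := ltnP 2 p.
  apply: (tmpl_almost_odd3 hp hk HF HF' PP' fR fx sR p3 xbR).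
  by move: sz ok hk => /=; clear; lia.
have k5 : 5 <= k.
  have p2' : p = 2 by apply/eqP; rewrite eqn_leq p2 hp.
  move: kp ok hk; rewrite p2'; clear; case: k => [|[|[|[|[|k']]]]] //.
case: R sz mR uR fR xbR sR => [|b' R] sz mR uR fR xbR sR; first by move: sz k5 => /=; clear; lia.
have fR' v : v \in b' :: R -> full P v by move=> vR; apply: fR; rewrite inE vR orbT.
apply: (tmpl_almost_odd hp hk HF HF' PP' fR' fx (ltnW sR) (fR b (mem_head _ _))).
  by uq xbR.
by move: sz ok hk => /=; clear; lia.
Qed.
End Tuple.

Hypothesis n0 : 0 < n.
Hypothesis hK1 : 16 * p * p * (2 * a + 3) * (2 ^ a * 3) <= K1.
Hypothesis hYl : forall i, 7 * n <= 8 * (p * #|Y i|).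
Hypothesis hYu : forall i, 16 * p * (2 * a + 2) * (p * #|Y i|) <= 16 * p * (2 * a + 2) * n + n.
Hypothesis hmu : 128 * k * p * p * mu <= n.
Hypothesis hcount : 8 * ((2 * p.-1 * a + 2 * s1) * n) <=
  8 * p * \sum_i (\sum_(v in Y i) 2 * dg v A + E2 (Y i)) + n.

Definition unpop i := [set v in Y i | ~~ popular i v].

Lemma K1_gt0 : 0 < K1.
Proof. by apply: leq_trans hK1; rewrite !muln_gt0 expn_gt0 /=; move: hp; clear; lia. Qed.

(** There are at most [2 ^ a * 3] types, and the vertices of an unpopular one number less than
    [n / K1]. *)
Lemma card_unpop i : 16 * p * p * (2 * a + 3) * #|unpop i| <= n.
Proof.
have h : K1 * #|unpop i| <= 2 ^ a * 3 * n.
  have h : #|unpop i| <= (2 ^ a * 3) * (n %/ K1).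
    rewrite leqNgt; apply/negP => h.
    have [||b _] := @pigeon G _ (ty i) (unpop i) (setX (powerset A) [set: 'I_3]) (n %/ K1).
    - by move=> v _; rewrite !inE /= subsetIr.
    - by rewrite cardsX card_powerset cardsT card_ord.
    move=> hb; have [v] : exists v, v \in [set u in unpop i | ty i u == b].
      by apply/set0Pn; rewrite -card_gt0; apply: leq_ltn_trans hb.
    rewrite !inE => /andP[/andP[vY np] /eqP tb].
    case/negP: np; rewrite /popular; move: hb; rewrite ltn_divLR ?K1_gt0 // => hb.
    apply: ltnW; apply: leq_trans hb _; rewrite mulnC leq_mul2l; apply/orP; right.
    apply: subset_leq_card; apply/subsetP => u; rewrite !inE tb => /andP[/andP[-> _] ->].
    by [].
  apply: leq_trans (_ : K1 * (2 ^ a * 3 * (n %/ K1)) <= _); first by rewrite leq_mul2l h orbT.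
  by rewrite mulnCA leq_mul2l (mulnC K1) leq_trunc_div orbT.
rewrite -(leq_pmul2l (_ : 0 < 2 ^ a * 3)) ?muln_gt0 ?expn_gt0 //; apply: leq_trans h.
by rewrite mulnA leq_mul2r mulnC hK1 orbT.
Qed.

Lemma val2_le i v : val2 i v <= 2 * a + 2.
Proof. by have := lm_lt i v; have := dg_le v A; rewrite /val2; clear; lia. Qed.

Lemma sum_lm i : E2 (Y i) <= \sum_(v in Y i) lm i v + 8 * k * mu.
Proof.
have -> : \sum_(v in Y i) lm i v = E2 (H i).
  rewrite -lam_sum.
  rewrite (big_setID (H i)) /= [X in _ + X]big1 ?addn0; last by move=> v; rewrite inE /lm => /andP[/negPf ->].
  by rewrite (setIidPr (hHY i)); apply: eq_bigr => v vH; rewrite /lm vH.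
have hs : \sum_(v in Y i :\: H i) dg v (Y i) <= 4 * k * mu.
  apply: leq_trans (_ : \sum_(v in Y i :\: H i) mu <= _).
    by apply: leq_sum => v; rewrite inE => /andP[_ vY]; apply: hdeg.
  by rewrite sum_nat_const leq_mul2r hHC orbT.
rewrite /E2 (big_setID (H i)) /= (setIidPr (hHY i)).
have e1 : \sum_(v in H i) dg v (Y i) = \sum_(v in H i) dg v (H i) + \sum_(v in H i) dg v (Y i :\: H i).
  rewrite -big_split /=; apply: eq_bigr => v _; rewrite /dg -(cardsID (H i) (nbr v :&: Y i)).
  by rewrite -setIA (setIidPr (hHY i)) setIDA.
have e2 : \sum_(v in H i) dg v (Y i :\: H i) <= \sum_(v in Y i :\: H i) dg v (Y i).
  by rewrite dg_exchange; apply: leq_sum => v _; apply: dgS.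
have -> : 8 * k * mu = 4 * k * mu + 4 * k * mu by ring.
rewrite e1; move: e2 hs; move: (\sum_(v in H i) _) (\sum_(v in H i) _) (\sum_(v in _ :\: _) _) (4 * k * mu).
by clear; lia.
Qed.

Section Count.
Variables (M : 'I_p -> nat) (Bd : 'I_p -> {set G}).
Hypothesis hM : forall i v, v \in Y i -> popular i v -> val2 i v + (v \in Bd i) <= M i.
Hypothesis hM2 : forall i, M i <= 2 * a + 2.
Hypothesis hBd : forall i, Bd i \subset Y i.

(** The set [Bd] lets one count serve twice: empty, it bounds the maximal weights from below; taken
    as the vertices not complete to [A], it shows that these are few. *)
Lemma count_le : 16 * ((2 * p.-1 * a + 2 * s1) * n) + 16 * p * \sum_i #|Bd i| <=
  16 * (n * \sum_i M i) + 5 * n.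
Proof.
have h1 i : \sum_(v in Y i) val2 i v + #|Bd i| <= #|Y i| * M i + (2 * a + 3) * #|unpop i|.
  have -> : #|Bd i| = \sum_(v in Y i) (v \in Bd i).
    rewrite -sum1_card [RHS](big_setID (Bd i)) /= (setIidPr (hBd i)) [X in _ = _ + X]big1 ?addn0; last first.
      by move=> v; rewrite inE => /andP[/negPf ->].
    by apply: eq_bigr => v ->.
  have -> : (2 * a + 3) * #|unpop i| = \sum_(v in Y i) (~~ popular i v) * (2 * a + 3).
    rewrite mulnC -sum_nat_const [RHS](bigID (popular i)) /= [X in _ = X + _]big1 ?add0n; last first.
      by move=> v /andP[_ ->].
    by apply: eq_big => [v|v]; rewrite inE // => /andP[_ ->]; rewrite mul1n.
  rewrite -sum_nat_const -!big_split /=; apply: leq_sum => v vY.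
  have [pv|nv] := boolP (popular i v); first by rewrite /= mul0n addn0 hM.
  by have := val2_le i v; rewrite /= mul1n; case: (_ \in _); move: (val2 i v) (M i); clear; lia.
have h2 i : E2 (Y i) + \sum_(v in Y i) 2 * dg v A <= \sum_(v in Y i) val2 i v + 8 * k * mu.
  by rewrite /val2 [X in _ <= X + _]big_split /= addnC -addnA leq_add2l; apply: sum_lm.
have h3 i : p * (16 * p * (#|Y i| * M i)) <= p * (16 * (n * M i)) + n.
  have := hYu i; have := hM2 i; move: #|Y i| (M i) (2 * a + 2) => y m b mb hb.
  have [le|lt] := leqP (p * y) n.
    apply: leq_trans (leq_addr _ _).
    have -> : p * (16 * p * (y * m)) = 16 * p * m * (p * y) by ring.
    have -> : p * (16 * (n * m)) = 16 * p * m * n by ring.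
    by rewrite leq_mul2l le orbT.
  have hd : 16 * p * m * (p * y - n) <= n.
    apply: leq_trans (_ : 16 * p * b * (p * y - n) <= _).
      by rewrite leq_mul2r leq_mul2l mb !orbT.
    by rewrite mulnBr leq_subLR.
  have -> : p * (16 * p * (y * m)) = 16 * p * m * (p * y) by ring.
  have -> : p * (16 * (n * m)) = 16 * p * m * n by ring.
  by rewrite -{1}(subnK (ltnW lt)) mulnDr addnC leq_add2l.
have h4 i : p * (16 * p * (\sum_(v in Y i) val2 i v)) + p * (16 * p * #|Bd i|) <= p * (16 * (n * M i)) + 2 * n.
  have h : p * (16 * p * (\sum_(v in Y i) val2 i v + #|Bd i|)) <= p * (16 * p * (#|Y i| * M i + (2 * a + 3) * #|unpop i|)).
    by rewrite !leq_mul2l h1 !orbT.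
  rewrite -mulnDr -mulnDr; apply: leq_trans h _.
  have := h3 i; have := card_unpop i.
  have -> : 16 * p * p * (2 * a + 3) * #|unpop i| = p * (16 * p * ((2 * a + 3) * #|unpop i|)) by ring.
  move: ((2 * a + 3) * _) => t; rewrite !mulnDr.
  by move: (p * (16 * p * t)) (p * (16 * p * (#|Y i| * M i))) (p * (16 * (n * M i))) => u1 u2 u3; clear; lia.
have h5 : p * (16 * p * (\sum_i \sum_(v in Y i) val2 i v)) + p * (16 * p * \sum_i #|Bd i|) <= p * (16 * (n * \sum_i M i)) + p * (2 * n).
  have -> : p * (2 * n) = \sum_(i < p) 2 * n by rewrite sum_nat_const card_ord.
  by rewrite !big_distrr /= -!big_split /=; apply: leq_sum => i _; rewrite h4.
have h6 : 16 * p * (\sum_i \sum_(v in Y i) val2 i v) + 16 * p * (\sum_i #|Bd i|) <= 16 * (n * \sum_i M i) + 2 * n.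
  have p0 : 0 < p by apply: leq_trans hp.
  by rewrite -(leq_pmul2l p0) mulnDr [X in _ <= X]mulnDr; exact: h5.
have h7 : \sum_i (\sum_(v in Y i) 2 * dg v A + E2 (Y i)) <= \sum_i \sum_(v in Y i) val2 i v + p * (8 * k * mu).
  have -> : p * (8 * k * mu) = \sum_(i < p) 8 * k * mu by rewrite sum_nat_const card_ord.
  by rewrite -big_split /=; apply: leq_sum => i _; rewrite addnC.
have h8 : 8 * p * \sum_i (\sum_(v in Y i) 2 * dg v A + E2 (Y i)) <= 8 * p * (\sum_i \sum_(v in Y i) val2 i v + p * (8 * k * mu)).
  by rewrite leq_mul2l h7 orbT.
move: hcount h8 h6 hmu; rewrite mulnDr.
have -> : 8 * p * (p * (8 * k * mu)) = 64 * (k * p * p * mu) by ring.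
have -> : 128 * k * p * p * mu = 128 * (k * p * p * mu) by ring.
move: (\sum_i (_ + _)) (\sum_i \sum_(v in _) _) (\sum_i #|Bd i|) (\sum_i M i) (k * p * p * mu) => x1 x2 x3 x4 x5.
by move: ((2 * p.-1 * a + 2 * s1) * n) n; clear; lia.
Qed.
End Count.

Lemma unpop_small i : exists2 v, v \in Y i & popular i v.
Proof.
apply/exists_inP; apply: contraT; rewrite negb_exists_in => /forall_inP h.
have E : unpop i = Y i by apply/setP => v; rewrite !inE; case vY: (v \in Y i) => //=; rewrite h.
have := card_unpop i; rewrite E => h1; have := hYl i.
have : 16 * (p * #|Y i|) <= n.
  apply: leq_trans h1; rewrite -!mulnA leq_mul2l /= leq_mul2l; apply/orP; right.
  by rewrite mulnA leq_pmull // muln_gt0 addn_gt0 orbT andbT; exact: ltnW hp.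
by move: n0; move: n (p * _); clear; lia.
Qed.

Lemma approx_exact : a = s1 /\ forall i, n <= 2 * p * #|[set v in Y i | A \subset nbr v]|.
Proof.
have ex i : exists v, (v \in Y i) && popular i v.
  by have [v vY pv] := unpop_small i; exists v; rewrite vY.
have ex2 i : exists v, [&& v \in Y i, popular i v &
    [forall u, (u \in Y i) && popular i u ==> (val2 i u <= val2 i v)]].
  have [v0 v0P] := ex i; have [v vP vmax] := @arg_maxnP G v0 (fun v => (v \in Y i) && popular i v) (val2 i) v0P.
  exists v; rewrite andbA; apply/andP; split=> //.
  by apply/forallP => u; apply/implyP; exact: vmax.
have [w hw] := fin_all_exists ex2.
have wY i : w i \in Y i by case/and3P: (hw i).
have wp i : popular i (w i) by case/and3P: (hw i).
have wm i v : v \in Y i -> popular i v -> val2 i v <= val2 i (w i).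
  by move=> vY pv; case/and3P: (hw i) => _ _ /forallP/(_ v); rewrite vY pv.
(* Weights are integers and the error [5 * n] stays below [16 * n], so the averaged inequality
   becomes an exact one. *)
have hS : 2 * p.-1 * a + 2 * s1 <= \sum_i val2 i (w i).
  have h : 16 * ((2 * p.-1 * a + 2 * s1) * n) + 16 * p * \sum_(i < p) #|@set0 G| <=
      16 * (n * \sum_i val2 i (w i)) + 5 * n.
    apply: (@count_le (fun i => val2 i (w i)) (fun=> set0)).
    - by move=> i v vY pv; rewrite inE addn0 wm.
    - by move=> i; apply: val2_le.
    - by move=> i; apply: sub0set.
  rewrite leqNgt; apply/negP => lt; move: h.
  have : (\sum_i val2 i (w i)).+1 * n <= (2 * p.-1 * a + 2 * s1) * n by rewrite leq_mul2r lt orbT.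
  rewrite mulSn [n * _]mulnC; move: n0 ((\sum_i _) * n) ((2 * p.-1 * a + 2 * s1) * n) (16 * p * _).
  by move: n; clear; lia.
have [as1 Aw lw] := tuple_exact wp hS.
have vw i : val2 i (w i) = 2 * a by rewrite /val2 lw addn0 /dg (setIidPr (Aw i)).
pose bad i := [set v in Y i | ~~ (A \subset nbr v)].
have hb i v : v \in Y i -> popular i v -> val2 i v + (v \in bad i) <= val2 i (w i).
  move=> vY pv; rewrite inE vY /=; have [_|nA] := boolP (A \subset nbr v); first by rewrite addn0 wm.
  rewrite addn1 ltn_neqAle wm // andbT; apply/negP => /eqP E; case/negP: nA.
  (* Exchanging one entry for a popular vertex of the same weight preserves the hypotheses of
     [tuple_exact], so this vertex is complete to [A] as well. *)
  pose w' j := if j == i then v else w j.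
  have w'p j : popular j (w' j) by rewrite /w'; case: eqP => [->|].
  have w'S : 2 * p.-1 * a + 2 * s1 <= \sum_i val2 i (w' i).
    apply: leq_trans hS _; apply: leq_sum => j _; rewrite /w'; case: eqP => [->|//].
    by rewrite E.
  have [_ /(_ i) h _] := tuple_exact w'p w'S.
  by move: h; rewrite /w' eqxx.
split=> // i.
have h : 16 * ((2 * p.-1 * a + 2 * s1) * n) + 16 * p * \sum_i #|bad i| <=
      16 * (n * \sum_i val2 i (w i)) + 5 * n.
  apply: count_le => //; first by move=> j; apply: val2_le.
  by move=> j; apply/subsetP => v; rewrite inE => /andP[].
have E : n * \sum_i val2 i (w i) = (2 * p.-1 * a + 2 * s1) * n.
  rewrite (eq_bigr (fun=> 2 * a)) // sum_nat_const card_ord -as1.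
  by rewrite -{1}(ltn_predK hp); ring.
have hbi : 16 * p * #|bad i| <= 5 * n.
  move: h; rewrite E leq_add2l; apply: leq_trans; rewrite leq_mul2l (bigD1 i) //= leq_addr orbT //.
have := hYl i; rewrite -(cardsID [set v | A \subset nbr v] (Y i)) mulnDr.
have -> : Y i :&: [set v | A \subset nbr v] = [set v in Y i | A \subset nbr v].
  by apply/setP => v; rewrite !inE.
have -> : Y i :\: [set v | A \subset nbr v] = bad i.
  by apply/setP => v; rewrite !inE andbC.
move: hbi; rewrite -!mulnA; move: (p * _) (p * _) n; clear; lia.
Qed.
End Approx.

(** * Turán-type edge counts around a set [A] *)

Lemma cauchy (p : nat) (b : 'I_p -> nat) : (\sum_i b i) * (\sum_i b i) <= p * \sum_i b i * b i.
Proof.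
have e : 2 * ((\sum_i b i) * (\sum_i b i)) <= 2 * (p * \sum_i b i * b i).
  have -> : (\sum_i b i) * (\sum_i b i) = \sum_i \sum_j b i * b j.
    by rewrite big_distrl /=; apply: eq_bigr => i _; rewrite big_distrr.
  have -> : 2 * (p * \sum_i b i * b i) = \sum_i \sum_j (b i * b i + b j * b j).
    rewrite [RHS](eq_bigr (fun i => p * (b i * b i) + \sum_j b j * b j)); last first.
      by move=> i _; rewrite big_split /= sum_nat_const card_ord.
    by rewrite big_split /= -big_distrr /= sum_nat_const card_ord mul2n addnn.
  rewrite big_distrr /=; apply: leq_sum => i _; rewrite big_distrr /=; apply: leq_sum => j _.
  exact: nat_Cauchy.
by move: e; rewrite leq_mul2l.
Qed.

Section Turan.
Variables (p : nat) (G : sgraph) (col : {ffun G -> 'I_p}).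
Implicit Types (v : G) (A B S : {set G}).

Lemma sum_clsI B : \sum_i #|cls col i :&: B| = #|B|.
Proof.
rewrite -[RHS]sum1_card (partition_big col predT) //=; apply: eq_bigr => i _.
by rewrite -sum1_card; apply: eq_bigl => v; rewrite !inE andbC.
Qed.

(** Missing edges between different classes, each counted from both ends. *)
Definition cross_miss B := \sum_(v in B) #|[set u in B | (col u != col v) && ~~ adj v u]|.

Lemma sum_dg_cls B : \sum_(v in B) dg v B + \sum_i #|cls col i :&: B| * #|cls col i :&: B| + cross_miss B =
  In2 col B + #|B| * #|B|.
Proof.
have -> : \sum_i #|cls col i :&: B| * #|cls col i :&: B| = \sum_(v in B) #|cls col (col v) :&: B|.
  rewrite (partition_big col predT) //=; apply: eq_bigr => i _.
  rewrite -sum_nat_const; apply: eq_big => [v|v]; first by rewrite !inE andbC.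
  by rewrite !inE => /andP[/eqP -> _].
rewrite -sum_nat_const /In2 /cross_miss -!big_split /=; apply: eq_bigr => v vB.
rewrite -[in RHS](cardsID (nbr v :|: cls col (col v)) B).
have -> : B :\: (nbr v :|: cls col (col v)) = [set u in B | (col u != col v) && ~~ adj v u].
  by apply/setP => u; rewrite !inE negb_or andbC [~~ adj _ _ && _]andbC.
rewrite addnA; congr (_ + _).
rewrite /dg -cardsUI addnC.
have -> : nbr v :&: B :&: (cls col (col v) :&: B) = nbr v :&: (cls col (col v) :&: B).
  by apply/setP => u; rewrite !inE; do !case: (_ \in _); rewrite ?andbF //; case: (adj _ _); case: (_ == _).
by congr (_ + _); rewrite -setIUl setIC.
Qed.

Lemma sum_nbr A : \sum_(v : G) #|nbr v| = E2 A + 2 * \sum_(v in ~: A) dg v A + \sum_(v in ~: A) dg v (~: A).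
Proof.
have h v : #|nbr v| = dg v A + dg v (~: A).
  by rewrite -(cardsID A (nbr v)) setDE.
rewrite (eq_bigr _ (fun v _ => h v)) (bigID (mem A)) /= big_split /=.
rewrite [X in _ + X + _](_ : _ = \sum_(v in ~: A) dg v A); last by rewrite dg_exchange.
rewrite [X in _ + X = _](_ : _ = \sum_(v in ~: A) dg v A + \sum_(v in ~: A) dg v (~: A)); last first.
  by rewrite -big_split /=; apply: eq_bigl => v; rewrite inE.
by rewrite /E2; clear; lia.
Qed.

(** Outside [A], missing edges are dropped and equal class sizes are the best case by [cauchy]; the
    edges within [A] only enter the term in [#|A| * #|A|]. *)
Lemma turan_upper A : 0 < p -> p * (\sum_(v : G) #|nbr v|) + 2 * (p.-1 * #|A| * #|G|) <=
  p * (\sum_(v in ~: A) 2 * dg v A + In2 col (~: A)) + p.-1 * #|G| * #|G| + 2 * (p * #|A| * #|A|).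
Proof.
move=> p0; rewrite (sum_nbr A) -big_distrr /=.
have h1 := sum_dg_cls (~: A); have h2 := cauchy (fun i => #|cls col i :&: ~: A|).
rewrite sum_clsI in h2.
have h3 : E2 A <= #|A| * #|A| by rewrite -sum_nat_const; apply: leq_sum => v _; apply: dg_le.
have h4 : #|A| + #|~: A| = #|G| by rewrite cardsC.
move: h1 h2 h3 h4; rewrite -!mulnA.
move: (\sum_(v in _) dg v A) (\sum_(v in _) dg v (~: A)) (In2 _ _) (cross_miss _) (E2 A) (\sum_i _ * _) => x y z c e s.
move: #|A| #|~: A| #|G| => a b n h1 h2 h3 <- {n}.
have h5 : p * (y + s + c) = p * (z + b * b) by rewrite h1.
have h6 : p * e <= p * (a * a) by rewrite leq_mul2l h3 orbT.
have : p = p.-1.+1 by rewrite prednK.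
move: h5 h6 h2; move: p p.-1 => P q h5 h6 h2 E; rewrite E in h5 h6 h2 *.
by move: h5 h6 h2; clear; lia.
Qed.
End Turan.

(** * Selecting a pair of consecutive thresholds for heavy vertices *)

Section Scales.
Variables (p k : nat).
Hypotheses (hp : 2 <= p) (hk : 3 <= k) (kp : (k, p) <> (3, 2)).
Notation F := (blowup (cycle_graph k) (p + 1)).
Notation s1 := ((k - 1) %/ 2).
Variables (G : sgraph) (C D E C4 J : nat) (col : {ffun G -> 'I_p}).
Variables (Q L K1 : nat -> nat).
Notation n := #|G|.
Hypothesis hC : mindeg p G C.
Hypothesis noF : ~~ contains G F.
Hypothesis hmax : forall v j, dg v (cls col (col v)) <= dg v (cls col j).
Hypothesis hE : E * In2 col setT <= n * n.
Hypothesis hED : 2 * p * p * D <= E.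
Hypothesis hnD : 2 * D * C <= n.
Hypothesis n0 : 0 < n.
(* The scales [Q j] grow so fast that types popular for the heavy set of one scale are
   still large compared with the slack of the next one. *)
Hypothesis hQ : forall j, 256 * k * p * p <= Q j.
Hypothesis hQK : forall j, 40 * k * p * K1 j <= Q j.+1.
Hypothesis hKQ : forall j, 2 * Q j <= K1 j.
Hypothesis hKL : forall j, 16 * p * p * (2 * L j + 3) * (2 ^ L j * 3) <= K1 j.
Hypothesis hQD : forall j, j <= J -> 2 * Q j <= D.
Hypothesis hQC : forall j, j <= J -> 2 * Q j * C <= n.
Hypothesis hQE : forall j, j < J -> 2 * Q j * Q j.+1 <= E.
Hypothesis hL : forall j, j <= J -> #|heavy col (Q j)| < L j.
Hypothesis hLD : forall j, j <= J -> 16 * p * (2 * L j + 2) <= D.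
Hypothesis hLp : forall j, j <= J -> 16 * p * L j <= n.
Hypothesis hKn : forall j, j < J -> 20 * k * p * K1 j <= n.
Hypothesis hkn : 40 * k * p * p <= n.
Hypothesis hJ : J = 32 * k * p.
Hypothesis hbig : forall j, j < J -> 16 * (p * (2 * L j * L j.+1) + 2 * (p * L j * L j) + C4) <= n.
Hypothesis low : p.-1 * n * n + 2 * s1 * n <= p * (\sum_(v : G) #|nbr v|) + C4.

Lemma kp0 : 0 < k * p. Proof. by rewrite muln_gt0; move: hk hp; clear; lia. Qed.
Lemma J0 : 0 < J. Proof. by rewrite hJ -mulnA muln_gt0 kp0. Qed.
Lemma Q0 j : 0 < Q j.
Proof. by apply: leq_trans (hQ j); rewrite !muln_gt0; move: hk hp; clear; lia. Qed.
Lemma D0 : 0 < D.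
Proof. by apply: leq_trans (hQD (leq0n J)); rewrite muln_gt0 Q0. Qed.

Definition YY j i := cls col i :\: heavy col (Q j).

Lemma YY_size j i : j <= J -> 7 * n <= 8 * (p * #|YY j i|).
Proof.
move=> jJ; have h1 := cls_lower hp hk hC hE hED hnD n0 i.
have h2 : #|cls col i| <= #|YY j i| + L j.
  rewrite -(cardsID (heavy col (Q j)) (cls col i)) addnC leq_add2l.
  by apply: leq_trans (ltnW (hL jJ)); apply: subset_leq_card; apply: subsetIr.
have h3 : 16 * p <= D.
  by apply: leq_trans (hLD jJ); rewrite leq_pmulr // addn_gt0 orbT.
have h4 : 16 * n <= 16 * (p * #|cls col i|) + n.
  rewrite -(leq_pmul2l D0) mulnDr.
  have -> : D * (16 * n) = 16 * (D * n) by ring.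
  have -> : D * (16 * (p * #|cls col i|)) = 16 * (D * (p * #|cls col i|)) by ring.
  have h5 : 16 * p * n <= D * n by rewrite leq_mul2r h3 orbT.
  by move: h1 h5; rewrite -!mulnA; move: (D * _) (D * _) (p * n); clear; lia.
have h6 : p * #|cls col i| <= p * #|YY j i| + p * L j by rewrite -mulnDr leq_mul2l h2 orbT.
have := hLp jJ; move: h4 h6; rewrite -mulnA; move: (p * _) (p * _) (p * _) n; clear; lia.
Qed.

Lemma fillQ j K (P : 'I_p -> {set G}) : j <= J -> (forall i, P i \subset YY j i) ->
  (forall i, n <= K * #|P i|) -> 40 * k * p * K <= Q j -> 20 * k * p * K <= n -> Fill k P (slack G (Q j)).
Proof.
move=> jJ hP hK h1 h2; apply: (fill_heavy hp hk hC hE hED hnD n0 hP _ _ _ hK) => //; first exact: Q0.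
- exact: hQD.
- exact: hQC.
Qed.

Lemma nrmQ j (P : 'I_p -> {set G}) v : j <= J -> (forall i, P i \subset cls col i) ->
  v \notin heavy col (Q j) -> nrm P (slack G (Q j)) (col v) v.
Proof.
move=> jJ hP; apply: (nrm_heavy hp hk hC hE hED hnD n0) => //; first exact: Q0.
- exact: hQD.
- exact: hQC.
Qed.

Notation g j := (In2 col (~: heavy col (Q j))).

Lemma gE j : g j = \sum_i E2 (YY j i).
Proof. by rewrite In2E; apply: eq_bigr => i _; rewrite /YY setDE. Qed.

Lemma g0_le : g 0 <= 2 * k * n.
Proof.
have J00 : 0 <= J by [].
have HF : Fill k (YY 0) (slack G (Q 0)).
  apply: (@fillQ 0 (2 * p)) => //.
  - by move=> i; have := YY_size i J00; rewrite -mulnA; move: (p * _) n0; move: n; clear; lia.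
  - apply: leq_trans (hQ 0); rewrite -!mulnA; apply: leq_trans (_ : 80 * (k * (p * p)) <= _); last by rewrite leq_mul2r orbT.
    by rewrite (_ : 80 * (k * (p * p)) = 40 * (k * (p * (2 * p)))) //; ring.
  - by apply: leq_trans hkn; rewrite (_ : 40 * k * p * p = 20 * k * p * (2 * p)) //; ring.
rewrite gE; apply: leq_trans (_ : \sum_i 2 * k * #|YY 0 i| <= _).
  apply: leq_sum => i _; apply: (E2_normal hp hk HF noF (i := i)) => v.
  rewrite !inE => /andP[vh /eqP <-]; apply: nrmQ => //; last by rewrite inE.
  by move=> j; apply: subsetDl.
rewrite -big_distrr /= leq_mul2l; apply/orP; right.
rewrite -(sum_cls col); apply: leq_sum => i _; apply: subset_leq_card; exact: subsetDl.
Qed.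

(* Vertices between two consecutive scales could absorb too many inside edges; among
   [J] scales some step loses little. *)
Lemma gap : exists2 j, j < J & J * g j <= J * g j.+1 + g 0.
Proof.
have [/existsP[[j jJ] h]|] := boolP [exists j : 'I_J, J * g j <= J * g j.+1 + g 0]; first by exists j.
rewrite negb_exists => /forallP h.
have hm m : m <= J -> J * g m + m * (g 0).+1 <= J * g 0.
  elim: m => [|m IH] mJ; first by rewrite addn0.
  apply: leq_trans (IH (ltnW mJ)); have := h (Ordinal mJ); rewrite -ltnNge /= mulSn.
  by move: (J * g m.+1) (J * g m) (g 0) (m * _); clear; lia.
have := hm J (leqnn J); rewrite mulnS; have := J0; move: (J * g J) (J * g 0) J; clear; lia.
Qed.

Lemma fillYY j : j <= J -> Fill k (YY j) (slack G (Q j)).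
Proof.
move=> jJ; apply: (@fillQ j (2 * p)) => //.
- by move=> i; have := YY_size i jJ; rewrite -mulnA; move: (p * _) n0; move: n; clear; lia.
- apply: leq_trans (hQ j); rewrite -!mulnA; apply: leq_trans (_ : 80 * (k * (p * p)) <= _); last by rewrite leq_mul2r orbT.
  by rewrite (_ : 80 * (k * (p * p)) = 40 * (k * (p * (2 * p)))) //; ring.
- by apply: leq_trans hkn; rewrite (_ : 40 * k * p * p = 20 * k * p * (2 * p)) //; ring.
Qed.

Lemma heavy_sub j : heavy col (Q j) \subset heavy col (Q j.+1).
Proof.
apply/subsetP => v; rewrite !inE => h; apply: leq_trans h _; rewrite leq_mul2r; apply/orP; right.
apply: leq_trans (hQK j); apply: leq_trans (_ : 2 * Q j <= _); first by rewrite leq_pmull.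
apply: leq_trans (hKQ j) _; rewrite leq_pmull // -mulnA muln_gt0; exact: kp0.
Qed.

Lemma slack_small c j : c <= Q j -> c * slack G (Q j) <= 2 * n.
Proof.
move=> h; apply: leq_trans (_ : Q j * slack G (Q j) <= _); first by rewrite leq_mul2r h orbT.
by rewrite /slack mulnC leq_trunc_div.
Qed.

(** Compares [turan_upper] for the heavy set at threshold [j] with the lower bound [low].
    Restricting the classes to the next threshold discards boundedly many vertices, and by the
    choice of [j] at most [n / (16 * p)] of [In2]. *)
Lemma heavy_count j : j < J -> J * g j <= J * g j.+1 + g 0 ->
  8 * ((2 * p.-1 * #|heavy col (Q j)| + 2 * s1) * n) <=
  8 * p * \sum_i (\sum_(v in YY j.+1 i) 2 * dg v (heavy col (Q j)) + E2 (YY j.+1 i)) + n.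
Proof.
move=> jJ hg; set A := heavy col (Q j).
have h1 := turan_upper col A (ltnW hp).
have h2 : \sum_(v in ~: A) 2 * dg v A <= \sum_i \sum_(v in YY j.+1 i) 2 * dg v A + 2 * L j * L j.+1.
  have -> : \sum_i \sum_(v in YY j.+1 i) 2 * dg v A = \sum_(v in ~: heavy col (Q j.+1)) 2 * dg v A.
    rewrite [RHS](partition_big col predT) //=; apply: eq_bigr => i _.
    by apply: eq_bigl => v; rewrite !inE.
  rewrite (big_setID (~: heavy col (Q j.+1))) /= (setIidPr _); last by rewrite setCS heavy_sub.
  rewrite leq_add2l; apply: leq_trans (_ : \sum_(v in ~: A :\: ~: heavy col (Q j.+1)) 2 * L j <= _).
    by apply: leq_sum => v _; rewrite leq_mul2l; apply: leq_trans (dg_le _ _) (ltnW (hL (ltnW jJ))).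
  rewrite sum_nat_const mulnC leq_mul2l; apply/orP; right; apply: leq_trans (ltnW (hL jJ)).
  by apply: subset_leq_card; apply/subsetP => v; rewrite !inE negbK => /andP[].
have h3 : 16 * (p * g j) <= 16 * (p * g j.+1) + n.
  have h : J * g j <= J * g j.+1 + 2 * k * n by apply: leq_trans hg _; rewrite leq_add2l g0_le.
  rewrite -(leq_pmul2l (_ : 0 < 2 * k)) ?muln_gt0 ?(ltn_trans _ hk) //.
  have -> : 2 * k * (16 * (p * g j)) = J * g j by rewrite hJ; ring.
  by have -> : 2 * k * (16 * (p * g j.+1) + n) = J * g j.+1 + 2 * k * n by rewrite hJ; ring.
have h4 : p * #|A| * #|A| <= p * L j * L j.
  have lA := ltnW (hL (ltnW jJ)).
  by apply: leq_mul => //; apply: leq_mul.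
have eS (f : 'I_p -> nat) : \sum_i (f i + E2 (YY j.+1 i)) = \sum_i f i + g j.+1.
  by rewrite gE -big_split.
have := hbig jJ; move: h1 h2 h3 h4 low; rewrite (eS (fun i => \sum_(v in YY j.+1 i) 2 * dg v A)).
move: (\sum_(v in ~: A) _) (\sum_i \sum_(v in _) _) (\sum_v _) (g j) (g j.+1) (p * L j * L j) (2 * L j * L j.+1).
move=> x1 x2 x3 x4 x5 x6 x7 h1 h2 h3 h4 lo hb.
have h5 : p * x1 <= p * (x2 + x7) by rewrite leq_mul2l h2 orbT.
move: h1 h3 h4 lo hb h5; move: #|A| p.-1 (p * #|A| * #|A|) => b q y.
by move: n s1; clear; lia.
Qed.

(** [A] is the heavy set at threshold [j], while the classes omit all vertices heavy at the next
    one. Vertices in between belong to neither, so that the vertices used for the weights have slack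
    far below the size of a popular set. *)
Lemma scales_exact : exists j, [/\ j <= J, #|heavy col (Q j)| = s1 &
  forall i, n <= 2 * p * #|[set v in YY j.+1 i | heavy col (Q j) \subset nbr v]|].
Proof.
have [j jJ hg] := gap; exists j.
have HF := fillYY jJ; set A := heavy col (Q j); set mu := slack G (Q j.+1) in HF.
have lA : #|A| <= L j := ltnW (hL (ltnW jJ)).
have sub i : YY j.+1 i \subset cls col i by apply: subsetDl.
have nY i v : v \in YY j.+1 i -> nrm (YY j.+1) mu i v.
  by rewrite !inE => /andP[vh /eqP <-]; apply: nrmQ => //; rewrite inE.
have cH i : exists H : {set G}, [/\ H \subset YY j.+1 i, #|YY j.+1 i :\: H| <= 4 * k, P4free H &
    ~~ ((p == 2) && odd k) -> P3free H].
  by apply: (clean hp hk HF noF) => v; apply: nY.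
have [H hH] := fin_all_exists cH.
have fP (P : 'I_p -> {set G}) : (forall i, P i \subset YY j.+1 i) -> (forall i, n <= K1 j * #|P i|) -> Fill k P mu.
  by move=> h1 h2; apply: (fillQ jJ h1 h2); rewrite ?hQK ?hKn.
have K1le : 16 * p * p * (2 * #|A| + 3) * (2 ^ #|A| * 3) <= K1 j.
  apply: leq_trans (hKL j); apply: leq_mul; first by rewrite leq_mul2l leq_add2r leq_mul2l lA !orbT.
  by rewrite leq_mul2r leq_exp2l ?lA ?orbT.
have hAY w i : w \in A -> w \notin YY j.+1 i.
  by move=> wA; rewrite inE (subsetP (heavy_sub j) _ wA).
have Qpos := Q0 j.
have hAd x i : x \in A -> n <= K1 j * dg x (YY j.+1 i).
  rewrite inE => hx; apply: leq_trans (_ : 2 * Q j * dg x (YY j.+1 i) <= _); last by rewrite leq_mul2r hKQ orbT.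
  have h1 : n <= Q j * dg x (cls col i) by apply: leq_trans hx _; rewrite leq_mul2l hmax orbT.
  have h2 : dg x (cls col i) <= dg x (YY j.+1 i) + #|heavy col (Q j.+1)|.
    rewrite /dg /YY -(cardsID (heavy col (Q j.+1)) (nbr x :&: cls col i)) addnC setIDA leq_add2l.
    by apply: subset_leq_card; apply: subsetIr.
  have h3 := card_heavy hE n0 (Q j.+1).
  have h4 : 2 * Q j * #|heavy col (Q j.+1)| <= n.
    rewrite -(leq_pmul2l (Q0 j.+1)); apply: leq_trans h3.
    rewrite mulnA leq_mul2r; apply/orP; right; apply: leq_trans (hQE jJ).
    by rewrite mulnC.
  have h5 : Q j * dg x (cls col i) <= Q j * (dg x (YY j.+1 i) + #|heavy col (Q j.+1)|) by rewrite leq_mul2l h2 orbT.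
  by move: h1 h4 h5; rewrite mulnDr -!mulnA; move: (Q j * _) (Q j * _) (Q j * _) n; clear; lia.
have [||||||] := approx_exact hp hk kp noF fP nY _ _ hAY hAd
  (fun i => let: And4 h _ _ _ := hH i in h) (fun i => let: And4 _ h _ _ := hH i in h)
  (fun i => let: And4 _ _ h _ := hH i in h) _ n0 K1le _ _ _ (heavy_count jJ hg).
- move=> i v; rewrite !inE -ltnNge => /andP[vh /eqP ci].
  rewrite /mu /slack leq_divRL ?Q0 // mulnC; apply: leq_trans (_ : Q j.+1 * din col v <= _).
    by rewrite leq_mul2l /din ci dgS ?orbT.
  by apply: leq_trans (ltnW vh) _; rewrite leq_pmull.
- by move=> i i' v; rewrite !inE => /andP[_ /eqP <-] /andP[_ /eqP].
- by move=> npk i; case: (hH i) => _ _ _; apply.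
- by move=> i; apply: YY_size.
- move=> i; have hu := cls_upper hp hk hC hE hED hnD n0 i.
  have hm : 16 * p * (2 * #|A| + 2) <= D.
    by apply: leq_trans (hLD (ltnW jJ)); rewrite leq_mul2l leq_add2r leq_mul2l lA !orbT.
  have hy : p * #|YY j.+1 i| <= p * #|cls col i| by rewrite leq_mul2l subset_leq_card ?orbT.
  move: hm; move: (16 * p * _) => m hm.
  have [le|lt] := leqP (p * #|YY j.+1 i|) n.
    by apply: leq_trans (leq_addr _ _); rewrite leq_mul2l le orbT.
  have hd : D * (p * #|YY j.+1 i|) <= (D + 1) * n by apply: leq_trans hu; rewrite leq_mul2l hy orbT.
  have hd2 : m * (p * #|YY j.+1 i| - n) <= n.
    apply: leq_trans (_ : D * (p * #|YY j.+1 i| - n) <= _); first by rewrite leq_mul2r hm orbT.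
    by rewrite mulnBr leq_subLR; move: hd; rewrite mulnDl mul1n.
  by rewrite -{1}(subnK (ltnW lt)) mulnDr addnC leq_add2l.
- have := @slack_small (256 * k * p * p) j.+1 (hQ _); rewrite -/mu.
  rewrite (_ : 256 * k * p * p * mu = 2 * (128 * k * p * p * mu)); last by ring.
  by rewrite leq_mul2l.
by move=> aE hP; split=> //; apply: ltnW.
Qed.

(** Back to a single threshold: once linearly many vertices of each class are complete to [A], they
    serve as [P], and every vertex outside [A], also one between the two thresholds, is normal with
    the slack of [Q j]. *)
Lemma scales_structure : exists (A : {set G}) (P : 'I_p -> {set G}) mu,
  [/\ #|A| = s1, Fill k P mu, forall i, P i \subset cls col i,
      forall v, v \notin A -> nrm P mu (col v) v & forall w, w \in A -> full P w].
Proof.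
have [j [jJ Aj hP]] := scales_exact.
pose P i := [set v in YY j.+1 i | heavy col (Q j) \subset nbr v].
have PY i : P i \subset YY j i.
  apply/subsetP => v; rewrite inE => /andP[+ _]; rewrite !inE => /andP[h ->]; rewrite andbT.
  by apply: contra h; have := subsetP (heavy_sub j) v; rewrite !inE.
have Pc i : P i \subset cls col i by apply: subset_trans (PY i) (subsetDl _ _).
exists (heavy col (Q j)), P, (slack G (Q j)); split=> //.
- apply: (fillQ jJ PY hP).
  + apply: leq_trans (hQ j); rewrite -!mulnA; apply: leq_trans (_ : 80 * (k * (p * p)) <= _); last by rewrite leq_mul2r orbT.
    by rewrite (_ : 80 * (k * (p * p)) = 40 * (k * (p * (2 * p)))) //; ring.
  + by apply: leq_trans hkn; rewrite (_ : 40 * k * p * p = 20 * k * p * (2 * p)) //; ring.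
- by move=> v; apply: nrmQ.
- by move=> w wA i v; rewrite inE => /andP[_ /subsetP h]; rewrite adjC -in_nbr; apply: h.
Qed.
End Scales.

(** * Order of choice of the constants *)

Section Structure.
Variables (p k : nat).
Hypotheses (hp : 2 <= p) (hk : 3 <= k) (kp : (k, p) <> (3, 2)).
Notation F := (blowup (cycle_graph k) (p + 1)).
Notation s1 := ((k - 1) %/ 2).

Let hb R := heavy_bound hp hk (ltn0Sn R).
Let K1f q L := 16 * p * p * (2 * L + 3) * (2 ^ L * 3) + 2 * q.
(** The threshold [Q j] is [(R j).+1], positive by construction as [heavy_bound] requires. Each step
    uses the bound on the number of heavy vertices at the previous threshold, hence the
    recursion. *)
Let R j := iter j (fun R => 40 * k * p * K1f R.+1 (sval (hb R)).1 + 256 * k * p * p) (256 * k * p * p).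
Let Q j := (R j).+1.
Let L j := (sval (hb (R j))).1.
Let Kk j := (sval (hb (R j))).2.
Let K1 j := K1f (Q j) (L j).

Lemma structure C C4 : exists n0, forall G : sgraph, n0 <= #|G| -> mindeg p G C -> ~~ contains G F ->
  p.-1 * #|G| * #|G| + 2 * s1 * #|G| <= p * (\sum_(v : G) #|nbr v|) + C4 ->
  exists (col : {ffun G -> 'I_p}) (A : {set G}) (P : 'I_p -> {set G}) mu,
    [/\ #|A| = s1, Fill k P mu, forall i, P i \subset cls col i,
        forall v, v \notin A -> nrm P mu (col v) v & forall w, w \in A -> full P w].
Proof.
pose J := 32 * k * p.
(* A common bound [W] for all thresholds and their constants; [Q'], [D], [E] and finally [N] are
   chosen after it, in this order. *)
have [W hW] : exists W, forall j, j <= J.+1 -> [/\ Q j <= W, L j <= W, Kk j <= W & K1 j <= W].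
  exists (\sum_(j < J.+2) (Q j + L j + Kk j + K1 j)) => j hj.
  rewrite (bigD1 (Ordinal (hj : j < J.+2))) //=.
  by split; move: (\sum_(i | _) _) (Q j) (L j) (Kk j) (K1 j); clear; lia.
have [Q' hQ'] : exists Q', Q' = 80 * k * p * W + 1 by exists (80 * k * p * W + 1).
have [D1 hD1] : exists D1, D1 = 200 * (k * p * p) by exists (200 * (k * p * p)).
have [D hD] : exists D, D = D1 * (W + 1) by exists (D1 * (W + 1)).
have [E hE] : exists E, E = 2 * p * p * D + 2 * Q' * W + 2 * W * W by exists (2 * p * p * D + 2 * Q' * W + 2 * W * W).
have [N0 hN0] := stability hp hk E C.
have [N hN] : exists N, [/\ N0 <= N, 2 * D * C + 1 <= N, 2 * Q' * C + 2 * W * C <= N,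
   16 * p * W <= N & 40 * k * p * W + 40 * k * p * p + 16 * (p * (2 * W * W) + 2 * (p * W * W) + C4) <= N].
  exists (N0 + 2 * D * C + 1 + (2 * Q' * C + 2 * W * C) + 16 * p * W +
    (40 * k * p * W + 40 * k * p * p + 16 * (p * (2 * W * W) + 2 * (p * W * W) + C4))).
  by split; move: (2 * D * C) (2 * Q' * C) (2 * W * C) (16 * p * W) (40 * k * p * W) (40 * k * p * p) (16 * _); clear; lia.
exists N => G nN hC noF low; set n := #|G| in nN low *.
case: hN => nN0 nD1 nQ nW nb.
have nD : 2 * D * C <= N by apply: leq_trans nD1; apply: leq_addr.
have n0 : 0 < n by apply: leq_trans nN; apply: leq_trans nD1; rewrite addn1.
have kp0 : 0 < k * p by rewrite muln_gt0; move: hk hp; clear; lia.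
have kpp : k * p <= k * p * p by rewrite leq_pmulr // (ltn_trans _ hp).
have kpp2 : p <= k * p * p by rewrite leq_pmull.
have hD1a : 2 * (80 * k * p) + 2 <= D1.
  by rewrite hD1 -!(mulnA 80); move: kpp kp0; move: (k * p) (k * p * p); clear; lia.
have hD1b : 32 * p <= D1 by rewrite hD1; move: kpp2; move: (k * p * p); clear; lia.
have DW : 2 * W <= D.
  by rewrite hD; apply: leq_mul; [apply: leq_trans hD1a; apply: leq_addl | rewrite leq_addr].
have [col0 h0] := hN0 G (leq_trans nN0 nN) hC noF.
have [col [h1 hmax]] := maxcut col0.
have hEE : E * In2 col setT <= n * n by apply: leq_trans h0; rewrite leq_mul2l h1 orbT.
have hED : 2 * p * p * D <= E by rewrite hE -addnA leq_addr.
have hnD : 2 * D * C <= n by apply: leq_trans nN.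
have Q'D : 2 * Q' <= D.
  rewrite hQ' hD !mulnDr !muln1 mulnA; apply: leq_add; last by apply: leq_trans hD1a; apply: leq_addl.
  by rewrite leq_mul2r; apply/orP; right; apply: leq_trans hD1a; apply: leq_addr.
have jle j : j <= J -> j <= J.+1 by apply: leqW.
have hL j : j <= J -> #|heavy col (Q j)| < L j.
  move=> jJ; have [_ _ hK _] := hW j (jle j jJ).
  apply: (svalP (hb (R j)) G C D E col Q') => //.
  - rewrite hQ'; apply: leq_trans (leq_addr _ _); rewrite leq_mul2l; apply/orP; right; exact: hK.
  - rewrite hE -addnA addnCA; apply: leq_trans (leq_addr _ _); rewrite leq_mul2l; apply/orP; right; exact: hK.
  - by apply: leq_trans nN; apply: leq_trans nQ; apply: leq_addr.
  - by rewrite hQ' addn1.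
  - apply: leq_trans nN; apply: leq_trans nb; rewrite -addnA; apply: leq_trans (leq_addr _ _).
    rewrite leq_mul2l; apply/orP; right; exact: hK.
have hQK j : 40 * k * p * K1 j <= Q j.+1 by rewrite /Q /R iterS -/(R j); apply: leqW; apply: leq_addr.
have hQQ j : 256 * k * p * p <= Q j.
  by rewrite /Q /R; apply: leqW; case: j => [|j] //; rewrite iterS leq_addl.
exists col; apply: (@scales_structure p k hp hk kp G C D E C4 J col Q L K1 hC noF hmax hEE hED hnD n0 hQQ hQK) => //.
- by move=> j; apply: leq_addl.
- by move=> j; apply: leq_addr.
- by move=> j /jle/hW[h _ _ _]; apply: leq_trans DW; rewrite leq_mul2l h orbT.
- move=> j /jle/hW[h _ _ _]; apply: leq_trans nN; apply: leq_trans nQ.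
  by apply: leq_trans (leq_addl _ _); rewrite leq_mul2r leq_mul2l h !orbT.
- move=> j jJ; have [h _ _ _] := hW j (jle j (ltnW jJ)); have [h' _ _ _] := hW j.+1 (leqW jJ).
  rewrite hE; apply: leq_trans (leq_addl _ _); apply: leq_mul => //; by rewrite leq_mul2l h orbT.
- move=> j /jle/hW[_ h _ _]; apply: leq_trans (_ : 16 * p * (2 * W + 2) <= _).
    by rewrite leq_mul2l leq_add2r leq_mul2l h !orbT.
  have -> : 16 * p * (2 * W + 2) = 32 * p * (W + 1) by ring.
  by rewrite hD leq_mul2r hD1b orbT.
- move=> j /jle/hW[_ h _ _]; apply: leq_trans nN; apply: leq_trans nW; by rewrite leq_mul2l h orbT.
- move=> j /ltnW/jle/hW[_ _ _ h]; apply: leq_trans nN; apply: leq_trans nb; rewrite -addnA.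
  by apply: leq_trans (leq_addr _ _); apply: leq_mul => //; rewrite !leq_mul2r !orbT.
- apply: leq_trans nN; apply: leq_trans nb; by rewrite -addnA addnCA leq_addr.
- move=> j jJ; have [_ h _ _] := hW j (jle j (ltnW jJ)); have [_ h' _ _] := hW j.+1 (leqW jJ).
  apply: leq_trans nN; apply: leq_trans nb; apply: leq_trans (leq_addl _ _).
  rewrite leq_mul2l /= leq_add2r leq_add // leq_mul2l; apply/orP; right.
    by apply: leq_mul => //; rewrite leq_mul2l h orbT.
  by apply: leq_mul => //; rewrite leq_mul2l h orbT.
Qed.
End Structure.

(** * The exact structure *)

Section Exact.
Variables (p k : nat).
Hypotheses (hp : 2 <= p) (hk : 3 <= k) (kp : (k, p) <> (3, 2)).
Notation F := (blowup (cycle_graph k) (p + 1)).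
Notation s1 := ((k - 1) %/ 2).
Variables (G : sgraph) (col : {ffun G -> 'I_p}) (A : {set G}) (P : 'I_p -> {set G}) (mu : nat).
Hypotheses (noF : ~~ contains G F) (hA : #|A| = s1) (HF : Fill k P mu).
Hypothesis hN : forall v, v \notin A -> nrm P mu (col v) v.
Hypothesis hR : forall w, w \in A -> full P w.
Implicit Types (u v w x y : G) (Z : seq G).

Definition ins v := nbr v :&: (cls col (col v) :&: ~: A).

Lemma in_ins v u : (u \in ins v) = [&& adj v u, col u == col v & u \notin A].
Proof. by rewrite !inE. Qed.

Lemma ins_sym v u : v \notin A -> u \in ins v -> v \in ins u.
Proof. by rewrite !in_ins => vA /and3P[a /eqP c _]; rewrite adjC a c eqxx. Qed.

Lemma s1_gt0 : 0 < s1. Proof. by move: hk; clear; lia. Qed.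

Lemma A_list : exists w R, [/\ uniq (w :: R), size R = s1.-1 & forall v, (v \in w :: R) = (v \in A)].
Proof.
have := enum_uniq A; have := mem_enum A; have : size (enum A) = s1 by rewrite -cardE.
case: (enum A) => [E|w R sz mR uR]; first by move: s1_gt0; rewrite -E.
by exists w, R; split=> //; move: sz => /= <-.
Qed.

Lemma A_list_last w1 : 1 < s1 -> w1 \in A ->
  exists w R, [/\ uniq (w :: R), size R = s1.-1, (forall v, (v \in w :: R) = (v \in A)) & last w R = w1].
Proof.
move=> s12 wA; have := enum_uniq (A :\ w1); have := mem_enum (A :\ w1).
have : size (enum (A :\ w1)) = s1.-1 by rewrite -cardE -hA (cardsD1 w1 A) wA.
case: (enum _) => [E|w R sz mR uR]; first by move: s12 E => /=; clear; case: s1 => [|[]].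
exists w, (rcons R w1); split=> /=.
- by rewrite mem_rcons inE negb_or rcons_uniq -andbA; move: uR => /= /andP[-> ->];
    have := mR w1; rewrite !inE eqxx /= => /negbT; rewrite negb_or eq_sym => /andP[-> ->].
- by rewrite size_rcons; move: sz => /=.
- move=> v; rewrite -rcons_cons mem_rcons in_cons [v \in w :: R]mR !inE.
  by case: eqP => [->|].
- by rewrite last_rcons.
Qed.

Lemma off_A (w : G) R Z : uniq (w :: R) -> (forall v, (v \in w :: R) = (v \in A)) -> uniq Z ->
  (forall v, v \in Z -> v \notin A) -> uniq (Z ++ w :: R).
Proof.
move=> uR mR uZ hZ; rewrite uniq_off; apply/and3P; split=> //.
by apply/allP => v; rewrite mR => vA; apply: contraL vA; apply: hZ.
Qed.

Lemma fullL (w : G) R : (forall v, (v \in w :: R) = (v \in A)) -> forall v, v \in w :: R -> full P v.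
Proof. by move=> mR v; rewrite mR; apply: hR. Qed.

(** Missing edges between [A] and its complement, each counted once. *)
Definition missA := \sum_(v in ~: A) (s1 - dg v A).

Lemma ins_P3 v x y : ~~ odd k -> v \notin A -> x \in ins v -> y \in ins v -> x = y.
Proof.
move=> ek vA; rewrite !in_ins => /and3P[vx /eqP cx xA] /and3P[vy /eqP cy yA].
apply/eqP; apply: contraT => xy; case/negP: noF.
have [w [R [uR sR mR]]] := A_list.
have sRk : size R <= k by rewrite sR; move: hk; clear; lia.
apply: (tmpl_P3 hp hk HF (fullL mR) sRk (i := col v) (l := x) (z := v) (r := y)) => //.
- apply: (@off_A w R [:: x; v; y]) => //.
    by rewrite /= !inE negb_or xy eq_sym (adj_neq vx) (adj_neq vy).
  by move=> u; rewrite !inE => /or3P[] /eqP ->.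
- by rewrite -cx; apply: hN.
- exact: hN.
- by rewrite -cy; apply: hN.
- by rewrite sR; have := s1_gt0; move: ek hk; clear; lia.
Qed.

Lemma In2_ins : In2 col (~: A) = \sum_(v in ~: A) #|ins v|.
Proof. by []. Qed.

(** For [p >= 3] any inside edge fills the one remaining clique. For [p = 2] an end of an inside
    edge sees no vertex of [A], so it misses [s1 >= 2] edges, while there is no path on four
    vertices and so at most one inside edge per such end. *)
Lemma ins_odd : odd k -> In2 col (~: A) = 0 \/ In2 col (~: A) < 2 * missA.
Proof.
move=> ok; have [w [R [uR sR mR]]] := A_list.
have sRk : size R <= k by rewrite sR; move: hk; clear; lia.
have [p3|p2] := ltnP 2 p.
  left; rewrite In2_ins big1 // => v; rewrite inE => vA; apply/eqP; rewrite cards_eq0; apply/eqP/setP => u.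
  rewrite in_ins in_set0; apply/negP => /and3P[vu /eqP cu uA]; case/negP: noF.
  apply: (tmpl_edge_apex hp hk HF (fullL mR) sRk (i := col v) p3 (u := u) (v := v)) => //.
  - apply: (@off_A w R [:: u; v]) => //; first by rewrite /= inE eq_sym (adj_neq vu).
    by move=> x; rewrite !inE => /orP[] /eqP ->.
  - by rewrite -cu; apply: hN.
  - exact: hN.
  - by rewrite adjC.
  - by rewrite sR; have := s1_gt0; move: ok hk; clear; lia.
have s12 : 1 < s1.
  have p2' : p = 2 by apply/eqP; rewrite eqn_leq p2 hp.
  move: kp ok hk; rewrite p2'; clear; case: k => [|[|[|[|[|k']]]]] //= *; lia.
pose U := [set v in ~: A | dg v A == 0].
have insU v u : v \notin A -> u \in ins v -> u \in U.
  rewrite in_ins => vA /and3P[vu /eqP cu uA]; rewrite !inE uA /= cards_eq0; apply/eqP/setP => w1.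
  rewrite !inE; apply/negP => /andP[uw wA]; case/negP: noF.
  have [{uR sR mR sRk}w [{}R [uR sR mR lR]]] := A_list_last s12 wA.
  have sRk : size R <= k by rewrite sR; move: hk; clear; lia.
  apply: (tmpl_edge_full hp hk HF (fullL mR) sRk (i := col v) (u := u) (v := v)) => //.
  - apply: (@off_A w R [:: u; v]) => //; first by rewrite /= inE eq_sym (adj_neq vu).
    by move=> x; rewrite !inE => /orP[] /eqP ->.
  - by rewrite -cu; apply: hN.
  - exact: hN.
  - by rewrite adjC.
  - by rewrite lR adjC.
  - by rewrite sR; have := s1_gt0; move: ok hk; clear; lia.
have h1 : In2 col (~: A) <= 2 * #|U|.
  apply: leq_trans (_ : In2 col U <= _).
    rewrite In2_ins /In2 (big_setID U) /= [X in _ + X]big1 ?addn0; last first.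
      move=> v; rewrite inE => /andP[vU vA]; apply/eqP; rewrite cards_eq0; apply/eqP/setP => u; rewrite in_set0.
      apply/negP => ui; case/negP: vU; apply: (insU u); last by apply: ins_sym ui; rewrite inE in vA.
      by move: ui; rewrite in_ins => /and3P[].
    have -> : ~: A :&: U = U by apply/setIidPr/subsetP => v; rewrite !inE => /andP[].
    apply: leq_sum => v; rewrite !inE => /andP[vA _]; apply: subset_leq_card.
    apply/subsetP => u ui; have uU := insU v u vA ui; move: ui; rewrite in_ins => /and3P[vu cu _].
    by rewrite inE in_nbr vu in_setI uU inE cu.
  rewrite In2E -[X in _ <= 2 * X](sum_clsI col U) big_distrr /=; apply: leq_sum => i _.
  apply: P4free_E2 => l a b r sub un la ab br; case/negP: noF.
  have hS v : v \in [:: l; a; b; r] -> v \notin A /\ col v = i.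
    by move/sub; rewrite !inE => /and3P[/eqP ? ? _].
  case: R uR sR mR sRk => [|w' R] uR sR mR sRk; first by move: sR s12 => /=; clear; lia.
  have fR v : v \in w' :: R -> full P v by move=> vR; apply: hR; rewrite -mR inE vR orbT.
  apply: (tmpl_P4 hp hk HF fR (ltnW sRk) (i := i) (l := l) (a := a) (b := b) (r := r)) => //.
  - have := @off_A w (w' :: R) [:: l; a; b; r] uR mR un (fun v vI => (hS v vI).1).
    by move=> h; uq h.
  - by have [h <-] := hS l ltac:(by rewrite !inE eqxx ?orbT); apply: hN.
  - by have [h <-] := hS a ltac:(by rewrite !inE eqxx ?orbT); apply: hN.
  - by have [h <-] := hS b ltac:(by rewrite !inE eqxx ?orbT); apply: hN.
  - by have [h <-] := hS r ltac:(by rewrite !inE eqxx ?orbT); apply: hN.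
  - by rewrite adjC.
  - by move: sR s12 ok hk => /=; clear; lia.
have h2 : s1 * #|U| <= missA.
  rewrite /missA (big_setID U) /=; apply: leq_trans (leq_addr _ _).
  have -> : ~: A :&: U = U by apply/setIidPr/subsetP => v; rewrite !inE => /andP[].
  by rewrite mulnC -sum_nat_const; apply: leq_sum => v; rewrite inE => /andP[_ /eqP ->]; rewrite subn0.
have h3 : 2 * #|U| <= s1 * #|U| by rewrite leq_mul2r s12 orbT.
by move: h1 h2 h3; move: (In2 _ _) #|U| (s1 * _) missA; clear; lia.
Qed.

Lemma ins_le1 v : ~~ odd k -> v \notin A -> #|ins v| <= 1.
Proof.
move=> ek vA; rewrite leqNgt; apply/negP => /card_gt1P[x [y [xi yi xy]]].
by case/eqP: xy; apply: ins_P3 ek vA xi yi.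
Qed.

Definition mate v := odflt v [pick u in ins v].
Definition M := [set v in ~: A | ins v != set0].

Lemma In2_M : ~~ odd k -> In2 col (~: A) = #|M|.
Proof.
move=> ek; rewrite In2_ins -sum1_card (big_setID M) /= [X in _ + X]big1 ?addn0; last first.
  by move=> v; rewrite !inE => /andP[h vA]; move: h; rewrite vA negbK => /eqP ->; rewrite cards0.
have -> : ~: A :&: M = M by apply/setIidPr/subsetP => v; rewrite !inE => /andP[].
apply: eq_bigr => v; rewrite !inE -card_gt0 => /andP[vA h]; apply/eqP; rewrite eqn_leq h.
by rewrite ins_le1.
Qed.

Lemma mateP v : v \in M -> [/\ mate v \in ins v, adj v (mate v), col (mate v) = col v, mate v \notin A & v \notin A].
Proof.
rewrite !inE => /andP[vA /set0Pn[x xi]]; rewrite /mate; case: pickP => [y yi|/(_ x)] /=; last by rewrite xi.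
by have : y \in ins v by []; rewrite in_ins => /and3P[h1 /eqP h2 h3]; split=> //; rewrite h1 h2 eqxx.
Qed.

Lemma mateM v : v \in M -> mate v \in M.
Proof.
move=> /mateP[h _ _ mA vA]; rewrite !inE mA; apply/set0Pn; exists v; exact: ins_sym.
Qed.

Lemma mate_ins v u : ~~ odd k -> v \in M -> u \in ins v -> u = mate v.
Proof. by move=> ek /mateP[h _ _ _ vA] ui; apply: ins_P3 ek vA ui h. Qed.

Lemma mateK v : ~~ odd k -> v \in M -> mate (mate v) = v.
Proof.
move=> ek vM; have [h _ _ _ vA] := mateP vM; apply/esym; apply: mate_ins => //; first exact: mateM.
exact: ins_sym.
Qed.

(** The edge at [v] is unblocked when each vertex of [A] sees one of its ends. If some [w] sees
    neither, both ends miss an edge to [A], and the inside edge is paid for by [missA]. *)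
Definition unb v := [forall w in A, adj w v || adj w (mate v)].

Lemma two_mates x y : ~~ odd k -> x \in M -> y \in M -> y \notin [:: x; mate x] ->
  uniq [:: x; mate x; y; mate y].
Proof.
move=> ek xM yM; have [_ ax _ _ _] := mateP xM; have [_ ay _ _ _] := mateP yM.
rewrite !inE negb_or => /andP[yx ymx].
have c : x != mate y by apply: contra ymx => /eqP ->; rewrite mateK.
have d : mate x != mate y by apply: contra yx => /eqP/(congr1 mate); rewrite !mateK // => ->.
by rewrite /= !inE !negb_or (adj_neq ax) (adj_neq ay) c d eq_sym yx [mate x == y]eq_sym ymx.
Qed.

Lemma mates_notA x y : x \in M -> y \in M -> forall v, v \in [:: x; mate x; y; mate y] -> v \notin A.
Proof.
move=> xM yM v; have [_ _ _ mxA xA] := mateP xM; have [_ _ _ myA yA] := mateP yM.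
by rewrite !inE => /or4P[] /eqP ->.
Qed.

Lemma nrm_mate x : x \in M -> nrm P mu (col x) (mate x).
Proof. by move=> /mateP[_ _ <- mA _]; apply: hN. Qed.

Lemma nrm_M x : x \in M -> nrm P mu (col x) x.
Proof. by move=> /mateP[_ _ _ _ xA]; apply: hN. Qed.

Lemma mates_p3 x y : ~~ odd k -> 3 <= p -> x \in M -> y \in M -> y \in [:: x; mate x].
Proof.
move=> ek p3 xM yM; apply: contraT => ny; case/negP: noF.
have un := two_mates ek xM yM ny; have [w [R [uR sR mR]]] := A_list.
have sRk : size R <= k by rewrite sR; move: hk; clear; lia.
apply: (tmpl_two_edges hp hk HF (fullL mR) sRk (i := col x) (i' := col y) (u := x) (v := mate x) (u' := y) (v' := mate y)) => //.
- exact: (@off_A w R [:: x; mate x; y; mate y] uR mR un (mates_notA xM yM)).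
- exact: nrm_M.
- exact: nrm_mate.
- exact: nrm_M.
- exact: nrm_mate.
- by case: (mateP xM).
- by case: (mateP yM).
- by rewrite sR; have := s1_gt0; move: ek hk; clear; lia.
Qed.

(** For two unblocked edges, the last vertex of the list of [A] sees an end of one and the first
    sees an end of the other, which is what [tmpl_two_edges_same] asks for. *)
Lemma unb_same x y : ~~ odd k -> x \in M -> y \in M -> unb x -> unb y -> col x = col y ->
  y \in [:: x; mate x].
Proof.
move=> ek xM yM bx ub cxy; apply: contraT => nyx; have un := two_mates ek xM yM nyx.
have [w [R [uR sR mR]]] := A_list.
have sRk : size R <= k by rewrite sR; move: hk; clear; lia.
have wA : w \in A by rewrite -mR mem_head.
have lA : last w R \in A by rewrite -mR mem_last.
have key u u' : u \in M -> u' \in M -> uniq [:: u; mate u; u'; mate u'] -> col u = col u' ->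
    adj (last w R) u -> adj w u' -> contains G F.
  move=> uM uM' un' cu lu wu.
  apply: (tmpl_two_edges_same hp hk HF (fullL mR) sRk (i := col u) (u := u) (v := mate u) (u' := u') (v' := mate u')) => //.
  - exact: (@off_A w R [:: u; mate u; u'; mate u'] uR mR un' (mates_notA uM uM')).
  - exact: nrm_M.
  - exact: nrm_mate.
  - by rewrite cu; apply: nrm_M.
  - by rewrite cu; apply: nrm_mate.
  - by case: (mateP uM).
  - by case: (mateP uM').
  - by rewrite sR; have := s1_gt0; move: ek hk; clear; lia.
have [_ _ cmx _ _] := mateP xM; have [_ _ cmy _ _] := mateP yM.
case/negP: noF; case/orP: (forall_inP bx _ lA) => lx; case/orP: (forall_inP ub _ wA) => wy.
- exact: (key x y).
- apply: (key x (mate y)); rewrite ?mateM ?mateK ?cmy //; by uq un.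
- apply: (key (mate x) y); rewrite ?mateM ?mateK ?cmx //; by uq un.
- apply: (key (mate x) (mate y)); rewrite ?mateM ?mateK ?cmx ?cmy //; by uq un.
Qed.

(** If [x] saw both ends of the edge at [y], the two edges would serve consecutive cliques, and
    [unb y] returns the chain to a vertex of [A]. *)
Lemma unb_cross x y : ~~ odd k -> x \in M -> y \in M -> unb y -> col x != col y ->
  ~~ adj x y || ~~ adj x (mate y).
Proof.
move=> ek xM yM ub cxy; rewrite -negb_and; apply/negP => /andP[xy xmy].
have [w [R [uR sR mR]]] := A_list.
have sRk : size R <= k by rewrite sR; move: hk; clear; lia.
have wA : w \in A by rewrite -mR mem_head.
have [_ _ cmx _ _] := mateP xM; have [_ ay cmy _ _] := mateP yM.
have nyx : y \notin [:: x; mate x].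
  by rewrite !inE; apply/negP => /orP[] /eqP E; move: cxy; rewrite E ?cmx eqxx.
have un := two_mates ek xM yM nyx.
have key u : u \in M -> uniq [:: x; mate x; u; mate u] -> col u = col y ->
    adj x u -> adj x (mate u) -> adj w u -> contains G F.
  move=> uM un' cu xu xmu wu.
  apply: (tmpl_two_edges_cross hp hk HF (fullL mR) sRk (i := col x) (j := col y) (a := x) (b := mate x) (c := u) (d := mate u)) => //.
  - exact: (@off_A w R [:: x; mate x; u; mate u] uR mR un' (mates_notA xM uM)).
  - exact: nrm_M.
  - exact: nrm_mate.
  - by rewrite -cu; apply: nrm_M.
  - by rewrite -cu; apply: nrm_mate.
  - by case: (mateP xM).
  - by case: (mateP uM).
  - by rewrite sR; have := s1_gt0; move: ek hk; clear; lia.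
case/negP: noF; case/orP: (forall_inP ub _ wA) => wy; first exact: (key y).
apply: (key (mate y)); rewrite ?mateM ?mateK ?cmy //; by uq un.
Qed.

Lemma miss_pair z a b : a \notin A -> b \notin A -> a != b -> col a != col z -> col b != col z ->
  ~~ adj z a + ~~ adj z b <= #|[set u in ~: A | (col u != col z) && ~~ adj z u]|.
Proof.
move=> aA bA ab ca cb; set X := [set _ in _ | _].
have aX : (a \in X) = ~~ adj z a by rewrite !inE aA ca.
have bX : (b \in X) = ~~ adj z b by rewrite !inE bA cb.
rewrite -aX -bX (cardsD1 a X) leq_add2l (cardsD1 b (X :\ a)) in_setD1 eq_sym ab /=.
exact: leq_addr.
Qed.

Lemma missA_blocked : #|[set v in M | ~~ unb v]| <= missA.
Proof.
rewrite /missA (big_setID [set v in M | ~~ unb v]) /=; apply: leq_trans (leq_addr _ _).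
have -> : ~: A :&: [set v in M | ~~ unb v] = [set v in M | ~~ unb v].
  by apply/setIidPr/subsetP => v; rewrite !inE => /andP[/andP[]].
rewrite -sum1_card; apply: leq_sum => v; rewrite inE => /andP[_]; rewrite negb_forall_in => /exists_inP[w wA].
rewrite negb_or => /andP[nwv _]; rewrite subn_gt0 -hA; apply: proper_card.
by apply/properP; split; [apply: subsetIr | exists w => //; rewrite !inE adjC (negPf nwv)].
Qed.

(** Inside edges form a matching, a single edge if [p >= 3]. For [p = 2] the blocked ones are paid
    by [missA], each class has at most one unblocked edge, and unblocked edges in both classes are
    paid by missing edges between them. *)
Lemma ins_even : ~~ odd k -> In2 col (~: A) <= 2 \/ In2 col (~: A) < 2 * missA + cross_miss col (~: A) + 2.
Proof.
move=> ek; rewrite In2_M //.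
have sub2 x (S : {set G}) : (forall y, y \in S -> y \in [:: x; mate x]) -> #|S| <= 2.
  move=> h; apply: leq_trans (_ : #|[set y in [:: x; mate x]]| <= _).
    by apply: subset_leq_card; apply/subsetP => y /h; rewrite inE.
  by rewrite cardsE; apply: card_size.
have [p3|p2] := ltnP 2 p.
  left; have [->|/set0Pn[x xM]] := eqVneq M set0; first by rewrite cards0.
  by apply: (sub2 x) => y yM; apply: mates_p3.
pose Mb := [set v in M | ~~ unb v]; pose Mu := [set v in M | unb v].
have cM : #|M| = #|Mu| + #|Mb|.
  rewrite -(cardsID [set v | unb v] M); congr (_ + _); apply: eq_card => v; rewrite !inE //.
  by rewrite andbC.
have cMb : #|Mb| <= missA := missA_blocked.
have [Mu0|/set0Pn[x]] := eqVneq Mu set0.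
  have Mu00 : #|Mu| = 0 by rewrite Mu0 cards0.
  by right; move: cM cMb Mu00; move: #|M| #|Mu| #|Mb| missA (cross_miss _ _); clear; lia.
rewrite [x \in _]inE => /andP[xM bx].
have [/forall_inP h|] := boolP [forall y in Mu, col y == col x].
  have Mu2 : #|Mu| <= 2.
    apply: (sub2 x) => y yM; have := h y yM; move: yM; rewrite [y \in _]inE => /andP[yM yb] /eqP cy.
    by apply: unb_same.
  have [Mb0|Mb0] := posnP #|Mb|; [left|right]; move: cM cMb Mb0 Mu2.
    by move: #|M| #|Mu| #|Mb|; clear; lia.
  by move: #|M| #|Mu| #|Mb| missA (cross_miss _ _); clear; lia.
rewrite negb_forall_in => /exists_inP[y]; rewrite [y \in _]inE => /andP[yM yb] cyx; right.
have cxy : col x != col y by rewrite eq_sym.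
have Mu4 : #|Mu| <= 4.
  have -> : Mu = [set z in Mu | col z == col x] :|: [set z in Mu | col z == col y].
    apply/setP => z; rewrite in_setU !inE -andb_orr; case: (_ && _) => //=.
    have := cxy; rewrite -!val_eqE /=; have := ltn_ord (col x); have := ltn_ord (col y); have := ltn_ord (col z).
    move: p2; move: (nat_of_ord (col x)) (nat_of_ord (col y)) (nat_of_ord (col z)); clear.
    by move=> a b c p2 h1 h2 h3 h4; apply/esym; move: p2 h1 h2 h3 h4; lia.
  apply: leq_trans (leq_card_setU _ _) _; rewrite (_ : 4 = 2 + 2) // leq_add //.
    apply: (sub2 x) => z; rewrite [z \in _]inE => /andP[]; rewrite [z \in _]inE => /andP[zM zb] /eqP cz.
    exact: (unb_same ek xM zM bx zb (esym cz)).
  apply: (sub2 y) => z; rewrite [z \in _]inE => /andP[]; rewrite [z \in _]inE => /andP[zM zb] /eqP cz.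
  exact: (unb_same ek yM zM yb zb (esym cz)).
have [_ ax cmx mxA xA] := mateP xM; have [_ ay cmy myA yA] := mateP yM.
have nyx : y \notin [:: x; mate x].
  by rewrite !inE; apply/negP => /orP[] /eqP E; move: cxy; rewrite E ?cmx eqxx.
have un := two_mates ek xM yM nyx.
(* Both [x] and [mate x] miss an end of the other edge; each of these two missing edges is counted
   from both ends. *)
have cross4 : 4 <= cross_miss col (~: A).
  pose X z := #|[set u in ~: A | (col u != col z) && ~~ adj z u]|.
  apply: leq_trans (_ : \sum_(z <- [:: x; mate x; y; mate y]) X z <= _); last first.
    rewrite big_uniq // big_mkcond /= [X in _ <= X]big_mkcond /=; apply: leq_sum => z _.
    by case: ifP => // /(mates_notA xM yM) zA; rewrite inE zA.
  rewrite !big_cons big_nil addn0.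
  have h1 := unb_cross ek xM yM yb cxy.
  have h2 : ~~ adj (mate x) y || ~~ adj (mate x) (mate y).
    by apply: unb_cross => //; rewrite ?mateM // cmx.
  have m1 := miss_pair (z := x) yA myA (adj_neq ay) cyx ltac:(by rewrite cmy).
  have m2 := miss_pair (z := mate x) yA myA (adj_neq ay) ltac:(by rewrite cmx) ltac:(by rewrite cmx cmy).
  have m3 := miss_pair (z := y) xA mxA (adj_neq ax) cxy ltac:(by rewrite cmx).
  have m4 := miss_pair (z := mate y) xA mxA (adj_neq ax) ltac:(by rewrite cmy) ltac:(by rewrite cmx cmy).
  rewrite !(adjC y) !(adjC (mate y)) in m3 m4.
  move: h1 h2 m1 m2 m3 m4; rewrite -/(X x) -/(X y) -/(X (mate x)) -/(X (mate y)).
  move: (X x) (X y) (X (mate x)) (X (mate y)) => x1 x2 x3 x4.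
  by case: (adj x y); case: (adj x (mate y)); case: (adj (mate x) y); case: (adj (mate x) (mate y)) => //=; clear; lia.
by move: cM cMb Mu4 cross4; move: #|M| #|Mu| #|Mb| missA (cross_miss _ _); clear; lia.
Qed.

Lemma exact_count : \sum_(v : G) #|nbr v| + \sum_i #|cls col i :&: ~: A| * #|cls col i :&: ~: A| +
  2 * missA + cross_miss col (~: A) = E2 A + 2 * s1 * #|~: A| + In2 col (~: A) + #|~: A| * #|~: A|.
Proof.
rewrite (sum_nbr A); have := sum_dg_cls col (~: A).
have : missA + \sum_(v in ~: A) dg v A = s1 * #|~: A|.
  rewrite /missA -big_split /= mulnC -sum_nat_const; apply: eq_bigr => v _.
  by rewrite subnK // -hA dg_le.
rewrite -mulnA; move: (\sum_(v in _) _) (\sum_(v in _) _) (\sum_i _) (In2 _ _) missA (cross_miss _ _) (E2 A) (_ * _) (_ * _).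
by clear; lia.
Qed.
End Exact.

(** * Colour-preserving bijections and the arithmetic of Turán graphs *)

Lemma fiber_bij (T1 T2 C : finType) (c1 : T1 -> C) (c2 : T2 -> C) :
  (forall c, #|[set x | c1 x == c]| = #|[set y | c2 y == c]|) ->
  exists2 f : T1 -> T2, bijective f & forall x, c2 (f x) = c1 x.
Proof.
move=> hc; pose E1 x := enum [set y | c1 y == c1 x]; pose E2 x := enum [set y | c2 y == c1 x].
have sE x : size (E1 x) = size (E2 x) by rewrite /E1 /E2 -!cardE.
have ix x : index x (E1 x) < size (E2 x) by rewrite -sE index_mem mem_enum inE.
have hf x : exists y, y == nth y (E2 x) (index x (E1 x)).
  by case: (E2 x) (ix x) => // y s h; exists (nth y (y :: s) (index x (E1 x))); rewrite (set_nth_default y) // size_nth.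
have ex x : exists y, forall z, nth z (E2 x) (index x (E1 x)) = y.
  have [y _] := hf x; exists (nth y (E2 x) (index x (E1 x))) => z; exact: set_nth_default.
have [f hfx] := fin_all_exists ex.
have cf x : c2 (f x) = c1 x.
  have : f x \in E2 x by rewrite -(hfx x (f x)) mem_nth.
  by rewrite mem_enum inE => /eqP.
exists f => //; apply: inj_card_bij.
  move=> x y E; have cxy : c1 x = c1 y by rewrite -!cf E.
  have h := hfx x (f x); rewrite {2}E -(hfx y (f x)) in h.
  have E1xy : E1 x = E1 y by rewrite /E1 cxy.
  have E2xy : E2 x = E2 y by rewrite /E2 cxy.
  have := ix x; have := ix y; rewrite -E2xy => iy jx.
  move: h; rewrite -E2xy => /eqP; rewrite nth_uniq ?enum_uniq // -E1xy => /eqP h.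
  have yE : y \in E1 x by rewrite E1xy mem_enum inE.
  have xE : x \in E1 x by rewrite mem_enum inE.
  by rewrite -(nth_index x yE) -h nth_index.
have sum (T : finType) (c : T -> C) : #|T| = \sum_d #|[set x | c x == d]|.
  rewrite -sum1_card (partition_big c predT) //=; apply: eq_bigr => d _.
  by rewrite -sum1_card; apply: eq_bigl => x; rewrite inE.
by rewrite (sum _ c1) (sum _ c2); apply: eq_leq; apply: eq_bigr => d _.
Qed.

Lemma balanced_bij (p q : nat) (b b' : 'I_p -> nat) : (forall i, b i = q \/ b i = q.+1) ->
  (forall i, b' i = q \/ b' i = q.+1) -> \sum_i b i = \sum_i b' i ->
  exists2 f : 'I_p -> 'I_p, bijective f & forall i, b' (f i) = b i.
Proof.
move=> hb hb' hs.
have cnt (d : 'I_p -> nat) : (forall i, d i = q \/ d i = q.+1) ->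
    \sum_i d i = p * q + #|[set i | (d i == q.+1) == true]| /\
    #|[set i | (d i == q.+1) == true]| + #|[set i | (d i == q.+1) == false]| = p.
  move=> hd; split; last first.
    rewrite -[RHS](card_ord p) -(cardsC [set i | (d i == q.+1) == true]); congr (_ + _).
    by apply: eq_card => i; rewrite !inE; case: (d i == q.+1).
  have -> : p * q = \sum_(i < p) q by rewrite sum_nat_const card_ord.
  rewrite -sum1_card [X in _ + X]big_mkcond -big_split /=; apply: eq_bigr => i _; rewrite inE eqb_id.
  by case: (hd i) => ->; rewrite ?eqxx ?addn1 // [q == _]eqn_leq ltnn andbF addn0.
have [s1 t1] := cnt b hb; have [s2 t2] := cnt b' hb'.
have h1 : #|[set i | (b i == q.+1) == true]| = #|[set i | (b' i == q.+1) == true]|.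
  by apply/eqP; rewrite -(eqn_add2l (p * q)) -s1 -s2 hs.
have [|f fb hf] := @fiber_bij 'I_p 'I_p bool (fun i => b i == q.+1) (fun i => b' i == q.+1).
  case=> //; apply/eqP; rewrite -(eqn_add2l #|[set i | (b i == q.+1) == true]|) t1 h1 t2.
  by [].
exists f => // i; have := hf i.
by case: (hb i) => ->; case: (hb' (f i)) => -> //; rewrite eqxx [q == _]eqn_leq ltnn andbF.
Qed.

(* The number of edges of the Turán graph on [N] vertices, which grows by
   [i - i / p] when the vertex [i] is added. *)
Definition tur p N := \sum_(i < N) (i - i %/ p).
(** The number of edges of the complete graph on [s] vertices. *)
Definition tri s := \sum_(i < s) i.

Lemma triE s : s * s = 2 * tri s + s.
Proof.
by elim: s => [|s IH]; rewrite /tri ?big_ord0 // big_ord_recr /= -/(tri s) mulSn mulnS IH; clear; lia.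
Qed.

Lemma div_step p N : 0 < p -> (N.+1 %/ p = N %/ p /\ N.+1 %% p = (N %% p).+1) \/
  [/\ N.+1 %/ p = (N %/ p).+1, N.+1 %% p = 0 & (N %% p).+1 = p].
Proof.
move=> p0; have := divn_eq N p; have := ltn_pmod N p0; move: (N %/ p) (N %% p) => q r rp E.
have E' : N.+1 = q * p + r.+1 by rewrite E addnS.
move: rp; rewrite leq_eqVlt => /orP[/eqP rp|rp]; [right|left].
  by rewrite E' rp addnC -mulSn mulnK // modnMl.
by rewrite E' divnMDl // modnMDl divn_small // modn_small // addn0.
Qed.

(** The closed form in [q = N / p], arranged so that it is the equality case of the sum of
    [sq_balanced] over [p] parts. *)
Lemma turE p N : 0 < p -> 2 * tur p N + (2 * (N %/ p) + 1) * N = N * N + p * (N %/ p) * (N %/ p + 1).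
Proof.
move=> p0; elim: N => [|N]; first by rewrite /tur big_ord0 div0n !muln0.
rewrite /tur big_ord_recr /= -/(tur p N); have := leq_div N p; have := divn_eq N p.
case: (div_step N p0) => [[-> _]|[-> _ rp]]; move: (tur p N) (N %/ p) => t q.
  by move=> _ qN IH; rewrite mulnDr mulnBr; move: IH; rewrite !mulSn !mulnS; move: qN; clear; nia.
by move=> E qN IH; have E' : N.+1 = p * q.+1 by [move: E rp; rewrite mulnS mulnC; clear; lia]; clear rp E; move: E' qN IH; clear; nia.
Qed.

(** The integer [(b - q) * (b - q - 1)] is never negative and vanishes only at [q] and [q + 1]; all
    terms are moved to the side where they are natural numbers. *)
Lemma sq_balanced q b : (2 * q + 1) * b <= b * b + q * (q + 1) /\
  ((2 * q + 1) * b = b * b + q * (q + 1) -> b = q \/ b = q.+1).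
Proof.
have [h|h] := leqP b q.
  rewrite -(subnKC h); move: (q - b) => d; split; first by clear; nia.
  case: d => [|d]; first by left; rewrite addn0.
  by clear; nia.
rewrite -(subnKC h); move: (b - _) => d; split; first by clear; nia.
case: d => [|d]; first by right; rewrite addn0.
by clear; nia.
Qed.

(** Summing [sq_balanced] over the parts gives Turán's bound together with its equality case, and no
    balancing of parts is needed. *)
Lemma sum_sq p (b : 'I_p -> nat) N : 0 < p -> \sum_i b i = N -> N * N <= \sum_i b i * b i + 2 * tur p N /\
  (N * N = \sum_i b i * b i + 2 * tur p N <-> forall i, b i = N %/ p \/ b i = (N %/ p).+1).
Proof.
move=> p0 hs; have := turE N p0; set q := N %/ p => hT.
have e1 : (2 * q + 1) * N = \sum_i (2 * q + 1) * b i by rewrite -big_distrr /= hs.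
have e2 : \sum_i (b i * b i + q * (q + 1)) = \sum_i b i * b i + p * q * (q + 1).
  by rewrite big_split /= sum_nat_const card_ord mulnA.
have h : \sum_i (2 * q + 1) * b i <= \sum_i (b i * b i + q * (q + 1)).
  by apply: leq_sum => i _; case: (sq_balanced q (b i)).
have E : N * N = \sum_i b i * b i + 2 * tur p N <-> \sum_i (2 * q + 1) * b i = \sum_i (b i * b i + q * (q + 1)).
  rewrite -e1 e2; move: hT; move: (\sum_i _) (N * N) (_ * N) (p * q * _) (tur p N); clear.
  by move=> a b' c d e; split; lia.
split.
  move: h hT; rewrite -e1 e2; move: (\sum_i _) (N * N) (_ * N) (p * q * _) (tur p N); clear; lia.
rewrite E; split=> [Es i|hb]; last first.
  by apply: eq_bigr => i _; case: (hb i) => ->; ring.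
apply: (sq_balanced q (b i)).2; apply/eqP; rewrite eqn_leq (sq_balanced q (b i)).1 /=.
move: Es; rewrite (bigD1 i) //= [RHS](bigD1 i) //=.
have : \sum_(j | j != i) (2 * q + 1) * b j <= \sum_(j | j != i) (b j * b j + q * (q + 1)).
  by apply: leq_sum => j _; case: (sq_balanced q (b j)).
by move: (\sum_(j | _) _) (\sum_(j | _) _) ((2 * q + 1) * b i) (b i * b i + _); clear; lia.
Qed.

Lemma card_mod p N i : 0 < p -> i < p -> #|[set x : 'I_N | x %% p == i]| = N %/ p + (i < N %% p).
Proof.
move=> p0 ip; have -> : #|[set x : 'I_N | x %% p == i]| = \sum_(x < N) (x %% p == i).
  by rewrite -sum1_card big_mkcond /=; apply: eq_bigr => x _; rewrite inE; case: (_ == _).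
elim: N => [|N IH]; first by rewrite big_ord0 div0n mod0n.
rewrite big_ord_recr /= IH; case: (div_step N p0) => [[-> ->]|[-> -> rp]].
  have -> : (i < (N %% p).+1) = (i < N %% p) + (N %% p == i) :> nat by rewrite ltnS; case: ltngtP.
  by rewrite addnA.
have h : (i < N %% p) + (N %% p == i) = 1.
  by have : i <= N %% p; [rewrite -ltnS rp | case: ltngtP].
by rewrite ltn0 addn0 -addnA h addn1.
Qed.

(* [None] is the colour of the [s] vertices joined to everything, [Some i] that of the
   [i]-th Turán class. *)
Definition badj (p : nat) (T : eqType) (c : T -> option 'I_p) (u v : T) :=
  (u != v) && ((c u == None) || (c u != c v)).

(** The extremal graphs of part (i), up to isomorphism. The flag [b] tells whether there is an extra
    inside edge [e]; otherwise [e] is empty, so that one adjacency formula covers both parities. *)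
Record eshape (p : nat) (b : bool) (s : nat) (G : sgraph) (c : G -> option 'I_p) (e : {set G}) : Prop := {
  shapeN : #|[set v | c v == None]| = s;
  shapeC : forall i, #|[set v | c v == Some i]| = (#|G| - s) %/ p \/
                     #|[set v | c v == Some i]| = ((#|G| - s) %/ p).+1;
  shapeE : if b then exists x y, [/\ x != y, c x = c y, c x != None & e = [set x; y]] else e = set0;
  shapeA : forall u v, adj u v = badj c u v || (u != v) && ([set u; v] == e) }.

(** The summands are the edges among the [s] joined vertices, from them to the rest, in the Turán
    graph, and the extra edge. The parameter [s] is one less than in [Hgraph]. *)
Definition fv (b : bool) p s n := tri s + s * (n - s) + tur p (n - s) + b.

Section Count.
Variables (p s : nat) (G : sgraph) (col : {ffun G -> 'I_p}) (A : {set G}).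
Hypotheses (p0 : 0 < p) (hA : #|A| = s).
Implicit Types (u v w x y : G).

Definition amiss := \sum_(v in A) #|[set u in A | (u != v) && ~~ adj v u]|.
Definition bmiss := \sum_(v in ~: A) (s - dg v A).
Definition csize i := #|cls col i :&: ~: A|.

Lemma E2_amiss : E2 A + s + amiss = s * s.
Proof.
have -> : s * s = \sum_(v in A) #|A| by rewrite sum_nat_const hA.
have -> : s = \sum_(v in A) 1 by rewrite sum1_card hA.
rewrite /E2 /amiss -!big_split /=; apply: eq_bigr => v vA.
rewrite -(cardsID (nbr v) A) /dg setIC -addnA; congr (_ + _).
rewrite (cardsD1 v (A :\: nbr v)) !inE vA adj_irrefl; congr (_ + _); apply: eq_card => u.
by rewrite !inE; do !case: (_ \in _); case: (_ == _); case: (adj _ _).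
Qed.

Lemma csize_sum : \sum_i csize i = #|G| - s.
Proof. by rewrite sum_clsI -hA -(cardsC A) addKn. Qed.

(** An identity in which every defect of [G] against the extremal shape is a separate nonnegative
    term on the left; bounds and equality cases then follow by linear arithmetic. *)
Lemma master : 2 * #|edges G| + \sum_i csize i * csize i + 2 * bmiss + cross_miss col (~: A) + amiss =
  2 * tri s + 2 * (s * (#|G| - s)) + In2 col (~: A) + (#|G| - s) * (#|G| - s).
Proof.
(* [exact_count] is stated for [(k - 1) / 2]; every [s] has this form with [k = 2 * s + 1]. *)
have hs : s = (2 * s + 1 - 1) %/ 2 by rewrite addnK mulKn.
have hA' : #|A| = (2 * s + 1 - 1) %/ 2 by rewrite -hs.
have := exact_count col hA'; rewrite handshake /missA -!hs -/bmiss.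
have cB : #|~: A| = #|G| - s by rewrite -hA -(cardsC A) addKn.
rewrite cB -mul2n; have := E2_amiss; rewrite triE -mulnA.
rewrite /csize; set S2 := \sum_(i < p) _; move: S2 (In2 _ _) bmiss (cross_miss _ _) (E2 A) amiss.
move: (s * (#|G| - s)) ((#|G| - s) * (#|G| - s)) (tri s) #|edges G|; clear; lia.
Qed.

Lemma bmiss0 v w : bmiss = 0 -> v \notin A -> w \in A -> adj v w.
Proof.
move/eqP; rewrite sum_nat_eq0 => /forall_inP h vA wA; have := h v; rewrite inE vA => /(_ isT).
rewrite subn_eq0 -hA => le; have E : nbr v :&: A = A.
  by apply/eqP; rewrite eqEcard subsetIr.
by move: wA; rewrite -{1}E !inE => /andP[].
Qed.

Lemma amiss0 v w : amiss = 0 -> v \in A -> w \in A -> v != w -> adj v w.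
Proof.
move/eqP; rewrite sum_nat_eq0 => /forall_inP h vA wA vw; have := h v vA.
rewrite cards_eq0 => /eqP/setP/(_ w); rewrite !inE wA eq_sym vw /= => /negbT.
by rewrite negbK.
Qed.

Lemma cross0 v w : cross_miss col (~: A) = 0 -> v \notin A -> w \notin A -> col v != col w -> adj v w.
Proof.
move/eqP; rewrite sum_nat_eq0 => /forall_inP h vA wA vw; have := h v; rewrite inE vA => /(_ isT).
rewrite cards_eq0 => /eqP/setP/(_ w); rewrite !inE wA eq_sym vw /= => /negbT.
by rewrite negbK.
Qed.

Lemma in2_0 v w : In2 col (~: A) = 0 -> v \notin A -> w \notin A -> col v = col w -> adj v w = false.
Proof.
rewrite In2_ins => /eqP; rewrite sum_nat_eq0 => /forall_inP h vA wA vw; have := h v; rewrite inE vA => /(_ isT).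
by rewrite cards_eq0 => /eqP/setP/(_ w); rewrite !inE wA vw eqxx /= andbT.
Qed.

Lemma in2_2 : In2 col (~: A) = 2 -> exists x y, [/\ x \notin A, y \notin A, x != y, col x = col y &
  forall v w, v \notin A -> w \notin A -> col v = col w -> adj v w = (v != w) && ([set v; w] == [set x; y])].
Proof.
rewrite In2_ins => h.
have [x xA /set0Pn[y]] : exists2 x, x \in ~: A & ins col A x != set0.
  apply/exists_inP; apply: contraT; rewrite negb_exists_in => /forall_inP h'.
  by rewrite big1 in h => // v vA; apply/eqP; rewrite cards_eq0; have := h' v vA; rewrite negbK.
rewrite inE in xA; rewrite in_ins => /and3P[xy /eqP cyx yA].
have yx : y \in ins col A x by rewrite in_ins xy cyx eqxx.
have xy' : x \in ins col A y by apply: ins_sym.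
have nxy := adj_neq xy.
move: h; rewrite (bigD1 x) ?inE //= (bigD1 y) ?inE ?yA ?(eq_sym y) //=.
rewrite (cardsD1 y (ins col A x)) yx (cardsD1 x (ins col A y)) xy' => h.
have [h1 h2 h3] : [/\ #|ins col A x :\ y| = 0, #|ins col A y :\ x| = 0 &
    \sum_(v in ~: A | (v != x) && (v != y)) #|ins col A v| = 0].
  move: h; under eq_bigl do rewrite -andbA; move: (\sum_(v | _) _) #|_ :\ y| #|_ :\ x|; clear; split; lia.
have sym v w : v \notin A -> w \notin A -> col v = col w -> adj v w = (w \in ins col A v).
  by move=> vA wA cvw; rewrite in_ins cvw eqxx wA !andbT.
exists x, y; split=> // v w vA wA cvw; apply/idP/andP => [vw|[nvw /eqP E]]; last first.
  have : v \in [set x; y] by rewrite -E set21.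
  have : w \in [set x; y] by rewrite -E set22.
  by case/set2P=> ew; case/set2P=> ev; move: nvw; rewrite ew ev ?eqxx // adjC.
split; first exact: adj_neq.
rewrite sym // in vw.
have [Ev|vx] := eqVneq v x.
  subst v; have [->//|wy] := eqVneq w y.
  by move/eqP: h1; rewrite cards_eq0 => /eqP/setP/(_ w); rewrite in_setD1 wy vw inE.
have [Ev|vy] := eqVneq v y.
  subst v; have [->|wx] := eqVneq w x; first by rewrite setUC.
  by move/eqP: h2; rewrite cards_eq0 => /eqP/setP/(_ w); rewrite in_setD1 wx vw inE.
move/eqP: h3; rewrite sum_nat_eq0 => /forallP/(_ v); rewrite inE vA vx vy /= cards_eq0 => /eqP E0.
by rewrite E0 inE in vw.
Qed.

Let c v := if v \in A then None else Some (col v).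

Lemma shape_of (b : bool) : amiss = 0 -> bmiss = 0 -> cross_miss col (~: A) = 0 ->
  In2 col (~: A) = 2 * b -> (forall i, csize i = (#|G| - s) %/ p \/ csize i = ((#|G| - s) %/ p).+1) ->
  exists c e, @eshape p b s G c e.
Proof.
move=> a0 b0 c0 i2 hs.
have cN v : (c v == None) = (v \in A) by rewrite /c; case: ifP.
have cS i v : (c v == Some i) = (v \in cls col i :&: ~: A).
  rewrite /c !inE; case: ifP => _; rewrite ?andbF //= andbT.
  by [].
have base u v : ~~ ((u \notin A) && (v \notin A) && (col u == col v)) -> adj u v = badj c u v.
  have [->|uv] := eqVneq u v; first by rewrite adj_irrefl /badj (eqxx v).
  rewrite /badj uv cN /c; case uA: (u \in A); case vA: (v \in A) => //=.
  - by rewrite amiss0.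
  - by rewrite adjC bmiss0 ?vA.
  - by rewrite bmiss0 ?uA.
  - by move=> n; rewrite cross0 ?uA ?vA //; apply/esym; apply: contra n => /eqP[->].
have badj0 u v : u \notin A -> v \notin A -> col u = col v -> badj c u v = false.
  by move=> uA vA cuv; rewrite /badj cN (negPf uA) /c (negPf uA) (negPf vA) cuv eqxx andbF.
have N : #|[set v | c v == None]| = s by rewrite -hA; apply: eq_card => v; rewrite inE cN.
have C i : #|[set v | c v == Some i]| = csize i by apply: eq_card => v; rewrite inE cS.
case: b i2 => i2; last first.
  exists c, set0; split=> // [i|u v]; first by rewrite C.
  have -> : ([set u; v] == set0) = false by apply/eqP/setP => /(_ u); rewrite !inE eqxx.
  rewrite andbF orbF; have [/andP[/andP[uA vA] /eqP cuv]|n] := boolP ((u \notin A) && (v \notin A) && (col u == col v)).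
    by rewrite badj0 // in2_0.
  exact: base.
have [x [y [xA yA xy cxy hxy]]] := in2_2 i2.
exists c, [set x; y]; split=> // [i| |u v]; first by rewrite C.
  by exists x, y; rewrite cN /c (negPf xA) (negPf yA) cxy.
have [/andP[/andP[uA vA] /eqP cuv]|n] := boolP ((u \notin A) && (v \notin A) && (col u == col v)).
  by rewrite badj0 // hxy.
rewrite base //; case: (boolP (badj c u v)) => //= _; apply/esym/negP => /andP[_ /eqP E]; case/negP: n.
have : u \in [set x; y] by rewrite -E set21.
have : v \in [set x; y] by rewrite -E set22.
by rewrite !inE; do 2!case/orP=> /eqP ->; rewrite ?xA ?yA ?cxy eqxx.
Qed.
End Count.

Section ExactShape.
Variables (p k : nat).
Hypotheses (hp : 2 <= p) (hk : 3 <= k) (kp : (k, p) <> (3, 2)).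
Notation F := (blowup (cycle_graph k) (p + 1)).
Notation s1 := ((k - 1) %/ 2).
Variables (G : sgraph) (col : {ffun G -> 'I_p}) (A : {set G}) (P : 'I_p -> {set G}) (mu : nat).
Hypotheses (noF : ~~ contains G F) (hA : #|A| = s1) (HF : Fill k P mu).
Hypothesis hN : forall v, v \notin A -> nrm P mu (col v) v.
Hypothesis hR : forall w, w \in A -> full P w.

(** By [ins_odd] and [ins_even], inside edges beyond the allowed one are outweighed by other defects
    in [master]; equality makes all defects vanish and the classes balanced. *)
Lemma exact_shape : #|edges G| <= fv (~~ odd k) p s1 #|G| /\
  (#|edges G| = fv (~~ odd k) p s1 #|G| -> exists c e, @eshape p (~~ odd k) s1 G c e).
Proof.
have p0 : 0 < p by apply: ltnW.
have m := master col hA; have [h1 h2] := sum_sq p0 (csize_sum col hA).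
have hin : In2 col (~: A) <= 2 * ~~ odd k \/ In2 col (~: A) < 2 * bmiss s1 A + cross_miss col (~: A) + 2 * ~~ odd k.
  case: (boolP (odd k)) => ok /=; last by case: (ins_even hp hk noF hA HF hN hR ok) => h; [left|right].
  case: (ins_odd hp hk kp noF hA HF hN hR ok) => h; [left|right]; first by rewrite h.
  by apply: leq_trans h _; rewrite addn0 leq_addr.
split.
  move: m h1 hin; rewrite /fv; move: (\sum_i _) (In2 _ _) (bmiss _ _) (cross_miss _ _) (amiss _).
  by move: (s1 * (#|G| - s1)) ((#|G| - s1) * (#|G| - s1)) (tri s1) (tur p _) #|edges G| (nat_of_bool _); clear; lia.
move=> E; have : [/\ amiss A = 0, bmiss s1 A = 0, cross_miss col (~: A) = 0,
   In2 col (~: A) = 2 * ~~ odd k & (#|G| - s1) * (#|G| - s1) = \sum_i csize col A i * csize col A i + 2 * tur p (#|G| - s1)].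
  move: E m h1 hin; rewrite /fv; move: (\sum_i _) (In2 _ _) (bmiss _ _) (cross_miss _ _) (amiss _).
  move: (s1 * (#|G| - s1)) ((#|G| - s1) * (#|G| - s1)) (tri s1) (tur p _) #|edges G| (nat_of_bool _); clear.
  by move=> a1 a2 a3 a4 a5 a6 a7 a8 a9 a10 a11 E m h1 hin; split; lia.
by case=> e1 e2 e3 e4 e5; apply: (shape_of hA e1 e2 e3 e4); apply/h2.
Qed.
End ExactShape.

(** * The extremal graphs *)

Section ShapeFacts.
Variables (p s : nat) (b : bool) (G : sgraph) (c : G -> option 'I_p) (e : {set G}).
Hypotheses (p0 : 0 < p) (hS : @eshape p b s G c e).
Implicit Types (u v w x y : G).

Let A := [set v | c v == None].
Let i0 : 'I_p := Ordinal p0.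
Let col : {ffun G -> 'I_p} := [ffun v => odflt i0 (c v)].

Lemma shape_inside u v : c u != None -> c u = c v -> adj u v = (u != v) && ([set u; v] == e).
Proof. by move=> nu cuv; rewrite (shapeA hS) /badj (negPf nu) cuv eqxx andbF. Qed.

Lemma shape_edges : #|edges G| = fv b p s #|G|.
Proof.
have cA v : (v \in A) = (c v == None) by rewrite inE.
have cS v : v \notin A -> c v = Some (col v) by rewrite cA ffunE; case: (c v).
have a0 : amiss A = 0.
  apply: big1 => v; rewrite cA => vA; apply/eqP; rewrite cards_eq0; apply/eqP/setP => u; rewrite !inE.
  by apply/negP => /and3P[uA uv]; rewrite (shapeA hS) /badj eq_sym uv vA.
have b0 : bmiss s A = 0.
  apply: big1 => v; rewrite inE cA => vA; apply/eqP; rewrite subn_eq0 -(shapeN hS) -/A.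
  apply: subset_leq_card; apply/subsetP => u uA; rewrite in_setI in_nbr uA andbT (shapeA hS) /badj.
  have uv : v != u by apply: contraNneq vA => ->; rewrite -cA.
  by move: uA; rewrite uv cA => /eqP ->; rewrite vA orbT.
have c0 : cross_miss col (~: A) = 0.
  apply: big1 => v; rewrite inE => vA; apply/eqP; rewrite cards_eq0; apply/eqP/setP => u; rewrite !inE.
  apply/negP => /and3P[uA cuv]; rewrite (shapeA hS) /badj (cS v vA) (cS u) ?cA //.
  have uv : v != u by apply: contraNneq cuv => ->.
  by rewrite uv /=; have -> : Some (col v) != Some (col u) by apply: contra cuv => /eqP[->].
have insE v u : v \notin A -> (u \in ins col A v) = (v != u) && ([set v; u] == e).
  move=> vA; rewrite in_ins; have [uA|uA] := boolP (u \in A).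
    rewrite !andbF; apply/esym/negP => /andP[_ /eqP E]; have := shapeE hS.
    case: b => [[x [y [xy cxy cx Ee]]]|Ee]; last by have := set21 v u; rewrite E Ee inE.
    have : u \in [set x; y] by rewrite -Ee -E set22.
    by rewrite !inE in uA *; case/orP=> /eqP Eu; move: uA; rewrite Eu -?cxy (negPf cx).
  rewrite andbT; have [cuv|cuv] := eqVneq (col u) (col v).
    rewrite andbT shape_inside //; first by rewrite -cA.
    by rewrite !cS // cuv.
  rewrite andbF; apply/esym/negP => /andP[_ /eqP E]; have := shapeE hS.
  case: b => [[x [y [xy cxy cx Ee]]]|Ee]; last by have := set21 v u; rewrite E Ee inE.
  have hc z : z \in [set x; y] -> c z = c x by rewrite !inE => /orP[] /eqP ->.
  have : c u = c v by rewrite !hc // -Ee -E ?set21 ?set22.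
  by rewrite !cS // => -[E']; rewrite E' eqxx in cuv.
have i2 : In2 col (~: A) = 2 * b.
  rewrite In2_ins; have := shapeE hS; case: (b) => [[x [y [xy cxy cx Ee]]]|Ee].
    have xA : x \in ~: A by rewrite inE cA.
    have yA : y \in ~: A by rewrite inE cA -cxy.
    have i1 v : v \in ~: A -> v != x -> v != y -> #|ins col A v| = 0.
      rewrite inE => vA vx vy; apply/eqP; rewrite cards_eq0; apply/eqP/setP => u; rewrite insE // inE.
      apply/negP => /andP[_ /eqP E]; have : v \in [set x; y] by rewrite -Ee -E set21.
      by rewrite !inE (negPf vx) (negPf vy).
    have ix : ins col A x = [set y].
      apply/setP => u; rewrite insE ?inE ?cA // Ee; apply/andP/eqP => [[xu /eqP E]|->]; last by rewrite eqxx.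
      have : u \in [set x; y] by rewrite -E set22.
      by rewrite !inE eq_sym (negPf xu) => /eqP.
    have iy : ins col A y = [set x].
      apply/setP => u; rewrite insE ?inE ?cA -?cxy // Ee; apply/andP/eqP => [[xu /eqP E]|->]; last first.
        by rewrite eq_sym xy setUC.
      have : u \in [set x; y] by rewrite -E set22.
      by rewrite !inE [u == y]eq_sym (negPf xu) orbF => /eqP.
    rewrite (bigD1 x) //= (bigD1 y) /= ?yA ?(eq_sym y) // ix iy !cards1 big1 ?addn0 // => v /andP[/andP[vA vx] vy].
    exact: i1.
  rewrite big1 // => v; rewrite inE => vA; apply/eqP; rewrite cards_eq0; apply/eqP/setP => u.
  rewrite insE // inE Ee; apply/negP => /andP[_ /eqP E]; have := set21 v u; by rewrite E inE.
have cs i : csize col A i = #|[set v | c v == Some i]|.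
  apply: eq_card => v; rewrite !inE ffunE; case: (c v) => [j|] /=; last by rewrite andbF.
  by rewrite andbT.
have hA : #|A| = s := shapeN hS.
have [_ [_ h2]] := sum_sq p0 (csize_sum col hA).
have := master col hA; rewrite a0 b0 c0 i2.
have : (#|G| - s) * (#|G| - s) = \sum_i csize col A i * csize col A i + 2 * tur p (#|G| - s).
  by apply: h2 => i; rewrite cs; apply: (shapeC hS).
rewrite /fv; move: (\sum_i _) (s * (#|G| - s)) ((#|G| - s) * (#|G| - s)) (tri s) (tur p _) #|edges G| (nat_of_bool b).
by clear; lia.
Qed.

Section Free.
Variable k : nat.
Hypotheses (hk : 3 <= k) (hks : 2 * s + b < k).
Notation H := (cycle_graph k).
Notation F := (blowup (cycle_graph k) (p + 1)).

Let eset (i : H) : {set H} := [set i; ordS i].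

Lemma eset_inj : injective eset.
Proof.
move=> i j E; apply/eqP; apply: contraT => ij.
have : i \in eset j by rewrite -E set21.
have : j \in eset i by rewrite E set21.
rewrite !inE (negPf ij) [j == i]eq_sym (negPf ij) /= => /eqP ej /eqP ei.
have := congr1 (@nat_of_ord k) ei; rewrite ej /=; have := ltn_ord i.
move: (nat_of_ord i) => a ak; case: (ltnP a.+2 k) => h.
  by rewrite (modn_small (ltnW h)) modn_small //; clear; lia.
have [E1|E1] : a.+1 = k \/ a.+2 = k by move: ak h; clear; lia.
  by rewrite E1 modnn modn_small; move: hk E1; clear; lia.
by rewrite (modn_small (_ : a.+1 < k)) ?E1 // modnn; move: hk E1; clear; lia.
Qed.

Lemma ordS_neq (i : H) : i != ordS i.
Proof.
rewrite -val_eqE /=; have := ltn_ord i; move: (nat_of_ord i) => a ak.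
have [h|h] : a.+1 < k \/ a.+1 = k by move: ak; clear; lia.
  by rewrite modn_small //; move: h; clear; lia.
by rewrite h modnn; move: hk h; clear; lia.
Qed.

Lemma eset_edge (i : H) : eset i \in edges H.
Proof.
rewrite inE; apply/existsP; exists i; apply/existsP; exists (ordS i).
by rewrite eqxx andbT /adj /= /simple_rel ordS_neq eqxx.
Qed.

Let Q (i : H) : {set F} := [set x : F | match x with inl j => j \in eset i | inr (f, _) => val f == eset i end].

Lemma Q_adj i (x y : F) : x \in Q i -> y \in Q i -> x != y -> adj x y.
Proof.
rewrite !inE /adj /= /simple_rel => hx hy nxy; rewrite nxy; move: nxy; case: x hx => [j|[f a]]; case: y hy => [j'|[f' a']] /=.
- have ni := ordS_neq i.
  have h (u v : H) : u \in eset i -> v \in eset i -> (u == v) || adj u v.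
    rewrite !inE => /orP[] /eqP -> /orP[] /eqP ->; rewrite ?eqxx //.
      by rewrite /adj /= /simple_rel ni eqxx orbT.
    by rewrite /adj /= /simple_rel eq_sym ni eqxx !orbT.
  move=> h1 h2 nxy; have njj : j != j' by apply: contra nxy => /eqP ->.
  by have := h j j' h2 h1; rewrite (negPf njj) /= => ->.
- by move=> /eqP E h _; rewrite E h.
- by move=> h /eqP E _; rewrite E h.
- by move=> /eqP E /eqP E' _; apply/orP; left; apply/eqP/val_inj; exact: etrans E' (esym E).
Qed.

Lemma card_Q i : p < #|Q i|.
Proof.
pose f : {e : {set H} | e \in edges H} := Sub (eset i) (eset_edge i).
pose S1 : {set F} := [set inl i; inl (ordS i)].
pose S2 : {set F} := [set inr (f, a) | a : 'I_(p + 1 - 2)].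
have : #|S1 :|: S2| = p.+1.
  rewrite cardsU (_ : S1 :&: S2 = set0) ?cards0 ?subn0; last first.
    apply/setP => x; rewrite !inE; apply/negP => /andP[h /imsetP[a _ E]]; by case/orP: h => /eqP h; rewrite h in E.
  rewrite cards2 (inj_eq (@inl_inj _ _)) ordS_neq card_imset; last by move=> a a' [].
  by rewrite card_ord /=; move: p0; clear; lia.
move=> <-; apply: subset_leq_card; apply/subsetP => x; rewrite !inE => /orP[/orP[]/eqP ->|/imsetP[a _ ->]].
- by rewrite set21.
- by rewrite set22.
- by rewrite /=.
Qed.

Lemma Q_le2 (x : F) : #|[set i | x \in Q i]| <= 2.
Proof.
case: x => [j|[f a]].
  apply: leq_trans (_ : #|[set j; ord_pred j]| <= _); last by rewrite cards2; case: eqP.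
  apply: subset_leq_card; apply/subsetP => i; rewrite !inE => /orP[/eqP ->|/eqP ->]; first by rewrite eqxx.
  by rewrite ordSK eqxx orbT.
rewrite (leq_trans _ (leqnSn 1)) //; apply/card_le1P => i; rewrite !inE => /eqP Ei j; rewrite !inE.
by rewrite Ei (inj_eq eset_inj) eq_sym.
Qed.

Lemma Q_meet i j (x y : F) : i != j -> x \in Q i -> x \in Q j -> y \in Q i -> y \in Q j -> x = y.
Proof.
rewrite !inE => ij; case: x => [u|[f a]]; last by move=> /eqP -> /eqP/eset_inj E; rewrite E eqxx in ij.
case: y => [v|[f a]]; last by move=> _ _ /eqP -> /eqP/eset_inj E; rewrite E eqxx in ij.
move=> ui uj vi vj; congr inl; apply/eqP; apply: contraT => uv.
have h l : u \in eset l -> v \in eset l -> eset l = [set u; v].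
  move=> ul vl; apply/esym/eqP; rewrite eqEcard subUset !sub1set ul vl /= !cards2 uv.
  by rewrite ordS_neq.
by move: ij; rewrite -(inj_eq eset_inj) (h i) // (h j) // eqxx.
Qed.

(** Each of the [k] cliques meets [A] or contains the edge [e], having more vertices than there are
    classes. A vertex lies in at most two cliques, and two cliques share at most one vertex, so [e]
    lies in one only; at most [2 * s + b < k] cliques are served. *)
Lemma shape_free : ~~ contains G F.
Proof.
apply/negP => /existsP[f /andP[/injectiveP fI /forallP fA]].
have fadj (x y : F) : adj x y -> adj (f x) (f y) by move=> h; have /forallP/(_ y)/implyP := fA x; apply.
pose Af := [set x : F | f x \in A].
have cAf : #|Af| <= s.
  rewrite -(shapeN hS) -/A -(card_imset _ fI); apply: subset_leq_card.
  by apply/subsetP => y /imsetP[x]; rewrite inE => h ->.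
pose bad := [set i : H | [disjoint Q i & Af]].
have cbad : #|bad| <= b.
  have key i : i \in bad -> exists x y : F, [/\ x \in Q i, y \in Q i, x != y, [set f x; f y] = e & b].
    rewrite inE => dis.
    have nA (x : F) : x \in Q i -> c (f x) != None.
      by move=> xQ; have := disjointFr dis xQ; rewrite !inE => ->.
    have [y [z [yQ zQ yz cyz]]] : exists y z : F, [/\ y \in Q i, z \in Q i, y != z & col (f y) = col (f z)].
      have : ~~ [forall y : F, forall z : F, (y \in Q i) && (z \in Q i) && (col (f y) == col (f z)) ==> (y == z)].
        apply/negP => /forallP h.
        have inj : {in Q i &, injective (fun x : F => col (f x))}.
          move=> y z yQ zQ E; have /forallP/(_ z) := h y; rewrite yQ zQ /= => /implyP h'.
          by apply/eqP/h'/eqP.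
        have := card_Q i; rewrite -(card_in_imset inj) ltnNge; case/negP.
        by apply: leq_trans (max_card _) _; rewrite card_ord.
      rewrite negb_forall => /existsP[y]; rewrite negb_forall => /existsP[z]; rewrite negb_imply.
      by case/andP=> /andP[/andP[yQ zQ] /eqP E] yz; exists y, z.
    have ayz := fadj _ _ (Q_adj yQ zQ yz).
    have cc : c (f y) = c (f z).
      by have := cyz; rewrite !ffunE; have := nA y yQ; have := nA z zQ; case: (c (f y)) => [?|] //; case: (c (f z)) => [?|] //= _ _ ->.
    move: ayz; rewrite shape_inside ?nA // => /andP[_ /eqP E]; exists y, z; split=> //.
    by have := shapeE hS; case: (b) => // E0; have := set21 (f y) (f z); rewrite E E0 inE.
  have [->|/set0Pn[i ib]] := eqVneq bad set0; first by rewrite cards0.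
  have [_ [_ [_ _ _ _ ->]]] := key i ib.
  apply/card_le1_eqP => i1 i2 /key[x1 [y1 [x1Q y1Q xy1 E1 _]]] /key[x2 [y2 [x2Q y2Q xy2 E2 _]]].
  apply/eqP; apply: contraT => ni; case/eqP: xy2.
  have hm (z : F) : z \in [set x2; y2] -> z \in Q i1.
    move=> zz; have : f z \in [set f x1; f y1].
      by rewrite E1 -E2; move: zz; rewrite !inE => /orP[] /eqP ->; rewrite eqxx ?orbT.
    by rewrite in_set2 !(inj_eq fI) => /orP[] /eqP ->.
  by apply: (Q_meet ni) => //; apply: hm; rewrite ?set21 ?set22.
have h1 : #|~: bad| <= \sum_(x in Af) 2.
  apply: leq_trans (_ : \sum_(x in Af) #|[set i | x \in Q i]| <= _); last by apply: leq_sum => x _; apply: Q_le2.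
  apply: leq_trans (_ : \sum_(x in Af) \sum_(i in ~: bad) (x \in Q i) <= _); last first.
    apply: leq_sum => x _; rewrite -sum1_card [X in X <= _]big_mkcond [X in _ <= X]big_mkcond /=.
    apply: leq_sum => i _; have -> : (i \in [set i0 : H | x \in Q i0]) = (x \in Q i) by rewrite inE.
    by case: ifP => _; case: (x \in Q i).
  rewrite exchange_big /= -sum1_card; apply: leq_sum => i; rewrite in_setC inE -setI_eq0.
  by case/set0Pn => x; rewrite inE => /andP[xQ xA]; rewrite (bigD1 x) //= xQ.
have := cardsC bad; rewrite card_ord => h2.
move: h1; rewrite sum_nat_const => h1; move: hks; rewrite ltnNge; case/negP.
by move: h1 h2 cbad cAf; move: #|~: bad| #|bad| #|Af| (nat_of_bool b); clear; lia.
Qed.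
End Free.
End ShapeFacts.

(** * Extremality and vertex deletion *)

Lemma set2_eq (T : finType) (a b c d : T) : a != b -> [set a; b] = [set c; d] ->
  (a = c /\ b = d) \/ (a = d /\ b = c).
Proof.
move=> ab E; have : a \in [set c; d] by rewrite -E set21.
have : b \in [set c; d] by rewrite -E set22.
by case/set2P=> eb; case/set2P=> ea; [rewrite ea eb eqxx in ab|right|left|rewrite ea eb eqxx in ab].
Qed.

Lemma contains_mono (G H F : sgraph) (f : G -> H) : injective f ->
  (forall x y, adj x y -> adj (f x) (f y)) -> contains G F -> contains H F.
Proof.
move=> fI fA /existsP[g /andP[/injectiveP gI /forallP gA]]; apply/existsP; exists [ffun x => f (g x)].
apply/andP; split; first by apply/injectiveP => x y; rewrite !ffunE => /fI/gI.
apply/forallP => x; apply/forallP => y; apply/implyP => xy; rewrite !ffunE; apply: fA.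
by have /forallP/(_ y)/implyP := gA x; apply.
Qed.

Lemma iso_sym (G H : sgraph) : iso G H -> iso H G.
Proof.
case=> f [[g fK gK] fA]; exists g; split; first by exists f.
by move=> x y; rewrite -fA !gK.
Qed.

Lemma iso_contains (G H F : sgraph) : iso G H -> contains G F = contains H F.
Proof.
move=> h; apply/idP/idP; [case: h|case: (iso_sym h)] => f [fb fA]; apply: contains_mono (bij_inj fb) _ => x y; by rewrite fA.
Qed.

Lemma iso_card (G H : sgraph) : iso G H -> #|G| = #|H|.
Proof. by case=> f [fb _]; apply: bij_eq_card fb. Qed.

Lemma iso_edges (G H : sgraph) : iso G H -> #|edges G| = #|edges H|.
Proof.
case=> f [fb fA]; apply: double_inj; rewrite -!handshake.
rewrite [RHS](reindex f) /=; last exact: onW_bij.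
apply: eq_bigr => v _; rewrite -(card_imset (nbr v) (bij_inj fb)); apply: eq_card => u.
have [g fK gK] := fb; rewrite -(gK u); apply/idP/idP.
  by case/imsetP=> w; rewrite !in_nbr => vw ->; rewrite fA.
by rewrite in_nbr fA => h; apply: imset_f; rewrite in_nbr.
Qed.

Lemma labelled_iso (G : sgraph) : exists E, iso G (@labelled_graph #|G| E).
Proof.
pose E := [set e : {set 'I_#|G|} | [exists x : G, exists y : G, adj x y && (e == [set enum_rank x; enum_rank y])]].
exists E, (@enum_rank G); split; first exact: enum_rank_bij.
have aE (a b : labelled_graph E) : adj a b = (a != b) && (([set a; b] \in E) || ([set b; a] \in E)) by [].
move=> x y; rewrite aE [[set enum_rank y; _]]setUC orbb (inj_eq enum_rank_inj).
have [->|xy] := eqVneq x y; first by rewrite adj_irrefl.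
rewrite /= inE; apply/existsP/idP => [[a /existsP[b /andP[ab /eqP]]]|h]; last first.
  by exists x; apply/existsP; exists y; rewrite h eqxx.
case/set2_eq; first by rewrite (inj_eq enum_rank_inj).
  by case=> /enum_rank_inj -> /enum_rank_inj ->.
by case=> /enum_rank_inj -> /enum_rank_inj ->; rewrite adjC.
Qed.

(** Frees extremality from labelled graphs: comparison with all graphs on [n] vertices, whatever
    their vertex type. *)
Lemma extremalP n (F G : sgraph) : extremal n F G <->
  [/\ #|G| = n, ~~ contains G F &
      forall G' : sgraph, #|G'| = n -> ~~ contains G' F -> #|edges G'| <= #|edges G|].
Proof.
have le (G' : sgraph) : #|G'| = n -> ~~ contains G' F -> #|edges G'| <= ex n F.
  move=> <- noF; have [E h] := labelled_iso G'; rewrite (iso_edges h).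
  by apply: (@leq_bigmax_cond _ _ (fun E => #|edges (labelled_graph E)|)); rewrite -(iso_contains F h).
split=> [[cG noF eG]|[cG noF h]]; split=> //.
  by move=> G' cG' noF'; rewrite eG; apply: le.
apply/eqP; rewrite eqn_leq le //=; apply/bigmax_leqP => E hE; apply: h => //.
by rewrite card_ord.
Qed.

Section Delete.
Variables (G : sgraph) (x : G).

Definition del_rel : rel {v : G | v != x} := fun u v => adj (val u) (val v).
Lemma del_sym : symmetric del_rel. Proof. by move=> u v; apply: adj_sym. Qed.
Lemma del_irrefl : irreflexive del_rel. Proof. by move=> u; apply: adj_irrefl. Qed.
Definition del := SGraph del_sym del_irrefl.

Lemma card_del : #|G| = #|del|.+1.
Proof.
have -> : #|del| = #|predC1 x| := card_sig _.
by rewrite cardC1 prednK //; apply/card_gt0P; exists x.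
Qed.

Lemma contains_del F : contains del F -> contains G F.
Proof. by apply: (@contains_mono del G F val) => //; apply: val_inj. Qed.

Lemma edges_del : #|edges G| = #|edges del| + #|nbr x|.
Proof.
apply: double_inj; rewrite doubleD -!handshake (bigD1 x) //=.
have e1 : \sum_(v : G | v != x) #|nbr v| = \sum_(v : del) #|nbr (val v : G)|.
  rewrite (reindex_omap (val : del -> G) insub) /=; last by move=> v vx; rewrite insubT.
  by apply: eq_bigl => v; rewrite valK eqxx andbT (valP v).
have e2 (v : del) : #|nbr (val v : G)| = #|nbr v| + adj x (val v).
  rewrite (cardsD1 x) in_nbr adjC addnC; congr (_ + _).
  rewrite -(card_imset _ val_inj); apply: eq_card => u; rewrite !inE.
  apply/andP/imsetP => [[ux vu]|[w]]; last by rewrite inE => vw ->; rewrite (valP w).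
  by exists (Sub u ux); rewrite ?inE.
have e3 : \sum_(v : del) adj x (val v) = #|nbr x|.
  rewrite -dgT dgE (big_setD1 x) ?inE //= adj_irrefl add0n.
  rewrite [RHS](reindex_omap (val : del -> G) insub) /=; last by move=> v; rewrite !inE andbT => vx; rewrite insubT.
  by apply: eq_bigl => v; rewrite valK eqxx !inE !andbT (valP v).
by rewrite e1 (eq_bigr _ (fun v _ => e2 v)) big_split /= e3 addnC -addnn addnA.
Qed.
End Delete.

(* [g n] is the surplus gained by passing from [n] to [n.-1] vertices. *)
Lemma deletion (F : sgraph) (f g : nat -> nat) m :
  (forall G : sgraph, m < #|G| -> ~~ contains G F -> f #|G| < #|edges G| ->
     exists x : G, #|nbr x| + f #|G|.-1 + g #|G| <= f #|G|) ->
  forall n (G : sgraph), m <= n -> #|G| = n -> ~~ contains G F -> f n < #|edges G| ->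
    #|edges G| + \sum_(m.+1 <= i < n.+1) g i <= f n + m * m.
Proof.
move=> h; elim=> [|n IH] G mn cG noF he.
  move: mn; rewrite leqn0 => /eqP m0; have : #|edges G| = 0.
    apply/eqP; rewrite -double_eq0 -handshake big1 // => v _.
    by have : #|nbr v| <= #|G| := max_card _; rewrite cG leqn0 => /eqP.
  by move: he => + E; rewrite E.
have [E|lt] : m = n.+1 \/ m <= n by move: mn; rewrite leq_eqVlt => /orP[/eqP|]; [left|right].
  rewrite E big_geq // addn0; apply: leq_trans (leq_addl _ _).
  have : (#|edges G|).*2 <= n.+1 * n.+1.
    rewrite -handshake -cG -sum_nat_const; apply: leq_sum => v _; exact: max_card.
  by move: (n.+1 * _) => N; rewrite -addnn; clear; lia.
have [||x hx] := h G _ noF; rewrite ?cG //; rewrite cG /= in hx.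
have cd : #|del x| = n by have := card_del x; rewrite cG => -[].
have nd : ~~ contains (del x) F by apply: contra noF; apply: contains_del.
have ed := edges_del x.
rewrite big_nat_recr //=; have := IH (del x) lt cd nd.
move: he hx; rewrite ed; move: #|edges (del x)| #|nbr x| (f n) (f n.+1) (g n.+1) (\sum_(_ <= _ < _) _) (m * m).
by clear; lia.
Qed.

Section HShape.
Variables (n p s : nat).
Hypothesis p0 : 0 < p.
Notation H := (Hgraph n p s).

Definition hcol (v : H) : option 'I_p :=
  match v with inl _ => None | inr x => Some (Ordinal (ltn_pmod (nat_of_ord x) p0)) end.

Lemma hcolE (x y : 'I_(n - (s - 1))) : (hcol (inr x) == hcol (inr y)) = (x == y %[mod p]).
Proof. by apply/eqP/eqP => [[]|E] //; congr Some; apply: val_inj. Qed.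

Lemma Hgraph_adj (u v : H) : adj u v = badj hcol u v.
Proof.
rewrite /adj /= /simple_rel /badj; have [//|uv] := eqVneq u v.
case: u uv => [i|x]; case: v => [j|y] uv //=.
  have nij : i != j by apply: contra uv => /eqP ->.
  by rewrite /adj /= /simple_rel nij.
have nxy : x != y by apply: contra uv => /eqP ->.
rewrite -/(hcol (inr x)) -/(hcol (inr y)) (hcolE x y) [simple_rel _ y x]simple_rel_sym orbb /simple_rel nxy /=.
by rewrite [y == x %[mod p]]eq_sym orbb.
Qed.

Lemma hcolN : #|[set v | hcol v == None]| = s - 1.
Proof.
rewrite -[RHS]card_ord -(card_imset predT (@inl_inj 'I_(s - 1) 'I_(n - (s - 1)))).
apply: eq_card => -[i|x]; rewrite !inE /=; first by rewrite imset_f.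
by apply/esym/negbTE/imsetP => -[].
Qed.

Lemma hcolC i : #|[set v | hcol v == Some i]| = (n - (s - 1)) %/ p + (i < (n - (s - 1)) %% p).
Proof.
rewrite -card_mod // -(card_imset [set x | _] (@inr_inj 'I_(s - 1) 'I_(n - (s - 1)))).
apply: eq_card => -[j|x]; rewrite !inE /=; first by apply/esym/negbTE/imsetP => -[].
rewrite (mem_imset _ _ (@inr_inj _ _)) inE.
by apply/eqP/eqP => [[<-]|E] //; apply: congr1; apply: val_inj.
Qed.

Lemma card_H : s - 1 <= n -> #|H| = n.
Proof. by move=> h; rewrite card_sum !card_ord subnKC. Qed.

Lemma H_shape : s - 1 <= n -> eshape false (s - 1) hcol (set0 : {set H}).
Proof.
move=> sn; split=> //; first exact: hcolN.
  by move=> i; rewrite card_H // hcolC; case: (_ < _); rewrite ?addn1 ?addn0; [right|left].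
move=> u v; rewrite Hgraph_adj; case: (_ =P set0) => [/setP/(_ u)|]; last by rewrite andbF orbF.
by rewrite !inE eqxx.
Qed.

Lemma Hprime_shape (x y : turan_graph (n - (s - 1)) p) : s - 1 <= n -> x != y -> val x = val y %[mod p] ->
  let G := @add_edges H [set [set inr x; inr y]] in
  @eshape p true (s - 1) G hcol [set inr x; inr y].
Proof.
move=> sn xy E G; split; first exact: hcolN.
- by move=> i; rewrite card_H // hcolC; case: (_ < _); rewrite ?addn1 ?addn0; [right|left].
- by exists (inr x), (inr y); split=> //; apply/eqP; rewrite hcolE E.
move=> u v.
have -> : @adj G u v = (u != v) && ((@adj H u v || ([set u; v] \in [set [set inr x; inr y]])) ||
    (@adj H v u || ([set v; u] \in [set [set inr x; inr y]]))) by [].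
have -> : badj hcol u v = (u != v) && @adj H u v.
  by rewrite Hgraph_adj /badj andbA andbb.
rewrite (@adj_sym H v u) -andb_orr !inE [[set v; u]]setUC; case: (u != v) => //=.
by rewrite orbb.
Qed.
End HShape.

Section ToH.
Variables (p s : nat) (b : bool) (G : sgraph) (c : G -> option 'I_p) (e : {set G}).
Hypotheses (p0 : 0 < p) (hS : @eshape p b s G c e).
Notation H := (Hgraph #|G| p (s + 1)).

Lemma shape_s : s <= #|G|.
Proof. by rewrite -(shapeN hS) max_card. Qed.

Lemma fiber_sum (T : finType) (d : T -> option 'I_p) :
  #|[set v | d v == None]| + \sum_i #|[set v | d v == Some i]| = #|T|.
Proof.
rewrite -[RHS]sum1_card (partition_big d predT) //= (bigD1 None) //=.
have h j : \sum_(v | d v == j) 1 = #|[set v | d v == j]| by rewrite -sum1_card; apply: eq_bigl => v; rewrite inE.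
rewrite h; congr (_ + _); rewrite (reindex_omap Some id) /=; last by case.
by apply: eq_big => [i|i _]; rewrite ?eqxx // h.
Qed.

(** Both graphs have the same multiset of class sizes, but in different orders; hence the
    permutation [pi] of the colours, which fixes [None]. *)
Lemma shape_bij : exists (f : G -> H) (pi : option 'I_p -> option 'I_p),
  [/\ bijective f, injective pi, pi None = None & forall v, hcol p0 (f v) = pi (c v)].
Proof.
have sH : s + 1 - 1 = s by rewrite addnK.
have sn := shape_s.
have [] := @balanced_bij p ((#|G| - s) %/ p) (fun i => #|[set v | c v == Some i]|)
    (fun i => #|[set v : H | hcol p0 v == Some i]|).
- exact: (shapeC hS).
- by move=> i; rewrite hcolC sH; case: (_ < _); rewrite ?addn1 ?addn0; [right|left].
- apply/eqP; rewrite -(eqn_add2l s) -{1}(shapeN hS) fiber_sum -{1}sH -(hcolN #|G| (s + 1) p0) fiber_sum.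
  by rewrite card_H // sH.
move=> r rb hr; have rI := bij_inj rb; pose pi := omap r.
have piI : injective pi by move=> [i|] [j|] //= [/rI ->].
have [|f fb hf] := @fiber_bij G H (option 'I_p) (pi \o c) (hcol p0).
  case=> [j|].
    have [r' rK r'K] := rb; rewrite -(r'K j) hr; apply: eq_card => v; rewrite !inE /=.
    by rewrite -(inj_eq piI (c v) (Some _)) /=.
  rewrite hcolN sH -(shapeN hS); apply: eq_card => v; rewrite !inE /=.
  by case: (c v).
by exists f, pi; split.
Qed.

Lemma badj_map (T T' : eqType) (d : T -> option 'I_p) (d' : T' -> option 'I_p) (f : T -> T') pi u v :
  injective f -> injective pi -> pi None = None -> (forall v, d' (f v) = pi (d v)) ->
  badj d' (f u) (f v) = badj d u v.
Proof.
move=> fI piI pN h; rewrite /badj (inj_eq fI) !h (inj_eq piI) -{1}pN (inj_eq piI).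
by [].
Qed.

Lemma shape_is_H : b = false -> is_H #|G| p (s + 1) G.
Proof.
move=> b0; have [f [pi [fb piI pN hf]]] := shape_bij.
exists f; split=> // u v; rewrite (Hgraph_adj p0) (badj_map u v (bij_inj fb) piI pN hf) (shapeA hS).
have := shapeE hS; rewrite b0 => ->; case: (_ =P set0) => [/setP/(_ u)|]; last by rewrite andbF orbF.
by rewrite !inE eqxx.
Qed.

Lemma shape_is_Hprime : b = true -> is_Hprime #|G| p (s + 1) G.
Proof.
move=> b1; have [f [pi [fb piI pN hf]]] := shape_bij; have fI := bij_inj fb.
have := shapeE hS; rewrite b1 => -[x [y [xy cxy cx Ee]]].
have isr v : c v != None -> exists z, f v = inr z.
  move=> cv; case E: (f v) => [i|z]; last by exists z.
  have := hf v; rewrite E /= => /esym; rewrite -pN => /piI E'.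
  by rewrite E' in cv.
have [x' fx] := isr x cx; have [y' fy] := isr y ltac:(by rewrite -cxy).
exists x', y'; split.
- by apply: contra xy => /eqP E; rewrite -(inj_eq fI) fx fy E.
- by apply/eqP; rewrite -(hcolE p0) -fx -fy !hf cxy.
have exy u v : ([set f u; f v] == [set inr x'; inr y']) = ([set u; v] == [set x; y]).
  have him a d : [set f a; f d] = f @: [set a; d] by rewrite imsetU1 imset_set1.
  by rewrite -fx -fy !him (inj_eq (imset_inj fI)).
exists f; split=> // u v.
have -> : @adj (@add_edges H [set [set inr x'; inr y']]) (f u) (f v) =
  (f u != f v) && ((@adj H (f u) (f v) || ([set f u; f v] \in [set [set inr x'; inr y']])) ||
    (@adj H (f v) (f u) || ([set f v; f u] \in [set [set inr x'; inr y']]))) by [].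
rewrite !inE (@adj_sym H (f v)) [[set f v; _]]setUC orbb.
rewrite exy (Hgraph_adj p0) (badj_map u v fI piI pN hf) (shapeA hS) Ee (inj_eq fI).
by rewrite /badj; case: (u != v).
Qed.
End ToH.

Lemma tur_low p N : 0 < p -> p.-1 * N * N <= p * (2 * tur p N) + p * p.
Proof.
move=> p0; have := turE N p0; have := divn_eq N p; have := ltn_pmod N p0.
move: (N %/ p) (N %% p) (tur p N) => q r t rp E h.
have : p * (2 * t) + p * ((2 * q + 1) * N) = p * (N * N) + p * (p * q * (q + 1)) by rewrite -!mulnDr h.
case: p p0 rp E {h} => // p _ rp E; rewrite /= E mulnC => h.
have : r * r + p.+1 * p.+1 >= p.+1 * r by apply: leq_trans (leq_addl _ _); rewrite leq_mul2l ltnW ?orbT.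
move: h; clear; lia.
Qed.

(** * Part (i): from large minimum degree to all graphs *)

Section PartI.
Variables (p k : nat).
Hypotheses (hp : 2 <= p) (hk : 3 <= k) (kp : (k, p) <> (3, 2)).
Notation F := (blowup (cycle_graph k) (p + 1)).
Notation s1 := ((k - 1) %/ 2).
Notation b := (~~ odd k).
Notation f n := (fv b p s1 n).

Lemma fv_step n : s1 < n -> f n = f n.-1 + (s1 + (n.-1 - s1 - (n.-1 - s1) %/ p)).
Proof.
case: n => // n sn; have tE : tur p (n - s1).+1 = tur p (n - s1) + (n - s1 - (n - s1) %/ p).
  by rewrite /tur big_ord_recr.
rewrite /fv subSn // tE /= mulnS.
by move: (n - s1 - _) (tur p _) (s1 * _) (tri s1) (nat_of_bool b); clear; lia.
Qed.

Lemma fv_low n : s1 <= n -> p.-1 * n * n + 2 * s1 * n <= p * (2 * f n) + (p * p + (p + 1) * (s1 * s1)).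
Proof.
move=> sn; rewrite /fv -{1 2 3}(subnKC sn); have := @tur_low p (n - s1) (ltnW hp).
move: s1 (n - s1) (tur p (n - s1)) (tri s1) (nat_of_bool b) => s N t r c.
by case: p hp => // p' _ /=; clear; lia.
Qed.

Lemma upper_mindeg : exists n0, forall G : sgraph, n0 <= #|G| -> ~~ contains G F ->
  (forall x : G, f #|G| <= f #|G|.-1 + #|nbr x|) -> f #|G| <= #|edges G| ->
  #|edges G| = f #|G| /\ exists c e, @eshape p b s1 G c e.
Proof.
(* The constant [p] absorbs the rounding in the increments of [f], the other one is the error term
   of [fv_low]. *)
have [n0 H] := structure hp hk kp p (p * p + (p + 1) * (s1 * s1)).
exists (n0 + s1.+1) => G hn noF hd he.
have sn : s1 < #|G| by apply: leq_trans hn; apply: leq_addl.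
have [||//||col [A [P [mu [hA HF Pc hN hR]]]]] := H G.
- by apply: leq_trans hn; apply: leq_addr.
- move=> v; have := hd v; rewrite (fv_step sn) leq_add2l.
  have h1 := leq_trunc_div (#|G|.-1 - s1) p.
  have e : #|G| = (#|G|.-1 - s1) + s1.+1 by move: sn; move: #|G| s1; clear; lia.
  have -> : p.-1 * #|G| = p.-1 * ((#|G|.-1 - s1) + s1.+1) by rewrite -e.
  move: h1; move: s1 (#|G|.-1 - s1) ((#|G|.-1 - s1) %/ p) #|nbr v| => s N q d h1 h2.
  have h3 : p * (s + (N - q)) <= p * d by rewrite leq_mul2l h2 orbT.
  move: h3 h1; rewrite mulnDr mulnBr; case: p hp => // p' _ /=; rewrite mulnDr !mulSn !mulnS (mulnC q).
  by move: (p' * N) (p' * q) (p' * s) (p' * d); clear; lia.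
- apply: leq_trans (fv_low (ltnW sn)) _; rewrite leq_add2r handshake -mul2n !leq_mul2l he !orbT.
  by [].
have [h1 h2] := exact_shape hp hk kp noF hA HF hN hR.
have E : #|edges G| = f #|G| by apply/eqP; rewrite eqn_leq h1 he.
by split=> //; apply: h2.
Qed.

(** Above [f n] edges, every deletion of a vertex of too small degree raises the surplus by at least
    1. At size [m] it would exceed [m * m], and a graph without such a vertex is covered by
    [upper_mindeg]. *)
Lemma upper : exists n0, forall G : sgraph, n0 <= #|G| -> ~~ contains G F ->
  #|edges G| <= f #|G| /\ (#|edges G| = f #|G| -> exists c e, @eshape p b s1 G c e).
Proof.
have [m H] := upper_mindeg.
have D := @deletion F (fun n => f n) (fun=> 1) m.
have le n (G : sgraph) : m + m * m <= n -> #|G| = n -> ~~ contains G F -> #|edges G| <= f n.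
  move=> hn cG noF; rewrite leqNgt; apply/negP => lt.
  have mn : m <= n by apply: leq_trans hn; apply: leq_addr.
  have := D _ n G mn cG noF lt; rewrite sum_nat_const_nat muln1 => h.
  have : #|edges G| + (n.+1 - m.+1) <= f n + m * m.
    apply: h => G' mG' noF' lt'.
    have [/forallP h|] := boolP [forall x : G', f #|G'| <= f #|G'|.-1 + #|nbr x|].
      by have [E _] := H G' (ltnW mG') noF' h (ltnW lt'); rewrite E ltnn in lt'.
    rewrite negb_forall => /existsP[x]; rewrite -ltnNge => h; exists x.
    by rewrite addn1 addnC.
  by move: hn lt; move: #|edges G| (m * m) (f n); clear; lia.
(* One more than the bound itself requires: in the equality case a vertex of too small degree is
   deleted, and the bound is applied to the smaller graph. *)
exists (m + m * m).+1 => G hn noF; split; first by apply: le => //; apply: ltnW.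
move=> E; have [/forallP h|] := boolP [forall x : G, f #|G| <= f #|G|.-1 + #|nbr x|].
  have mn : m <= #|G| by apply: leq_trans (ltnW hn); apply: leq_addr.
  by case: (H G mn noF h); rewrite ?E.
rewrite negb_forall => /existsP[x]; rewrite -ltnNge => h.
have cd := card_del x; have nd : ~~ contains (del x) F by apply: contra noF; apply: contains_del.
have := le #|G|.-1 (del x); rewrite cd /= => /(_ _ erefl nd); have := edges_del x.
rewrite cd in hn h; rewrite E cd => ed /(_ hn).
by move: ed h => /=; move: (f _) (f _) #|nbr x| #|edges (del x)|; clear; lia.
Qed.

Lemma part_i : exists n0, forall n, n0 <= n ->
  let s := (k - 1) %/ 2 + 1 in
  (odd k -> unique_extremal n F (is_H n p s)) /\ (~~ odd k -> unique_extremal n F (is_Hprime n p s)).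
Proof.
have [n0 H] := upper; have p0 := ltnW hp.
exists (n0 + s1 + p + 1) => n hn s.
have n0n : n0 <= n by move: hn; clear; lia.
have sn : s1 <= n by move: hn; move: s1; clear; lia.
have sE : s - 1 = s1 by rewrite addnK.
have free (W : sgraph) c e : @eshape p b s1 W c e -> ~~ contains W F.
  by move=> hS; apply: (shape_free p0 hS hk); move: hk; clear; case: (boolP (odd k)) => /=; lia.
have main (W : sgraph) (c : W -> option 'I_p) e (Fam : sgraph -> Prop) : #|W| = n -> eshape b s1 c e ->
    (forall G : sgraph, #|G| = n -> (exists c e, @eshape p b s1 G c e) -> Fam G) ->
    (forall G, Fam G -> exists (W' : sgraph) c e, [/\ #|W'| = n, @eshape p b s1 W' c e & iso G W']) ->
    unique_extremal n F Fam.
  move=> cW hW f1 f2 G; rewrite extremalP; split=> [[cG noF mx]|FG].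
    apply: f1 => //; have [h1 h2] := H G ltac:(by rewrite cG) noF; apply: h2.
    apply/eqP; rewrite eqn_leq h1 cG -cW -(shape_edges p0 hW); apply: mx => //; exact: free hW.
  have [W' [c' [e' [cW' hW' iW']]]] := f2 G FG; split.
  - by rewrite (iso_card iW').
  - by rewrite (iso_contains F iW'); apply: free hW'.
  move=> G' cG' noF'; rewrite (iso_edges iW') (shape_edges p0 hW') cW' -cG'.
  by case: (H G' ltac:(by rewrite cG') noF').
have cH : #|Hgraph n p s| = n by rewrite card_H ?sE.
split=> par.
  have hS : @eshape p b s1 (Hgraph n p s) (hcol p0) set0 by rewrite par -sE; apply: H_shape; rewrite sE.
  apply: (main _ _ _ _ cH hS) => G cG; last by exists (Hgraph n p s), (hcol p0), set0.
  by case=> c [e hG]; rewrite -cG; apply: (shape_is_H p0 hG); rewrite par.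
have hx x y : x != y -> val x = val y %[mod p] ->
    @eshape p b s1 (@add_edges (Hgraph n p s) [set [set inr x; inr y]]) (hcol p0) [set inr x; inr y].
  by move=> xy E; rewrite par -sE; apply: Hprime_shape; rewrite ?sE.
have [x [y [xy E]]] : exists x y : turan_graph (n - (s - 1)) p, x != y /\ val x = val y %[mod p].
  have h0 : 0 < n - (s - 1) by rewrite sE; move: hn; move: s1; clear; lia.
  have h1 : p < n - (s - 1) by rewrite sE; move: hn; move: s1; clear; lia.
  exists (Ordinal h0), (Ordinal h1); split; last by rewrite /= modnn mod0n.
  by rewrite -val_eqE /= eq_sym -lt0n.
apply: (main (@add_edges (Hgraph n p s) [set [set inr x; inr y]]) _ _ _ cH (hx x y xy E)) => G.
  by move=> cG [c [e hG]]; rewrite -cG; apply: (shape_is_Hprime p0 hG).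
case=> x' [y' [xy' E' iG]].
by exists (@add_edges (Hgraph n p s) [set [set inr x'; inr y']]), (hcol p0), [set inr x'; inr y']; split=> //; apply: hx.
Qed.
End PartI.

(** * The case of [C_3^3] *)

(** Hall's theorem for three sets, by cases. *)
Lemma sdr3 (T : finType) (X Y Z : {set T}) : X != set0 -> Y != set0 -> Z != set0 ->
  1 < #|X :|: Y| -> 1 < #|Y :|: Z| -> 1 < #|X :|: Z| -> 2 < #|X :|: Y :|: Z| ->
  exists x y z, [/\ x \in X, y \in Y, z \in Z & uniq [:: x; y; z]].
Proof.
move=> X0 Y0 Z0 XY YZ XZ XYZ.
have two (A : {set T}) x : 1 < #|A| -> exists2 y, y \in A & y != x.
  move=> h; have : 0 < #|A :\ x| by rewrite -ltnS; apply: leq_trans h _; rewrite (cardsD1 x A) -add1n leq_add2r leq_b1.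
  by case/card_gt0P=> y; rewrite !inE => /andP[yx yA]; exists y.
have [x [y [xX yY xy]]] : exists x y, [/\ x \in X, y \in Y & x != y].
  have /set0Pn[x xX] := X0; have /set0Pn[y yY] := Y0.
  have [E|xy] := eqVneq x y; last by exists x, y.
  have [z zXY zx] := two _ x XY; move: zXY; rewrite inE => /orP[zX|zY].
    by exists z, y; split=> //; rewrite -E.
  by exists x, z; split=> //; rewrite eq_sym.
have fin x' y' z' : x' \in X -> y' \in Y -> z' \in Z -> x' != y' -> x' != z' -> y' != z' ->
    exists x y z, [/\ x \in X, y \in Y, z \in Z & uniq [:: x; y; z]].
  by move=> *; exists x', y', z'; split=> //; rewrite /= !inE negb_or; apply/and3P; split=> //; apply/andP.
have [t tU txy] : exists2 t, t \in X :|: Y :|: Z & t \notin [set x; y].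
  apply/subsetPn; apply: contraTN XYZ => /subset_leq_card; rewrite cards2 xy -leqNgt.
  by [].
move: txy; rewrite !inE negb_or => /andP[tx ty].
have [tZ|tZ] := boolP (t \in Z); first by apply: (fin x y t) => //; rewrite eq_sym.
have /set0Pn[z zZ] := Z0.
have [zx|zx] := eqVneq z x; last first.
  have [zy|zy] := eqVneq z y; last by apply: (fin x y z) => //; rewrite eq_sym.
  subst z; move: tU; rewrite !inE (negPf tZ) orbF => /orP[tX|tY]; last by apply: (fin x t y) => //; rewrite eq_sym.
  have [xZ|xZ] := boolP (x \in Z); first by apply: (fin t y x) => //; rewrite eq_sym.
  have [y' + y'y] := two _ y YZ; rewrite inE => /orP[y'Y|y'Z].
    have [E|xy'] := eqVneq x y'; last by apply: (fin x y' y).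
    by apply: (fin t y' y) => //; rewrite -E.
  have [E|y'x] := eqVneq y' x; first by rewrite -E y'Z in xZ.
  by apply: (fin x y y') => //; rewrite eq_sym.
subst z; move: tU; rewrite !inE (negPf tZ) orbF => /orP[tX|tY]; first by apply: (fin t y x) => //; rewrite eq_sym.
have [yZ|yZ] := boolP (y \in Z); first by apply: (fin x t y) => //; rewrite eq_sym.
have [x' + x'x] := two _ x XZ; rewrite inE => /orP[x'X|x'Z].
  have [E|yx'] := eqVneq y x'; last by apply: (fin x' y x) => //; rewrite eq_sym.
  by apply: (fin x' t x) => //; rewrite -E // eq_sym.
have [E|x'y] := eqVneq x' y; first by rewrite -E x'Z in yZ.
by apply: (fin x y x') => //; rewrite eq_sym.
Qed.

Notation F33 := (blowup (cycle_graph 3) 3).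

Lemma contains33 (G : sgraph) (a b c x y z : G) : adj a b -> adj b c -> adj c a ->
  adj x a -> adj x b -> adj y b -> adj y c -> adj z c -> adj z a -> uniq [:: a; b; c; x; y; z] ->
  contains G F33.
Proof.
move=> ab bc ca xa xb yb yc zc za un.
apply: (@ring_contains G 2 3 isT isT a [:: ([:: x], b); ([:: y], c); ([:: z], a)]) => //.
  by rewrite /= /cliq /= !(adjC _ x) !(adjC _ y) !(adjC _ z) ab bc ca xa xb yb yc zc za ?eqxx.
by uq un.
Qed.

Lemma contains33P (G : sgraph) : contains G F33 -> exists a b c x y z : G,
  [/\ [/\ adj a b, adj b c & adj c a], [/\ adj x a, adj x b & adj y b], [/\ adj y c, adj z c & adj z a] &
      uniq [:: a; b; c; x; y; z]].
Proof.
case/existsP=> f /andP[/injectiveP fI /forallP fA].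
have fadj (u v : F33) : adj u v -> adj (f u) (f v) by move=> h; have /forallP/(_ v)/implyP := fA u; apply.
have k3 : 2 < 3 by [].
pose E (i : cycle_graph 3) : {e : {set cycle_graph 3} | e \in edges (cycle_graph 3)} := Sub [set i; ordS i] (eset_edge k3 i).
pose i0 : 'I_3 := ord0; pose i1 : 'I_3 := ordS i0; pose i2 : 'I_3 := ordS i1.
have i20 : ordS i2 = i0 by apply: val_inj.
pose a : F33 := inl i0; pose b : F33 := inl i1; pose c : F33 := inl i2.
pose x : F33 := inr (E i0, ord0); pose y : F33 := inr (E i1, ord0); pose z : F33 := inr (E i2, ord0).
exists (f a), (f b), (f c), (f x), (f y), (f z).
have aS (i : 'I_3) : @adj F33 (inl i) (inl (ordS i)).
  by rewrite /adj /= /simple_rel (inj_eq (@inl_inj _ _)) (ordS_neq k3) /= /simple_rel (ordS_neq k3) eqxx.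
have aE (i : 'I_3) : @adj F33 (inr (E i, ord0)) (inl i) by rewrite /adj /= /simple_rel /= set21.
have aE' (i : 'I_3) : @adj F33 (inr (E i, ord0)) (inl (ordS i)) by rewrite /adj /= /simple_rel /= set22.
split; [split|split|split|]; try (by apply: fadj; first [exact: aS | exact: aE | exact: aE']).
- by apply: fadj; have := aS i2; rewrite i20.
- by apply: fadj; have := aE' i2; rewrite i20.
have Eij i j : (E i == E j) = (i == j).
  by rewrite -val_eqE /= (inj_eq (@eset_inj 3 k3)).
rewrite (map_inj_uniq fI [:: a; b; c; x; y; z]).
have nab : [&& i0 != i1, i0 != i2 & i1 != i2] by [].
have nI (i j : 'I_3) : i != j -> (inl i : F33) != inl j by move=> ij; apply: contra ij => /eqP[->].
have nE (i j : 'I_3) : i != j -> (inr (E i, ord0) : F33) != inr (E j, ord0).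
  rewrite -Eij => ij; apply: contra ij => /eqP h; apply/eqP.
  by have := congr1 (fun w : F33 => if w is inr (e, _) then e else E i) h.
have nM (i j : 'I_3) : (inl i : F33) != inr (E j, ord0) by [].
have un (u1 u2 u3 u4 u5 u6 : F33) : u1 != u2 -> u1 != u3 -> u2 != u3 -> u4 != u5 -> u4 != u6 -> u5 != u6 ->
    u1 != u4 -> u1 != u5 -> u1 != u6 -> u2 != u4 -> u2 != u5 -> u2 != u6 -> u3 != u4 -> u3 != u5 -> u3 != u6 ->
    uniq [:: u1; u2; u3; u4; u5; u6].
  by rewrite /= !inE !negb_or; do 15!move=> ->.
by apply: un; rewrite ?nI ?nE.
Qed.

(** * Triangles and the common neighbours of their sides *)

Section Tri.
Variables (G : sgraph) (dl : nat).
Notation n := #|G|.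
Hypotheses (noF : ~~ contains G F33) (hd : forall v : G, dl <= #|nbr v|) (hdl : n + 7 < 3 * dl).
Implicit Types (a b c u v w x y z : G).

(** The candidates for the new vertex on the side [u v] of the triangle [u v w]. *)
Definition TT u v w := (nbr u :&: nbr v) :\ w.

Lemma TTC u v w : TT u v w = TT v u w. Proof. by rewrite /TT setIC. Qed.

Lemma in_TT u v w x : (x \in TT u v w) = [&& x != w, adj u x & adj v x].
Proof. by rewrite !inE. Qed.

(** A vertex off the triangle that lies outside the union sees at most one of [a], [b], [c], so the
    three degrees add up to at most [n + 3] plus twice the size of the union. This is the origin of
    [n + 7] in [hdl]. *)
Lemma union3 a b c : adj a b -> adj b c -> adj c a -> 2 < #|TT a b c :|: TT b c a :|: TT a c b|.
Proof.
move=> ab bc ca; set U := _ :|: _ :|: _; rewrite ltnNge; apply/negP => hU.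
have h : \sum_v (adj a v + adj b v + adj c v) <= \sum_v (1 + ((v == a) + (v == b) + (v == c)) + ((v \in U) + (v \in U))).
  apply: leq_sum => v _; rewrite /U !in_setU !in_TT.
  have [->|va] := eqVneq v a; first by rewrite adj_irrefl (adjC b a) ab ca; case: (_ == b); case: (_ == c).
  have [->|vb] := eqVneq v b; first by rewrite adj_irrefl ab (adjC c b) bc; case: (_ == c).
  have [->|vc] := eqVneq v c; first by rewrite adj_irrefl bc (adjC a c) ca.
  by case: (adj a v); case: (adj b v); case: (adj c v).
have one w : \sum_(v : G) (v == w) = 1 by rewrite (bigD1 w) //= eqxx big1 // => v /negPf ->.
have dE w : \sum_v adj w v = #|nbr w|.
  by rewrite -dgT dgE; apply: eq_bigl => v; rewrite inE.
have cU : \sum_v (v \in U) = #|U|.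
  by rewrite -sum1_card [in RHS]big_mkcond; apply: eq_bigr => v _; case: (v \in U).
move: h; rewrite !big_split /= !one !dE cU sum1_card => h.
by have := hd a; have := hd b; have := hd c; move: h hU hdl; move: n #|nbr a| #|nbr b| #|nbr c| #|U|; clear; lia.
Qed.

(** Hall's condition must fail. It holds for single sets by assumption and for all three by
    [union3], so it fails for two of them. *)
Lemma tri_cases a b c : adj a b -> adj b c -> adj c a -> TT a b c != set0 -> TT b c a != set0 -> TT a c b != set0 ->
  [\/ #|TT a b c :|: TT a c b| <= 1, #|TT a b c :|: TT b c a| <= 1 | #|TT b c a :|: TT a c b| <= 1].
Proof.
move=> ab bc ca n1 n2 n3; have u3 := union3 ab bc ca.
have [h1|h1] := leqP #|TT a b c :|: TT a c b| 1; first by constructor 1.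
have [h2|h2] := leqP #|TT a b c :|: TT b c a| 1; first by constructor 2.
have [h3|h3] := leqP #|TT b c a :|: TT a c b| 1; first by constructor 3.
have [x [y [z [xT yT zT un]]]] := sdr3 n1 n2 n3 h2 h3 h1 u3.
case/negP: noF; move: xT yT zT; rewrite !in_TT => /and3P[xc ax bx] /and3P[ya by' cy] /and3P[zb az cz].
apply: (@contains33 G a b c x y z) => //; try by rewrite adjC.
move: un; rewrite /= !inE !negb_or !andbT => /andP[/andP[-> ->] ->]; rewrite (adj_neq ab) (adj_neq bc) eq_sym (adj_neq ca).
by rewrite (adj_neq ax) (adj_neq az) (adj_neq bx) (adj_neq by') (adj_neq cy) (adj_neq cz) [a == y]eq_sym ya [b == z]eq_sym zb [c == x]eq_sym xc.
Qed.

Lemma common_ge u v : #|nbr u| + #|nbr v| <= n + #|nbr u :&: nbr v|.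
Proof. by rewrite -cardsUI leq_add2r max_card. Qed.

Lemma TT_card u v w : w \in nbr u :&: nbr v -> #|nbr u :&: nbr v| = (#|TT u v w|).+1.
Proof. by move=> h; rewrite (cardsD1 w) h. Qed.
End Tri.

Lemma card_le1_set1 (T : finType) (A B : {set T}) d : #|A :|: B| <= 1 -> d \in A -> A = [set d] /\ B \subset [set d].
Proof.
move=> h dA; have s : A :|: B \subset [set d].
  by apply/subsetP => x xU; rewrite inE; apply/eqP/(card_le1_eqP h) => //; rewrite inE dA.
split; last by apply: subset_trans s; apply: subsetUr.
by apply/eqP; rewrite eqEsubset sub1set dA andbT; apply: subset_trans s; apply: subsetUl.
Qed.

Lemma E2_even (G : sgraph) (S : {set G}) : ~~ odd (E2 S).
Proof.
move: {2}#|S| (leqnn #|S|) => m; elim: m S => [|m IH] S.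
  by rewrite leqn0 cards_eq0 => /eqP ->; rewrite /E2 big_set0.
move=> hS; have [->|/set0Pn[x xS]] := eqVneq S set0; first by rewrite /E2 big_set0.
rewrite (E2_setD1 xS) oddD oddM /= addbF; apply: IH.
by move: hS; rewrite (cardsD1 x S) xS.
Qed.

(** * Even order with all degrees above one half *)

Section Even.
Variables (G : sgraph) (N : nat).
Notation n := #|G|.
Hypotheses (noF : ~~ contains G F33) (hn : n = 2 * N) (hN : 5 <= N) (hd : forall v : G, N.+1 <= #|nbr v|).
Implicit Types (a b c u v w x y z d : G).

Lemma even_dl : n + 7 < 3 * N.+1. Proof. by rewrite hn; move: hN; clear; lia. Qed.

Lemma even_common u v : 2 <= #|nbr u :&: nbr v|.
Proof.
have := common_ge u v; have := hd u; have := hd v; rewrite hn.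
by move: #|nbr u| #|nbr v| #|_ :&: _|; clear; lia.
Qed.

Lemma even_TT u v w : adj u w -> adj v w -> TT u v w != set0.
Proof.
move=> uw vw; rewrite -card_gt0 -ltnS -TT_card ?even_common //.
by rewrite !inE uw.
Qed.

Lemma even_cases a b c : adj a b -> adj b c -> adj c a ->
  [\/ #|TT a b c :|: TT a c b| <= 1, #|TT a b c :|: TT b c a| <= 1 | #|TT b c a :|: TT a c b| <= 1].
Proof.
move=> ab bc ca; apply: (tri_cases noF hd even_dl) => //; apply: even_TT => //; by rewrite adjC.
Qed.

Lemma even_center x y z : adj x y -> adj y z -> adj z x -> #|TT x y z :|: TT x z y| <= 1 ->
  exists d, [/\ nbr x :&: nbr y = [set z; d], nbr x :&: nbr z = [set y; d] & z != d /\ y != d].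
Proof.
move=> xy yz zx h; have /set0Pn[d dT] : TT x y z != set0 by apply: even_TT; rewrite // adjC.
have [E1 s2] := card_le1_set1 h dT.
have /set0Pn[d' d'T] : TT x z y != set0 by apply: even_TT => //; rewrite adjC.
have E2 : TT x z y = [set d].
  apply/eqP; rewrite eqEsubset s2 sub1set; move: (subsetP s2 _ d'T); rewrite inE => /eqP <-.
  exact: d'T.
exists d; split.
- by rewrite -E1 /TT setD1K // !inE (adjC x z) zx yz.
- by rewrite -E2 /TT setD1K // !inE xy (adjC z y) yz.
- have : d \in TT x y z by rewrite E1 inE.
  have : d \in TT x z y by rewrite E2 inE.
  by rewrite !in_TT ![d == _]eq_sym => /and3P[-> _ _] /and3P[-> _ _].
Qed.

(** Two degrees of at least [N + 1] on [2 * N] vertices force two common neighbours; exactly two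
    makes everything tight. *)
Lemma even_deg u v z d : nbr u :&: nbr v = [set z; d] -> #|nbr u| = N.+1 /\ #|nbr v| = N.+1 /\ nbr u :|: nbr v = setT.
Proof.
move=> E; have c2 : #|nbr u :&: nbr v| <= 2 by rewrite E cards2; case: eqP.
have := cardsUI (nbr u) (nbr v); have := max_card (nbr u :|: nbr v); rewrite hn => h1 h2.
have := hd u; have := hd v => h3 h4.
have [e1 e2 e3] : [/\ #|nbr u| = N.+1, #|nbr v| = N.+1 & #|nbr u :|: nbr v| = 2 * N].
  by move: h1 h2 h3 h4 c2; move: #|nbr u| #|nbr v| #|_ :&: _| #|_ :|: _|; clear; split; lia.
split=> //; split=> //; apply/eqP; rewrite eqEcard subsetT /= cardsT e3 hn.
by [].
Qed.

Lemma even_triangle u : exists x y z, [/\ adj x y, adj y z, adj z x, #|TT x y z :|: TT x z y| <= 1 & u \in [:: x; y; z]].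
Proof.
have /card_gt0P[v uv] : 0 < #|nbr u| by apply: leq_trans (hd u).
rewrite in_nbr in uv; have /card_gt0P[w] : 0 < #|nbr u :&: nbr v| by apply: leq_trans (even_common u v).
rewrite !inE => /andP[uw vw]; have wu : adj w u by rewrite adjC.
case: (even_cases uv vw wu) => h.
- by exists u, v, w; rewrite !inE eqxx.
- exists v, u, w; rewrite (adjC v u) (adjC w v) uv uw vw !inE eqxx orbT; split=> //.
  by rewrite TTC.
- exists w, v, u; rewrite (adjC w v) (adjC v u) vw uv uw !inE eqxx !orbT; split=> //.
  by rewrite (TTC w v) (TTC w u).
Qed.

Lemma even_regular u : #|nbr u| = N.+1.
Proof.
have [x [y [z [xy yz zx h]]]] := even_triangle u.
have [d [E1 E2 _]] := even_center xy yz zx h.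
have [dx [dy _]] := even_deg E1; have [_ [dz _]] := even_deg E2.
by rewrite !inE => /or3P[] /eqP ->.
Qed.

(** One side is [B], the neighbourhood of the centre [x] without [d]; the other consists of [d] and
    the non-neighbours of [x], with [x] itself among them. It suffices that a vertex of the latter
    has at most one neighbour on its own side, as regularity then makes it complete to [B]. *)
Lemma even_struct (u0 : G) : exists B : {set G}, [/\ #|B| = N, #|~: B| = N,
  forall u v, u \notin B -> v \in B -> adj u v, forall v, v \in B -> #|nbr v :&: B| = 1 &
  forall v, v \notin B -> #|nbr v :&: ~: B| = 1].
Proof.
have [x [y [z [xy yz zx h _]]]] := even_triangle u0.
have [d [E1 E2 [zd yd]]] := even_center xy yz zx h.
have [dx [dy Uy]] := even_deg E1; have [_ [dz Uz]] := even_deg E2.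
have yx : adj y x by rewrite adjC.
have zy : adj z y by rewrite adjC.
have xz : adj x z by rewrite adjC.
have [xd yd'] : adj x d /\ adj y d by apply/andP; have := set22 z d; rewrite -E1 !inE.
have zd' : adj z d by have := set22 y d; rewrite -E2 !inE => /andP[].
have Wy w : ~~ adj x w -> adj y w.
  by move=> nw; have := in_setT w; rewrite -Uy !inE (negPf nw).
have Wz w : ~~ adj x w -> adj z w.
  by move=> nw; have := in_setT w; rewrite -Uz !inE (negPf nw).
pose W := ~: nbr x.
have cW : #|W|.+1 = N by have := cardsC (nbr x); rewrite -/W dx hn; move: #|W|; clear; lia.
pose B := nbr x :\ d.
have cB : #|B| = N by apply/eqP; rewrite -eqSS -dx (cardsD1 d (nbr x)) in_nbr xd.
have cS : #|~: B| = N by have := cardsC B; rewrite cB hn; clear; lia.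
have SE v : (v \in ~: B) = (v == d) || ~~ adj x v by rewrite !inE negb_and negbK.
have Ny v : v != z -> adj y v = (v \in ~: B).
  move=> vz; rewrite SE; have [->|vd] /= := eqVneq v d; first by rewrite yd'.
  have [xv|xv] /= := boolP (adj x v); last exact: Wy.
  apply/negP => yv; have : v \in nbr x :&: nbr y by rewrite !inE xv.
  by rewrite E1 !inE (negPf vz) (negPf vd).
have zB : z \in B by rewrite !inE zd xz.
have compl w : #|nbr w :&: ~: B| <= 1 -> B \subset nbr w /\ #|nbr w :&: ~: B| = 1.
  move=> h1; have h2 := cardsID B (nbr w); rewrite setDE even_regular in h2.
  have h3 : #|nbr w :&: B| <= #|B| by apply: subset_leq_card; apply: subsetIr.
  have [h4 h5] : #|B| <= #|nbr w :&: B| /\ #|nbr w :&: ~: B| = 1.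
    by move: h1 h2 h3; rewrite cB; move: #|_ :&: _| #|_ :&: _|; clear; lia.
  split=> //; have /eqP <- : nbr w :&: B == B by rewrite eqEcard subsetIr.
  exact: subsetIl.
have WT u v : {subset W <= nbr u} -> {subset W <= nbr v} -> forall w, 1 < #|TT u v w|.
  move=> hu hv w; apply: leq_trans (_ : #|W :\ w| <= _).
    rewrite -ltnS; apply: (@leq_trans #|W|); first by move: cW hN; move: #|W|; clear; lia.
    by rewrite (cardsD1 w W) -add1n leq_add2r leq_b1.
  by apply: subset_leq_card; apply: setSD; apply/subsetP => v' v'W; rewrite inE hu ?hv.
have Wy' : {subset W <= nbr y} by move=> w; rewrite !inE; apply: Wy.
have Wz' : {subset W <= nbr z} by move=> w; rewrite !inE; apply: Wz.
have big1 u v w (A : {set G}) : 1 < #|TT u v w| -> (#|TT u v w :|: A| <= 1) = false.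
  by move=> h1; apply/negbTE; rewrite -ltnNge; apply: leq_trans h1 _; apply: subset_leq_card; apply: subsetUl.
have big2 u v w (A : {set G}) : 1 < #|TT u v w| -> (#|A :|: TT u v w| <= 1) = false.
  by move=> h1; rewrite setUC big1.
have SW w : ~~ adj x w -> #|nbr w :&: ~: B| <= 1.
  move=> nw; have wy : adj w y by rewrite adjC Wy.
  have zw := Wz w nw; have T1 : 1 < #|TT y z w| by apply: WT.
  case: (even_cases wy yz zw) => h1; [|by rewrite (big2 _ _ _ _ T1) in h1|by rewrite (big1 _ _ _ _ T1) in h1].
  have wz : adj w z by rewrite adjC.
  have h2 : #|TT w y z| <= 1 by apply: leq_trans h1; apply: subset_leq_card; apply: subsetUl.
  apply: leq_trans h2; apply: subset_leq_card; apply/subsetP => v; rewrite in_setI in_nbr => /andP[wv vS].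
  have vz : v != z by apply: contraTneq vS => ->; rewrite inE zB.
  by rewrite in_TT vz wv Ny.
have Sd : #|nbr d :&: ~: B| <= 1.
  have key : TT y d x \subset [set z] -> #|nbr d :&: ~: B| <= 1.
    move=> hs; rewrite -(cards1 x); apply: subset_leq_card; apply/subsetP => v; rewrite in_setI in_nbr inE => /andP[dv vS].
    apply: contraT => vx; have vz : v != z by apply: contraTneq vS => ->; rewrite inE zB.
    have : v \in TT y d x by rewrite in_TT vx Ny // vS dv.
    by move/(subsetP hs); rewrite inE (negPf vz).
  have dy' : adj d y by rewrite adjC.
  have z1 : z \in TT y x d by rewrite in_TT zd yz xz.
  have dz' : adj d z by rewrite adjC.
  have z2 : z \in TT x d y by rewrite in_TT eq_sym (adj_neq yz) xz dz'.
  case: (even_cases yx xd dy') => h1.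
  - by apply: key; case: (card_le1_set1 h1 z1).
  (* In this case [d] would be complete to [W], as [y] and [z] are, so all sides of the triangle
     [d y z] would have many common neighbours, against [even_cases]. *)
  - rewrite setUC in h1; have [E3 _] := card_le1_set1 h1 z2.
    have Wd : {subset W <= nbr d}.
      have E4 : nbr x :&: nbr d = [set y; z] by rewrite -E3 /TT setD1K // !inE xy dy'.
      have [_ [_ Ud]] := even_deg E4.
      by move=> w; rewrite !inE => nw; have := in_setT w; rewrite -Ud !inE (negPf nw).
    by case: (even_cases dy' yz zd'); rewrite big1 //; exact: WT.
  - by apply: key; case: (card_le1_set1 h1 z2).
have S1 v : v \notin B -> #|nbr v :&: ~: B| <= 1.
  move=> vB; have : v \in ~: B by rewrite inE.
  by rewrite SE => /orP[/eqP ->|] //; apply: SW.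
exists B; split=> //.
- by move=> u v uB vB; have [/subsetP/(_ v vB)] := compl u (S1 u uB); rewrite in_nbr.
- move=> v vB; have := cardsID B (nbr v); rewrite setDE even_regular.
  have -> : nbr v :&: ~: B = ~: B.
    apply/setIidPr/subsetP => u; rewrite inE => uB.
    by have [/subsetP/(_ v vB)] := compl u (S1 u uB); rewrite !in_nbr adjC.
  by rewrite cS; move: #|_ :&: _|; clear; lia.
- by move=> v vB; case: (compl v (S1 v vB)).
Qed.

Lemma even_edges : #|edges G| = N * N.+1.
Proof.
apply/eqP; rewrite -(eqn_pmul2l (isT : 0 < 2)) mul2n -handshake (eq_bigr (fun=> N.+1)) => [|v _]; last exact: even_regular.
by rewrite sum_nat_const -/n hn mulnA.
Qed.

Lemma even_N (u0 : G) : ~~ odd N.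
Proof.
have [B [cB _ _ hB _]] := even_struct u0; have := E2_even B.
by rewrite /E2 (eq_bigr (fun=> 1)) // sum1_card cB.
Qed.
End Even.

Lemma cardU_gt1 (T : finType) (A B : {set T}) : 1 < #|A| -> (#|A :|: B| <= 1) = false /\ (#|B :|: A| <= 1) = false.
Proof.
move=> h; suff E : (#|A :|: B| <= 1) = false by rewrite [B :|: A]setUC.
by apply/negbTE; rewrite -ltnNge; apply: leq_trans h _; apply: subset_leq_card; apply: subsetUl.
Qed.

(** Otherwise any two vertices have at least [2 * (2 * q + 3) - (4 * q + 3) = 3] common neighbours,
    so every set [TT] of a triangle has two elements and no pair violates Hall's condition. *)
Lemma mod3_case (G : sgraph) q (u : G) : ~~ contains G F33 -> #|G| = 4 * q + 3 -> 2 <= q ->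
  exists x : G, #|nbr x| < 2 * q + 3.
Proof.
move=> noF hn hq; apply/existsP; apply: contraT; rewrite negb_exists => /forallP h.
have hd (v : G) : 2 * q + 3 <= #|nbr v| by have := h v; rewrite -leqNgt.
have dl : #|G| + 7 < 3 * (2 * q + 3) by rewrite hn; move: hq; clear; lia.
have c3 (a b : G) : 3 <= #|nbr a :&: nbr b|.
  by have := common_ge a b; have := hd a; have := hd b; rewrite hn; move: #|nbr a| #|nbr b| #|_ :&: _|; clear; lia.
have /card_gt0P[v] : 0 < #|nbr u| by apply: leq_trans (hd u); rewrite addn_gt0 orbT.
rewrite in_nbr => uv; have /card_gt0P[w] : 0 < #|nbr u :&: nbr v| by apply: leq_trans (c3 u v).
rewrite !inE => /andP[uw vw]; have wu : adj w u by rewrite adjC.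
have T2 (a b c : G) : adj a c -> adj b c -> 1 < #|TT a b c|.
  by move=> ac bc; rewrite -ltnS -TT_card ?c3 // !inE ac bc.
have T0 (a b c : G) : adj a c -> adj b c -> TT a b c != set0.
  by move=> ac bc; rewrite -card_gt0; apply: ltnW; apply: T2.
have t1 := T2 u v w uw vw; have wv : adj w v by rewrite adjC.
have vu : adj v u by rewrite adjC.
have t2 := T2 v w u vu wu; have t3 := T2 u w v uv wv.
case: (tri_cases noF hd dl uv vw wu); try (by apply: T0).
- by rewrite (cardU_gt1 _ t1).1.
- by rewrite (cardU_gt1 _ t1).1.
- by rewrite (cardU_gt1 _ t2).1.
Qed.

(** * Order 1 modulo 4 *)

Section Mod1.
Variables (G : sgraph) (q : nat).
Notation n := #|G|.
Hypotheses (noF : ~~ contains G F33) (hn : n = 4 * q + 1) (hq : 3 <= q) (hd : forall v : G, 2 * q + 1 <= #|nbr v|).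
Implicit Types (a b c u v w x y z d h : G).

Lemma mod1_dl : n + 7 < 3 * (2 * q + 1). Proof. by rewrite hn; move: hq; clear; lia. Qed.

Lemma TT_gt u v w m : adj u w -> adj v w -> n + m < #|nbr u| + #|nbr v| -> m <= #|TT u v w|.
Proof.
move=> uw vw h; have := common_ge u v; rewrite (@TT_card _ u v w) ?inE ?uw //.
  by move: h; move: (#|nbr u| + _) n #|TT _ _ _|; clear; lia.
Qed.

Section Big.
Variable h : G.
Hypothesis hh : 2 * q + 3 <= #|nbr h|.

Lemma big_common a : 3 <= #|nbr h :&: nbr a|.
Proof. by have := common_ge h a; have := hd a; move: hh; rewrite hn; move: #|nbr h| #|nbr a| #|_ :&: _|; clear; lia. Qed.

(** The two sides at [h] have at least two candidates each, so Hall's condition can only fail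
    through an empty third set. *)
Lemma big_edge a b : adj h a -> adj h b -> adj a b -> TT a b h = set0.
Proof.
move=> ha hb ab; apply/eqP; apply: contraT => t0.
have ah : adj a h by rewrite adjC.
have bh : adj b h by rewrite adjC.
have ba : adj b a by rewrite adjC.
have t1 : 1 < #|TT h a b| by rewrite -ltnS -TT_card ?big_common // !inE hb ab.
have t2 : 1 < #|TT h b a| by rewrite -ltnS -TT_card ?big_common // !inE ha ba.
have t10 : TT h a b != set0 by rewrite -card_gt0 ltnW.
have t20 : TT h b a != set0 by rewrite -card_gt0 ltnW.
case: (tri_cases noF hd mod1_dl ha ab bh t10 t0 t20).
- by rewrite (cardU_gt1 _ t1).1.
- by rewrite (cardU_gt1 _ t1).1.
- by rewrite (cardU_gt1 _ t2).2.
Qed.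

(** Two degrees of at least [2 * q + 1] with the single common neighbour [h] fill all [4 * q + 1]
    vertices, so off [h] the two neighbourhoods are complementary. *)
Lemma big_comp a b : adj h a -> adj h b -> adj a b ->
  #|nbr a| = 2 * q + 1 /\ forall v, v != h -> adj a v = ~~ adj b v.
Proof.
move=> ha hb ab; have E := big_edge ha hb ab.
have hI : h \in nbr a :&: nbr b by rewrite !inE !(adjC _ h) ha hb.
have c1 : #|nbr a :&: nbr b| = 1 by rewrite (TT_card hI) E cards0.
have := cardsUI (nbr a) (nbr b); have := max_card (nbr a :|: nbr b); rewrite c1 hn => h1 h2.
have [e1 e3] : #|nbr a| = 2 * q + 1 /\ #|nbr a :|: nbr b| = 4 * q + 1.
  by have := hd a; have := hd b; move: h1 h2; move: #|nbr a| #|nbr b| #|_ :|: _|; clear; lia.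
split=> // v vh; have UT : nbr a :|: nbr b = setT by apply/eqP; rewrite eqEcard subsetT /= cardsT e3 hn.
have := in_setT v; rewrite -UT !inE; have : v \notin TT a b h by rewrite E inE.
by rewrite in_TT vh /=; case: (adj a v); case: (adj b v).
Qed.

Definition rest b := [set v | [&& adj b v, ~~ adj h v & v != h]].

(** A path [l u v r] would extend the triangle [b u v] to [C_3^3]: [l] and [r] are adjacent to [b],
    and a second common neighbour [c] of [h] and [a] is complementary to [a], hence adjacent to [u]
    and [v]. *)
Lemma rest_P4free a b : adj h a -> adj h b -> adj a b -> P4free (rest b).
Proof.
move=> ha hb ab l u v r sub un lu uv vr; case/negP: noF.
have hs x : x \in [:: l; u; v; r] -> [/\ adj b x, x != h & adj a x = false].
  move/sub; rewrite inE => /and3P[bx _ xh]; split=> //.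
  by have [_ /(_ x xh) ->] := big_comp ha hb ab; rewrite bx.
have [bl lh al] := hs l ltac:(by rewrite !inE eqxx).
have [bu uh au] := hs u ltac:(by rewrite !inE eqxx ?orbT).
have [bv vh av] := hs v ltac:(by rewrite !inE eqxx ?orbT).
have [br rh ar] := hs r ltac:(by rewrite !inE eqxx ?orbT).
have [c [hc ac cb]] : exists c, [/\ adj h c, adj a c & c != b].
  have : 0 < #|(nbr h :&: nbr a) :\ b|.
    have := big_common a; rewrite (cardsD1 b (nbr h :&: nbr a)); case: (b \in _); move: #|_|; clear; lia.
  by case/card_gt0P=> c; rewrite !inE => /and3P[cb hc ac]; exists c.
have ca : adj c a by rewrite adjC.
have [_ cc] := big_comp hc ha ca.
apply: (@contains33 G b u v l c r) => //; rewrite ?cc ?au ?av //; try by rewrite adjC.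
have ncl x : adj a x = false -> c != x by move=> ax; apply: contraTneq ac => ->; rewrite ax.
move: un; rewrite /= !inE !negb_or !andbT => /and3P[/and3P[nlu nlv nlr] /andP[nuv nur] nvr].
have nc x : adj a x = false -> x != c by move=> ax; rewrite eq_sym ncl.
rewrite (adj_neq bu) (adj_neq bv) (adj_neq bl) (adj_neq br) [b == c]eq_sym cb nuv [u == l]eq_sym nlu (nc u) // nur.
by rewrite [v == l]eq_sym nlv (nc v) // nvr (nc l) // nlr ncl.
Qed.

(** A neighbour of [v] outside [rest b] is one of the [2 * q] neighbours of [a] other than [h];
    inside, the average degree is at most 2 because there is no path on four vertices. *)
Lemma rest_sum a b : adj h a -> adj h b -> adj a b ->
  \sum_(v in rest b) #|nbr v| <= (2 * q + 2) * #|rest b|.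
Proof.
move=> ha hb ab; have ba : adj b a by rewrite adjC.
have [da cab] := big_comp ha hb ab.
have hp : \sum_(v in rest b) #|nbr v| <= \sum_(v in rest b) (dg v (rest b) + 2 * q).
  apply: leq_sum => v; rewrite inE => /and3P[bv nhv vh].
  have hA : h \in nbr a by rewrite in_nbr adjC.
  have e : #|nbr a :\ h| = 2 * q by have := cardsD1 h (nbr a); rewrite hA da; move: #|_ :\ _|; clear; lia.
  rewrite -e; apply: leq_trans (leq_card_setU _ _); apply: subset_leq_card; apply/subsetP => u; rewrite in_nbr => vu.
  have uh : u != h by apply: contraNneq nhv => <-; rewrite adjC.
  rewrite in_setU in_setD1 uh !in_nbr cab //; case: (boolP (adj b u)) => bu; last by rewrite orbT.
  rewrite orbF inE in_nbr vu inE bu uh andbT /=; apply/negP => hu.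
  have ub : adj u b by rewrite adjC.
  by have [_ /(_ v vh)] := big_comp hu hb ub; rewrite bv adjC vu.
apply: leq_trans hp _; rewrite big_split /= sum_nat_const.
have := P4free_E2 (rest_P4free ha hb ab); rewrite /E2 => h2.
rewrite mulnDl addnC (mulnC #|rest b|) leq_add2l.
exact: h2.
Qed.

(** The vertices other than [h] split into its neighbours, [rest a] and [rest b]. Neighbours of [h]
    have degree [2 * q + 1] only, and the degree of [h] itself supplies the missing 1 for each, so
    the total is at most [(2 * q + 2) * (n - 1)]. *)
Lemma big_edges : #|edges G| <= 4 * q * (q + 1).
Proof.
have /card_gt0P[a] : 0 < #|nbr h| by apply: leq_trans hh; rewrite addn_gt0 orbT.
rewrite in_nbr => ha; have /card_gt0P[b] : 0 < #|nbr h :&: nbr a| by apply: leq_trans (big_common a).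
rewrite !inE => /andP[hb ab]; have ba : adj b a by rewrite adjC.
have [_ cab] := big_comp ha hb ab.
have hr : #|nbr h| + (#|rest a| + #|rest b|) + 1 = n /\
    \sum_(v : G) #|nbr v| = \sum_(v in nbr h) #|nbr v| + (\sum_(v in rest a) #|nbr v| + \sum_(v in rest b) #|nbr v|) + #|nbr h|.
  have part (f : G -> nat) : \sum_v f v = \sum_(v in nbr h) f v + (\sum_(v in rest a) f v + \sum_(v in rest b) f v) + f h.
    rewrite (bigD1 h) //= addnC; congr (_ + _); rewrite (bigID (mem (nbr h))) /=; congr (_ + _).
      apply: eq_bigl => v; rewrite in_nbr; case: (boolP (adj h v)) => hv; rewrite ?andbF // andbT.
      by rewrite eq_sym adj_neq.
    rewrite (bigID (mem (nbr a))) /=; congr (_ + _); apply: eq_bigl => v; rewrite !inE.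
      by rewrite andbC; case: (adj a v); case: (adj h v); case: (v != h).
    have [->|vh] := eqVneq v h; first by rewrite !andbF.
    by rewrite cab // negbK; case: (adj b v); case: (adj h v).
  split; last exact: part.
  by have := part (fun=> 1); rewrite !sum1_card => <-.
have s1 : \sum_(v in nbr h) #|nbr v| = #|nbr h| * (2 * q + 1).
  rewrite -sum_nat_const; apply: eq_bigr => v; rewrite in_nbr => hv.
  have /card_gt0P[u] : 0 < #|nbr h :&: nbr v| by apply: leq_trans (big_common v).
  by rewrite !inE => /andP[hu vu]; case: (big_comp hv hu vu).
case: hr; rewrite handshake s1 hn => e1 e2; have s2 := rest_sum ha hb ab; have s3 := rest_sum hb ha ba.
rewrite -(leq_pmul2l (isT : 0 < 2)) mul2n e2.
have e3 : (2 * q + 2) * (#|nbr h| + (#|rest a| + #|rest b|)) = (2 * q + 2) * (4 * q).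
  by congr (_ * _); apply/eqP; rewrite -(eqn_add2r 1) e1.
move: s2 s3 e3; move: (\sum_(v in rest a) _) (\sum_(v in rest b) _) #|nbr h| #|rest a| #|rest b|.
by clear; lia.
Qed.
End Big.

Section Small.
Hypothesis hs : forall v : G, #|nbr v| <= 2 * q + 2.
Definition top := [set v : G | #|nbr v| == 2 * q + 2].

Lemma topE v : v \in top -> #|nbr v| = 2 * q + 2. Proof. by rewrite inE => /eqP. Qed.

(** Only the two sides at [b] can violate Hall's condition; both candidate sets are then the same
    single vertex [d]. The degrees are tight: [h] and [h'] see all non-neighbours of [b] and, among
    its neighbours, only [d] and each other. *)
Lemma top_common h h' b : h \in top -> h' \in top -> adj h h' -> adj h b -> adj h' b ->
  b \notin top /\ forall v, v != h -> v != h' -> adj h v = adj h' v.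
Proof.
move=> hT h'T hh' hb hb'.
have bh : adj b h by rewrite adjC.
have bh' : adj b h' by rewrite adjC.
have h'h : adj h' h by rewrite adjC.
have dh := topE hT; have dh' := topE h'T.
have t1 : 1 < #|TT h h' b| by apply: TT_gt => //; rewrite dh dh' hn; clear; lia.
have db := hd b.
have t2 : 0 < #|TT h' b h| by apply: TT_gt => //; rewrite dh' hn; move: db; clear; lia.
have t3 : 0 < #|TT h b h'| by apply: TT_gt => //; rewrite dh hn; move: db; clear; lia.
have t10 : TT h h' b != set0 by rewrite -card_gt0 ltnW.
rewrite card_gt0 in t2; rewrite card_gt0 in t3.
case: (tri_cases noF hd mod1_dl hh' hb' bh t10 t2 t3) => hc.
- by rewrite (cardU_gt1 _ t1).1 in hc.
- by rewrite (cardU_gt1 _ t1).1 in hc.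
have /set0Pn[d dT] := t2; have [E1 sE] := card_le1_set1 hc dT.
have E2 : TT h b h' = [set d].
  apply/eqP; rewrite eqEsubset sE sub1set; have /set0Pn[d' d'T] := t3.
  by have := subsetP sE _ d'T; rewrite inE => /eqP <-.
have I1 : h' \in nbr h :&: nbr b by rewrite !inE hh'.
have I2 : h \in nbr h' :&: nbr b by rewrite !inE h'h.
have c1 := TT_card I1; have c2 := TT_card I2; rewrite E2 cards1 in c1; rewrite E1 cards1 in c2.
have dbE : #|nbr b| = 2 * q + 1.
  have := common_ge h b; rewrite c1 dh hn; move: db; move: #|nbr b|; clear; lia.
split; first by rewrite inE dbE; clear; lia.
have cover g : #|nbr g| = 2 * q + 2 -> #|nbr g :&: nbr b| = 2 -> forall v, ~~ adj b v -> adj g v.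
  move=> dg' cg v nb; have := cardsUI (nbr g) (nbr b); rewrite dg' cg dbE => hU.
  have UT : nbr g :|: nbr b = setT.
    apply/eqP; rewrite eqEcard subsetT /= cardsT hn; move: hU; move: #|_ :|: _|; clear; lia.
  by have := in_setT v; rewrite -UT !inE (negPf nb) orbF.
move=> v vh vh'; case: (boolP (adj b v)) => bv; last by rewrite (cover h) // (cover h').
have m1 : (v \in TT h b h') = adj h v by rewrite in_TT vh' bv andbT.
have m2 : (v \in TT h' b h) = adj h' v by rewrite in_TT vh bv andbT.
by rewrite -m1 -m2 E1 E2.
Qed.

(** Too many edges give at least [2 * q + 1] vertices of degree [2 * q + 2], so one of them has two
    such neighbours [h1], [h2]. As [h] and [h1] agree on all other vertices, [h h1 h2] is a triangle
    of top vertices, which [top_common] forbids. *)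
Lemma small_edges : #|edges G| <= 4 * q * (q + 1).
Proof.
rewrite leqNgt; apply/negP => he.
have sE : \sum_(v : G) #|nbr v| = n * (2 * q + 1) + #|top|.
  rewrite -sum_nat_const -sum1_card [X in _ = _ + X]big_mkcond -big_split /=; apply: eq_bigr => v _.
  rewrite inE; case: eqP => [->|/eqP ne]; first by rewrite -addnA.
  by rewrite addn0; have := hd v; have := hs v; move: ne; move: #|nbr v|; clear; lia.
have cT : 2 * q + 1 <= #|top|.
  by move: sE he; rewrite handshake hn; move: #|top| #|edges G|; clear; lia.
have two h : h \in top -> 1 < #|nbr h :&: top|.
  move=> hT; have := cardsUI (nbr h) top; have := max_card (nbr h :|: top); rewrite (topE hT) hn.
  by move: cT; move: #|top| #|_ :&: _| #|_ :|: _|; clear; lia.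
have /card_gt0P[h hT] : 0 < #|top| by apply: leq_trans cT; rewrite addn_gt0 orbT.
have /card_gt1P[h1 [h2 [h1I h2I h12]]] := two h hT.
move: h1I h2I; rewrite !in_setI !in_nbr => /andP[a1 T1] /andP[a2 T2].
have /card_gt0P[b] : 0 < #|nbr h :&: nbr h1|.
  by have := common_ge h h1; rewrite (topE hT) (topE T1) hn; move: #|_ :&: _|; clear; lia.
rewrite !inE => /andP[hb h1b].
have [_ E] := top_common hT T1 a1 hb h1b.
have a12 : adj h1 h2 by rewrite -E // eq_sym // adj_neq.
by have [+ _] := top_common hT T1 a1 a2 a12; rewrite T2.
Qed.
End Small.

Lemma mod1_edges : #|edges G| <= 4 * q * (q + 1).
Proof.
have [/existsP[h hh]|] := boolP [exists h : G, 2 * q + 3 <= #|nbr h|]; first exact: big_edges hh.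
rewrite negb_exists => /forallP hs; apply: small_edges => v.
by have := hs v; rewrite -ltnNge addn3 ltnS addn2.
Qed.
End Mod1.

(** The number of edges of [H^*(n)]. *)
Definition fs n := uphalf n * n./2 + (uphalf n)./2 + n./2./2.

Lemma half4 q r : r < 4 -> (4 * q + r)./2 = 2 * q + r./2 /\ uphalf (4 * q + r) = 2 * q + uphalf r.
Proof. by clear; move=> rr; split; lia. Qed.

Lemma fsE q : [/\ fs (4 * q) = 4 * q * q + 2 * q, fs (4 * q + 1) = 4 * q * (q + 1),
  fs (4 * q + 2) = 4 * q * q + 6 * q + 1 & fs (4 * q + 3) = 4 * q * q + 8 * q + 3].
Proof.
have [h0 u0] := @half4 q 0 isT; have [h1 u1] := @half4 q 1 isT.
have [h2 u2] := @half4 q 2 isT; have [h3 u3] := @half4 q 3 isT.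
rewrite addn0 /= in h0 u0; rewrite /fs h0 u0 h1 u1 h2 u2 h3 u3 /= !addn0.
have e0 : (2 * q)./2 = q by rewrite mul2n doubleK.
have e1 : (2 * q + 1)./2 = q by clear; lia.
have e2 : (2 * q + 2)./2 = q + 1 by clear; lia.
by split; rewrite ?e0 ?e1 ?e2; clear; lia.
Qed.

(** For [n = 4 * q] a vertex of degree at most [2 * q] gains 1, since [fs] increases by [2 * q + 1]
    there; in the other residue classes a vertex of degree at most the increment exists and gains
    nothing. If no such vertex exists, the degree lemmas bound the edges, or for [n = 4 * q + 2]
    contradict [even_N]. *)
Lemma fs_pred n (G : sgraph) : 20 < #|G| -> #|G| = n -> ~~ contains G F33 -> fs n < #|edges G| ->
  exists x : G, #|nbr x| + fs n.-1 + (4 %| n) <= fs n.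
Proof.
move=> n40 cG noF he.
have [u0 _] : exists u0 : G, true by have /card_gt0P[u _] : 0 < #|G| by [apply: leq_trans n40]; exists u.
have alt d : (exists x : G, #|nbr x| <= d) \/ forall x : G, d < #|nbr x|.
  have [/existsP|] := boolP [exists x : G, #|nbr x| <= d]; first by left.
  by rewrite negb_exists => /forallP h; right=> x; have := h x; rewrite -ltnNge.
have [q [r [r4 nE]]] : exists q r, r < 4 /\ n = 4 * q + r.
  by exists (n %/ 4), (n %% 4); rewrite ltn_mod mulnC -divn_eq.
have q10 : 4 < q by move: n40; rewrite cG nE; move: r4; clear; lia.
have [f0 f1 f2 f3] := fsE q.
case: r r4 nE => [|[|[|[|//]]]] _; rewrite ?addn0 => nE.
- have [_ _ _ f3'] := fsE q.-1; have nP : n.-1 = 4 * q.-1 + 3 by move: nE q10; clear; lia.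
  have d4 : 4 %| n by rewrite nE dvdn_mulr.
  have [[x hx]|h] := alt (2 * q).
    exists x; rewrite nP f3' d4 nE f0; move: hx q10; move: #|nbr x|; clear; case: q => //= q; lia.
  have e := @even_edges G (2 * q) noF ltac:(by rewrite cG nE; clear; lia) ltac:(by move: q10; clear; lia) h.
  by move: he; rewrite e nE f0; clear; lia.
- have d4 : (4 %| n) = false by rewrite nE dvdn_addr ?dvdn_mulr.
  have nP : n.-1 = 4 * q by rewrite nE addn1.
  have [[x hx]|h] := alt (2 * q).
    by exists x; rewrite nP f0 d4 nE f1; move: hx; move: #|nbr x|; clear; lia.
  have e := @mod1_edges G q noF ltac:(by rewrite cG nE) ltac:(by move: q10; clear; lia)
    ltac:(by move=> v; rewrite addn1).
  by move: he; rewrite nE f1; move: e; clear; lia.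
- have d4 : (4 %| n) = false by rewrite nE dvdn_addr ?dvdn_mulr.
  have nP : n.-1 = 4 * q + 1 by rewrite nE addn2 addn1.
  have [[x hx]|h] := alt (2 * q + 1).
    by exists x; rewrite nP f1 d4 nE f2; move: hx; move: #|nbr x|; clear; lia.
  have := @even_N G (2 * q + 1) noF ltac:(by rewrite cG nE; clear; lia) ltac:(by move: q10; clear; lia) h u0.
  by rewrite oddD oddM.
- have d4 : (4 %| n) = false by rewrite nE dvdn_addr ?dvdn_mulr.
  have nP : n.-1 = 4 * q + 2 by rewrite nE addn3 addn2.
  have [x hx] := mod3_case u0 noF (etrans cG nE) ltac:(by move: q10; clear; lia).
  by exists x; rewrite nP f2 d4 nE f3; move: hx; move: #|nbr x|; clear; lia.
Qed.

Lemma sum_dvd4 m n : m <= n -> \sum_(m.+1 <= i < n.+1) (4 %| i) + m %/ 4 = n %/ 4.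
Proof.
move=> /subnKC <-; elim: (n - m) => [|d IH]; first by rewrite addn0 big_geq.
rewrite addnS big_nat_recr /=; last by rewrite ltnS leq_addr.
by rewrite addnAC IH; move: (m + d); clear; lia.
Qed.

(** Down to 20 vertices the surplus grows by at least 495, the number of multiples of 4 above 20 up
    to 2000, whereas it could be at most [20 * 20]. *)
Lemma upper2 (G : sgraph) : 2000 <= #|G| -> ~~ contains G F33 -> #|edges G| <= fs #|G|.
Proof.
move=> hn noF; rewrite leqNgt; apply/negP => lt.
have D := @deletion F33 fs (fun i => nat_of_bool (4 %| i)) 20.
have := D _ #|G| G (leq_trans _ hn) erefl noF lt.
have s := @sum_dvd4 20 #|G| (leq_trans (isT : 20 <= 2000) hn).
rewrite (_ : 20 %/ 4 = 5) // in s.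
have h4 : 500 <= #|G| %/ 4 by rewrite leq_divRL.
move=> /(_ _ isT) h; have := h (fun G' mG' noF' lt' => @fs_pred #|G'| G' mG' erefl noF' lt').
move: s lt h4; move: (\sum_(_ <= _ < _) _) #|edges G| (fs _) (#|G| %/ 4); clear; lia.
Qed.

(** * Near perfect matchings and the graphs [H^*(n)] *)

Section Matching.
Variables (T : finType) (M : {set {set T}}).
Hypotheses (M2 : forall e, e \in M -> #|e| = 2) (tM : trivIset M).

Lemma match_nbr v : #|[set u | (v != u) && ([set v; u] \in M)]| = (v \in cover M).
Proof.
have [vM|vM] := boolP (v \in cover M); last first.
  apply: eq_card0 => u; rewrite !inE; apply: contraNF vM => /andP[_ h].
  by apply/bigcupP; exists [set v; u]; rewrite ?set21.
have BM := pblock_mem vM; have vB : v \in pblock M v by rewrite mem_pblock.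
have c := M2 BM; rewrite (cardsD1 v) vB in c.
have -> : [set u | (v != u) && ([set v; u] \in M)] = pblock M v :\ v; last by case: c.
apply/setP => u; rewrite !inE eq_sym; case: eqP => //= /eqP uv; apply/idP/idP => [h|uB].
  by rewrite (def_pblock tM h (set21 v u)) set22.
suff -> : [set v; u] = pblock M v by [].
by apply/eqP; rewrite eqEcard subUset !sub1set vB uB (M2 BM) cards2 eq_sym uv.
Qed.
End Matching.

Lemma npm_parts (T : finType) (A : {set T}) M : near_perfect_matching A M ->
  [/\ forall e, e \in M -> #|e| = 2, trivIset M, cover M \subset A & #|cover M| = #|A| - odd #|A|].
Proof.
case/and4P=> /forall_inP h1 h2 h3 /eqP h4; split=> //; first by move=> e /h1 /eqP.
by rewrite -h4 -(cardsID (cover M) A) (setIidPr h3) addnK.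
Qed.

Lemma npm_exists (T : finType) (A : {set T}) : exists M, near_perfect_matching A M.
Proof.
have small (B : {set T}) : #|B| <= 1 -> exists M, near_perfect_matching B M.
  move=> c1; exists set0; apply/and4P; rewrite /cover big_set0 sub0set setD0; split=> //.
  - by apply/forall_inP => e; rewrite inE.
  - by apply/trivIsetP => e e'; rewrite inE.
  - by case: #|B| c1 => [|[]].
move: {2}#|A| (leqnn #|A|) => m; elim: m A => [|m IH] A hA; first by apply: small; apply: leq_trans hA _.
have [/small //|/card_gt1P[a [b [aA bA ab]]]] := leqP #|A| 1.
have bA' : b \in A :\ a by rewrite !inE eq_sym ab.
have cA : #|A| = (#|A :\ a :\ b|).+2 by rewrite (cardsD1 a A) aA (cardsD1 b (A :\ a)) bA'.
have [|M hM] := IH (A :\ a :\ b); first by rewrite -ltnS; apply: leq_trans hA; rewrite cA.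
have [M2 tM cM nM] := npm_parts hM.
have nC x : x \in [set a; b] -> x \notin cover M.
  move=> xab; apply/negP => /(subsetP cM); move: xab; rewrite !inE => /orP[] /eqP ->; rewrite eqxx ?andbF //.
have cE : cover ([set a; b] |: M) = [set a; b] :|: cover M by rewrite /cover bigcup_setU big_set1.
exists ([set a; b] |: M); apply/and4P; split.
- by apply/forall_inP => e; rewrite in_setU1 => /predU1P[->|/M2 ->//]; rewrite cards2 ab.
- apply/trivIsetP => e e'; rewrite !in_setU1 => /predU1P[->|eM] /predU1P[->|eM'] ee'.
  + by rewrite eqxx in ee'.
  + by apply/pred0P => x /=; apply/negP => /andP[/nC + xe]; case/negP; apply/bigcupP; exists e'.
  + by apply/pred0P => x /=; apply/negP => /andP[xe /nC]; case/negP; apply/bigcupP; exists e.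
  + by move/trivIsetP: tM; apply.
- rewrite cE subUset; apply/andP; split; first by apply/subsetP => x /set2P[] ->.
  by apply: subset_trans cM _; apply/subsetP => x; rewrite !inE => /and3P[].
- case/and4P: hM => _ _ _ /eqP h4; rewrite cA /= negbK -h4; apply/eqP; congr #|pred_of_set _|.
  apply/setP => x; rewrite cE !inE negb_or negb_or; case: (x == a) => //=; case: (x == b) => //=; rewrite ?andbF //.
Qed.

Section Star.
Variables (G : sgraph) (A : {set G}) (M1 M2 : {set {set G}}).
Hypothesis cross : forall u v, u \in A -> v \notin A -> adj u v.
Hypothesis in1 : forall u v, u \in A -> v \in A -> adj u v = (u != v) && ([set u; v] \in M1).
Hypothesis in2 : forall u v, u \notin A -> v \notin A -> adj u v = (u != v) && ([set u; v] \in M2).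
Hypotheses (n1 : near_perfect_matching A M1) (n2 : near_perfect_matching (~: A) M2).

Definition mates v := [set u in nbr v | (u \in A) == (v \in A)].

Lemma card_mates v : #|mates v| = (v \in cover M1) + (v \in cover M2).
Proof.
have [c1 t1 s1 _] := npm_parts n1; have [c2 t2 s2 _] := npm_parts n2.
have [vA|vA] := boolP (v \in A).
  have -> : (v \in cover M2) = false by apply: contraTF vA => /(subsetP s2); rewrite inE.
  rewrite addn0 -(match_nbr c1 t1); apply: eq_card => u; rewrite !inE vA eqb_id.
  have [uA|uA] := boolP (u \in A); first by rewrite in1 // andbT.
  rewrite andbF; apply/esym/negP => /andP[_ h]; case/negP: uA; apply: (subsetP s1).
  by apply/bigcupP; exists [set v; u]; rewrite ?set22.
have -> : (v \in cover M1) = false by apply: contraNF vA => /(subsetP s1).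
rewrite add0n -(match_nbr c2 t2); apply: eq_card => u; rewrite !inE (negPf vA).
have [uA|uA] := boolP (u \in A); last by rewrite in2 // andbT.
rewrite andbF; apply/esym/negP => /andP[_ h]; have : u \in ~: A; last by rewrite inE uA.
by apply: (subsetP s2); apply/bigcupP; exists [set v; u]; rewrite ?set22.
Qed.

Lemma mates_le1 v : #|mates v| <= 1.
Proof.
have [_ _ s1 _] := npm_parts n1; have [_ _ s2 _] := npm_parts n2.
rewrite card_mates; case: (boolP (v \in cover M1)) => [/(subsetP s1) vA|_]; last by case: (_ \in _).
by case: (boolP (v \in cover M2)) => // /(subsetP s2); rewrite inE vA.
Qed.

(** No vertex has two neighbours on its own side of the bipartition. Applied to all vertices of a
    copy of [C_3^3], this leaves no way of distributing its six vertices over the two sides. *)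
Lemma star_free : ~~ contains G F33.
Proof.
apply/negP => /contains33P[a [b [c [x [y [z [[ab bc ca] [xa xb yb] [yc zc za] un]]]]]]].
have h v u w : adj v u -> adj v w -> u != w -> ((u \in A) == (v \in A)) && ((w \in A) == (v \in A)) = false.
  move=> vu vw uw; apply: contraNF uw => /andP[hu hw]; apply/eqP.
  by apply: (card_le1_eqP (mates_le1 v)); rewrite !inE ?vu ?vw.
rewrite !(adjC _ a) !(adjC _ b) !(adjC _ c) in ca xa xb yb yc zc za.
have ba : adj b a by rewrite adjC.
have cb : adj c b by rewrite adjC.
have ac : adj a c by rewrite adjC.
move: un; rewrite /= !inE !negb_or -!andbA => /and5P[nab nac nax nay /and5P[naz nbc nbx nby /and5P[nbz ncx ncy ncz /and4P[nxy nxz nyz _]]]].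
move: (h a b c ab ac nbc) (h b a c ba bc nac) (h c a b ca cb nab) (h a b x ab xa nbx) (h b a x ba xb nax)
  (h b c y bc yb ncy) (h c b y cb yc nby) (h c a z ca zc naz) (h a c z ac za ncz) (h a x z xa za nxz)
  (h b x y xb yb nxy) (h c y z yc zc nyz) (h a b z ab za nbz) (h a c x ac xa ncx) (h b a y ba yb nay)
  (h b c x bc xb ncx) (h c a y ca yc nay) (h c b z cb zc nbz).
by case: (a \in A); case: (b \in A); case: (c \in A); case: (x \in A); case: (y \in A); case: (z \in A).
Qed.

Lemma star_edges : 2 * #|edges G| = 2 * (#|A| * #|~: A|) + (#|A| - odd #|A|) + (#|~: A| - odd #|~: A|).
Proof.
have [_ _ s1 <-] := npm_parts n1; have [_ _ s2 <-] := npm_parts n2.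
rewrite mul2n -handshake.
have dE v : #|nbr v| = (if v \in A then #|~: A| else #|A|) + ((v \in cover M1) + (v \in cover M2)).
  rewrite -card_mates -(cardsID (mates v) (nbr v)) addnC; congr (_ + _); last first.
    by apply: eq_card => u; rewrite !inE andbA andbb.
  case: ifP => vA; apply: eq_card => u; rewrite !inE vA; case uA: (u \in A); rewrite ?andbF ?andbT //=.
  - by rewrite andNb.
  - by rewrite cross ?uA.
  - by rewrite adjC cross ?vA.
  - by rewrite andNb.
rewrite (eq_bigr _ (fun v _ => dE v)) !big_split /= -addnA; congr (_ + (_ + _)).
- rewrite (bigID (mem A)) /=.
  have -> : \sum_(v in A) (if v \in A then #|~: A| else #|A|) = #|A| * #|~: A|.
    by rewrite -sum_nat_const; apply: eq_bigr => v ->.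
  have -> : \sum_(v | v \notin A) (if v \in A then #|~: A| else #|A|) = #|~: A| * #|A|.
    by rewrite -sum_nat_const; apply: eq_big => v; rewrite ?inE // => /negPf ->.
  by rewrite (mulnC #|~: A|) addnn mul2n.
- by rewrite -sum1_card [RHS]big_mkcond; apply: eq_bigr => v _; case: (_ \in _).
- by rewrite -sum1_card [RHS]big_mkcond; apply: eq_bigr => v _; case: (_ \in _).
Qed.
End Star.

Section HstarFacts.
Variable n : nat.
Notation K := (complete_bipartite (uphalf n) n./2).
Let A : {set K} := [set inl i | i : 'I_(uphalf n)].
Let A' : {set K} := [set inr j | j : 'I_n./2].
Definition isl (v : K) := if v is inl _ then true else false.

Lemma in_A v : (v \in A) = isl v.
Proof. by case: v => [i|j]; apply/imsetP => /=; [exists i | case]. Qed.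

Lemma setC_A : ~: A = A'.
Proof.
apply/setP => v; rewrite inE in_A; case: v => [i|j] /=; apply/esym; first by apply/negbTE/imsetP => -[].
by apply/imsetP; exists j.
Qed.

Lemma card_A : #|A| = uphalf n.
Proof. by rewrite card_imset ?card_ord //; apply: inl_inj. Qed.

Lemma card_A' : #|~: A| = n./2.
Proof. by rewrite setC_A card_imset ?card_ord //; apply: inr_inj. Qed.

Lemma adjK (u v : K) : adj u v = (isl u != isl v).
Proof. by case: u => [i|j]; case: v => [i'|j'] //=; rewrite /adj /= /simple_rel /= andbF. Qed.

Section Graph.
Variables (M1 M2 : {set {set K}}).
Hypotheses (n1 : near_perfect_matching A M1) (n2 : near_perfect_matching A' M2).
Notation W := (@add_edges K (M1 :|: M2)).

Lemma adjW (u v : W) : adj u v = (u != v) && ((isl u != isl v) || ([set u; v] \in M1 :|: M2)).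
Proof.
have -> : adj u v = (u != v) && ((@adj K u v || ([set u; v] \in M1 :|: M2)) || (@adj K v u || ([set v; u] \in M1 :|: M2))) by [].
by rewrite [[set v; u]]setUC !adjK [isl v == _]eq_sym orbb.
Qed.

Let cross (u v : W) : u \in A -> v \notin A -> adj u v.
Proof.
rewrite !in_A adjW => ul vr; rewrite ul (negPf vr) /= andbT.
by apply: contraNneq vr => <-.
Qed.

Let in1 (u v : W) : u \in A -> v \in A -> adj u v = (u != v) && ([set u; v] \in M1).
Proof.
have [_ _ s2 _] := npm_parts n2.
move=> uA vA; rewrite adjW; move: (uA) (vA); rewrite !in_A => -> -> /=; rewrite inE.
case: (boolP ([set u; v] \in M2)) => h; last by rewrite orbF.
have : u \in A' by apply: (subsetP s2); apply/bigcupP; exists [set u; v]; rewrite ?set21.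
by rewrite -setC_A inE uA.
Qed.

Let in2 (u v : W) : u \notin A -> v \notin A -> adj u v = (u != v) && ([set u; v] \in M2).
Proof.
have [_ _ s1 _] := npm_parts n1.
move=> uA vA; rewrite adjW; move: (uA) (vA); rewrite !in_A => /negPf -> /negPf -> /=; rewrite inE.
case: (boolP ([set u; v] \in M1)) => h //=.
have : u \in A by apply: (subsetP s1); apply/bigcupP; exists [set u; v]; rewrite ?set21.
by rewrite (negPf uA).
Qed.

Let n2' : near_perfect_matching (~: A) M2. Proof. by rewrite setC_A. Qed.

Lemma W_free : ~~ contains W F33.
Proof. exact: (@star_free W A M1 M2 in1 in2 n1 n2'). Qed.

Lemma W_card : #|W| = n.
Proof. by rewrite card_sum !card_ord addnC; clear; lia. Qed.

Lemma W_edges : #|edges W| = fs n.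
Proof.
have := @star_edges W A M1 M2 cross in1 in2 n1 n2'; rewrite card_A card_A' /fs.
move: (uphalf n) (n./2) #|edges W|; clear => a b e; have := odd_double_half a; have := odd_double_half b.
move: (a./2) (b./2) (odd a) (odd b) (a * b) => a' b' oa ob ab; case: oa; case: ob; lia.
Qed.
End Graph.

Lemma is_Hstar_facts G : is_Hstar n G -> [/\ #|G| = n, ~~ contains G F33 & #|edges G| = fs n].
Proof.
case=> M1 [M2 [n1 n2 iG]].
by rewrite (iso_card iG) (iso_contains _ iG) (iso_edges iG) (W_card M1 M2) (W_edges n1 n2) W_free.
Qed.

Lemma Hstar_ex : exists G, is_Hstar n G.
Proof.
have [M1 n1] := npm_exists A; have [M2 n2] := npm_exists A'.
exists (@add_edges K (M1 :|: M2)), M1, M2; split=> //.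
by exists id; split; first exact: id_bij || exact: (Bijective (g := id)).
Qed.
End HstarFacts.

Lemma pair_matching (G : sgraph) (T : finType) (B : {set G}) (f : G -> T) : injective f -> ~~ odd #|B| ->
  (forall v, v \in B -> #|nbr v :&: B| = 1) ->
  exists M : {set {set T}}, near_perfect_matching (f @: B) M /\
    forall u v, (u != v) && ([set f u; f v] \in M) = [&& u \in B, v \in B & adj u v].
Proof.
move=> fI oB h.
pose M := [set e | [exists u : G, exists v : G, [&& u \in B, v \in B & adj u v] && (e == [set f u; f v])]].
have ME u v : (u != v) && ([set f u; f v] \in M) = [&& u \in B, v \in B & adj u v].
  apply/andP/and3P => [[uv]|[uB vB uv]]; last first.
    by rewrite (adj_neq uv) inE; split=> //; apply/existsP; exists u; apply/existsP; exists v; rewrite uB vB uv eqxx.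
  rewrite inE => /existsP[a /existsP[b /andP[/and3P[aB bB ab] /eqP E]]].
  by case: (set2_eq _ E) => [||]; rewrite ?(inj_eq fI) //; case=> /fI -> /fI ->; split=> //; rewrite adjC.
have uniq_nbr v x y : v \in B -> x \in B -> y \in B -> adj v x -> adj v y -> x = y.
  move=> vB xB yB vx vy; have : #|nbr v :&: B| <= 1 by rewrite h.
  by move/card_le1_eqP; apply; rewrite !inE ?vx ?vy.
have Mel e t : e \in M -> f t \in e -> exists w, [/\ t \in B, w \in B, adj t w & e = [set f t; f w]].
  rewrite inE => /existsP[a /existsP[b /andP[/and3P[aB bB ab] /eqP ->]]].
  rewrite in_set2 !(inj_eq fI) => /orP[] /eqP ->; first by exists b.
  by exists a; split=> //; [rewrite adjC | rewrite setUC].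
have Mf e x : e \in M -> x \in e -> exists t, x = f t.
  by rewrite inE => /existsP[a /existsP[b /andP[_ /eqP ->]]] /set2P[] ->; [exists a | exists b].
exists M; split=> //; apply/and4P; split.
- apply/forall_inP => e; rewrite inE => /existsP[a /existsP[b /andP[/and3P[aB bB ab] /eqP ->]]].
  by rewrite cards2 (inj_eq fI) (adj_neq ab).
- apply/trivIsetP => e e' eM eM' ee'; apply/pred0P => x /=; apply/negP => /andP[xe xe'].
  have [t xt] := Mf e x eM xe; subst x.
  have [w [tB wB tw Ee]] := Mel e t eM xe; have [w' [_ wB' tw' Ee']] := Mel e' t eM' xe'.
  by case/eqP: ee'; rewrite Ee Ee' (uniq_nbr t w w').
- apply/bigcupsP => e eM; apply/subsetP => x xe; have [t xt] := Mf e x eM xe; subst x.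
  by have [w [tB _ _ _]] := Mel e t eM xe; apply: imset_f.
- rewrite card_imset // (negPf oB) cards_eq0 setD_eq0; apply/subsetP => x /imsetP[v vB ->].
  have /card_gt0P[w] : 0 < #|nbr v :&: B| by rewrite h.
  rewrite !inE => /andP[vw wB]; apply/bigcupP; exists [set f v; f w]; rewrite ?set21 //.
  by have := ME v w; rewrite vB wB vw => /andP[].
Qed.

Lemma struct_Hstar (G : sgraph) N : ~~ contains G F33 -> #|G| = 2 * N -> 5 <= N ->
  (forall v : G, N.+1 <= #|nbr v|) -> is_Hstar (2 * N) G.
Proof.
move=> noF cG hN hd.
have [u0 _] : exists u0 : G, true by have /card_gt0P[u _] : 0 < #|G| by [rewrite cG; move: hN; clear; lia]; exists u.
have [B [cB cB' cr h1 h2]] := even_struct noF cG hN hd u0.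
have oN := even_N noF cG hN hd u0.
have un : uphalf (2 * N) = N by rewrite mul2n uphalf_double.
have hf : (2 * N)./2 = N by rewrite mul2n doubleK.
have [|f fb hfc] := @fiber_bij G (complete_bipartite (uphalf (2 * N)) (2 * N)./2) bool (fun v => v \in B) (fun v => isl v).
  case.
    rewrite (_ : [set x | (x \in B) == true] = B); last by apply/setP => v; rewrite inE eqb_id.
    by rewrite cB; apply: etrans (etrans (esym un) (esym (card_A (2 * N)))) _; apply: eq_card => v; rewrite inE in_A eqb_id.
  rewrite (_ : [set x | (x \in B) == false] = ~: B); last by apply/setP => v; rewrite !inE eqbF_neg.
  by rewrite cB'; apply: etrans (etrans (esym hf) (esym (card_A' (2 * N)))) _; apply: eq_card => v; rewrite !inE in_A eqbF_neg.
have fI := bij_inj fb.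
have [|M1 [n1 a1]] := @pair_matching G _ B f fI _ h1; first by rewrite cB.
have [||M2 [n2 a2]] := @pair_matching G _ (~: B) f fI.
- by rewrite cB'.
- by move=> v; rewrite inE; apply: h2.
have [g fK gK] := fb.
have fB : f @: B = [set inl i | i : 'I_(uphalf (2 * N))].
  apply/setP => w; rewrite in_A -(gK w) hfc; apply/imsetP/idP => [[v vB /fI ->//]|h]; by exists (g w).
have fB' : f @: (~: B) = [set inr j | j : 'I_(2 * N)./2].
  rewrite -setC_A; apply/setP => w; rewrite inE in_A -(gK w) hfc; apply/imsetP/idP => [[v + /fI ->]|h].
    by rewrite inE.
  by exists (g w); rewrite ?inE.
exists M1, M2; split; rewrite -?fB -?fB' //.
exists f; split=> // u v; rewrite adjW !hfc (inj_eq fI) inE andb_orr andb_orr a1 a2 !inE.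
have [->|uv] /= := eqVneq u v; first by rewrite adj_irrefl !andbF.
case uB: (u \in B); case vB: (v \in B) => //=; rewrite ?orbF //.
- by rewrite adjC cr ?vB.
- by rewrite cr ?uB.
Qed.

Lemma part_ii n : 2004 <= n -> (4 %| n -> unique_extremal n F33 (is_Hstar n)) /\
  (~~ (4 %| n) -> (forall G, is_Hstar n G -> extremal n F33 G) /\ extremal n F33 (Hgraph n 2 2)).
Proof.
move=> hn; have hn' : 2000 <= n by apply: leq_trans hn.
have up (G : sgraph) : #|G| = n -> ~~ contains G F33 -> #|edges G| <= fs n.
  by move=> cG; rewrite -cG; apply: upper2; rewrite cG.
have ex G : is_Hstar n G -> extremal n F33 G.
  by move=> hG; have [cG noF eG] := is_Hstar_facts hG; apply/extremalP; split=> // G' cG' noF'; rewrite eG; apply: up.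
split=> [/dvdnP[q nE]|n4].
  rewrite mulnC in nE; have q10 : 500 < q by move: hn; rewrite nE; clear; lia.
  move=> G; split=> [/extremalP[cG noF mx]|]; last exact: ex.
  have [W hW] := Hstar_ex n; have [cW fW eW] := is_Hstar_facts hW.
  have eG : #|edges G| = fs n by apply/eqP; rewrite eqn_leq up //= -eW; apply: mx.
  have N2 : n = 2 * (2 * q) by rewrite nE; clear; lia.
  rewrite N2; apply: struct_Hstar => //; [by rewrite cG | by move: q10; clear; lia|].
  (* Deleting a vertex of degree at most [2 * q] from a graph with [fs (4 * q)] edges would leave
     more than [fs (4 * q - 1)] edges. *)
  move=> v; rewrite leqNgt; apply/negP => hv.
  have cd := card_del v; have ed := edges_del v.
  have nd : ~~ contains (del v) F33 by apply: contra noF; apply: contains_del.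
  have cd' : #|del v| = 4 * q.-1 + 3 by move: cd q10; rewrite cG nE; move: #|del v|; clear; lia.
  have := upper2 (G := del v) _ nd; rewrite cd' => /(_ ltac:(by move: q10; clear; lia)).
  have [_ _ _ ->] := fsE q.-1; have [f0 _ _ _] := fsE q.
  move: ed hv; rewrite eG nE f0; move: #|edges _| #|nbr _| q10; clear; case: q => // q; lia.
split; first exact: ex.
have hS : @eshape 2 false 1 (Hgraph n 2 2) (@hcol n 2 2 isT) set0 by apply: (@H_shape n 2 2 isT); apply: leq_trans hn.
have cH : #|Hgraph n 2 2| = n by apply: card_H; apply: leq_trans hn.
apply/extremalP; split=> //; first exact: (@shape_free 2 1 false _ _ _ isT hS 3 isT isT).
move=> G' cG' noF'; rewrite (@shape_edges 2 1 false _ _ _ isT hS) cH; apply: leq_trans (up G' cG' noF') _.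
rewrite /fv; have -> : tri 1 = 0 by rewrite /tri big_ord_recl big_ord0.
(* In the residue classes 1, 2, 3 modulo 4 the edge count of [H(n, 2, 2)] equals [fs n]; at
   multiples of 4 it is smaller by one. *)
have := @turE 2 (n - 1) isT; have [r0|r0] := posnP (n %% 4); first by rewrite /dvdn r0 in n4.
have := divn_eq n 4; have := ltn_pmod n (isT : 0 < 4); move: r0 hn; move: (n %/ 4) (n %% 4) => q r r0 hn r4 nE.
rewrite mulnC in nE; have [_ f1 f2 f3] := fsE q; move: (tur 2 _) => t.
case: r r0 r4 nE => [|[|[|[|//]]]] // _ _ nE; rewrite nE ?f1 ?f2 ?f3.
- by have -> : (4 * q + 1 - 1) %/ 2 = 2 * q; [clear; lia | clear; lia].
- by have -> : (4 * q + 2 - 1) %/ 2 = 2 * q; [clear; lia | clear; lia].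
- by have -> : (4 * q + 3 - 1) %/ 2 = 2 * q + 1; [clear; lia | clear; lia].
Qed.

Theorem theorem3 (p k : nat) (hp : 2 <= p) (hk : 3 <= k) :
  exists n0 : nat, forall n : nat, n0 <= n ->
    ((k, p) <> (3, 2) ->
       let s := (k - 1) %/ 2 + 1 in
       (odd k ->
          unique_extremal n (blowup (cycle_graph k) (p + 1)) (is_H n p s)) /\
       (~~ odd k ->
          unique_extremal n (blowup (cycle_graph k) (p + 1)) (is_Hprime n p s)))
    /\
    ((k, p) = (3, 2) ->
       (4 %| n ->
          unique_extremal n (blowup (cycle_graph 3) 3) (is_Hstar n)) /\
       (~~ (4 %| n) ->
          (forall G : sgraph,
             is_Hstar n G -> extremal n (blowup (cycle_graph 3) 3) G) /\
          extremal n (blowup (cycle_graph 3) 3) (Hgraph n 2 2))).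
Proof.
have [E|kp] := eqVneq (k, p) (3, 2).
  by exists 2004 => n hn; split=> // _; apply: part_ii.
have [n0 h] := part_i hp hk (elimN eqP kp).
by exists n0 => n hn; split=> [_|E]; [apply: h | rewrite E eqxx in kp].
Qed.
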